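(* Let $q$ be a power of a prime, $G=\mathrm{U}(3)_{\mathbb{F}_q}$ with $\mu$, $T$, $B$ as in the context (signature $(r,s)=(2,1)$), and let $S$ be a $k$-scheme with a morphism $\zeta\colon S\to G\text{-}\mathtt{Zip}^\mu$ satisfying conditions (a), (b), (c) of the context. Then $\langle C_S\rangle=\langle C_{\mathrm{zip}}\rangle$.
   Context: Notation: $k=\overline{\mathbb{F}}_q$, $\sigma$ the $q$-power Frobenius. For a connected reductive group $G$ over $\mathbb{F}_q$ and a cocharacter $\mu\colon\mathbb{G}_{m,k}\to G_k$: let $P=P_-(\mu)$ (resp. $P_+(\mu)$) be the parabolic subgroup of $G_k$ consisting of $g$ such that $t\mapsto\mu(t)^{-1}g\mu(t)$ (resp. $t\mapsto\mu(t)g\mu(t)^{-1}$) extends to a morphism $\mathbb{A}^1_k\to G_k$; $L$ the centralizer of $\mu$; $Q=(P_+(\mu))^{(q)}$, $M=L^{(q)}$, $\varphi\colon L\to M$ the $q$-Frobenius. The zip group is $E=\{(x,y)\in P\times Q:\varphi(\bar x)=\bar y\}$ ($\bar x$, $\bar y$ the Levi components), acting on $G_k$ by $(x,y)\cdot g=xgy^{-1}$; $G\text{-}\mathtt{Zip}^\mu:=[E\backslash G_k]$. Fix a Borel pair $(B,T)$ over $\mathbb{F}_q$ with $B\subset P$; positive roots are those with root groups in the opposite Borel $B^+$; $I$ the simple roots of $L$, $W$ the Weyl group, $w_0$ its longest element, $w_{0,I}$ the longest element of $W_I$, $z=\sigma(w_{0,I})w_0$. For $\lambda\in X^*(T)$,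 $V_I(\lambda)=\mathrm{Ind}_B^P(\lambda)=\{f\colon P\to\mathbb{A}^1: f(xb)=\lambda(b)^{-1}f(x)\}$ and $\mathcal{V}_I(\lambda)$ its associated vector bundle on $G\text{-}\mathtt{Zip}^\mu$. The zip flag stack is $[E'\backslash G_k]$, $E'=E\cap(B\times G_k)$, and $\mathcal{F}_w=[E'\backslash BwBz^{-1}]$ for $w\in W$. Condition on $(S,\zeta)$: (a) $\zeta$ smooth; (b) $\zeta$ surjective on each connected component of $S$; (c) for each $w\in W$ of length 1, $\overline{\mathrm{Flag}(S)}_w$ is pseudo-complete (global regular functions are locally constant), where $\mathrm{Flag}(S)=S\times_{G\text{-}\mathtt{Zip}^\mu}[E'\backslash G_k]$ and $\mathrm{Flag}(S)_w$ is the preimage of $\mathcal{F}_w$. $\mathcal{V}_I(\lambda)$ on $S$ is the pullback. $C_{\mathrm{zip}}=\{\lambda: H^0(G\text{-}\mathtt{Zip}^\mu,\mathcal{V}_I(\lambda))\neq0\}$, $C_S=\{\lambda: H^0(S,\mathcal{V}_I(\lambda))\neq0\}$, $\langle C\rangle=\{\lambda:\exists N\ge1, N\lambda\in C\}$. Specifics: $V$ is an $n$-dimensional $\mathbb{F}_{q^2}$-vector space ($n=3$) with a nondegenerate hermitian form whose matrix in a basis is the antidiagonal matrix $J$ of ones, and $G=\mathrm{U}(V,\psi)$; then $G_k\simeq\mathrm{GL}_{n,k}$ and the Frobenius acts on $\mathrm{GL}_n(k)$ by $A\mapsto J\sigma({}^tA)^{-1}J$. $T$ is the diagonal torus and $B$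 the lower-triangular Borel (both defined over $\mathbb{F}_q$), $X^*(T)=\mathbb{Z}^n$ via $\mathrm{diag}(x_i)\mapsto\prod x_i^{a_i}$, and $\mu(x)=\mathrm{diag}(xI_r,I_s)$ under $G_k\simeq\mathrm{GL}_{n,k}$, with $(r,s)=(2,1)$. *)

(* Defs.v *)
(* k-schemes are treated through their functors of points on commutative
   k-algebras: a scheme is a Zariski sheaf covered by affine open subfunctors
   (Demazure-Gabriel, Groupes algebriques, I.1).  [comAlgType k] consists of
   nonzero algebras; since a Zariski sheaf has exactly one point over the zero
   algebra, nothing is lost. *)
From HB Require Import structures.
From mathcomp Require Import all_boot all_order all_fingroup all_algebra.
From mathcomp Require Import -(notations) mpoly.

Set Implicit Arguments.
Unset Strict Implicit.
Unset Printing Implicit Defensive.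

Import GRing.Theory.
Local Open Scope ring_scope.

Definition is_field (K : comNzRingType) : Prop :=
  forall x : K, x != 0 -> exists y : K, x * y = 1.

(* The image under [f] of the ideal generated by [D] generates the unit ideal. *)
Definition gen_unit (R R' : comNzRingType) (f : R -> R') (D : R -> Prop) : Prop :=
  exists n (a : 'I_n -> R) (c : 'I_n -> R'),
    (forall i, D (a i)) /\ \sum_(i < n) c i * f (a i) = 1.

Definition is_localization (A B : comNzRingType) (l : A -> B) (f : A) : Prop :=
  [/\ exists u : B, l f * u = 1,
      forall b : B, exists n (a : A), b * l f ^+ n = l a
    & forall a : A, l a = 0 -> exists n, f ^+ n * a = 0].

(* B = A[X_1,..,X_n] / (r_1,..,r_m), with X_i going to [b i]. *)
Definition fin_pres (A B : comNzRingType) (f : A -> B) : Prop :=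
  exists n m (b : 'I_n -> B) (r : 'I_m -> mpoly n A),
    (forall x : B, exists p : mpoly n A, mmap f b p = x) /\
    (forall p : mpoly n A, mmap f b p = 0 <->
       exists c : 'I_m -> mpoly n A, p = \sum_(j < m) c j * r j).

(* C' is the quotient of C by an ideal of square zero. *)
Definition sq_zero_thickening (C C' : comNzRingType) (t : C -> C') : Prop :=
  (forall y : C', exists x, t x = y) /\
  (forall x y : C, t x = 0 -> t y = 0 -> x * y = 0).

Section KAlgebras.
Variable k : closedFieldType.
Implicit Types R A B C K : comAlgType k.

Definition formally_etale A B (f : {lrmorphism A -> B}) : Prop :=
  forall C C' (t : {lrmorphism C -> C'}), sq_zero_thickening t ->
  forall (g : {lrmorphism A -> C}) (h' : {lrmorphism B -> C'}),
    (forall a, h' (f a) = t (g a)) ->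
    (exists h : {lrmorphism B -> C},
        (forall a, h (f a) = g a) /\ (forall b, t (h b) = h' b)) /\
    (forall h1 h2 : {lrmorphism B -> C},
        (forall a, h1 (f a) = g a) -> (forall b, t (h1 b) = h' b) ->
        (forall a, h2 (f a) = g a) -> (forall b, t (h2 b) = h' b) -> h1 =1 h2).

(* Every field-valued point of Spec A lifts to Spec B after a field extension. *)
Definition spec_surjective A B (f : {lrmorphism A -> B}) : Prop :=
  forall K (g : {lrmorphism A -> K}), is_field K ->
  exists K' (e : {lrmorphism K -> K'}) (h : {lrmorphism B -> K'}),
    is_field K' /\ (forall a, h (f a) = e (g a)).

Definition etale_cover A B (f : {lrmorphism A -> B}) : Prop :=
  [/\ fin_pres f, formally_etale f & spec_surjective f].

Record kfunctor := KFunctor {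
  pts :> comAlgType k -> Type;
  fmap : forall R R' : comAlgType k, {lrmorphism R -> R'} -> pts R -> pts R';
  fmap_id : forall R (x : pts R), fmap idfun x = x;
  fmap_comp : forall (R R' R'' : comAlgType k)
    (f : {lrmorphism R -> R'}) (g : {lrmorphism R' -> R''}) (x : pts R),
    fmap (g \o f) x = fmap g (fmap f x) }.

Record kmor (X Y : kfunctor) := KMor {
  kfun :> forall R, X R -> Y R;
  kfun_nat : forall (R R' : comAlgType k) (f : {lrmorphism R -> R'}) (x : X R),
    kfun (fmap f x) = fmap f (kfun x) }.

Record subfunctor (X : kfunctor) := SubFunctor {
  smem :> forall R, X R -> Prop;
  smem_map : forall (R R' : comAlgType k) (f : {lrmorphism R -> R'}) (x : X R),
    smem x -> smem (fmap f x) }.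

(* The pullback of U along any Spec R -> X is an open (resp. closed) subscheme
   of Spec R. *)
Definition open_sub (X : kfunctor) (U : subfunctor X) : Prop :=
  forall R (x : X R), exists D : R -> Prop,
  forall R' (f : {lrmorphism R -> R'}), U R' (fmap f x) <-> gen_unit f D.

Definition closed_sub (X : kfunctor) (Z : subfunctor X) : Prop :=
  forall R (x : X R), exists D : R -> Prop,
  forall R' (f : {lrmorphism R -> R'}),
    Z R' (fmap f x) <-> (forall a, D a -> f a = 0).

(* U is Spec A, with universal point u. *)
Definition represents (X : kfunctor) (U : subfunctor X) A (u : X A) : Prop :=
  [/\ U A u,
      forall R (x : X R), U R x -> exists f : {lrmorphism A -> R}, fmap f u = x
    & forall R (f g : {lrmorphism A -> R}), fmap f u = fmap g u -> f =1 g].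

(* All localizations are nonzero here, so no f_i is nilpotent; nilpotent members
   of a family generating the unit ideal can always be dropped. *)
Definition zariski_sheaf (X : kfunctor) : Prop :=
  forall A n (f : 'I_n -> A) (B : 'I_n -> comAlgType k)
         (l : forall i, {lrmorphism A -> B i}),
    (exists c : 'I_n -> A, \sum_(i < n) c i * f i = 1) ->
    (forall i, is_localization (l i) (f i)) ->
  forall s : forall i, X (B i),
    (forall i j C (g : {lrmorphism B i -> C}) (h : {lrmorphism B j -> C}),
       (forall a, g (l i a) = h (l j a)) -> fmap g (s i) = fmap h (s j)) ->
  exists! x : X A, forall i, fmap (l i) x = s i.

Definition is_scheme (X : kfunctor) : Prop :=
  zariski_sheaf X /\
  forall K (x : X K), is_field K ->
    exists U : subfunctor X,
      [/\ open_sub U, U K x & exists A (u : X A), represents U u].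

Definition formally_smooth (X Y : kfunctor) (a : kmor X Y) : Prop :=
  forall C C' (t : {lrmorphism C -> C'}), sq_zero_thickening t ->
  forall (x' : X C') (y : Y C), a C' x' = fmap t y ->
  exists x : X C, fmap t x = x' /\ a C x = y.

Definition locally_fin_pres (X Y : kfunctor) (a : kmor X Y) : Prop :=
  forall K (x : X K), is_field K ->
  exists (U : subfunctor X) (V : subfunctor Y) A (u : X A) B (v : Y B)
         (f : {lrmorphism B -> A}),
    [/\ open_sub U /\ open_sub V, represents U u /\ represents V v,
        U K x, a A u = fmap f v & fin_pres f].

Definition smooth (X Y : kfunctor) (a : kmor X Y) : Prop :=
  formally_smooth a /\ locally_fin_pres a.

(* Points of the space |X| are field-valued points up to field extension.  A
   subset of |X| is a predicate on field-valued points (its values on other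
   algebras are irrelevant) that is invariant under extension; the open subsets
   are those given by open subfunctors. *)
Definition point_pred (X : kfunctor) := forall K : comAlgType k, X K -> Prop.

Definition point_set (X : kfunctor) (W : point_pred X) : Prop :=
  forall K K' (f : {lrmorphism K -> K'}) (x : X K), is_field K -> is_field K' ->
    (W K x <-> W K' (fmap f x)).

Definition point_sub (X : kfunctor) (W W' : point_pred X) : Prop :=
  forall K (x : X K), is_field K -> W K x -> W' K x.

Definition connected (X : kfunctor) (W : point_pred X) : Prop :=
  (exists K (x : X K), is_field K /\ W K x) /\
  forall U V : subfunctor X, open_sub U -> open_sub V ->
    (forall K (x : X K), is_field K -> W K x -> U K x \/ V K x) ->
    (forall K (x : X K), is_field K -> W K x -> ~ (U K x /\ V K x)) ->
    point_sub W U \/ point_sub W V.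

Definition connected_component (X : kfunctor) (W : point_pred X) : Prop :=
  [/\ point_set W, connected W
    & forall W' : point_pred X,
        point_set W' -> connected W' -> point_sub W W' -> point_sub W' W].

(* Closure of W in |X| with its reduced structure: the smallest closed subscheme
   whose underlying set contains W. *)
Definition red_closure (X : kfunctor) (W : point_pred X) R (x : X R) : Prop :=
  forall Z : subfunctor X, closed_sub Z -> point_sub W Z -> Z R x.

(* Here Z is a subfunctor of X, so its values on all algebras matter.  A regular
   function on Z is given by [s], whose values off Z are irrelevant. *)
Definition regular_on (X : kfunctor) (Z : point_pred X)
    (s : forall R, X R -> R) : Prop :=
  forall R R' (f : {lrmorphism R -> R'}) (x : X R),
    Z R x -> s R' (fmap f x) = f (s R x).

Definition locally_constant_on (X : kfunctor) (Z : point_pred X)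
    (s : forall R, X R -> R) : Prop :=
  forall K (x : X K), is_field K -> Z K x ->
  exists U : subfunctor X,
    [/\ open_sub U, U K x
      & exists c : k, forall R (y : X R), Z R y -> U R y -> s R y = c%:A].

Definition pseudo_complete (X : kfunctor) (Z : point_pred X) : Prop :=
  forall s, regular_on Z s -> locally_constant_on Z s.

End KAlgebras.

Record GL3 (R : comNzRingType) := MkGL3 {
  gmx : 'M[R]_3;
  gmxV : 'M[R]_3;
  gmx_mulV : gmx *m gmxV == 1%:M }.

Lemma GL3_inj (R : comNzRingType) (g h : GL3 R) :
  gmx g = gmx h -> g = h.
Proof.
case: g h => [a a' Ha] [b b' Hb] /= eab; subst b.
have e : a' = b'.
  by rewrite -[a']mulmx1 -(eqP Hb) mulmxA (mulmx1C (eqP Ha)) mul1mx.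
by subst b'; rewrite (eq_irrelevance Ha Hb).
Qed.

Lemma gone_subproof (R : comNzRingType) : (1%:M : 'M[R]_3) *m 1%:M == 1%:M.
Proof. by rewrite mulmx1. Qed.
Definition gone (R : comNzRingType) : GL3 R := MkGL3 (gone_subproof R).

Lemma gmul_subproof (R : comNzRingType) (g h : GL3 R) :
  (gmx g *m gmx h) *m (gmxV h *m gmxV g) == 1%:M.
Proof.
by rewrite mulmxA -(mulmxA (gmx g)) (eqP (gmx_mulV h)) mulmx1 (eqP (gmx_mulV g)).
Qed.
Definition gmul (R : comNzRingType) (g h : GL3 R) : GL3 R :=
  MkGL3 (gmul_subproof g h).

Lemma ginv_subproof (R : comNzRingType) (g : GL3 R) : gmxV g *m gmx g == 1%:M.
Proof. by apply/eqP/mulmx1C/eqP/gmx_mulV. Qed.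
Definition ginv (R : comNzRingType) (g : GL3 R) : GL3 R :=
  MkGL3 (ginv_subproof g).

Lemma gmap_subproof (R R' : comNzRingType) (f : {rmorphism R -> R'}) (g : GL3 R) :
  map_mx f (gmx g) *m map_mx f (gmxV g) == 1%:M.
Proof. by rewrite -map_mxM (eqP (gmx_mulV g)) map_mx1. Qed.
Definition gmap (R R' : comNzRingType) (f : {rmorphism R -> R'}) (g : GL3 R) :
  GL3 R' := MkGL3 (gmap_subproof f g).

Definition Jmx (R : comNzRingType) : 'M[R]_3 :=
  \matrix_(i, j) (i == rev_ord j)%:R.

Lemma Jmx2 (R : comNzRingType) : Jmx R *m Jmx R = 1%:M.
Proof.
apply/matrixP=> i j; rewrite !mxE (bigD1 (rev_ord j)) //= !mxE rev_ordK eqxx.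
rewrite mulr1 big1 ?addr0 // => l /negPf ne.
by rewrite !mxE ne mulr0.
Qed.

Lemma gtwist_subproof (R : comNzRingType) (g : GL3 R) :
  (Jmx R *m (gmxV g)^T *m Jmx R) *m (Jmx R *m (gmx g)^T *m Jmx R) == 1%:M.
Proof.
rewrite !mulmxA -(mulmxA (Jmx R *m (gmxV g)^T)) Jmx2 mulmx1.
by rewrite -(mulmxA (Jmx R)) -trmx_mul (eqP (gmx_mulV g)) trmx1 mulmx1 Jmx2.
Qed.
(* A |-> J (tA)^{-1} J *)
Definition gtwist (R : comNzRingType) (g : GL3 R) : GL3 R :=
  MkGL3 (gtwist_subproof g).

(* The matrix of phi(A) = J sigma(tA)^{-1} J, with sigma the entrywise q-th power. *)
Definition frob_mx (q : nat) (R : comNzRingType) (g : GL3 R) : 'M[R]_3 :=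
  Jmx R *m (map_mx (fun x => x ^+ q) (gmxV g))^T *m Jmx R.

Definition mu (R : comNzRingType) (t : R) : 'M[R]_3 :=
  diag_mx (\row_(i < 3) (if (i < 2)%N then t else 1)).

Definition polyG (R : comNzRingType) (g : GL3 R) : 'M[{poly R}]_3 :=
  map_mx polyC (gmx g).

(* mu(t)^{-1} g mu(t), resp. mu(t) g mu(t)^{-1}, extends to a morphism N from the
   affine line over R to GL_3, and N(0) = l.  The equation N = mu^{-1} g mu is
   written without denominators; mu('X) is not a zero divisor. *)
Definition lim_minus (R : comNzRingType) (g l : GL3 R) : Prop :=
  exists N : GL3 {poly R},
    mu 'X *m gmx N = polyG g *m mu 'X /\
    map_mx (fun p : {poly R} => p.[0]) (gmx N) = gmx l.

Definition lim_plus (R : comNzRingType) (g l : GL3 R) : Prop :=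
  exists N : GL3 {poly R},
    gmx N *m mu 'X = mu 'X *m polyG g /\
    map_mx (fun p : {poly R} => p.[0]) (gmx N) = gmx l.

(* P = P_-(mu); the Levi component of x in L is its limit. *)
Definition in_P (R : comNzRingType) (x : GL3 R) : Prop :=
  exists l, lim_minus x l.

Definition in_B (R : comNzRingType) (x : GL3 R) : Prop := is_trig_mx (gmx x).

(* y lies in Q = (P_+(mu))^(q), with Levi component m in M = L^(q).  The equations
   of P_+(mu) and L in GL_3 have coefficients in the prime field, so their
   conjugates under sigma : k -> k are given by the same equations; under the
   identification G^(q) = G given by the F_q-structure of U(3) these become the
   images by A |-> J (tA)^{-1} J. *)
Definition lim_Q (R : comNzRingType) (y m : GL3 R) : Prop :=
  exists y' m', [/\ lim_plus y' m', y = gtwist y' & m = gtwist m'].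

Definition zipE (q : nat) (R : comNzRingType) (e : GL3 R * GL3 R) : Prop :=
  exists l m, [/\ lim_minus e.1 l, lim_Q e.2 m & gmx m = frob_mx q l].

Definition zipE' (q : nat) (R : comNzRingType) (e : GL3 R * GL3 R) : Prop :=
  zipE q e /\ in_B e.1.

Definition G2pred := forall R : comNzRingType, GL3 R * GL3 R -> Prop.

Definition zip_act (R : comNzRingType) (e : GL3 R * GL3 R) (g : GL3 R) : GL3 R :=
  gmul (gmul e.1 g) (ginv e.2).

Section ZipStacks.
Variable k : closedFieldType.
Implicit Types R K : comAlgType k.

Lemma GLfun_id R (g : GL3 R) : gmap idfun g = g.
Proof. by apply: GL3_inj; rewrite /= map_mx_id. Qed.

Lemma GLfun_comp (R R' R'' : comAlgType k)
    (f : {lrmorphism R -> R'}) (h : {lrmorphism R' -> R''}) (g : GL3 R) :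
  gmap (h \o f) g = gmap h (gmap f g).
Proof. by apply: GL3_inj; rewrite /= map_mx_comp. Qed.

Definition GLfun : kfunctor k :=
  @KFunctor k (fun R => GL3 R) (fun R R' f g => gmap f g) GLfun_id GLfun_comp.

(* Actions are total on pairs (x, y); only elements of the subgroup H of GL_3 x GL_3
   are ever constrained or used. *)
Definition pre_action (X : kfunctor k) :=
  forall R, GL3 R * GL3 R -> X R -> X R.

Definition is_action (H : G2pred) (X : kfunctor k) (act : pre_action X) : Prop :=
  [/\ forall R (i : X R), act R (gone R, gone R) i = i,
      forall R (e e' : GL3 R * GL3 R) (i : X R), H R e -> H R e' ->
        act R (gmul e.1 e'.1, gmul e.2 e'.2) i = act R e (act R e' i)
    & forall (R R' : comAlgType k) (f : {lrmorphism R -> R'})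
        (e : GL3 R * GL3 R) (i : X R), H R e ->
        fmap f (act R e i) = act R' (gmap f e.1, gmap f e.2) (fmap f i)].

(* Torsor for the etale topology; etale covers of Spec R are refined by a single
   faithfully flat etale R-algebra. *)
Definition is_torsor (H : G2pred) (X Y : kfunctor k) (act : pre_action X)
    (pi : kmor X Y) : Prop :=
  [/\ forall R (e : GL3 R * GL3 R) (i : X R), H R e -> pi R (act R e i) = pi R i,
      forall R (i j : X R), pi R i = pi R j ->
        exists! e : GL3 R * GL3 R, H R e /\ act R e i = j
    & forall R (y : Y R), exists R' (f : {lrmorphism R -> R'}) (i : X R'),
        etale_cover f /\ pi R' i = fmap f y].

(* A morphism zeta : S -> G-Zip^mu = [E \ G_k]: an E-torsor on S with an
   E-equivariant map to G_k.  As E is affine, the torsor is a scheme. *)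
Record zip_mor (q : nat) (S : kfunctor k) := ZipMor {
  ztors : kfunctor k;
  ztors_scheme : is_scheme ztors;
  zact : pre_action ztors;
  zactP : is_action (@zipE q) zact;
  zproj : kmor ztors S;
  zprojP : is_torsor (@zipE q) zact zproj;
  zmap : kmor ztors GLfun;
  zmap_equiv : forall R (e : GL3 R * GL3 R) (i : ztors R), zipE q e ->
    zmap R (zact e i) = zip_act e (zmap R i) }.

(* The torsor is the base change of S along the smooth atlas G_k -> [E \ G_k], and
   smoothness of a representable morphism is tested on an atlas. *)
Definition zip_smooth (q : nat) (S : kfunctor k) (zeta : zip_mor q S) : Prop :=
  smooth (zmap zeta).

(* Points of [E \ G_k] are represented by field-valued points of G_k. *)
Definition zip_surjective_on_components (q : nat) (S : kfunctor k)
    (zeta : zip_mor q S) : Prop :=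
  forall W : point_pred S, connected_component W ->
  forall K (g : GL3 K), is_field K ->
  exists K' (f : {lrmorphism K -> K'}) (i : ztors zeta K'),
    [/\ is_field K', W K' (zproj zeta K' i) & zmap zeta K' i = gmap f g].

(* Flag(S) = S x_{[E \ G]} [E' \ G] is the quotient by E' of the E-torsor on S,
   i.e. the scheme over which that torsor becomes an E'-torsor. *)
Record flag_space (q : nat) (S : kfunctor k) (zeta : zip_mor q S) := FlagSpace {
  flag : kfunctor k;
  flag_scheme : is_scheme flag;
  fproj : kmor (ztors zeta) flag;
  fprojP : is_torsor (@zipE' q) (zact (z := zeta)) fproj }.

(* s : 'S_3 is represented in N(T) by perm_mx s, which is multiplicative for the
   product of 'S_3. *)
Definition w0 : 'S_3 := perm (@rev_ord_inj 3).
Definition w0I : 'S_3 := tperm (inord 0) (inord 1).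

(* The Frobenius maps perm_mx s to J (perm_mx s) J, and J = perm_mx w0. *)
Definition sigmaW (s : 'S_3) : 'S_3 := (w0 * s * w0)%g.

Definition zW : 'S_3 := (sigmaW w0I * w0)%g.

Definition lenW (s : 'S_3) : nat :=
  #|[set p : 'I_3 * 'I_3 | (p.1 < p.2)%N && (s p.2 < s p.1)%N]|.

Definition in_cell (w : 'S_3) (R : comNzRingType) (g : GL3 R) : Prop :=
  exists b b' : GL3 R, [/\ in_B b, in_B b'
    & gmx g = gmx b *m perm_mx w *m gmx b' *m perm_mx (zW^-1)%g].

Definition flag_stratum (q : nat) (S : kfunctor k) (zeta : zip_mor q S)
    (F : flag_space zeta) (w : 'S_3) : point_pred (flag F) :=
  fun K x => exists K' (f : {lrmorphism K -> K'}) (i : ztors zeta K'),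
    [/\ is_field K', fproj F K' i = fmap f x & in_cell w (zmap zeta K' i)].

Definition flag_curves_pseudo_complete (q : nat) (S : kfunctor k)
    (zeta : zip_mor q S) (F : flag_space zeta) : Prop :=
  forall w : 'S_3, lenW w = 1%N ->
    pseudo_complete (red_closure (flag_stratum (F := F) w)).

(* u ^ a for a unit u with inverse u' *)
Definition upow (R : comNzRingType) (u u' : R) (a : int) : R :=
  match a with Posz n => u ^+ n | Negz n => u' ^+ n.+1 end.

(* lambda(b) for b in B; the diagonal of b^{-1} is the inverse of that of b. *)
Definition chi (la : 'rV[int]_3) (R : comNzRingType) (b : GL3 R) : R :=
  \prod_(i < 3) upow (gmx b i i) (gmxV b i i) (la ord0 i).

(* R-points of V_I(lambda) = Ind_B^P(lambda), i.e. elements of V_I(lambda) (x)_k R: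
   functions v on P_R with v(x b) = lambda(b)^{-1} v(x).  (Induction commutes with
   the flat base change k -> R.)  Values off P are irrelevant. *)
Definition PfunT (R : comAlgType k) : Type :=
  forall R' : comAlgType k, {lrmorphism R -> R'} -> GL3 R' -> R'.

Definition in_VI (la : 'rV[int]_3) (R : comAlgType k) (v : PfunT R) : Prop :=
  (forall (R' R'' : comAlgType k) (f : {lrmorphism R -> R'})
      (h : {lrmorphism R' -> R''}) (x : GL3 R'), in_P x ->
      v R'' (h \o f) (gmap h x) = h (v R' f x)) /\
  (forall (R' : comAlgType k) (f : {lrmorphism R -> R'}) (x b : GL3 R'),
      in_P x -> in_B b -> v R' f (gmul x b) = chi la (ginv b) * v R' f x).

(* For an E-scheme X, sections on [E \ X] of the bundle V_I(lambda): morphisms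
   s : X -> V_I(lambda) with s(e . i) = e . s(i), where e = (a, b) acts on V_I(lambda)
   through the action (a . v)(x) = v(a^{-1} x) of P. *)
Definition is_section (q : nat) (la : 'rV[int]_3) (X : kfunctor k)
    (act : pre_action X) (s : forall R, X R -> PfunT R) : Prop :=
  [/\ forall R (i : X R), in_VI la (s R i),
      forall (R R' R'' : comAlgType k) (f : {lrmorphism R -> R'})
        (h : {lrmorphism R' -> R''}) (i : X R) (x : GL3 R''), in_P x ->
        s R' (fmap f i) R'' h x = s R i R'' (h \o f) x
    & forall (R R' : comAlgType k) (f : {lrmorphism R -> R'})
        (e : GL3 R * GL3 R) (i : X R) (x : GL3 R'), zipE q e -> in_P x ->
        s R (act R e i) R' f x = s R i R' f (gmul (ginv (gmap f e.1)) x)].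

Definition H0_nonzero (q : nat) (X : kfunctor k) (act : pre_action X)
    (la : 'rV[int]_3) : Prop :=
  exists s : forall R, X R -> PfunT R, is_section q la act s /\
    exists R (i : X R) (R' : comAlgType k) (f : {lrmorphism R -> R'}) (x : GL3 R'),
      in_P x /\ s R i R' f x <> 0.

Definition C_zip (q : nat) (la : 'rV[int]_3) : Prop :=
  @H0_nonzero q GLfun (fun R e g => zip_act e g) la.

(* H^0(S, V_I(lambda)), the pullback along zeta being X x^E V_I(lambda) for the
   E-torsor X on S. *)
Definition C_S (q : nat) (S : kfunctor k) (zeta : zip_mor q S)
    (la : 'rV[int]_3) : Prop :=
  H0_nonzero q (zact (z := zeta)) la.

End ZipStacks.

Definition saturation (C : 'rV[int]_3 -> Prop) (la : 'rV[int]_3) : Prop :=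
  exists2 N : nat, (0 < N)%N & C (la *+ N).

(* Main.v *)
Require Import Defs.
From HB Require Import structures.
From mathcomp Require Import all_boot all_order all_fingroup all_algebra.
From mathcomp Require Import -(notations) mpoly.
From mathcomp Require Import ring_quotient.
From mathcomp Require Import boolp ring.
From mathcomp Require classical_sets.

(* A section of V_I(la) on [E \ X] is a regular function f on the E-torsor X with
   f(e x) = la(e.1) f(x) for e in E' = E /\ (B x G), by Frobenius reciprocity.  Write
   f2, f3 for the minors of the rows 0, 1 of g in the columns (0, 1) and (0, 2), and
   h = g00^q f2 - g10^q f3.  The monomials f3^a h^b det^c with a, b >= 0 produce, up to
   multiples, all weights la = (l0, l1, l2) with l0 >= l1 and (q - 1) l0 + l1 <= q l2.

   Conversely let f <> 0 have weight la on X.  For the lower unipotent u_T of L, lifted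
   to E, f(u_T x) is a polynomial in T of degree at most d = l0 - l1, so l0 >= l1.  If f
   vanishes on the divisor f3 = 0, divide f by f3 and induct on d.  Otherwise raise the
   coefficients of this polynomial to the q-th power, homogenize in degree d and evaluate
   at (f2, - f3).  The result rho is not zero, and the set of points near which rho
   vanishes is open, closed and E-stable; as X meets the smallest zip stratum
   g00 = g10 = 0 over every component of S, rho is not zero near a point of that stratum.
   On g00 = 0, rho is divisible by g10^d; dividing by the largest possible power of g10
   leaves a function psi, of weight (a0, a1, a2) say, with psi(x) <> 0 at some x with
   g10 = 0.  As long as q (a0 - a2) - (a1 - a2) > 0, a power of psi times monomials in
   g10, g01 and det is E'-invariant on the closure g00 = g02 = 0 of a one-dimensional
   flag stratum and vanishes where g10 = 0; it is locally constant, so psi is divisible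
   by g02 near that locus.  Repeating this, psi is divisible by g02^J with
   J q (q + 1) >= q (a0 - a2) - (a1 - a2).  Since g02(u_T x) has degree q + 1 in T and
   psi(u_T x) has degree at most a0 - a1, this gives J (q + 1) <= a0 - a1, hence
   a1 <= a2, which for the weight of psi is the second inequality.

   Functions on X are controlled through smoothness: X is reduced, a function that
   vanishes on all jets at a point vanishes near that point, and a function that
   vanishes where a transversal function does is divisible by it.  Functions on Flag(S)
   are obtained from functions on X by etale descent; the flatness behind it comes from
   formal etaleness, which provides an endomorphism of a polynomial ring contracting
   towards the etale algebra. *)

Set Implicit Arguments.
Unset Strict Implicit.
Unset Printing Implicit Defensive.

Import Order.TTheory GRing.Theory Num.Theory.
Local Open Scope ring_scope.

(** * Quotients, points and localizations of algebras *)

(** Why q-th powers: f2 is fixed by u_t and f3 goes to f3 + t^q f2, while the polynomial f(u_T x) is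
    translated by t. After the Frobenius both shifts are t^q, and they cancel in rho. The weight
    (q+1, 1, q) of f3 lies on the hyperplane (q - 1) l0 + l1 = q l2, so division by f3 does not
    affect the second inequality, and it lowers d by q. If f does not vanish on f3 = 0, the bound
    for psi gives even l0 <= l2.

    The obstacle in dividing by g02: X need not be connected, and pseudo-completeness makes
    functions on the curve closure only locally constant. The invariant function may be nonzero on
    parts of that locus away from g10 = 0. Each division is therefore made on an open set that
    contains the rest of the divisor g00 = 0 and meets the locus in an open and closed subset
    containing its points with g10 = 0. It subtracts (q+1, 0, 0) from the weight, hence q (q + 1)
    from q (a0 - a2) - (a1 - a2), which is the origin of the bound on J. *)

Definition is_ideal (T : comNzRingType) (J : T -> Prop) : Prop :=
  [/\ J 0, forall x y, J x -> J y -> J (x + y) & forall a x, J x -> J (a * x)].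

(** Properness keeps the quotient nonzero, as [comNzRingType] demands; this is why several proofs
    below first split off the case of the unit ideal. *)
Record pideal (T : comNzRingType) := PIdeal {
  pid :> T -> Prop;
  pid_ideal : is_ideal pid;
  pid1 : ~ pid 1 }.

Definition pidb (T : comNzRingType) (J : pideal T) : T -> bool := fun x => `[< J x >].

Lemma pidb_closed (T : comNzRingType) (J : pideal T) : idealr_closed (pidb J).
Proof.
case: (pid_ideal J) => J0 JD JM; split; rewrite ?unfold_in /pidb.
- exact/asboolP.
- by apply/asboolP; exact: pid1.
- move=> a x y; rewrite !unfold_in => /asboolP Jx /asboolP Jy.
  by apply/asboolP/JD => //; exact: JM.
Qed.
HB.instance Definition _ (T : comNzRingType) (J : pideal T) :=
  isIdealr.Build T (pidb J) (pidb_closed J).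

Definition pidI (T : comNzRingType) (J : pideal T) : idealr T :=
  Idealr.clone T (pidb J) _.

Section QAlg.
Variables (k : closedFieldType) (T : comNzRingType) (eta : {rmorphism k -> T}).
Variable J : pideal T.

(** The idle [let] makes the type depend on [eta], so that the scalar multiplication of k through
    [eta] can be attached to it. *)
Definition qalg : Type := let _ := eta in {ideal_quot (pidI J)}.
HB.instance Definition _ := GRing.ComNzRing.on qalg.
Definition qpi : T -> qalg := \pi_({ideal_quot (pidI J)})%qT.
Lemma qpi_zmod : zmod_morphism qpi.
Proof. exact: raddfB. Qed.
HB.instance Definition _ := GRing.isZmodMorphism.Build T qalg qpi qpi_zmod.
Lemma qpi_monoid : monoid_morphism qpi.
Proof. exact: (rmorphism_monoidP \pi_({ideal_quot (pidI J)})%qT). Qed.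
HB.instance Definition _ := GRing.isMonoidMorphism.Build T qalg qpi qpi_monoid.

Definition qscale (a : k) (x : qalg) : qalg := qpi (eta a) * x.
Lemma qscaleA a b v : qscale a (qscale b v) = qscale (a * b) v.
Proof. by rewrite /qscale mulrA !rmorphM. Qed.
Lemma qscale1 : left_id 1 qscale.
Proof. by move=> x; rewrite /qscale !rmorph1 mul1r. Qed.
Lemma qscaleDr : right_distributive qscale +%R.
Proof. by move=> a x y; rewrite /qscale mulrDr. Qed.
Lemma qscaleDl v : {morph qscale^~ v : a b / a + b}.
Proof. by move=> a b; rewrite /qscale !rmorphD mulrDl. Qed.
HB.instance Definition _ :=
  GRing.Zmodule_isLmodule.Build k qalg qscaleA qscale1 qscaleDr qscaleDl.
Lemma qscaleAl (a : k) (u v : qalg) : a *: (u * v) = a *: u * v.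
Proof. by rewrite /GRing.scale /= /qscale mulrA. Qed.
HB.instance Definition _ := GRing.Lmodule_isLalgebra.Build k qalg qscaleAl.
HB.instance Definition _ := GRing.Lalgebra_isComAlgebra.Build k qalg.

Lemma qpi_surj (y : qalg) : exists x, qpi x = y.
Proof. by exists (generic_quotient.repr (y : {ideal_quot (pidI J)})); rewrite /qpi generic_quotient.reprK. Qed.

Lemma qpi0P x : qpi x = 0 <-> J x.
Proof.
have -> : (0 : qalg) = qpi 0 by rewrite rmorph0.
rewrite /qpi; split.
  by move/eqP; rewrite -Quotient.idealrBE subr0 => /asboolP.
by move=> Jx; apply/eqP; rewrite -Quotient.idealrBE subr0; apply/asboolP.
Qed.

Lemma qpi_eq x y : qpi x = qpi y <-> J (x - y).
Proof.
rewrite -qpi0P rmorphB /=; split=> [->|/eqP]; first by rewrite subrr.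
by rewrite subr_eq0 => /eqP.
Qed.

Lemma qpi_alg (c : k) : qpi (eta c) = c%:A.
Proof. by rewrite /GRing.scale /= /qscale mulr1. Qed.
End QAlg.

Definition QAlg (k : closedFieldType) (T : comNzRingType)
  (eta : {rmorphism k -> T}) (J : pideal T) : comAlgType k := qalg eta J.

Lemma idealN_ (T : comNzRingType) (J : T -> Prop) x : is_ideal J -> J x -> J (- x).
Proof. by case=> _ _ JM Jx; rewrite -mulN1r; exact: JM. Qed.

Lemma idealB_ (T : comNzRingType) (J : T -> Prop) x y :
  is_ideal J -> J x -> J y -> J (x - y).
Proof. by move=> iJ Jx Jy; case: (iJ) => _ JD _; apply: JD => //; exact: idealN_. Qed.

Section LR.
Variable k : closedFieldType.

Section MkLR.
Variables (A B : comAlgType k) (f : {rmorphism A -> B}).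
Hypothesis fk : forall c : k, f c%:A = c%:A.
Definition mklr_fun := (f : A -> B).
Lemma mklr_zmod : zmod_morphism mklr_fun. Proof. exact: raddfB. Qed.
HB.instance Definition _ := GRing.isZmodMorphism.Build A B mklr_fun mklr_zmod.
Lemma mklr_monoid : monoid_morphism mklr_fun.
Proof. by split; [exact: rmorph1 | exact: rmorphM]. Qed.
HB.instance Definition _ := GRing.isMonoidMorphism.Build A B mklr_fun mklr_monoid.
Lemma mklr_scal : scalable mklr_fun.
Proof.
by move=> c x; rewrite /mklr_fun -mulr_algl rmorphM /= fk mulr_algl.
Qed.
HB.instance Definition _ := GRing.isScalable.Build k A B *:%R mklr_fun mklr_scal.
Definition mklr : {lrmorphism A -> B} := mklr_fun.
Lemma mklrE x : mklr x = f x. Proof. by []. Qed.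
End MkLR.

Section QLift.
Variables (T : comNzRingType) (eta : {rmorphism k -> T}) (J : pideal T).
Variables (B : comAlgType k) (f : {rmorphism T -> B}).
Hypothesis fJ : forall x, J x -> f x = 0.
Hypothesis fk : forall c : k, f (eta c) = c%:A.
Let Q := QAlg eta J.
Definition qlift_fun (y : Q) : B :=
  f (generic_quotient.repr (y : {ideal_quot (pidI J)})).
Lemma qlift_pi x : qlift_fun (qpi eta J x) = f x.
Proof.
rewrite /qlift_fun; apply/eqP; rewrite -subr_eq0 -rmorphB; apply/eqP/fJ.
by apply/(@qpi_eq _ _ eta); rewrite /qpi generic_quotient.reprK.
Qed.
Lemma qlift_zmod : zmod_morphism qlift_fun.
Proof.
move=> y1 y2; case: (qpi_surj y1) => x1 <-; case: (qpi_surj y2) => x2 <-.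
by rewrite -rmorphB !qlift_pi rmorphB.
Qed.
HB.instance Definition _ := GRing.isZmodMorphism.Build Q B qlift_fun qlift_zmod.
Lemma qlift_monoid : monoid_morphism qlift_fun.
Proof.
split=> [|y1 y2]; first by rewrite -(rmorph1 (qpi eta J)) qlift_pi rmorph1.
case: (qpi_surj y1) => x1 <-; case: (qpi_surj y2) => x2 <-.
by rewrite -rmorphM !qlift_pi rmorphM.
Qed.
HB.instance Definition _ := GRing.isMonoidMorphism.Build Q B qlift_fun qlift_monoid.
Lemma qlift_scal : scalable qlift_fun.
Proof.
move=> c y; case: (qpi_surj y) => x <-.
by rewrite -mulr_algl -qpi_alg -rmorphM !qlift_pi rmorphM /= fk mulr_algl.
Qed.
HB.instance Definition _ := GRing.isScalable.Build k Q B *:%R qlift_fun qlift_scal.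
Definition qlift : {lrmorphism Q -> B} := qlift_fun.
Lemma qliftE x : qlift (qpi eta J x) = f x.
Proof. exact: qlift_pi. Qed.
End QLift.
End LR.

Lemma exists_maximal_ideal (T : comNzRingType) (J : T -> Prop) :
  is_ideal J -> ~ J 1 ->
  exists M : pideal T, (forall x, J x -> M x) /\
    forall x, ~ M x -> exists a b, M b /\ a * x + b = 1.
Proof.
move=> iJ J1.
pose P (X : T -> Prop) := X = (fun _ => False) \/
   [/\ is_ideal X, forall x, J x -> X x & ~ X 1].
have [|A [PA Amax]] := @classical_sets.Zorn_bigcup T P.
  move=> F FP Ftot.
  have [[X [FX [x Xx]]]|no] := pselect (exists X, F X /\ exists x, X x); last first.
    left; apply/funext => x; apply/propext; split=> // -[X FX Xx].
    by case: no; exists X; split=> //; exists x.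
  have FI Y y : F Y -> Y y -> [/\ is_ideal Y, forall x, J x -> Y x & ~ Y 1].
    by move=> FY Yy; case: (FP Y FY) => // Y0; rewrite Y0 in Yy.
  have [iX JX X1] := FI X x FX Xx.
  right; split.
  - split.
    + by exists X => //; case: iX.
    + move=> y z [Y FY Yy] [Z FZ Zz].
      case: (FI Y y FY Yy) (FI Z z FZ Zz) => [[_ YD _] _ _] [[_ ZD _] _ _].
      case: (Ftot Y Z FY FZ) => sub.
        by exists Z => //; apply: ZD => //; exact: sub.
      by exists Y => //; apply: YD => //; exact: sub.
    + move=> a y [Y FY Yy]; exists Y => //.
      by case: (FI Y y FY Yy) => -[_ _ YM] _ _; exact: YM.
  - by move=> y Jy; exists X => //; exact: JX.
  - by move=> [Y FY Y1]; case: (FI Y 1 FY Y1).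
have iA : [/\ is_ideal A, forall x, J x -> A x & ~ A 1].
  case: PA => // A0; exfalso; apply: (Amax J).
    split; first by rewrite A0.
    by move=> sub; have := sub 0 (let: And3 J0 _ _ := iJ in J0); rewrite A0.
  by right.
case: iA => iA JA A1; exists (PIdeal iA A1); split=> // x Ax /=.
pose B y := exists a b, A b /\ y = a * x + b.
have [B1|B1] := pselect (B 1).
  by case: B1 => a [b [Ab e]]; exists a, b.
exfalso; apply: (Amax B).
  split; first by move=> y Ay; exists 0, y; rewrite mul0r add0r.
  move=> sub; apply: Ax; apply: sub; exists 1, 0; rewrite mul1r addr0.
  by split=> //; case: (iA).
right; split=> //.
  case: (iA) => A0 AD AM; split.
  + by exists 0, 0; rewrite mul0r addr0.
  + move=> y z [a [b [Ab ->]]] [c [d [Ad ->]]]; exists (a + c), (b + d).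
    by split; [exact: AD | rewrite mulrDl addrACA].
  + move=> c y [a [b [Ab ->]]]; exists (c * a), (c * b).
    by split; [exact: AM | rewrite mulrDr mulrA].
by move=> y Jy; exists 0, y; split; [exact: JA | rewrite mul0r add0r].
Qed.

Section KAlg.
Variable k : closedFieldType.
Implicit Types R A B C K : comAlgType k.

Section Quot.
Variables (R : comAlgType k) (J : pideal R).
Definition qa : comAlgType k := QAlg (GRing.in_alg R) J.
Lemma qa_k (c : k) : qpi (GRing.in_alg R) J c%:A = c%:A.
Proof. exact: qpi_alg. Qed.
Definition qap : {lrmorphism R -> qa} := mklr qa_k.
Lemma qap_surj y : exists x, qap x = y. Proof. exact: qpi_surj. Qed.
Lemma qap0 x : qap x = 0 <-> J x. Proof. exact: qpi0P. Qed.
Lemma qap_eq x y : qap x = qap y <-> J (x - y). Proof. exact: qpi_eq. Qed.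
Lemma qap_lift B (f : {lrmorphism R -> B}) :
  (forall x, J x -> f x = 0) -> exists g : {lrmorphism qa -> B}, forall x, g (qap x) = f x.
Proof.
move=> fJ; have fk (c : k) : f (GRing.in_alg R c) = c%:A by exact: rmorph_alg.
by exists (qlift fJ fk) => x; exact: qliftE.
Qed.
End Quot.

Lemma exists_field_quotient R (J : R -> Prop) : is_ideal J -> ~ J 1 ->
  exists K (f : {lrmorphism R -> K}), is_field K /\ forall x, J x -> f x = 0.
Proof.
move=> iJ J1; have [M [JM Mmax]] := exists_maximal_ideal iJ J1.
exists (qa M), (qap M); split; last by move=> x Jx; apply/qap0/JM.
move=> y y0; have [x xy] := qap_surj y.
have /Mmax [a [b [Mb e]]] : ~ M x by move=> Mx; rewrite -xy (proj2 (qap0 M x) Mx) eqxx in y0.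
exists (qap M a); rewrite -xy -rmorphM -(rmorph1 (qap M)); apply/qap_eq.
have -> : x * a - 1 = - b by rewrite -e opprD addrA mulrC subrr add0r.
exact: idealN_ (pid_ideal M) Mb.
Qed.

(** Otherwise J lies in a maximal ideal, and all of J vanishes at its residue field. Most
    local-to-global arguments below apply this to an ideal of denominators or annihilators. *)
Lemma ideal1_pt R (J : R -> Prop) : is_ideal J ->
  (forall K (f : {lrmorphism R -> K}), is_field K -> exists2 x, J x & f x <> 0) -> J 1.
Proof.
move=> iJ H; apply: contrapT => J1.
have [K [f [fK fJ]]] := exists_field_quotient iJ J1.
by have [x Jx] := H K f fK; apply; exact: fJ.
Qed.

Lemma exists_field_pt R : exists K (f : {lrmorphism R -> K}), is_field K.
Proof.
have [||K [f [fK _]]] := @exists_field_quotient R (fun x => x = 0).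
- split=> // [x y -> ->|a x ->]; first exact: addr0.
  exact: mulr0.
- by apply/eqP; exact: oner_neq0.
by exists K, f.
Qed.

Lemma zero_local R (x : R) :
  (forall K (f : {lrmorphism R -> K}), is_field K ->
     exists2 s, s * x = 0 & f s <> 0) -> x = 0.
Proof.
move=> H; rewrite -[x]mul1r.
apply: (@ideal1_pt R (fun s => s * x = 0)) => //.
split=> [|s t sx tx|a s sx]; first exact: mul0r.
  by rewrite mulrDl sx tx addr0.
by rewrite -mulrA sx mulr0.
Qed.

Section Field.
Variables (K : comAlgType k) (fK : is_field K).
Lemma field_mul0 (x y : K) : x * y = 0 -> x <> 0 -> y = 0.
Proof.
move=> xy /eqP /fK [z xz].
by rewrite -[y]mul1r -xz -mulrA [z * y]mulrC mulrA xy mul0r.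
Qed.
Lemma field_mulf (x y : K) : x <> 0 -> y <> 0 -> x * y <> 0.
Proof. by move=> x0 y0 xy; apply: y0; exact: field_mul0 xy x0. Qed.
Lemma field_exp0 (x : K) n : x ^+ n = 0 -> x = 0.
Proof.
elim: n => [|n IH]; first by rewrite expr0 => /eqP; rewrite oner_eq0.
rewrite exprS => e; apply: contrapT => x0; apply: (x0); apply: IH.
exact: field_mul0 e x0.
Qed.
End Field.

Definition rC R : {rmorphism k -> {poly R}} := polyC \o GRing.in_alg R.

(** Comparing coefficients forces g to be the geometric series - a (1 + x X + x^2 X^2 + ...), and a
    polynomial has only finitely many nonzero coefficients. *)
Lemma loc_ker R (x : R) (a : R) (g : {poly R}) :
  a%:P = g * (x *: 'X - 1) -> exists n, x ^+ n * a = 0.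
Proof.
move=> e.
have co i : (a%:P)`_i = x * (g * 'X)`_i - g`_i.
  by rewrite e mulrBr mulr1 coefB -scalerAr coefZ.
have g0 : g`_0 = - a by move: (co 0%N); rewrite coefC coefMX /= mulr0 sub0r => ->; rewrite opprK.
have gS i : g`_i.+1 = x * g`_i.
  by move: (co i.+1); rewrite coefC coefMX /= => /esym/eqP; rewrite subr_eq0 => /eqP.
have gi i : g`_i = - (x ^+ i * a).
  elim: i => [|i IH]; first by rewrite expr0 mul1r.
  by rewrite gS IH exprS mulrN mulrA.
exists (size g); apply/eqP; rewrite -oppr_eq0 -gi; apply/eqP.
exact: nth_default.
Qed.

Lemma exists_localization R (x : R) : (forall n, x ^+ n <> 0) ->
  exists (Rx : comAlgType k) (l : {lrmorphism R -> Rx}), is_localization l x /\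
    forall C (f : {lrmorphism R -> C}) (u : C), f x * u = 1 ->
      exists f' : {lrmorphism Rx -> C}, forall a, f' (l a) = f a.
Proof.
move=> xn; pose J (p : {poly R}) := exists g, p = g * (x *: 'X - 1).
have iJ : is_ideal J.
  split=> [|p q [g ->] [h ->]|a p [g ->]]; first by exists 0; rewrite mul0r.
    by exists (g + h); rewrite mulrDl.
  by exists (a * g); rewrite mulrA.
have J1 : ~ J 1.
  by case=> g; rewrite -[1]/(1%:P) => /loc_ker [n]; rewrite mulr1; exact: xn.
pose M := PIdeal iJ J1; pose Q := QAlg (rC R) M.
pose pi : {rmorphism {poly R} -> Q} := qpi (rC R) M.
have lk (c : k) : (pi \o polyC : {rmorphism R -> Q}) c%:A = c%:A by exact: qpi_alg.
exists Q, (mklr lk); split.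
  split.
  - exists (pi 'X); rewrite mklrE /= -rmorphM -(rmorph1 pi); apply/qpi_eq.
    by exists 1; rewrite mul1r mul_polyC.
  - move=> b; have [p <-] := qpi_surj b; rewrite -/pi.
    elim/poly_ind: p => [|p c [n [a e]]].
      by exists 0%N, 0; rewrite !rmorph0 mul0r.
    have piX : pi 'X * pi x%:P = 1.
      rewrite -rmorphM -(rmorph1 pi); apply/qpi_eq; exists 1.
      by rewrite mul1r mulrC mul_polyC.
    exists n.+1, (a + c * x ^+ n.+1).
    have e' : pi p * pi x%:P ^+ n = pi a%:P := e.
    have -> : mklr lk (a + c * x ^+ n.+1) = pi a%:P + pi c%:P * pi x%:P ^+ n.+1.
      by rewrite mklrE /= polyCD polyCM polyC_exp rmorphD rmorphM rmorphXn.
    change (pi (p * 'X + c%:P) * pi x%:P ^+ n.+1 =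
      pi a%:P + pi c%:P * pi x%:P ^+ n.+1).
    by rewrite -e' rmorphD rmorphM mulrDl exprSr mulrACA piX mulr1.
  - move=> a; rewrite mklrE /= => /qpi0P [g]; exact: loc_ker.
move=> C f u fu.
have cf : commr_rmorph f u by move=> c; rewrite /GRing.comm mulrC.
have hJ p : M p -> horner_morph cf p = 0.
  case=> g ->; rewrite rmorphM rmorphB rmorph1 -mul_polyC rmorphM /=.
  by rewrite horner_morphC horner_morphX fu subrr mulr0.
have hk (c : k) : horner_morph cf (rC R c) = c%:A.
  by rewrite /= horner_morphC; exact: rmorph_alg.
exists (qlift hJ hk) => a.
change (qlift hJ hk (qpi (rC R) M a%:P) = f a); rewrite qliftE.
exact: horner_morphC.
Qed.

Lemma nilpotent_pt R (x : R) :
  (forall K (f : {lrmorphism R -> K}), is_field K -> f x = 0) -> exists n, x ^+ n = 0.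
Proof.
move=> H; apply: contrapT => no.
have xn n : x ^+ n <> 0 by move=> e; apply: no; exists n.
have [Rx [l [[[u lu] _ _] _]]] := exists_localization xn.
have [K [f fK]] := exists_field_pt Rx.
have := H K (f \o l) fK; rewrite /= => fl.
move: (congr1 f lu); rewrite rmorphM /= fl mul0r rmorph1 => /esym/eqP.
by rewrite oner_eq0.
Qed.
End KAlg.

(** * Noetherian rings and graded relations *)

(** The ideal generated by l, as the intersection of all ideals containing l; membership is then
    used by choosing the ideal, and no coefficients are carried along. *)
Definition spn (T : comNzRingType) (l : seq T) (x : T) : Prop :=
  forall I : T -> Prop, is_ideal I -> (forall y, y \in l -> I y) -> I x.

Definition noeth (T : comNzRingType) : Prop :=
  forall J : T -> Prop, is_ideal J ->
  exists l : seq T, (forall x, x \in l -> J x) /\ forall x, J x -> spn l x.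

Lemma seq_lift (A : Type) (B : eqType) (Q : A -> B -> Prop) (l : seq B) :
  (forall b, b \in l -> exists a, Q a b) ->
  exists s : seq A, forall b, b \in l -> exists2 i, (i < size s)%N &
     forall x0, Q (nth x0 s i) b.
Proof.
elim: l => [|b l IH] H; first by exists [::].
have [s Hs] := IH (fun b' lb' => H b' (@mem_behead _ (b :: l) b' lb')).
have [a Qa] := H b (mem_head _ _).
exists (a :: s) => b'; rewrite inE => /orP [/eqP ->|/Hs [i ilt Qi]].
  by exists 0%N.
by exists i.+1.
Qed.

Section Hilbert.
Variable R : comNzRingType.
Hypothesis nR : noeth R.
Variable J : {poly R} -> Prop.
Hypothesis iJ : is_ideal J.

Let lc d (a : R) := exists p, [/\ J p, (size p <= d.+1)%N & p`_d = a].

Let lc_ideal d : is_ideal (lc d).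
Proof.
case: iJ => J0 JD JM; split.
- by exists 0; rewrite size_poly0 coef0.
- move=> x y [p [Jp sp <-]] [q [Jq sq <-]]; exists (p + q); split.
  + exact: JD.
  + by rewrite (leq_trans (size_polyD _ _)) // geq_max sp sq.
  + by rewrite coefD.
- move=> a x [p [Jp sp <-]]; exists (a%:P * p); split; first exact: JM.
    by rewrite mul_polyC (leq_trans (size_scale_leq _ _)).
  by rewrite coefCM.
Qed.

Let lc_le d e a : (d <= e)%N -> lc d a -> lc e a.
Proof.
move=> /subnK <-; move: (e - d)%N => n [p [Jp sp <-]]; exists ('X^n * p).
split; first by case: iJ => _ _; apply.
  rewrite mulrC (leq_trans (size_polyMleq _ _)) // size_polyXn addnS /=.
  by rewrite addnC -addnS leq_add2l.
by rewrite coefXnM ltnNge leq_addr /= addKn.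
Qed.

Let lcs d : exists s : seq {poly R},
  (forall p, p \in s -> J p /\ (size p <= d.+1)%N) /\
  forall a, lc d a -> spn [seq (p : {poly R})`_d | p <- s] a.
Proof.
have [l [lJ lS]] := nR (lc_ideal d).
pose Q (p : {poly R}) a := [/\ J p, (size p <= d.+1)%N & p`_d = a].
have [s Hs] := @seq_lift _ _ Q l lJ.
exists [seq p <- s | `[< J p >] && (size p <= d.+1)%N]; split.
  by move=> p; rewrite mem_filter => /andP [/andP [/asboolP]].
move=> a /lS la I iI sI; apply: la => // b /Hs [i ilt /(_ 0) [Jp sp <-]].
apply: sI; apply: (map_f (fun p : {poly R} => p`_d) (x := nth 0 s i)).
by rewrite mem_filter mem_nth // sp asboolT.
Qed.

(** The generators are taken in degrees up to D, where the increasing ideals of leading coefficients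
    have become stationary. *)
Lemma hilbert_fg : exists l : seq {poly R},
  (forall x, x \in l -> J x) /\ forall x, J x -> spn l x.
Proof.
have [ss Hss] := choice lcs.
pose lcinf a := exists d, lc d a.
have iinf : is_ideal lcinf.
  split; first by exists 0%N; case: (lc_ideal 0).
    move=> x y [d dx] [e ey]; exists (maxn d e).
    case: (lc_ideal (maxn d e)) => _ D _; apply: D.
      exact: lc_le (leq_maxl _ _) dx.
    exact: lc_le (leq_maxr _ _) ey.
  by move=> a x [d dx]; exists d; case: (lc_ideal d) => _ _; apply.
have [l [lJ lS]] := nR iinf.
have [D HD] : exists D, forall a, a \in l -> lc D a.
  elim: l lJ {lS} => [|a l IH] lJ; first by exists 0%N.
  have [D HD] := IH (fun b lb => lJ b (@mem_behead _ (a :: l) b lb)).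
  have [e ea] := lJ a (mem_head _ _).
  exists (maxn D e) => b; rewrite inE => /orP [/eqP ->|/HD].
    exact: lc_le (leq_maxr _ _) ea.
  exact: lc_le (leq_maxl _ _).
have infD d a : lc d a -> lc (minn d D) a.
  case: (leqP d D) => // Dd da.
  by apply: (lS a); [exists d | exact: lc_ideal | exact: HD].
exists (flatten [seq ss d | d <- iota 0 D.+1]); split.
  by move=> x /flattenP [s /mapP [d _ ->]] /(proj1 (Hss d)) [].
move=> p Jp I iI sI.
have [n sp] : exists n, (size p <= n)%N by exists (size p).
elim: n p Jp sp => [|d IH] p Jp sp.
  by move: sp; rewrite leqn0 size_poly_eq0 => /eqP ->; case: iI.
have lcd : lc d p`_d by exists p.
pose m := minn d D.
have [q [Iq Jq sq qd]] : exists q, [/\ I q, J q, (size q <= d.+1)%N & q`_d = p`_d].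
  apply: (proj2 (Hss m) _ (infD _ _ lcd)
    (fun a => exists q, [/\ I q, J q, (size q <= d.+1)%N & q`_d = a])).
  - case: (iI) (iJ) => I0 ID IM [J0 JD JM]; split.
    + by exists 0; rewrite size_poly0 coef0.
    + move=> x y [q [Iq Jq sq <-]] [q' [Iq' Jq' sq' <-]]; exists (q + q').
      split; [exact: ID | exact: JD | | by rewrite coefD].
      by rewrite (leq_trans (size_polyD _ _)) // geq_max sq sq'.
    + move=> a x [q [Iq Jq sq <-]]; exists (a%:P * q).
      split; [exact: IM | exact: JM | | by rewrite coefCM].
      by rewrite mul_polyC (leq_trans (size_scale_leq _ _)).
  - move=> _ /mapP [q qs ->].
    have [Jq sq] := proj1 (Hss m) q qs.
    have md : (m <= d)%N := geq_minl _ _.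
    exists ('X^(d - m) * q); split.
    + case: (iI) => _ _; apply; apply: sI; apply/flattenP.
      exists (ss m) => //; apply: map_f; rewrite mem_iota add0n ltnS.
      exact: geq_minr.
    + by case: iJ => _ _; apply.
    + rewrite mulrC (leq_trans (size_polyMleq _ _)) // size_polyXn addnS /=.
      by rewrite (leq_trans (leq_add sq (leqnn _))) // addSn subnKC.
    + by rewrite coefXnM ltnNge leq_subr /= subKn.
have Ipq : I (p - q).
  apply: IH; first by apply: idealB_.
  apply/leq_sizeP => j; rewrite leq_eqVlt => /orP [/eqP <-|dj].
    by rewrite coefB qd subrr.
  by rewrite coefB !nth_default ?subrr // (leq_trans _ dj).
by rewrite -[p](subrK q); case: (iI) => _ D' _; exact: D'.
Qed.
End Hilbert.

Lemma noeth_poly (R : comNzRingType) : noeth R -> noeth {poly R}.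
Proof. by move=> nR J iJ; exact: hilbert_fg. Qed.

Lemma noeth_surj (A B : comNzRingType) (f : {rmorphism A -> B}) :
  (forall y, exists x, f x = y) -> noeth A -> noeth B.
Proof.
move=> fs nA J iJ; have iJ' : is_ideal (fun x => J (f x)).
  case: iJ => J0 JD JM; split; first by rewrite rmorph0.
    by move=> x y Jx Jy; rewrite rmorphD; exact: JD.
  by move=> a x Jx; rewrite rmorphM; exact: JM.
have [l [lJ lS]] := nA _ iJ'; exists (map f l); split.
  by move=> _ /mapP [x xl ->]; exact: lJ.
move=> y; have [x <-] := fs y => Jx I iI sI.
apply: (lS x Jx (fun z => I (f z))).
  case: iI => I0 ID IM; split; first by rewrite rmorph0.
    by move=> u v Iu Iv; rewrite rmorphD; exact: ID.
  by move=> a u Iu; rewrite rmorphM; exact: IM.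
by move=> z zl; apply: sI; exact: map_f.
Qed.

Section Mpoly.
Variables (n : nat) (R : comNzRingType).
Notation P := (mpoly n R).
Definition mvar (i : 'I_n) : P := mpolyX R (mnm1 i).

Lemma mpoly_gen (Q : P -> Prop) :
  (forall c, Q (mpolyC n c)) -> (forall i, Q (mvar i)) ->
  (forall p q, Q p -> Q q -> Q (p + q)) -> (forall p q, Q p -> Q q -> Q (p * q)) ->
  forall p, Q p.
Proof.
move=> QC QX QD QM; elim/mpolyind => [|c m p _ _ Qp].
  by rewrite -(mpolyC0 n R).
apply: QD => //; rewrite -mul_mpolyC; apply: (QM) => //.
rewrite mpolyXE_id; apply: (big_ind Q) => [||i _]; [by rewrite -(mpolyC1 n R)|exact: QM|].
elim: (m i) => [|j IH]; first by rewrite expr0 -(mpolyC1 n R).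
by rewrite exprS; apply: QM; [exact: QX | exact: IH].
Qed.

Lemma mmap_var (S : comNzRingType) (f : {rmorphism R -> S}) (h : 'I_n -> S) i :
  mmap f h (mvar i) = h i.
Proof. by rewrite mmapX mmap1U. Qed.

Lemma mpoly_hom_eq (S : comNzRingType) (f g : {rmorphism P -> S}) :
  (forall c, f (mpolyC n c) = g (mpolyC n c)) -> (forall i, f (mvar i) = g (mvar i)) ->
  f =1 g.
Proof.
move=> fgC fgX; apply: mpoly_gen => // p q fp fq.
  by rewrite !rmorphD fp fq.
by rewrite !rmorphM fp fq.
Qed.
End Mpoly.

Lemma noeth_mpoly n (R : comNzRingType) : noeth R -> noeth (mpoly n R).
Proof.
move=> nR; elim: n => [|n IH].
  apply: (@noeth_surj _ _ (@mpolyC 0 R)) => //.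
  apply: mpoly_gen.
  + by move=> c; exists c.
  + by case.
  + by move=> _ _ [x <-] [y <-]; exists (x + y); rewrite rmorphD.
  + by move=> _ _ [x <-] [y <-]; exists (x * y); rewrite rmorphM.
have cf : commr_rmorph (@mwiden n R) (mvar R ord_max).
  by move=> c; rewrite /GRing.comm mulrC.
apply: (@noeth_surj _ _ (horner_morph cf)); last exact: noeth_poly.
apply: mpoly_gen => [c|i|_ _ [x <-] [y <-]|_ _ [x <-] [y <-]].
- by exists (mpolyC n c)%:P; rewrite /= horner_morphC /= mwidenC.
- case: (unliftP ord_max i) => [j ->|->]; last by exists 'X; rewrite /= horner_morphX.
  exists (mvar R j)%:P; rewrite /= horner_morphC /= /mvar mwidenX mnmwiden1.
  by congr (mpolyX _ (mnm1 _)); apply/val_inj; rewrite /= /bump leqNgt ltn_ord.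
- by exists (x + y); rewrite rmorphD.
- by exists (x * y); rewrite rmorphM.
Qed.

Lemma noeth_field (R : comNzRingType) : (forall x : R, x != 0 -> exists y, x * y = 1) ->
  noeth R.
Proof.
move=> fR J iJ; have [[x [Jx x0]]|no] := pselect (exists x, J x /\ x <> 0).
  exists [:: x]; split=> [_ /[!inE] /eqP -> //|y _ I [_ _ IM] sI].
  have [z xz] := fR x (introN eqP x0).
  by rewrite -[y]mulr1 -xz [x * z]mulrC mulrA; apply: IM; apply: sI; rewrite inE.
exists [::]; split=> // x Jx I [I0 _ _] _.
have [->//|x0] := eqVneq x 0; case: no; exists x; split=> //; exact/eqP.
Qed.

(* Homogeneous components of a relation F_N = sum_(i < N) Q_i F_i between
   homogeneous elements of a Noetherian ring graded by [lam]. *)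
Lemma graded_stable (W : comNzRingType) (lam : {rmorphism W -> {poly W}})
    (F : nat -> W) (d : nat -> nat) (J : W -> Prop) :
  noeth W -> (forall i, lam (F i) = (F i)%:P * 'X^(d i)) ->
  (forall i j, (i < j)%N -> (d i < d j)%N) ->
  is_ideal J -> (forall x j, J x -> J (lam x)`_j) ->
  exists N (Q : nat -> W), J (F N - \sum_(i < N) (lam (Q i))`_(d N - d i) * F i).
Proof.
move=> nW hF dlt iJ Jlam; case: (iJ) => J0 JD JM.
pose I N x := exists Q : nat -> W, J (x - \sum_(i < N) Q i * F i).
have I_ideal N : is_ideal (I N).
  split.
  - exists (fun=> 0); rewrite big1 ?subr0 // => i _; exact: mul0r.
  - move=> x y [Q Jx] [Q' Jy]; exists (fun i => Q i + Q' i).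
    under eq_bigr do rewrite mulrDl.
    by rewrite big_split /= opprD addrACA; exact: JD.
  - move=> a x [Q Jx]; exists (fun i => a * Q i).
    under eq_bigr do rewrite -mulrA.
    by rewrite -mulr_sumr -mulrBr; exact: JM.
have I_le M N x : (M <= N)%N -> I M x -> I N x.
  move=> MN [Q Jx]; exists (fun i => if (i < M)%N then Q i else 0).
  move: Jx; rewrite (big_ord_widen N (fun i => Q i * F i) MN) big_mkcond.
  by congr (J (_ - _)); apply: eq_bigr => i _; case: ifP => // _; rewrite mul0r.
pose Iinf x := exists N, I N x.
have iinf : is_ideal Iinf.
  split; first by exists 0%N; case: (I_ideal 0%N).
    move=> x y [M Ix] [N Iy]; exists (maxn M N).
    case: (I_ideal (maxn M N)) => _ D _; apply: D.
      exact: I_le (leq_maxl _ _) Ix.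
    exact: I_le (leq_maxr _ _) Iy.
  by move=> a x [N Ix]; exists N; case: (I_ideal N) => _ _; apply.
have [l [lI lS]] := nW _ iinf.
have [N HN] : exists N, forall a, a \in l -> I N a.
  elim: l lI {lS} => [|a l IH] lI; first by exists 0%N.
  have [D HD] := IH (fun b lb => lI b (@mem_behead _ (a :: l) b lb)).
  have [e ea] := lI a (mem_head _ _).
  exists (maxn D e) => b; rewrite inE => /orP [/eqP ->|/HD].
    exact: I_le (leq_maxr _ _) ea.
  exact: I_le (leq_maxl _ _).
have [Q JQ] : I N (F N).
  apply: (lS (F N)) => //; exists N.+1, (fun i => (i == N)%:R).
  rewrite big_ord_recr /= eqxx mul1r big1 ?add0r ?subrr // => i _.
  by rewrite ltn_eqF ?mul0r.
exists N, Q; have := Jlam _ (d N) JQ; rewrite rmorphB rmorph_sum coefB coef_sum.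
rewrite hF coefCM coefXn eqxx mulr1.
congr (J (_ - _)); apply: eq_bigr => i _.
rewrite rmorphM hF mulrA coefMXn ltnNge (ltnW (dlt _ _ (ltn_ord i))) /= mulrC.
by rewrite mulrC coefMC.
Qed.

Section PosCoef.
Variables (W B : comNzRingType) (g : {rmorphism W -> B}) (p q : {poly W}).
Hypothesis Hp : forall e, (0 < e)%N -> g p`_e = 0.
Hypothesis Hq : forall e, (0 < e)%N -> g q`_e = 0.
Lemma pos_coefD e : (0 < e)%N -> g (p + q)`_e = 0.
Proof. by move=> e0; rewrite coefD rmorphD Hp // Hq // addr0. Qed.
Lemma pos_coefM e : (0 < e)%N -> g (p * q)`_e = 0.
Proof.
move=> e0; rewrite coefM rmorph_sum big1 // => i _; rewrite rmorphM.
have [i0|i0] := posnP i; last by rewrite Hp // mul0r.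
by rewrite (Hq (e := (e - i)%N)) ?i0 ?subn0 // mulr0.
Qed.
End PosCoef.

Section SurjLift.
Variables (k : closedFieldType) (T : comNzRingType) (A B : comAlgType k).
Variables (p : {rmorphism T -> A}) (g : {rmorphism T -> B}) (eta : {rmorphism k -> T}).
Hypothesis ps : forall y, exists x, p x = y.
Hypothesis kerp : forall x, p x = 0 -> g x = 0.
Hypotheses (pk : forall c : k, p (eta c) = c%:A) (gk : forall c : k, g (eta c) = c%:A).

Definition slift_fun (y : A) : B := g (projT1 (cid (ps y))).
Lemma slift_p x : slift_fun (p x) = g x.
Proof.
rewrite /slift_fun; case: cid => z /= e; apply/eqP; rewrite -subr_eq0 -rmorphB.
by apply/eqP/kerp; rewrite rmorphB e subrr.
Qed.
Lemma slift_zmod : zmod_morphism slift_fun.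
Proof.
move=> y1 y2; case: (ps y1) => x1 <-; case: (ps y2) => x2 <-.
by rewrite -rmorphB !slift_p rmorphB.
Qed.
HB.instance Definition _ := GRing.isZmodMorphism.Build A B slift_fun slift_zmod.
Lemma slift_monoid : monoid_morphism slift_fun.
Proof.
split=> [|y1 y2]; first by rewrite -(rmorph1 p) slift_p rmorph1.
case: (ps y1) => x1 <-; case: (ps y2) => x2 <-.
by rewrite -rmorphM !slift_p rmorphM.
Qed.
HB.instance Definition _ := GRing.isMonoidMorphism.Build A B slift_fun slift_monoid.
Lemma slift_scal : scalable slift_fun.
Proof.
move=> c y; case: (ps y) => x <-.
by rewrite -mulr_algl -pk -rmorphM !slift_p rmorphM gk mulr_algl.
Qed.
HB.instance Definition _ := GRing.isScalable.Build k A B *:%R slift_fun slift_scal.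
Lemma surj_lift : exists h : {lrmorphism A -> B}, forall x, h (p x) = g x.
Proof. by exists (slift_fun : {lrmorphism A -> B}); exact: slift_p. Qed.
End SurjLift.

Lemma mpolyw (n D : nat) (R : comNzRingType) (p : mpoly n R) :
  (mmeasure mdeg p <= D)%N ->
  p = \sum_(m : bmultinom n D) mpolyC n (mcoeff m p) * mpolyX R m.
Proof.
move=> /mpolywE {1}->; apply: eq_bigr => m _.
by rewrite mul_mpolyC.
Qed.

Lemma mmapw (n D : nat) (R S : comNzRingType) (f : {rmorphism R -> S}) (b : 'I_n -> S)
  (p : mpoly n R) : (mmeasure mdeg p <= D)%N ->
  mmap f b p = \sum_(m : bmultinom n D) f (mcoeff m p) * mmap f b (mpolyX R m).
Proof.
move=> sp; rewrite {1}(mpolyw sp) rmorph_sum; apply: eq_bigr => m _.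
by rewrite rmorphM /= mmapC.
Qed.

Lemma mcoeff_big (n : nat) (R : comNzRingType) (p : mpoly n R) D m :
  (mmeasure mdeg p <= D)%N -> (D <= mdeg m)%N -> mcoeff m p = 0.
Proof. by move=> sp Dm; apply: memN_msupp_eq0; apply: msize_mdeg_ge; exact: leq_trans Dm. Qed.

(** The finitely many coefficients become variables over k. In this way an arbitrary base R is
    replaced by a Noetherian one. *)
Lemma mpoly_family_lift (k : closedFieldType) (R : comAlgType k) (n : nat) (T : finType)
    (p : T -> mpoly n R) :
  exists s (tau : {rmorphism mpoly s k -> R}) (p' : T -> mpoly n (mpoly s k)),
    forall t, map_mpoly tau (p' t) = p t.
Proof.
pose D := (\max_t mmeasure mdeg (p t))%N.
pose V := (T * bmultinom n D)%type.
pose w (i : 'I_#|{: V}|) := let v := enum_val i in mcoeff v.2 (p v.1).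
pose tau : {rmorphism mpoly #|{: V}| k -> R} := mmap (GRing.in_alg R) w.
exists #|{: V}|, tau, (fun t => \sum_(m : bmultinom n D)
  mpolyC n (mvar k (enum_rank (t, m))) * mpolyX _ m).
move=> t; rewrite rmorph_sum [RHS](@mpolyw _ D); last exact: (leq_bigmax t).
apply: eq_bigr => m _; rewrite rmorphM /= map_mpolyC map_mpolyX; congr (mpolyC _ _ * _).
by rewrite /tau /= mmap_var /w enum_rankK.
Qed.

(** * Descent along etale algebras *)

Section Flat.
Variable k : closedFieldType.
Variables (R R' : comAlgType k) (f : {lrmorphism R -> R'}).
Hypothesis fet : formally_etale f.
Variables (n m : nat) (b : 'I_n -> R') (r : 'I_m -> mpoly n R).
Notation P := (mpoly n R).
Let ev : {rmorphism P -> R'} := mmap f b.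
Hypothesis ev_surj : forall y, exists p, ev p = y.
Hypothesis ev_ker : forall p, ev p = 0 <-> exists c : 'I_m -> P, p = \sum_j c j * r j.

Let ev_r j : ev (r j) = 0.
Proof.
apply/ev_ker; exists (fun i => (i == j)%:R); rewrite (bigD1 j) //= eqxx mul1r.
by rewrite big1 ?addr0 // => i /negPf ->; rewrite mul0r.
Qed.

(** With I the kernel of [ev], formal etaleness lifts the identity of R' = P / I to a map R' -> P /
    I^2. Lifting the images of the generators to P gives [eps], which sends I into I^2. *)
Lemma etale_section : exists eps : {rmorphism P -> P},
  [/\ forall a, eps (mpolyC n a) = mpolyC n a,
      forall p, ev (eps p) = ev p
    & forall p, ev p = 0 -> exists d : 'I_m -> 'I_m -> P,
        eps p = \sum_i \sum_j d i j * r i * r j].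
Proof.
pose I2 (p : P) := exists d : 'I_m -> 'I_m -> P, p = \sum_i \sum_j d i j * r i * r j.
have iI2 : is_ideal I2.
  split=> [|x y [d ->] [e ->]|a x [d ->]].
  - exists (fun _ _ => 0); rewrite big1 // => i _; rewrite big1 // => j _.
    by rewrite !mul0r.
  - exists (fun i j => d i j + e i j); rewrite -big_split; apply: eq_bigr => i _.
    by rewrite -big_split; apply: eq_bigr => j _; rewrite !mulrDl.
  - exists (fun i j => a * d i j); rewrite mulr_sumr; apply: eq_bigr => i _.
    by rewrite mulr_sumr; apply: eq_bigr => j _; rewrite !mulrA.
have evI2 p : I2 p -> ev p = 0.
  case=> d ->; rewrite rmorph_sum big1 // => i _; rewrite rmorph_sum big1 // => j _.
  by rewrite rmorphM ev_r mulr0.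
have I21 : ~ I2 1 by move/evI2; rewrite rmorph1 => /eqP; rewrite oner_eq0.
pose J := PIdeal iI2 I21.
pose eta : {rmorphism k -> P} := @mpolyC n R \o GRing.in_alg R.
pose C := QAlg eta J; pose pi : {rmorphism P -> C} := qpi eta J.
have evk (c : k) : ev (eta c) = c%:A by rewrite /ev /eta /= mmapC; exact: rmorph_alg.
pose t : {lrmorphism C -> R'} := @qlift k P eta J R' ev evI2 evk.
have tpi p : t (pi p) = ev p by exact: qliftE.
have gk (c : k) : (pi \o @mpolyC n R : {rmorphism R -> C}) c%:A = c%:A.
  exact: (qpi_alg eta J c).
pose g := mklr gk.
have sq : sq_zero_thickening t.
  split=> [y|x y].
    by have [p <-] := ev_surj y; exists (pi p).
  have [p <-] := qpi_surj x; have [q <-] := qpi_surj y.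
  rewrite -/pi !tpi => /ev_ker [c ->] /ev_ker [d ->].
  rewrite -rmorphM; apply/qpi0P; exists (fun i j => c i * d j).
  rewrite mulr_suml; apply: eq_bigr => i _; rewrite mulr_sumr.
  by apply: eq_bigr => j _; rewrite mulrACA mulrA.
have fg a : (idfun : {lrmorphism R' -> R'}) (f a) = t (g a).
  by rewrite -[RHS]/(t (pi (mpolyC n a))) tpi /ev /= mmapC.
have [[h [hf ht]] _] := fet sq fg.
have [E HE] := choice (fun i => qpi_surj (h (b i))).
pose eps : {rmorphism P -> P} := mmap (@mpolyC n R) E.
have pieps p : pi (eps p) = h (ev p).
  rewrite -[LHS]/((pi \o eps : {rmorphism P -> C}) p).
  rewrite -[RHS]/((h \o ev : {rmorphism P -> C}) p).
  apply: mpoly_hom_eq => [c|i].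
    by rewrite /= /eps /ev /= !mmapC hf.
  by rewrite /= /eps /ev /= !mmap_var HE.
exists eps; split.
- by move=> a; rewrite /eps /= mmapC.
- by move=> p; rewrite -tpi pieps ht.
- by move=> p evp; apply/(@qpi0P _ _ eta J); rewrite -/pi pieps evp rmorph0.
Qed.
End Flat.

Lemma mul_square_aux (A : comNzRingType) (a x y t : A) :
  a * (x * t) * (y * t) = a * x * y * t ^+ 2.
Proof. by ring. Qed.

Section Flat2.
Variable k : closedFieldType.
Variables (R R' : comAlgType k) (f : {lrmorphism R -> R'}).
Hypothesis fet : formally_etale f.
Variables (n m : nat) (b : 'I_n -> R') (r : 'I_m -> mpoly n R).
Notation P := (mpoly n R).
Let ev : {rmorphism P -> R'} := mmap f b.
Hypothesis ev_surj : forall y, exists p, ev p = y.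
Hypothesis ev_ker : forall p, ev p = 0 <-> exists c : 'I_m -> P, p = \sum_j c j * r j.

(* [eps] raises the order of vanishing along Spec R' at each step, so by
   Noetherianity some iterate of the relation is a combination of the previous
   ones with coefficients in the ideal of R'. *)
Lemma flat_relation (L : finType) (rho : L -> R) (A : L -> P) :
  ev (\sum_l mpolyC n (rho l) * A l) = 0 ->
  exists B : L -> P, (forall l, ev (B l) = ev (A l)) /\
    \sum_l mpolyC n (rho l) * B l = 0.
Proof.
move=> evA.
have [eps [epsC ev_eps eps_sq]] := etale_section fet ev_surj ev_ker.
have ev_r j : ev (r j) = 0.
  apply/ev_ker; exists (fun i => (i == j)%:R); rewrite (bigD1 j) //= eqxx mul1r.
  by rewrite big1 ?addr0 // => i /negPf ->; rewrite mul0r.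
have [g Hg] := proj1 (ev_ker _) evA.
have /choice [c Hc] : forall i, exists c : 'I_m -> P,
    eps (mvar R i) = mvar R i + \sum_j c j * r j.
  move=> i; have /ev_ker [c Hc] : ev (eps (mvar R i) - mvar R i) = 0.
    by rewrite rmorphB ev_eps subrr.
  by exists c; rewrite -Hc addrC subrK.
have /choice [d Hd] : forall j, exists d : 'I_m -> 'I_m -> P,
    eps (r j) = \sum_a \sum_b d a b * r a * r b.
  by move=> j; apply: eps_sq; exact: ev_r.
pose T : finType := ('I_m + 'I_m + ('I_n * 'I_m) + ('I_m * ('I_m * 'I_m)))%type.
pose fam (t : T) : P := match t with
  | inl (inl (inl j)) => r j | inl (inl (inr j)) => g j
  | inl (inr (i, j)) => c i j | inr (j, (a, b')) => d j a b' end.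
have [s [tau [fam' Hfam]]] := mpoly_family_lift fam.
pose r' j := fam' (inl (inl (inl j))); pose g' j := fam' (inl (inl (inr j))).
pose c' i j := fam' (inl (inr (i, j))); pose d' j a b' := fam' (inr (j, (a, b'))).
have Hr j : map_mpoly tau (r' j) = r j := Hfam (inl (inl (inl j))).
have Hg' j : map_mpoly tau (g' j) = g j := Hfam (inl (inl (inr j))).
have Hc' i j : map_mpoly tau (c' i j) = c i j := Hfam (inl (inr (i, j))).
have Hd' j a b' : map_mpoly tau (d' j a b') = d j a b' := Hfam (inr (j, (a, b'))).
pose P0 : comNzRingType := mpoly n (mpoly s k).
(* The variables of W stand for the relations r j, and [lam] records the degree in them. [Et] lifts
   [eps] and doubles this degree, because each [eps (r j)] is quadratic in the relations. *)
pose W : comNzRingType := mpoly m P0.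
have Wgen (Q : W -> Prop) : (forall u, Q (mpolyC m u)) -> (forall j, Q (mvar P0 j)) ->
    (forall p q : W, Q p -> Q q -> Q (p + q)) -> (forall p q : W, Q p -> Q q -> Q (p * q)) ->
    forall p, Q p.
  exact: mpoly_gen.
have nW : noeth W.
  apply/noeth_mpoly/noeth_mpoly/noeth_mpoly/noeth_field => x x0.
  by exists x^-1; rewrite mulfV.
pose X (j : 'I_m) : W := mvar P0 j.
pose e0 : {rmorphism P0 -> P0} :=
  mmap (@mpolyC n (mpoly s k)) (fun i => mvar _ i + \sum_j c' i j * r' j).
pose Et : {rmorphism W -> W} := mmap (@mpolyC m P0 \o e0)
  (fun j => \sum_a \sum_b mpolyC m (d' j a b) * X a * X b).
pose evW : {rmorphism W -> P} := mmap (@map_mpoly n _ _ tau) r.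
have evWX j : evW (X j) = r j by rewrite /evW /= mmap_var.
have evWC u : evW (mpolyC m u) = map_mpoly tau u by rewrite /evW /= mmapC.
have map_e0 u : map_mpoly tau (e0 u) = eps (map_mpoly tau u).
  rewrite -[LHS]/((@map_mpoly n _ _ tau \o e0 : {rmorphism P0 -> P}) u).
  rewrite -[RHS]/((eps \o @map_mpoly n _ _ tau : {rmorphism P0 -> P}) u).
  apply: mpoly_hom_eq => [x|i].
    by rewrite /= /e0 /= mmapC !map_mpolyC epsC.
  rewrite /= /e0 /= mmap_var rmorphD rmorph_sum /= /mvar !map_mpolyX -/(mvar R i) Hc.
  by congr (_ + _); apply: eq_bigr => j _; rewrite rmorphM /= Hc' Hr.
have evW_Et w : evW (Et w) = eps (evW w).
  rewrite -[LHS]/((evW \o Et : {rmorphism W -> P}) w).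
  rewrite -[RHS]/((eps \o evW : {rmorphism W -> P}) w).
  apply: mpoly_hom_eq => [u|j].
    by rewrite /= /Et /= mmapC /= !evWC map_e0.
  rewrite /= /Et /= mmap_var rmorph_sum evWX Hd; apply: eq_bigr => i _.
  by rewrite rmorph_sum; apply: eq_bigr => l _; rewrite !rmorphM /= !evWX evWC Hd'.
pose lam : {rmorphism W -> {poly W}} :=
  mmap (polyC \o @mpolyC m P0) (fun j => (X j)%:P * 'X).
have cf : commr_rmorph (polyC \o Et : {rmorphism W -> {poly W}}) ('X^2).
  by move=> x; rewrite /GRing.comm mulrC.
pose sg : {rmorphism {poly W} -> {poly W}} := horner_morph cf.
have sgC w : sg w%:P = (Et w)%:P by rewrite /sg /= horner_morphC.
have sgX : sg 'X = 'X^2 by rewrite /sg /= horner_morphX.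
have lamX j : lam (X j) = (X j)%:P * 'X by rewrite /lam /= mmap_var.
have lamC u : lam (mpolyC m u) = (mpolyC m u)%:P by rewrite /lam /= mmapC.
have EtC u : Et (mpolyC m u) = mpolyC m (e0 u) by rewrite /Et /= mmapC.
have EtX j : Et (X j) = \sum_a \sum_b mpolyC m (d' j a b) * X a * X b.
  by rewrite /Et /= mmap_var.
have pCs (I : finType) (G : I -> W) : (\sum_i G i)%:P = \sum_i (G i)%:P.
  exact: (rmorph_sum polyC).
have lam_Et w : lam (Et w) = sg (lam w).
  rewrite -[LHS]/((lam \o Et : {rmorphism W -> {poly W}}) w).
  rewrite -[RHS]/((sg \o lam : {rmorphism W -> {poly W}}) w).
  apply: mpoly_hom_eq => [u|j].
    rewrite -[LHS]/(lam (Et (mpolyC m u))) -[RHS]/(sg (lam (mpolyC m u))).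
    by rewrite EtC !lamC sgC EtC.
  rewrite -[LHS]/(lam (Et (X j))) -[RHS]/(sg (lam (X j))) lamX rmorphM sgC sgX EtX.
  rewrite (rmorph_sum lam) pCs mulr_suml; apply: eq_bigr => i _.
  rewrite (rmorph_sum lam) pCs mulr_suml; apply: eq_bigr => l _.
  by rewrite !(rmorphM lam) !lamX lamC !polyCM mul_square_aux.
pose Fr (i : nat) : W := iter i Et (\sum_j mpolyC m (g' j) * X j).
have lamF i : lam (Fr i) = (Fr i)%:P * 'X^(2 ^ i).
  elim: i => [|i IH].
    rewrite /Fr /= expn0 expr1 (rmorph_sum lam) pCs mulr_suml.
    by apply: eq_bigr => j _; rewrite (rmorphM lam) lamX lamC polyCM mulrA.
  by rewrite /Fr iterS lam_Et IH rmorphM /= sgC rmorphXn /= sgX -exprM -expnS.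
pose y0 := \sum_l mpolyC n (rho l) * A l.
have evF i : evW (Fr i) = iter i eps y0.
  elim: i => [|i IH]; last by rewrite /Fr !iterS evW_Et IH.
  rewrite /= /y0 Hg rmorph_sum; apply: eq_bigr => j _.
  by rewrite rmorphM /= evWX evWC Hg'.
have [|||N [Q HQ]] := @graded_stable W lam Fr (fun i => 2 ^ i)%N (fun x => x = 0) nW lamF.
- by move=> i j ij; rewrite ltn_exp2l.
- split=> // [x y -> ->|a x ->]; [exact: addr0 | exact: mulr0].
- by move=> x j ->; rewrite rmorph0 coef0.
move/eqP: HQ; rewrite subr_eq0 => /eqP HQ.
pose gW : {rmorphism W -> R'} := ev \o evW.
have gWE w : gW w = ev (evW w) by [].
have posI q e : (0 < e)%N -> gW (lam q)`_e = 0.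
  move: q e; apply: Wgen => [u e e0'|j e e0'|p q Hp Hq e e0'|p q Hp Hq e e0'].
  - by rewrite lamC coefC gtn_eqF ?rmorph0.
  - rewrite lamX coefCM coefX; case: (e == 1)%N; last by rewrite mulr0 !rmorph0.
    by rewrite mulr1 gWE evWX ev_r.
  - have -> : lam (p + q) = lam p + lam q by exact: rmorphD.
    exact (@pos_coefD W R' gW (lam p) (lam q) Hp Hq e e0').
  - have -> : lam (p * q) = lam p * lam q by exact: rmorphM.
    exact (@pos_coefM W R' gW (lam p) (lam q) Hp Hq e e0').
have iter_lin i : iter i eps y0 = \sum_l mpolyC n (rho l) * iter i eps (A l).
  elim: i => [//|i IH]; rewrite iterS IH (rmorph_sum eps); apply: eq_bigr => l _.
  by rewrite (rmorphM eps) epsC.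
have ev_iter i p : ev (iter i eps p) = ev p.
  by elim: i => [//|i IH]; rewrite iterS ev_eps.
(* A component of positive degree 2 ^ N - 2 ^ i in the relations, hence killed by [ev]; subtracting
   such multiples does not change the value of A l in R'. *)
pose eta (i : 'I_N) := evW (lam (Q i))`_(2 ^ N - 2 ^ i).
exists (fun l => iter N eps (A l) - \sum_(i < N) eta i * iter i eps (A l)); split.
  move=> l; rewrite (rmorphB ev) ev_iter (rmorph_sum ev) big1 ?subr0 // => i _.
  by rewrite (rmorphM ev) -gWE posI ?mul0r // subn_gt0 ltn_exp2l.
under eq_bigr do rewrite mulrBr.
rewrite sumrB -iter_lin -evF HQ (rmorph_sum evW); apply/eqP; rewrite subr_eq0; apply/eqP.
under [RHS]eq_bigr do rewrite mulr_sumr.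
rewrite exchange_big; apply: eq_bigr => i _.
rewrite (rmorphM evW) evF iter_lin mulr_sumr; apply: eq_bigr => l _.
by rewrite mulrCA.
Qed.

(** The equational criterion of flatness. By induction on the equations: a solution of the others is
    substituted into the one at the head, and [flat_relation] is applied to the resulting single
    relation. *)
Lemma flat_system (L : finType) (y : L -> R') (rs : seq (L -> R)) :
  (forall a, (a < size rs)%N -> \sum_l f (nth (fun=> 0) rs a l) * y l = 0) ->
  exists (H : finType) (s : L -> H -> R) (bb : H -> R'),
    (forall l, y l = \sum_h f (s l h) * bb h) /\
    forall a h, (a < size rs)%N -> \sum_l nth (fun=> 0) rs a l * s l h = 0.
Proof.
elim: rs => [|rho rs IH] Hy.
  exists L, (fun l h => (l == h)%:R), y; split=> // l.
  rewrite (bigD1 l) //= eqxx rmorph1 mul1r big1 ?addr0 // => h /negPf.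
  by rewrite eq_sym => ->; rewrite rmorph0 mul0r.
have [|H [s [bb [ys rss]]]] := IH; first by move=> a asz; exact: (Hy a.+1).
pose rho' h := \sum_l rho l * s l h.
have [A HA] := choice (fun h => ev_surj (bb h)).
have [|B [BA B0]] := @flat_relation H rho' A.
  rewrite (rmorph_sum ev) -[RHS](Hy 0%N isT) /=.
  under [RHS]eq_bigr do rewrite ys mulr_sumr.
  rewrite exchange_big; apply: eq_bigr => h _.
  have fs : f (rho' h) = \sum_l f (rho l * s l h) by exact: raddf_sum.
  rewrite rmorphM /ev /= mmapC -/ev HA.
  apply: (etrans (congr1 (fun z => z * bb h) fs)); rewrite mulr_suml.
  by apply: eq_bigr => l _; rewrite rmorphM mulrA.
pose D := (\max_h mmeasure mdeg (B h))%N.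
have sB h : (mmeasure mdeg (B h) <= D)%N by exact: (leq_bigmax h).
exists (bmultinom n D), (fun l (q : bmultinom n D) => \sum_h s l h * mcoeff q (B h)),
  (fun q : bmultinom n D => ev (mpolyX R q)); split.
  move=> l; rewrite ys.
  under [RHS]eq_bigr do rewrite rmorph_sum mulr_suml.
  rewrite exchange_big; apply: eq_bigr => h _.
  rewrite -HA -BA /ev /= (mmapw _ _ (sB h)) mulr_sumr; apply: eq_bigr => q _.
  by rewrite rmorphM mulrA.
move=> a q asz.
have E : \sum_l nth (fun=> 0) (rho :: rs) a l * (\sum_h s l h * mcoeff q (B h)) =
    \sum_h (\sum_l nth (fun=> 0) (rho :: rs) a l * s l h) * mcoeff q (B h).
  under eq_bigr do rewrite mulr_sumr.
  rewrite exchange_big; apply: eq_bigr => h _; rewrite mulr_suml.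
  by apply: eq_bigr => l _; rewrite mulrA.
rewrite E; case: a asz {E} => [_|a asz].
  rewrite -[RHS](mcoeff0 R q) -B0 raddf_sum; apply: eq_bigr => h _.
  by rewrite /= mcoeffCM.
by rewrite big1 // => h _; rewrite /= rss // mul0r.
Qed.
End Flat2.

Lemma sum_pair (A : nmodType) (T1 T2 : finType) (F : T1 * T2 -> A) :
  \sum_u F u = \sum_a \sum_b F (a, b).
Proof. by rewrite pair_bigA; apply: eq_bigr => -[]. Qed.

Section Descent.
Variable k : closedFieldType.
Variables (R R' : comAlgType k) (f : {lrmorphism R -> R'}).
Hypothesis fet : formally_etale f.
Hypothesis fsurj : spec_surjective f.
Variables (n m : nat) (b : 'I_n -> R') (r : 'I_m -> mpoly n R).
Notation P := (mpoly n R).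
Let ev : {rmorphism P -> R'} := mmap f b.
Hypothesis ev_surj : forall y, exists p, ev p = y.
Hypothesis ev_ker : forall p, ev p = 0 <-> exists c : 'I_m -> P, p = \sum_j c j * r j.

Let ev_r j : ev (r j) = 0.
Proof.
apply/ev_ker; exists (fun i => (i == j)%:R); rewrite (bigD1 j) //= eqxx mul1r.
by rewrite big1 ?addr0 // => i /negPf ->; rewrite mul0r.
Qed.

(** Faithfulness: if all s h vanished at some field-valued point of R, they would vanish at a point
    of R' above it, where their combination is 1. *)
Lemma unit_descent (H : finType) (s : H -> R) (bb : H -> R') :
  \sum_h f (s h) * bb h = 1 -> exists c : H -> R, \sum_h c h * s h = 1.
Proof.
move=> e; pose J x := exists c : H -> R, \sum_h c h * s h = x.
apply: (@ideal1_pt k R J).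
  split=> [|x y [c <-] [d <-]|a x [c <-]].
  - by exists (fun=> 0); rewrite big1 // => h _; rewrite mul0r.
  - exists (fun h => c h + d h); rewrite -big_split; apply: eq_bigr => h _.
    by rewrite mulrDl.
  - exists (fun h => a * c h); rewrite mulr_sumr; apply: eq_bigr => h _.
    by rewrite mulrA.
move=> K g fK; apply: contrapT => no.
have g0 h : g (s h) = 0.
  apply: contrapT => gs; apply: no; exists (s h) => //.
  exists (fun i => (i == h)%:R); rewrite (bigD1 h) //= eqxx mul1r.
  by rewrite big1 ?addr0 // => i /negPf ->; rewrite mul0r.
have [K' [e' [h' [_ hf]]]] := fsurj g fK.
move: (congr1 h' e); rewrite rmorph1 rmorph_sum big1 => [/esym/eqP|h _].
  by rewrite oner_eq0.
by rewrite rmorphM /= hf g0 rmorph0 mul0r.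
Qed.

Section Pushout.
Variables (N : comAlgType k) (h : {lrmorphism R -> N}).
Let hP : {rmorphism P -> mpoly n N} := @map_mpoly n R N h.

(** N[X] modulo this ideal is the tensor product of R' and N over R. *)
Definition push_ideal (V : mpoly n N) : Prop :=
  exists G : 'I_m -> mpoly n N, V = \sum_j G j * hP (r j).

(** In bounded degree, the multiples of the r j by monomials are finitely many linear equations over
    R, satisfied by the values of the monomials in R'. Flatness expresses these values through
    solutions over R, and every element of the ideal is orthogonal to such solutions. *)
Lemma push_ideal_key (V : mpoly n N) D0 : push_ideal V ->
  exists (D : nat) (H : finType) (s : bmultinom n D -> H -> R) (bb : H -> R'),
   [/\ (D0 <= D)%N, (mmeasure mdeg V <= D)%N,
     forall q, ev (mpolyX R (bmnm q)) = \sum_i f (s q i) * bb i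
     & forall i, \sum_q mcoeff (bmnm q) V * h (s q i) = 0].
Proof.
case=> G eV.
pose D1 := (\max_j mmeasure mdeg (G j))%N.
have sG j : (mmeasure mdeg (G j) <= D1)%N by exact: (leq_bigmax j).
pose D2 := (\max_(u : 'I_m * bmultinom n D1) mmeasure mdeg (r u.1 * mpolyX R (bmnm u.2)))%N.
pose D := maxn (maxn D0 (mmeasure mdeg V)) D2.
have sR j (q : bmultinom n D1) : (mmeasure mdeg (r j * mpolyX R (bmnm q)) <= D)%N.
  apply: (@leq_trans D2); last exact: leq_maxr.
  exact: (leq_bigmax (j, q)).
pose row (u : 'I_m * bmultinom n D1) (q : bmultinom n D) : R :=
  mcoeff (bmnm q) (r u.1 * mpolyX R (bmnm u.2)).
pose y (q : bmultinom n D) := ev (mpolyX R (bmnm q)).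
pose rs := [seq row u | u : 'I_m * bmultinom n D1].
have nth_rs u : nth (fun=> 0) rs (enum_rank u) = row u.
  rewrite (nth_map u); last by rewrite -cardE; exact: ltn_ord.
  by rewrite nth_enum_rank.
have rs_lt (u : 'I_m * bmultinom n D1) : (enum_rank u < size rs)%N by rewrite size_map -cardE; exact: ltn_ord.
have [|H [s [bb [ys srow]]]] := @flat_system k R R' f fet n m b r ev_surj ev_ker _ y rs.
  move=> a asz; have asz' : (a < #|{: 'I_m * bmultinom n D1}|)%N.
    by move: asz; rewrite size_map -cardE.
  have -> : a = enum_rank (enum_val (Ordinal asz')) :> nat by rewrite enum_valK.
  rewrite nth_rs; set u := enum_val _.
  transitivity (ev (r u.1 * mpolyX R (bmnm u.2))); last by rewrite rmorphM ev_r mul0r.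
  exact/esym/(mmapw f b (sR u.1 u.2)).
exists D, H, s, bb; split.
- by rewrite !leq_max leqnn.
- by rewrite !leq_max leqnn orbT.
- exact: ys.
move=> i.
have VE (q : bmultinom n D) : mcoeff (bmnm q) V = \sum_j \sum_(q1 : bmultinom n D1)
    mcoeff (bmnm q1) (G j) * h (row (j, q1) q).
  rewrite eV raddf_sum; apply: eq_bigr => j _.
  rewrite {1}(mpolyw (sG j)) mulr_suml raddf_sum; apply: eq_bigr => q1 _.
  rewrite -mulrA /= mcoeffCM; congr (_ * _); rewrite /row /= -mcoeff_map_mpoly.
  by rewrite rmorphM /= map_mpolyX mulrC.
under eq_bigr do rewrite VE mulr_suml.
rewrite exchange_big big1 // => j _.
under eq_bigr do rewrite mulr_suml.
rewrite exchange_big big1 // => q1 _.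
under eq_bigr do rewrite -mulrA.
rewrite -mulr_sumr; have := srow (enum_rank (j, q1)) i (rs_lt _).
rewrite nth_rs => e.
have := congr1 h e; rewrite rmorph0 rmorph_sum => e'.
have -> : \sum_q h (row (j, q1) q) * h (s q i) = 0.
  by rewrite -[RHS]e'; apply: eq_bigr => q _; rewrite rmorphM.
by rewrite mulr0.
Qed.

(** N embeds into the pushout. Orthogonality for a constant x says that x annihilates the constant
    entries of the solutions, and these generate the unit ideal by [unit_descent]. *)
Lemma push_const x : push_ideal (mpolyC n x) -> x = 0.
Proof.
move=> /(push_ideal_key 1) [D [H [s [bb [D0 _ ys sV]]]]].
have lt0 : (mdeg (@mnm0 n) < D)%N by rewrite mdeg0.
pose q0 := BMultinom lt0.
have sx i : x * h (s q0 i) = 0.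
  rewrite -[RHS](sV i) (bigD1 q0) //= mcoeffC eqxx mulr1 big1 ?addr0 // => q qq0.
  rewrite mcoeffC; case: eqP => [e|_]; last by rewrite mulr0 mul0r.
  by case/eqP: qq0; exact/val_inj.
have [c Hc] : exists c : H -> R, \sum_i c i * s q0 i = 1.
  apply: (@unit_descent H (s q0) bb); rewrite -ys /= mpolyX0.
  exact: rmorph1.
rewrite -[x]mulr1 -(rmorph1 h) -Hc rmorph_sum mulr_sumr big1 // => i _.
by rewrite rmorphM mulrCA sx mulr0.
Qed.

(** Flatness once more: the kernel of R' -> R' (x)_R N is generated by the kernel of h. *)
Lemma push_ker (A : P) : push_ideal (hP A) ->
  exists (H : finType) (d : H -> R) (c : H -> R'),
    (forall i, h (d i) = 0) /\ ev A = \sum_i c i * f (d i).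
Proof.
move=> /(push_ideal_key (mmeasure mdeg A)) [D [H [s [bb [sA _ ys sV]]]]].
exists H, (fun i => \sum_q mcoeff (bmnm q) A * s q i), bb; split.
  move=> i; rewrite -[RHS](sV i) rmorph_sum; apply: eq_bigr => q _.
  by rewrite rmorphM /hP /= mcoeff_map_mpoly.
have -> : ev A = \sum_(q : bmultinom n D) f (mcoeff (bmnm q) A) * ev (mpolyX R (bmnm q)).
  exact: mmapw.
under eq_bigr do rewrite ys mulr_sumr.
rewrite exchange_big; apply: eq_bigr => i _; rewrite rmorph_sum mulr_sumr.
by apply: eq_bigr => q _; rewrite rmorphM mulrA mulrC.
Qed.

Lemma push_ideal_ideal : is_ideal push_ideal.
Proof.
split=> [|x y [c ->] [d ->]|a x [c ->]].
- by exists (fun=> 0); rewrite big1 // => j _; rewrite mul0r.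
- by exists (fun j => c j + d j); rewrite -big_split; apply: eq_bigr => j _; rewrite mulrDl.
- by exists (fun j => a * c j); rewrite mulr_sumr; apply: eq_bigr => j _; rewrite mulrA.
Qed.

Lemma push_ideal1 : ~ push_ideal 1.
Proof.
rewrite -(mpolyC1 n N) => /push_const /eqP; by rewrite oner_eq0.
Qed.

Lemma pushout_aux : exists (N' : comAlgType k) (f' : {lrmorphism N -> N'})
    (h' : {lrmorphism R' -> N'}),
  (forall a, h' (f a) = f' (h a)) /\
  forall x A, f' x = h' (ev A) -> push_ideal (mpolyC n x - hP A).
Proof.
pose J := PIdeal push_ideal_ideal push_ideal1.
pose eta : {rmorphism k -> mpoly n N} := @mpolyC n N \o GRing.in_alg N.
pose N' := QAlg eta J; pose pi : {rmorphism mpoly n N -> N'} := qpi eta J.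
have fk (c : k) : (pi \o @mpolyC n N : {rmorphism N -> N'}) c%:A = c%:A.
  exact: (qpi_alg eta J c).
pose etaP : {rmorphism k -> P} := @mpolyC n R \o GRing.in_alg R.
have evk (c : k) : ev (etaP c) = c%:A by rewrite /ev /etaP /= mmapC; exact: rmorph_alg.
have gk (c : k) : (pi \o hP : {rmorphism P -> N'}) (etaP c) = c%:A.
  rewrite -(qpi_alg eta J c) /= /hP /etaP /eta /= map_mpolyC.
  by congr (pi (mpolyC n _)); exact: rmorph_alg.
have kerg x : ev x = 0 -> (pi \o hP : {rmorphism P -> N'}) x = 0.
  move/ev_ker => [c ->]; apply: (proj2 (@qpi0P _ _ eta J (hP (\sum_j c j * r j)))).
  exists (fun j => hP (c j)); rewrite (rmorph_sum hP); apply: eq_bigr => j _.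
  by rewrite rmorphM.
have [h' Hh'] := @surj_lift k P R' N' ev (pi \o hP) etaP ev_surj kerg evk gk.
exists N', (mklr fk), h'; split.
  move=> a; have -> : f a = ev (mpolyC n a) by rewrite /ev /= mmapC.
  rewrite Hh' -[RHS]/(pi (mpolyC n (h a))) -[LHS]/(pi (hP (mpolyC n a))).
  by rewrite /hP /= map_mpolyC.
move=> x A; rewrite Hh' -[LHS]/(pi (mpolyC n x)) -[RHS]/(pi (hP A)).
by move/(@qpi_eq _ _ eta J).
Qed.
End Pushout.

(** The hypothesis is a linear system over R solved in R' by 1, v and the coefficients of the G j.
    Flatness writes this solution through solutions over R. Since the first entry is 1, a
    combination of these has first entry 1 over R, and its second entry is the wanted w. *)
Lemma element_descent (v : R') (V : P) : ev V = v ->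
  push_ideal f (mpolyC n v - map_mpoly f V) -> exists w, f w = v.
Proof.
move=> eV [G eG].
pose D1 := (\max_j mmeasure mdeg (G j))%N.
have sG j : (mmeasure mdeg (G j) <= D1)%N by exact: (leq_bigmax j).
pose D2 := (\max_(u : 'I_m * bmultinom n D1) mmeasure mdeg (r u.1 * mpolyX R (bmnm u.2)))%N.
pose D := maxn (maxn 1 (mmeasure mdeg V)) D2.
have sR j (q : bmultinom n D1) : (mmeasure mdeg (r j * mpolyX R (bmnm q)) <= D)%N.
  apply: (@leq_trans D2); last exact: leq_maxr.
  exact: (leq_bigmax (j, q)).
have sV : (mmeasure mdeg V <= D)%N by rewrite !leq_max leqnn orbT.
have D1' : (0 < D)%N by rewrite !leq_max.
pose L : finType := (bool + 'I_m * bmultinom n D1)%type.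
pose row (q : bmultinom n D) (l : L) : R := match l with
  | (inl true) => - mcoeff (bmnm q) V
  | inl false => (bmnm q == mnm0)%:R
  | inr u => - mcoeff (bmnm q) (r u.1 * mpolyX R (bmnm u.2)) end.
pose y (l : L) : R' := match l with
  | (inl true) => 1 | inl false => v | inr u => mcoeff (bmnm u.2) (G u.1) end.
pose rs := [seq row u | u : bmultinom n D].
have nth_rs u : nth (fun=> 0) rs (enum_rank u) = row u.
  rewrite (nth_map u); last by rewrite -cardE; exact: ltn_ord.
  by rewrite nth_enum_rank.
have rs_lt (u : bmultinom n D) : (enum_rank u < size rs)%N by rewrite size_map -cardE; exact: ltn_ord.
have sumL (A : comNzRingType) (F : L -> A) : \sum_l F l =
    F (inl true) + (F (inl false) + \sum_u F (inr u)).
  by rewrite big_sumType /= big_bool addrA.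
have [|H [s [bb [ys srow]]]] := @flat_system k R R' f fet n m b r ev_surj ev_ker _ y rs.
  move=> a asz; have asz' : (a < #|{: bmultinom n D}|)%N.
    by move: asz; rewrite size_map -cardE.
  have -> : a = enum_rank (enum_val (Ordinal asz')) :> nat by rewrite enum_valK.
  rewrite nth_rs; set q := enum_val _.
  rewrite sumL /= mulr1 rmorphN.
  have := congr1 (mcoeff (bmnm q)) eG; rewrite mcoeffB mcoeffC mcoeff_map_mpoly => e.
  rewrite rmorph_nat addrA [_ * v]mulrC [- _ + _]addrC e raddf_sum sum_pair /=.
  apply/eqP; rewrite addr_eq0 -sumrN; apply/eqP; apply: eq_bigr => j _.
  rewrite {1}(mpolyw (sG j)) mulr_suml raddf_sum -sumrN; apply: eq_bigr => q1 _.
  rewrite rmorphN mulNr opprK -mulrA /= mcoeffCM mulrC; congr (_ * _).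
  by rewrite -mcoeff_map_mpoly rmorphM /= map_mpolyX mulrC.
have [c Hc] : exists c : H -> R, \sum_i c i * s (inl true) i = 1.
  by apply: (@unit_descent H (s (inl true)) bb); rewrite -(ys (inl true)).
pose w := \sum_i c i * s (inl false) i.
pose G0 j := \sum_(q1 : bmultinom n D1)
  mpolyC n (\sum_i c i * s (inr (j, q1)) i) * mpolyX R (bmnm q1).
have key : mpolyC n w - V = \sum_j G0 j * r j.
  apply/mpolyP => q; rewrite mcoeffB mcoeffC raddf_sum.
  have G0E j : mcoeff q (G0 j * r j) = \sum_(q1 : bmultinom n D1)
      (\sum_i c i * s (inr (j, q1)) i) * mcoeff q (r j * mpolyX R (bmnm q1)).
    rewrite /G0 mulr_suml raddf_sum; apply: eq_bigr => q1 _.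
    by rewrite -mulrA /= mcoeffCM [r j * _]mulrC.
  under [RHS]eq_bigr do rewrite /= G0E.
  have [qD|qD] := ltnP (mdeg q) D; last first.
    rewrite (mcoeff_big sV qD) subr0 big1; last first.
      by move=> j _; rewrite big1 // => q1 _; rewrite (mcoeff_big (sR j q1) qD) mulr0.
    case: eqP qD => [->|_ _]; last by rewrite mulr0.
    by rewrite mdeg0 leqNgt D1'.
  pose q' := BMultinom qD.
  have rowE i : - mcoeff q V * s (inl true) i + ((q == mnm0)%:R * s (inl false) i +
      \sum_u - mcoeff q (r u.1 * mpolyX R (bmnm u.2)) * s (inr u) i) = 0.
    by have := srow (enum_rank q') i (rs_lt _); rewrite nth_rs sumL.
  have : \sum_i c i * (- mcoeff q V * s (inl true) i) +
      (\sum_i c i * ((q == mnm0)%:R * s (inl false) i) +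
       \sum_i c i * (\sum_u - mcoeff q (r u.1 * mpolyX R (bmnm u.2)) * s (inr u) i)) = 0.
    rewrite -!big_split big1 // => i _.
    apply: (etrans _ (mulr0 (c i))); apply: (etrans _ (congr1 ( *%R (c i)) (rowE i))).
    by rewrite /= !mulrDr.
  have -> : \sum_i c i * (- mcoeff q V * s (inl true) i) = - mcoeff q V.
    under eq_bigr do rewrite mulrCA.
    by rewrite -mulr_sumr Hc mulr1.
  have -> : \sum_i c i * ((q == mnm0)%:R * s (inl false) i) = w * (q == mnm0)%:R.
    by rewrite /w mulr_suml; apply: eq_bigr => i _; rewrite [_%:R * _]mulrC mulrA.
  have -> : \sum_i c i * (\sum_u - mcoeff q (r u.1 * mpolyX R (bmnm u.2)) *
      s (inr u) i) = - \sum_j \sum_(q1 : bmultinom n D1)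
      (\sum_i c i * s (inr (j, q1)) i) * mcoeff q (r j * mpolyX R (bmnm q1)).
    under eq_bigr do rewrite mulr_sumr.
    rewrite exchange_big -sumrN sum_pair /=; apply: eq_bigr => j _.
    rewrite -sumrN; apply: eq_bigr => q1 _; rewrite mulr_suml -sumrN.
    by apply: eq_bigr => i _; rewrite mulNr mulrN mulrCA mulrC.
  by move/eqP; rewrite addrA subr_eq0 addrC => /eqP.
exists w; apply/eqP; rewrite -eV -subr_eq0; apply/eqP.
have -> : f w = ev (mpolyC n w) by rewrite /ev /= mmapC.
rewrite -rmorphB key rmorph_sum big1 // => j _.
by rewrite rmorphM ev_r mulr0.
Qed.
End Descent.

(* For N = R' the pushout is R' (x)_R R'. *)
Theorem etale_pushout (k : closedFieldType) (R R' : comAlgType k) (f : {lrmorphism R -> R'}) :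
  etale_cover f -> forall (N : comAlgType k) (h : {lrmorphism R -> N}),
  exists (N' : comAlgType k) (f' : {lrmorphism N -> N'}) (h' : {lrmorphism R' -> N'}),
  [/\ forall a, h' (f a) = f' (h a),
      forall x, f' x = 0 -> x = 0
    & forall a, h' a = 0 -> exists (H : finType) (d : H -> R) (c : H -> R'),
         (forall i, h (d i) = 0) /\ a = \sum_i c i * f (d i)].
Proof.
case=> [[n [m [b [r [evs evk]]]]] fet fs] N h.
have [N' [f' [h' [comm push]]]] := pushout_aux fet fs evs evk h.
exists N', f', h'; split=> // [x x0|a a0].
  apply: (push_const fet fs evs evk (h := h)).
  by have := push x 0; rewrite !rmorph0 subr0; apply.
have [A eA] := evs a; rewrite -eA.
apply: (push_ker fet evs evk).
have hA : f' 0 = h' (mmap f b A) by rewrite eA a0 rmorph0.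
have := push 0 A hA; rewrite rmorph0 sub0r.
by move=> /(idealN_ (push_ideal_ideal _ _)); rewrite opprK.
Qed.

Theorem etale_descent (k : closedFieldType) (R R' : comAlgType k) (f : {lrmorphism R -> R'}) :
  etale_cover f -> forall v : R',
  (forall (C : comAlgType k) (g h : {lrmorphism R' -> C}),
     (forall a, g (f a) = h (f a)) -> g v = h v) -> exists w, f w = v.
Proof.
case=> [[n [m [b [r [evs evk]]]]] fet fs] v Hv.
have [N' [f' [h' [comm push]]]] := pushout_aux fet fs evs evk f.
have [V eV] := evs v.
apply: (element_descent fet fs evs evk eV).
apply: push; apply: (etrans _ (congr1 h' (esym eV))).
by apply: Hv => a; rewrite comm.
Qed.

Lemma etale_inj (k : closedFieldType) (R R' : comAlgType k) (f : {lrmorphism R -> R'}) :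
  etale_cover f -> injective f.
Proof.
move=> ef x y e; have [N' [f' [h' [comm inj _]]]] := etale_pushout ef idfun.
apply/eqP; rewrite -subr_eq0; apply/eqP/inj.
have cx z : f' z = h' (f z) by rewrite comm.
by rewrite rmorphB /= !cx e subrr.
Qed.

Section LinIndep.
Variables (k : closedFieldType) (K : comAlgType k).

Lemma finite_basis (s : seq K) : exists M (w : 'I_M -> K),
  (forall c : 'I_M -> k, \sum_i c i *: w i = 0 -> forall i, c i = 0) /\
  forall x, x \in s -> exists c : 'I_M -> k, x = \sum_i c i *: w i.
Proof.
elim: s => [|x s [M [w [wi ws]]]].
  exists 0%N, (fun=> 0); split=> [c _ []|x]; by rewrite ?inE.
have [xs|xs] := pselect (exists c : 'I_M -> k, x = \sum_i c i *: w i).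
  by exists M, w; split=> // y; rewrite inE => /orP [/eqP ->|/ws].
pose w' (i : 'I_M.+1) := if unlift ord_max i is Some j then w j else x.
have wl i : w' (widen_ord (leqnSn M) i) = w i.
  have -> : widen_ord (leqnSn M) i = lift ord_max i.
    by apply/val_inj; rewrite /= /bump leqNgt ltn_ord.
  by rewrite /w' liftK.
have wm : w' ord_max = x by rewrite /w' unlift_none.
have sumE (c : 'I_M.+1 -> k) : \sum_i c i *: w' i =
    \sum_i c (widen_ord (leqnSn M) i) *: w i + c ord_max *: x.
  by rewrite big_ord_recr wm; congr (_ + _); apply: eq_bigr => i _; rewrite wl.
exists M.+1, w'; split=> [c|y].
  rewrite sumE => e.
  have cm : c ord_max = 0.
    apply/eqP; apply: contrapT => /negP cm; apply: xs.
    exists (fun i => - (c ord_max)^-1 * c (widen_ord (leqnSn M) i)).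
    under eq_bigr do rewrite mulNr scaleNr -scalerA.
    rewrite sumrN -scaler_sumr.
    move/eqP: e; rewrite addr_eq0 => /eqP ->.
    by rewrite scalerN opprK scalerA mulVf // scale1r.
  move: e; rewrite cm scale0r addr0 => /wi c0 i.
  case: (unliftP ord_max i) => [j ->|-> //].
  rewrite -(c0 j); congr c.
  by apply/val_inj; rewrite /= /bump leqNgt ltn_ord.
rewrite inE => /orP [/eqP ->|/ws [c ->]].
  exists (fun i => (i == ord_max)%:R); rewrite sumE eqxx scale1r big1 ?add0r // => i _.
  by rewrite -val_eqE /= ltn_eqF ?scale0r.
exists (fun i => if unlift ord_max i is Some j then c j else 0).
rewrite sumE unlift_none scale0r addr0; apply: eq_bigr => i _.
have -> : widen_ord (leqnSn M) i = lift ord_max i.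
  by apply/val_inj; rewrite /= /bump leqNgt ltn_ord.
by rewrite liftK.
Qed.

(** Elements of K independent over k split an identity over K into identities over k; [krull] needs
    this because A is presented over k while the point has values in K. *)
Lemma poly_basis n (T : finType) (p : T -> mpoly n K) :
  exists M (w : 'I_M -> K) (q : T -> 'I_M -> mpoly n k),
  (forall c : 'I_M -> k, \sum_i c i *: w i = 0 -> forall i, c i = 0) /\
  forall t, p t = \sum_i mpolyC n (w i) * map_mpoly (GRing.in_alg K) (q t i).
Proof.
pose D := (\max_t mmeasure mdeg (p t))%N.
have sp t : (mmeasure mdeg (p t) <= D)%N by exact: (leq_bigmax t).
have [M [w [wi ws]]] := finite_basis
  [seq mcoeff (bmnm u.2) (p u.1) | u <- enum {: T * bmultinom n D}].
have /choice [c Hc] : forall u : T * bmultinom n D, exists c : 'I_M -> k,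
    mcoeff (bmnm u.2) (p u.1) = \sum_i c i *: w i.
  move=> u; apply: ws; apply: (map_f (fun u : T * bmultinom n D => mcoeff (bmnm u.2) (p u.1))).
  exact: mem_enum.
exists M, w, (fun t i => \sum_(m : bmultinom n D) mpolyC n (c (t, m) i) * mpolyX k (bmnm m)).
split=> // t; rewrite {1}(mpolyw (sp t)).
under [RHS]eq_bigr do rewrite rmorph_sum mulr_sumr.
rewrite exchange_big; apply: eq_bigr => m _.
have -> : mcoeff (bmnm m) (p t) = \sum_i c (t, m) i *: w i by exact: (Hc (t, m)).
rewrite rmorph_sum mulr_suml; apply: eq_bigr => i _.
rewrite rmorphM /= map_mpolyC map_mpolyX mulrA -mpolyCM; congr (mpolyC _ _ * _).
by rewrite /= mulr_algr.
Qed.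
End LinIndep.

(** * Jets of smooth algebras *)

(* R[T]/(T^(N+1)) *)
Section Jets.
Variables (k : closedFieldType) (R : comAlgType k) (N : nat).

Lemma jet_ideal_subproof : is_ideal (fun p : {poly R} => forall j, (j <= N)%N -> p`_j = 0).
Proof.
split=> [j _|p q Hp Hq j jN|a p Hp j jN]; first by rewrite coef0.
  by rewrite coefD Hp ?Hq ?addr0.
rewrite coefM big1 // => i _; rewrite Hp ?mulr0 //.
exact: leq_trans (leq_subr _ _) jN.
Qed.
Lemma jet_ideal1 : ~ forall j, (j <= N)%N -> (1 : {poly R})`_j = 0.
Proof. by move/(_ 0%N isT)/eqP; rewrite coef1 oner_eq0. Qed.
Definition jet_ideal := PIdeal jet_ideal_subproof jet_ideal1.
Definition jet : comAlgType k := QAlg (rC R) jet_ideal.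
Definition jpi : {rmorphism {poly R} -> jet} := qpi (rC R) jet_ideal.
Lemma jpi_surj y : exists p, jpi p = y. Proof. exact: qpi_surj. Qed.
Lemma jpi0 p : jpi p = 0 <-> forall j, (j <= N)%N -> p`_j = 0.
Proof. exact: (@qpi0P _ _ (rC R) jet_ideal). Qed.
Lemma jC_k (c : k) : (jpi \o polyC : {rmorphism R -> jet}) c%:A = c%:A.
Proof. exact: (qpi_alg (rC R) jet_ideal). Qed.
Definition jC : {lrmorphism R -> jet} := mklr jC_k.
Lemma jCE a : jC a = jpi a%:P. Proof. by []. Qed.
Definition jT : jet := jpi 'X.

Section Lift.
Variables (B : comAlgType k) (g : {lrmorphism R -> B}) (t : B).
Hypothesis tN : t ^+ N.+1 = 0.
Let cg : commr_rmorph g t. Proof. by move=> x; rewrite /GRing.comm mulrC. Qed.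
Lemma jlift_ex : exists h : {lrmorphism jet -> B},
  (forall a, h (jC a) = g a) /\ h jT = t.
Proof.
pose hm : {rmorphism {poly R} -> B} := horner_morph cg.
have hJ p : jet_ideal p -> hm p = 0.
  move=> Hp; rewrite /hm /= /horner_morph horner_coef big1 // => i _.
  have [iN|iN] := leqP i N; first by rewrite coef_map Hp //= rmorph0 mul0r.
  by rewrite -(subnK iN) exprD tN mulr0 mulr0.
have hk (c : k) : hm (rC R c) = c%:A.
  by rewrite /hm /= horner_morphC; exact: rmorph_alg.
exists (qlift hJ hk); split=> [a|].
  by rewrite -[LHS]/(qlift hJ hk (qpi (rC R) jet_ideal a%:P)) qliftE /hm /= horner_morphC.
by rewrite -[LHS]/(qlift hJ hk (qpi (rC R) jet_ideal 'X)) qliftE /hm /= horner_morphX.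
Qed.
End Lift.

Lemma j0_ex : exists h : {lrmorphism jet -> R}, (forall a, h (jC a) = a) /\ h jT = 0.
Proof. by apply: (@jlift_ex R idfun 0); rewrite exprS mul0r. Qed.
Definition j0 : {lrmorphism jet -> R} := projT1 (cid j0_ex).
Lemma j0C a : j0 (jC a) = a. Proof. exact: (proj1 (projT2 (cid j0_ex))). Qed.
Lemma j0T : j0 jT = 0. Proof. exact: (proj2 (projT2 (cid j0_ex))). Qed.
Lemma j0pi p : j0 (jpi p) = p`_0.
Proof.
elim/poly_ind: p => [|p c IH]; first by rewrite !rmorph0 coef0.
by rewrite !(rmorphD, rmorphM) /= -/jT j0T mulr0 add0r -jCE j0C coefD coefMX coefC add0r.
Qed.
Lemma jTN : jT ^+ N.+1 = 0.
Proof.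
rewrite /jT -rmorphXn; apply/jpi0 => j jN.
by rewrite coefXn ltn_eqF.
Qed.
End Jets.

Definition fsmooth (k : closedFieldType) (A : comAlgType k) : Prop :=
  forall (C C' : comAlgType k) (t : {lrmorphism C -> C'}), sq_zero_thickening t ->
  forall h' : {lrmorphism A -> C'}, exists h : {lrmorphism A -> C},
    forall a, t (h a) = h' a.

Definition fin_gen (k : closedFieldType) (A : comAlgType k) : Prop :=
  exists n (b : 'I_n -> A), forall a, exists p, mmap (GRing.in_alg A) b p = a.

Lemma poly_low_mul (S : comNzRingType) (u v : {poly S}) a b :
  (forall j, (j < a)%N -> u`_j = 0) -> (forall j, (j < b)%N -> v`_j = 0) ->
  forall j, (j < a + b)%N -> (u * v)`_j = 0.
Proof.
move=> ua vb j jab; rewrite coefM big1 // => i _.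
have [ia|ia] := ltnP i a; first by rewrite ua ?mul0r.
rewrite vb ?mulr0 // ltn_subLR; last by rewrite -ltnS.
by rewrite (leq_trans jab) // leq_add2r.
Qed.

Lemma poly_low_unit (S : comNzRingType) (u v : {poly S}) N (z : S) : u`_0 * z = 1 ->
  (forall j, (j < N)%N -> (u * v)`_j = 0) -> forall j, (j < N)%N -> v`_j = 0.
Proof.
move=> uz uv j; elim/ltn_ind: j => j IH jN.
have := uv j jN; rewrite coefM big_ord_recl /= subn0 big1 ?addr0 => [e|i _].
  by rewrite -[_`_j]mul1r -uz [u`_0 * z]mulrC -mulrA e mulr0.
rewrite /bump /= add1n; have ij : (j - i.+1 < j)%N.
  by rewrite ltn_subrL; case: j i {IH jN} => [[]|].
by rewrite IH ?mulr0 // (ltn_trans ij).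
Qed.

Lemma poly_low_exp (S : comNzRingType) (u : {poly S}) a n :
  (forall j, (j < a)%N -> u`_j = 0) -> (u ^+ n)`_(n * a) = u`_a ^+ n /\
  forall j, (j < n * a)%N -> (u ^+ n)`_j = 0.
Proof.
move=> ua; elim: n => [|n [IH1 IH2]]; first by rewrite !expr0 mul0n coef1.
split; last first.
  by move=> j; rewrite mulSn exprS; exact: poly_low_mul.
rewrite !exprS mulSn coefM (bigD1 (inord a)) //= inordK ?ltnS ?leq_addr //.
rewrite addKn IH1 big1 ?addr0 // => i ia.
have [lt_ia|] := ltnP i a; first by rewrite ua ?mul0r.
rewrite leq_eqVlt => /orP [/eqP e|lt_ai].
  by case/eqP: ia; apply/val_inj; rewrite /= inordK // ltnS leq_addr.
rewrite IH2 ?mulr0 // ltn_subLR; last by rewrite -ltnS.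
by rewrite ltn_add2r.
Qed.

Local Notation mlc p := (mcoeff (mlead p) p).
Lemma mpoly_field_exp (k : closedFieldType) (K : comAlgType k) n (p : mpoly n K) m :
  is_field K -> p ^+ m = 0 -> p = 0.
Proof.
move=> fK; elim: m => [|m IH]; first by rewrite expr0 => /eqP; rewrite oner_eq0.
rewrite exprS => e; apply: contrapT => p0; apply: (p0); apply: IH.
apply: contrapT => pm0.
have lead_nz (q : mpoly n K) : q <> 0 -> mlc q <> 0.
  by move=> q0; apply/eqP; rewrite mleadc_eq0; exact/eqP.
have nz : mlc p * mlc (p ^+ m) != 0.
  by apply/eqP/(field_mulf fK); exact: lead_nz.
have z0 (z : mpoly n K) : z = 0 -> mlc z = 0 by move=> ->; exact: mcoeff0.
by move: (nz); rewrite -(mleadcM_proper nz) (z0 _ e) eqxx.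
Qed.

Lemma krull_rel_aux (S : comNzRingType) N (eta : 'I_N -> S) (t : nat -> S) :
  t N = \sum_i eta i * t i ->
  (1 - \sum_i eta i) * t 0%N = \sum_i eta i * (t i - t 0%N) - (t N - t 0%N).
Proof.
move=> e; have -> : \sum_i eta i * (t i - t 0%N) = t N - (\sum_i eta i) * t 0%N.
  by rewrite mulr_suml e -sumrB; apply: eq_bigr => i _; rewrite mulrBr.
by ring.
Qed.

Section Smooth.
Variable k : closedFieldType.
Variable A : comAlgType k.
Hypothesis smA : fsmooth A.
Variables (n : nat) (b : 'I_n -> A).
Notation P := (mpoly n k).
Let ev : {rmorphism P -> A} := mmap (GRing.in_alg A) b.
Hypothesis ev_surj : forall a, exists p, ev p = a.

(* A formally smooth quotient of P is a retract of P / I^2. *)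
Lemma smooth_section : exists eps : {rmorphism P -> P},
  [/\ forall a, eps (mpolyC n a) = mpolyC n a,
      forall p, ev (eps p) = ev p
    & forall p, ev p = 0 -> exists N (u v : 'I_N -> P),
        [/\ forall i, ev (u i) = 0, forall i, ev (v i) = 0 & eps p = \sum_i u i * v i]].
Proof.
pose I2 (p : P) := exists N (u v : 'I_N -> P),
  [/\ forall i, ev (u i) = 0, forall i, ev (v i) = 0 & p = \sum_i u i * v i].
have iI2 : is_ideal I2.
  split=> [|x y [N [u [v [u0 v0 ->]]]] [M [u' [v' [u0' v0' ->]]]]|a x [N [u [v [u0 v0 ->]]]]].
  - by exists 0%N, (fun=> 0), (fun=> 0); split=> [[]|[]|] //; rewrite big_ord0.
  - exists (N + M)%N, (fun i => match split i with inl j => u j | inr j => u' j end),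
      (fun i => match split i with inl j => v j | inr j => v' j end); split.
    + by move=> i; case: (split i).
    + by move=> i; case: (split i).
    + rewrite big_split_ord /=; congr (_ + _); apply: eq_bigr => i _.
        by rewrite (unsplitK (inl i)).
      by rewrite (unsplitK (inr i)).
  - exists N, (fun i => a * u i), v; split=> // [i|]; first by rewrite rmorphM u0 mulr0.
    by rewrite mulr_sumr; apply: eq_bigr => i _; rewrite mulrA.
have evI2 p : I2 p -> ev p = 0.
  case=> N [u [v [u0 v0 ->]]]; rewrite rmorph_sum big1 // => i _.
  by rewrite rmorphM u0 mul0r.
have I21 : ~ I2 1 by move/evI2; rewrite rmorph1 => /eqP; rewrite oner_eq0.
pose J := PIdeal iI2 I21.
pose eta : {rmorphism k -> P} := @mpolyC n k.
pose C := QAlg eta J; pose pi : {rmorphism P -> C} := qpi eta J.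
have evk (c : k) : ev (eta c) = c%:A by rewrite /ev /eta /= mmapC.
pose t : {lrmorphism C -> A} := @qlift k P eta J A ev evI2 evk.
have tpi p : t (pi p) = ev p by exact: qliftE.
have sq : sq_zero_thickening t.
  split=> [y|x y]; first by have [p <-] := ev_surj y; exists (pi p).
  have [p <-] := qpi_surj x; have [q <-] := qpi_surj y.
  rewrite -/pi !tpi => p0 q0; rewrite -rmorphM; apply/qpi0P.
  by exists 1%N, (fun=> p), (fun=> q); split=> //; rewrite big_ord1.
have [h ht] := smA sq idfun.
have [E HE] := choice (fun i => qpi_surj (h (b i))).
pose eps : {rmorphism P -> P} := mmap (@mpolyC n k) E.
have pieps p : pi (eps p) = h (ev p).
  rewrite -[LHS]/((pi \o eps : {rmorphism P -> C}) p).
  rewrite -[RHS]/((h \o ev : {rmorphism P -> C}) p).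
  apply: mpoly_hom_eq => [c|i].
    rewrite /= /eps /ev /= !mmapC -[LHS]/(qpi eta J (eta c)) qpi_alg.
    exact/esym/rmorph_alg.
  by rewrite /= /eps /ev /= !mmap_var HE.
exists eps; split.
- by move=> a; rewrite /eps /= mmapC.
- by move=> p; rewrite -tpi pieps ht.
- by move=> p evp; apply/(@qpi0P _ _ eta J); rewrite -/pi pieps evp rmorph0.
Qed.

Section Taylor.
Variables (K : comAlgType k) (fK : is_field K) (x : {lrmorphism A -> K}).
Notation S := (mpoly n K).

(** The expansion of p(x + T Y) at the point x in the generic direction Y. *)
Definition taylor : {rmorphism P -> {poly S}} :=
  mmap (polyC \o (@mpolyC n K \o GRing.in_alg K))
       (fun i => (mpolyC n (x (b i)))%:P + (mvar K i)%:P * 'X).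

Lemma taylor0 p : (taylor p)`_0 = mpolyC n (x (ev p)).
Proof.
rewrite -[LHS]/((coefp 0 \o taylor : {rmorphism P -> S}) p).
rewrite -[RHS]/((@mpolyC n K \o (x \o ev) : {rmorphism P -> S}) p).
apply: mpoly_hom_eq => [c|i].
  rewrite /= /taylor /ev /= !mmapC /= coefC eqxx; congr (mpolyC _ _).
  exact/esym/rmorph_alg.
by rewrite /= /taylor /ev /= !mmap_var coefD coefC coefMX eqxx addr0.
Qed.

Definition tlow N p := forall j, (j < N)%N -> (taylor p)`_j = 0.

Lemma tlow_unit s p N : x (ev s) <> 0 -> tlow N (s * p) -> tlow N p.
Proof.
move=> /eqP /fK [z xz] sp; apply: (@poly_low_unit _ (taylor s) (taylor p) N (mpolyC n z)).
  by rewrite taylor0 -mpolyCM xz mpolyC1.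
move=> j jN; have <- : taylor (s * p) = taylor s * taylor p by exact: rmorphM.
exact: sp.
Qed.

(** Krull's intersection theorem at x. The Taylor polynomial of [u N], taken at T = 1, has order at
    least N in Y, so by [graded_stable] one of them is a combination of the previous ones with
    coefficients [eta i] of positive order. All [u N] represent a, so (1 - sum eta) annihilates a,
    and this factor is 1 at x. *)
Lemma krull (a : A) : (forall N, exists u, ev u = a /\ tlow N u) ->
  exists s, x s <> 0 /\ s * a = 0.
Proof.
move=> Hu; have [u Hu'] := choice Hu.
have evu N : ev (u N) = a by case: (Hu' N).
have lowu N : tlow N (u N) by case: (Hu' N).
pose W : comNzRingType := mpoly n S.
have nW : noeth W by do 2!apply: noeth_mpoly; exact: noeth_field.
pose evW : {rmorphism W -> S} := mmap (@idfun S) (@mvar n K).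
have evWC c : evW (mpolyC n c) = c by rewrite /evW /= mmapC.
have evWX i : evW (mvar S i) = mvar K i by rewrite /evW /= mmap_var.
pose lam : {rmorphism W -> {poly W}} :=
  mmap (polyC \o @mpolyC n S) (fun j => (mvar S j)%:P * 'X).
have lamX j : lam (mvar S j) = (mvar S j)%:P * 'X by rewrite /lam /= mmap_var.
have lamC c : lam (mpolyC n c) = (mpolyC n c)%:P by rewrite /lam /= mmapC.
(* [hom N w] says that w lies in the N-th power of the ideal of the variables: it is the value of a
   form of degree N with coefficients in S. *)
pose hom N (w : S) := exists F : W, lam F = F%:P * 'X^N /\ evW F = w.
have hom0 N : hom N 0 by exists 0; rewrite !rmorph0 mul0r.
have homD N v w : hom N v -> hom N w -> hom N (v + w).
  by move=> [F [lF <-]] [G [lG <-]]; exists (F + G); rewrite !rmorphD lF lG mulrDl.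
have homM N M v w : hom N v -> hom M w -> hom (N + M)%N (v * w).
  move=> [F [lF <-]] [G [lG <-]]; exists (F * G).
  by rewrite !rmorphM lF lG mulrACA exprD.
have homC w : hom 0%N w.
  by exists (mpolyC n w); rewrite lamC evWC expr0 mulr1.
have hom_taylor p j N : (N <= j)%N -> hom N (taylor p)`_j.
  move: p j N; apply: mpoly_gen => [c|i|p q Hp Hq|p q Hp Hq] j N Nj.
  - rewrite /taylor /= mmapC /= coefC; case: eqP => [j0|_]; last exact: hom0.
    by move: Nj; rewrite j0 leqn0 => /eqP ->; exact: homC.
  - rewrite /taylor /= mmap_var coefD coefC coefMX coefC.
    case: j Nj => [|[|j]] Nj; last by rewrite addr0; exact: hom0.
      by move: Nj; rewrite leqn0 => /eqP ->; exact: homC.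
    rewrite /= add0r; case: N Nj => [|[|//]] _; first exact: homC.
    by exists (mvar S i); rewrite lamX evWX expr1.
  - by rewrite rmorphD coefD; apply: homD; [exact: Hp | exact: Hq].
  - rewrite rmorphM coefM; apply: (big_ind (hom N)) => [|v w|i _]; [exact: hom0|exact: homD|].
    rewrite -(@subnKC (minn N i) N) ?geq_minl //; apply: homM.
      by apply: Hp; exact: geq_minr.
    apply: Hq; have [Ni|iN] := leqP N i; first by rewrite subnn.
    by rewrite leq_sub2r.
pose th p := (taylor p).[1].
have thE : th =1 (horner_eval (1 : S) \o taylor : {rmorphism P -> S}) by [].
have hom_th N : hom N (th (u N)).
  rewrite /th horner_coef; apply: (big_ind (hom N)) => [|v w|i _]; [exact: hom0|exact: homD|].
  rewrite expr1n mulr1; have [iN|Ni] := ltnP i N; last exact: hom_taylor.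
  by rewrite lowu.
have [F HF] := choice hom_th.
have [|||N [Q HQ]] := @graded_stable W lam F id (fun z => z = 0) nW (fun i => proj1 (HF i)).
- by [].
- split=> // [y z -> ->|c y ->]; [exact: addr0 | exact: mulr0].
- by move=> y j ->; rewrite rmorph0 coef0.
have posI (q : W) e : (0 < e)%N -> mcoeff mnm0 (evW (lam q)`_e) = 0.
  move: q e; pose g : {rmorphism W -> K} := (@mcoeff n K mnm0) \o evW.
  have Wgen (R : W -> Prop) : (forall u, R (mpolyC n u)) -> (forall j, R (mvar S j)) ->
    (forall p q : W, R p -> R q -> R (p + q)) -> (forall p q : W, R p -> R q -> R (p * q)) ->
    forall p, R p by exact: mpoly_gen.
  apply: (Wgen (fun q => forall e, (0 < e)%N -> g (lam q)`_e = 0)).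
  - by move=> c e e0; rewrite lamC coefC gtn_eqF ?rmorph0.
  - move=> j e e0; rewrite lamX coefCM coefX; case: (e == 1)%N.
      by rewrite mulr1 /g /= evWX mcoeffX mnm1_eq0.
    by rewrite mulr0 rmorph0.
  - move=> p q Hp Hq e e0; have -> : lam (p + q) = lam p + lam q by exact: rmorphD.
    exact (@pos_coefD W K g (lam p) (lam q) Hp Hq e e0).
  - move=> p q Hp Hq e e0; have -> : lam (p * q) = lam p * lam q by exact: rmorphM.
    exact (@pos_coefM W K g (lam p) (lam q) Hp Hq e e0).
pose eta (i : 'I_N) := evW (lam (Q i))`_(N - i).
have eta0 i : mcoeff mnm0 (eta i) = 0 by apply: posI; rewrite subn_gt0.
have rel : th (u N) = \sum_i eta i * th (u i).
  have /(congr1 evW) := HQ; rewrite rmorphB rmorph_sum rmorph0 => /eqP.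
  rewrite subr_eq0 (proj2 (HF N)) => /eqP ->; apply: eq_bigr => i _.
  by rewrite rmorphM /= (proj2 (HF i)).
pose al (l : 'I_N.+1) : S := if unlift ord_max l is Some i then eta i else -1.
have alE (G : nat -> S) : \sum_l al l * G l = \sum_i eta i * G i - G N.
  rewrite big_ord_recr /= /al unlift_none mulN1r; congr (_ - _); apply: eq_bigr => i _.
  have -> : widen_ord (leqnSn N) i = lift ord_max i.
    by apply/val_inj; rewrite /= /bump leqNgt ltn_ord.
  by rewrite liftK.
pose s' : S := 1 - \sum_i eta i.
pose thr : {rmorphism P -> S} := horner_eval 1 \o taylor.
have key : s' * thr (u 0%N) = \sum_(l < N.+1) al l * thr (u l - u 0%N).
  rewrite (alE (fun l => thr (u l - u 0%N))).
  have thB l : thr (u l - u 0%N) = th (u l) - th (u 0%N) by exact: rmorphB.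
  rewrite thB; have -> : \sum_i eta i * thr (u i - u 0%N) =
      \sum_i eta i * (th (u i) - th (u 0%N)) by apply: eq_bigr => i _; rewrite thB.
  exact: (@krull_rel_aux S N eta (fun i => th (u i)) rel).
(* Substituting Y - x(b) for Y undoes the expansion: it turns the Taylor polynomial of p at T = 1
   back into p ([sh_th]). *)
pose sh : {rmorphism S -> S} := mmap (@mpolyC n K) (fun i => mvar K i - mpolyC n (x (b i))).
pose io : {rmorphism P -> S} := @map_mpoly n k K (GRing.in_alg K).
pose ex : {rmorphism S -> K} := mmap (@idfun K) (fun i => x (b i)).
have sh_th p : sh (thr p) = io p.
  rewrite -[LHS]/((sh \o thr : {rmorphism P -> S}) p).
  apply: mpoly_hom_eq => [c|i].
    by rewrite /= /taylor /= mmapC /= /horner_eval hornerC /sh /= mmapC /io /= map_mpolyC.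
  rewrite /= /taylor /= mmap_var /= /horner_eval hornerD hornerM !hornerC hornerX mulr1.
  rewrite rmorphD /= /sh /= mmapC mmap_var addrC subrK /io /= /mvar map_mpolyX.
  by [].
have ex_sh p : ex (sh p) = mcoeff mnm0 p.
  rewrite -[LHS]/((ex \o sh : {rmorphism S -> K}) p).
  rewrite -[RHS]/((@mcoeff n K mnm0 : {rmorphism S -> K}) p).
  apply: mpoly_hom_eq => [c|i].
    by rewrite /= /sh /= mmapC /ex /= mmapC /= mcoeffC eqxx mulr1.
  rewrite /= /sh /= mmap_var rmorphB /= /ex /= mmap_var mmapC subrr.
  by rewrite mcoeffX mnm1_eq0.
have ex_io p : ex (io p) = x (ev p).
  rewrite -[LHS]/((ex \o io : {rmorphism P -> K}) p).
  rewrite -[RHS]/((x \o ev : {rmorphism P -> K}) p).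
  apply: mpoly_hom_eq => [c|i].
    by rewrite /= /io /= map_mpolyC /ex /= mmapC /ev /= mmapC; exact/esym/rmorph_alg.
  have ioX : io (mvar k i) = mvar K i by rewrite /io /= map_mpolyX.
  by rewrite -[LHS]/(ex (io (mvar k i))) ioX -[RHS]/(x (ev (mvar k i))) /ex /ev /= !mmap_var.
pose fam (t : option 'I_N.+1) := if t is Some l then sh (al l) else sh s'.
(* The relation so far has coefficients in K. It splits into relations over k, and for one of them
   the coefficient [q None m] does not vanish at x. *)
have [M [w [q [wi Hq]]]] := poly_basis fam.
have indep (G : 'I_M -> P) : \sum_m mpolyC n (w m) * io (G m) = 0 -> forall m, G m = 0.
  move=> e m; apply/mpolyP => g; rewrite mcoeff0.
  apply: (wi (fun m => mcoeff g (G m))); rewrite -[RHS](mcoeff0 K g) -e raddf_sum.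
  apply: eq_bigr => m' _; rewrite /= mcoeffCM /io /= mcoeff_map_mpoly /=.
  by rewrite mulr_algr.
have rel2 m : q None m * u 0%N - \sum_l q (Some l) m * (u l - u 0%N) = 0.
  move: m; apply: indep; under eq_bigr do rewrite rmorphB rmorphM mulrBr mulrA.
  rewrite sumrB -mulr_suml -(Hq None) -(sh_th (u 0%N)) -[fam None]/(sh s') -(rmorphM sh).
  rewrite key (rmorph_sum sh).
  apply/eqP; rewrite subr_eq0; apply/eqP.
  under [RHS]eq_bigr do rewrite rmorph_sum mulr_sumr.
  rewrite exchange_big; apply: eq_bigr => l _ /=.
  rewrite rmorphM /= sh_th -[sh (al l)]/(fam (Some l)) Hq mulr_suml; apply: eq_bigr => m _.
  by rewrite rmorphM mulrA.
have one : \sum_m w m * x (ev (q None m)) = 1.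
  transitivity (ex (sh s')).
    rewrite -[sh s']/(fam None) Hq rmorph_sum; apply: eq_bigr => m _.
    have exC : ex (mpolyC n (w m)) = w m by rewrite /ex /= mmapC.
    by rewrite (rmorphM ex) exC ex_io.
  rewrite ex_sh /s' rmorphB rmorph1 raddf_sum big1 ?subr0 // => i _.
  exact: eta0.
have [m xm] : exists m, x (ev (q None m)) <> 0.
  apply: contrapT => no; move: one; rewrite big1 => [/esym/eqP|m _].
    by rewrite oner_eq0.
  have [->|/eqP xm] := eqVneq (x (ev (q None m))) 0; first by rewrite mulr0.
  by case: no; exists m.
exists (ev (q None m)); split=> //.
move/eqP: (rel2 m); rewrite subr_eq0 => /eqP e.
rewrite -(evu 0%N) -rmorphM e rmorph_sum big1 // => l _.
by rewrite rmorphM rmorphB !evu subrr mulr0.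
Qed.
End Taylor.
End Smooth.

(** Each application of [eps] doubles the order of vanishing, since it writes an element of I
    through products of two elements of I. *)
Lemma iter_low (P S : comNzRingType) (T : {rmorphism P -> {poly S}}) (I : P -> Prop)
    (eps : {rmorphism P -> P}) (E : nat -> {rmorphism P -> P}) :
  (forall q, I q -> (T q)`_0 = 0) ->
  (forall q, I q -> exists N (u v : 'I_N -> P),
     [/\ forall i, I (u i), forall i, I (v i) & eps q = \sum_i u i * v i]) ->
  (forall q, E 0%N q = q) -> (forall t q, E t.+1 q = E t (eps q)) ->
  forall t q, I q -> forall j, (j < 2 ^ t)%N -> (T (E t q))`_j = 0.
Proof.
move=> T0 eps_sq E0 ES; elim=> [|t IH] q Iq j; first by rewrite E0; case: j => // _; exact: T0.
rewrite expnS mul2n -addnn => jt; have [N [u [v [Iu Iv e]]]] := eps_sq q Iq.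
rewrite ES e !rmorph_sum coef_sum big1 // => i _; rewrite !rmorphM.
by apply: (poly_low_mul (a := 2 ^ t) (b := 2 ^ t)) => // l lt; exact: IH.
Qed.

Section Smooth2.
Variable k : closedFieldType.
Variable A : comAlgType k.
Hypothesis smA : fsmooth A.
Hypothesis fgA : fin_gen A.

(* All maps from A to jets R[T]/(T^(N+1)) over extensions of x kill a. *)
Definition jet_zero (K : comAlgType k) (x : {lrmorphism A -> K}) (a : A) : Prop :=
  forall (R : comAlgType k) (e : {lrmorphism K -> R}) N (h : {lrmorphism A -> jet R N}),
    (forall a', j0 R N (h a') = e (x a')) -> h a = 0.

(** Let f represent a. G consists of the Taylor coefficients of the iterates [epsn t f] in degrees
    below 2 ^ t. If all vanish at x, a has representatives of any order there, and [krull] applies.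
    Conversely, if s a = 0 with s nonzero at x, then [epsn t (s f)] has order at least 2 ^ t.
    Finally, the truncated expansion of [epsn t] kills the ideal of A, so it is a jet of A at x.
    Thus vanishing near x is both an open and a closed condition. *)
Lemma smooth_local_zero (a : A) : exists G : A -> Prop,
  forall (K : comAlgType k) (x : {lrmorphism A -> K}), is_field K ->
  [/\ (forall g, G g -> x g = 0) -> exists s, x s <> 0 /\ s * a = 0,
      (exists s, x s <> 0 /\ s * a = 0) -> forall g, G g -> x g = 0
    & jet_zero x a -> forall g, G g -> x g = 0].
Proof.
have [n [b ev_surj]] := fgA.
pose P := mpoly n k; pose ev : {rmorphism P -> A} := mmap (GRing.in_alg A) b.
have [eps [epsC ev_eps eps_sq]] := smooth_section smA ev_surj.
pose fix epsn t : {rmorphism P -> P} := if t is t'.+1 then epsn t' \o eps else idfun.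
have ev_epsn t p : ev (epsn t p) = ev p.
  by elim: t p => [//|t IH] p; rewrite /= IH ev_eps.
have [f evf] := ev_surj a.
(* The Taylor expansion at the universal point of affine space; its coefficients specialize to those
   at every x ([UE]). *)
pose U : {rmorphism P -> {poly (mpoly n P)}} :=
  mmap (polyC \o (@mpolyC n P \o @mpolyC n k))
    (fun i => (mpolyC n (mvar k i))%:P + (mvar P i)%:P * 'X).
pose G g := exists t j m, (j < 2 ^ t)%N /\ g = ev (mcoeff m (U (epsn t f))`_j).
have UE (K : comAlgType k) (x : {lrmorphism A -> K}) p m j :
    mcoeff m (taylor b x p)`_j = x (ev (mcoeff m (U p)`_j)).
  pose xe : {rmorphism P -> K} := x \o ev.
  pose mp : {rmorphism mpoly n P -> mpoly n K} := @map_mpoly n _ _ xe.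
  have -> : taylor b x p = map_poly mp (U p).
    rewrite -[RHS]/((map_poly mp \o U : {rmorphism P -> {poly (mpoly n K)}}) p).
    apply: mpoly_hom_eq => [c|i].
      rewrite /= /taylor /U /= !mmapC /= map_polyC /= /mp /= map_mpolyC; congr ((mpolyC _ _)%:P).
      by rewrite /xe /= mmapC; exact/esym/rmorph_alg.
    rewrite /= /taylor /U /= !mmap_var rmorphD rmorphM /= map_polyX !map_polyC /= /mp /=.
    rewrite map_mpolyC map_mpolyX; congr ((mpolyC _ _)%:P + _).
    by rewrite /xe /= mmap_var.
  by rewrite coef_map /= mcoeff_map_mpoly.
have low_epsn (K : comAlgType k) (x : {lrmorphism A -> K}) t q :
    ev q = 0 -> tlow b x (2 ^ t) (epsn t q).
  apply: (@iter_low P (mpoly n K) (taylor b x) (fun q => ev q = 0) eps epsn) => //.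
  by move=> q'; rewrite taylor0 => ->; rewrite rmorph0 mpolyC0.
have lowG (K : comAlgType k) (x : {lrmorphism A -> K}) :
    (forall t, tlow b x (2 ^ t) (epsn t f)) -> forall g, G g -> x g = 0.
  by move=> H _ [t [j [m [jt ->]]]]; rewrite -UE H // mcoeff0.
exists G => K x fK; split.
- move=> HG; have [|s Hs] := @krull k A n b K fK x a; last by exists s.
  move=> N.
  exists (epsn N f); split; first by rewrite -/ev ev_epsn.
  move=> j jN; apply/mpolyP => m; rewrite UE mcoeff0; apply: HG; exists N, j, m; split=> //.
  by rewrite (ltn_trans jN) // ltn_expl.
- move=> [s [xs sa]]; have [p evp] := ev_surj s.
  apply: lowG => t; apply: (@tlow_unit k A n b K fK x (epsn t p)).
    by rewrite -/ev ev_epsn /ev /= evp.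
  by rewrite -rmorphM; apply: low_epsn; rewrite rmorphM /ev /= evp evf.
move=> jz; apply: lowG => t.
pose S := mpoly n K; pose eta : {rmorphism k -> S} := @mpolyC n K \o GRing.in_alg K.
have i0 : is_ideal (fun y : S => y = 0).
  by split=> [//|y z -> ->|c y ->]; rewrite ?addr0 ?mulr0.
have i01 : ~ (1 : S) = 0 by apply/eqP; exact: oner_neq0.
pose J0 := PIdeal i0 i01.
pose Sa := QAlg eta J0; pose pi : {rmorphism S -> Sa} := qpi eta J0.
have ek (c : k) : (pi \o @mpolyC n K : {rmorphism K -> Sa}) c%:A = c%:A.
  exact: (qpi_alg eta J0 c).
pose e : {lrmorphism K -> Sa} := mklr ek.
pose N := (2 ^ t).-1; have Nt : N.+1 = (2 ^ t)%N by rewrite prednK // expn_gt0.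
pose h0 : {rmorphism P -> jet Sa N} := jpi Sa N \o (map_poly pi \o (taylor b x \o epsn t)).
have kerh q : ev q = 0 -> h0 q = 0.
  move=> q0; apply/jpi0 => j; rewrite -ltnS Nt => jt.
  by rewrite coef_map (low_epsn _ _ _ _ q0 j jt); exact: rmorph0.
have evk (c : k) : ev (mpolyC n c) = c%:A by rewrite /ev /= mmapC.
have epsnC c : epsn t (mpolyC n c) = mpolyC n c.
  by elim: (t) => [//|t' IH] /=; rewrite epsC.
have hk (c : k) : h0 (mpolyC n c) = c%:A.
  rewrite /h0 /= epsnC /taylor /= mmapC /= map_polyC /= -/pi -[pi _]/(qpi eta J0 (eta c)).
  by rewrite qpi_alg -[LHS]/((jpi Sa N \o polyC) c%:A) jC_k.
have [h Hh] := @surj_lift k P A (jet Sa N) ev h0 (@mpolyC n k) ev_surj kerh evk hk.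
have ha : h0 f = 0.
  rewrite -Hh; apply: (etrans (congr1 h evf)); apply: (jz Sa e N h) => a'.
  have [p <-] := ev_surj a'.
  rewrite -/(ev p) Hh /h0 /= j0pi coef_map taylor0 -/ev ev_epsn.
  by [].
move=> j jt; have /jpi0 := ha => /(_ j); rewrite -ltnS Nt => /(_ jt).
rewrite coef_map => /(@qpi0P _ _ eta J0) ->; exact: rmorph0.
Qed.

(** A nilpotent a has d-th power 0 for some d. If f represents a and some late iterate of f had
    order exactly j < N at x, its d-th power would have order d j, yet that power represents 0 and
    has order at least 2 ^ (d N). So a has representatives of any order at every point, and [krull]
    applies. *)
Lemma smooth_reduced (a : A) :
  (forall (K : comAlgType k) (x : {lrmorphism A -> K}), is_field K -> x a = 0) -> a = 0.
Proof.
move=> Ha; have [d ad] := nilpotent_pt Ha.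
have [n [b ev_surj]] := fgA.
pose P := mpoly n k; pose ev : {rmorphism P -> A} := mmap (GRing.in_alg A) b.
have [eps [epsC ev_eps eps_sq]] := smooth_section smA ev_surj.
have [f evf] := ev_surj a.
pose fix epsn t : {rmorphism P -> P} := if t is t'.+1 then epsn t' \o eps else idfun.
have ev_epsn t p : ev (epsn t p) = ev p.
  by elim: t p => [//|t IH] p; rewrite /= IH ev_eps.
have low_epsn (K : comAlgType k) (x : {lrmorphism A -> K}) t q :
    ev q = 0 -> tlow b x (2 ^ t) (epsn t q).
  apply: (@iter_low P (mpoly n K) (taylor b x) (fun q => ev q = 0) eps epsn) => //.
  by move=> q'; rewrite taylor0 => ->; rewrite rmorph0 mpolyC0.
apply: zero_local => K x fK.
have [|s [xs sa]] := @krull k A n b K fK x a; last by exists s.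
move=> N; exists (epsn (d * N)%N f); split; first by rewrite -/ev ev_epsn.
move=> j; elim/ltn_ind: j => j IH jN.
have low i : (i < j)%N -> (taylor b x (epsn (d * N)%N f))`_i = 0.
  by move=> ij; apply: IH => //; exact: ltn_trans jN.
have [e _] := poly_low_exp d low.
apply: (mpoly_field_exp fK (m := d)); rewrite -e -!rmorphXn.
apply: low_epsn; first by rewrite rmorphXn /ev /= evf.
have [d0|d0] := posnP d; first by rewrite d0 !mul0n expn_gt0.
apply: (leq_trans (n := d * N)); first by rewrite ltn_pmul2l.
by apply: ltnW; rewrite ltn_expl.
Qed.
End Smooth2.

(** * Regular functions on smooth functors *)

Section Functors.
Variable k : closedFieldType.
Implicit Types (R A B C K : comAlgType k) (T X Y : kfunctor k).

Lemma lrmorphism_eq R R' (f g : {lrmorphism R -> R'}) : f =1 g -> f = g.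
Proof.
case: f g => f [[cf1] [cf2] [cf3]] [g [[cg1] [cg2] [cg3]]] /= fg.
have e : f = g by apply/funext.
subst g.
by rewrite (Prop_irrelevance cf1 cg1) (Prop_irrelevance cf2 cg2) (Prop_irrelevance cf3 cg3).
Qed.

Lemma fmap_eq T R R' (f g : {lrmorphism R -> R'}) (x : T R) : f =1 g -> fmap f x = fmap g x.
Proof. by move/lrmorphism_eq ->. Qed.

Lemma fmap_tri T R R' R'' (f : {lrmorphism R -> R'}) (g : {lrmorphism R' -> R''})
    (h : {lrmorphism R -> R''}) (x : T R) :
  (forall a, g (f a) = h a) -> fmap g (fmap f x) = fmap h x.
Proof. by move=> e; rewrite -fmap_comp; exact: fmap_eq. Qed.

Definition ideal_gen R (D : R -> Prop) (x : R) : Prop :=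
  exists n (a c : 'I_n -> R), (forall i, D (a i)) /\ \sum_i c i * a i = x.

Lemma ideal_gen_ideal R (D : R -> Prop) : is_ideal (ideal_gen D).
Proof.
split=> [|x y [n [a [c [Da <-]]]] [m [a' [c' [Da' <-]]]]|b x [n [a [c [Da <-]]]]].
- by exists 0%N, (fun=> 0), (fun=> 0); split=> [[]|] //; rewrite big_ord0.
- exists (n + m)%N, (fun i => match split i with inl j => a j | inr j => a' j end),
    (fun i => match split i with inl j => c j | inr j => c' j end); split.
    by move=> i; case: (split i).
  rewrite big_split_ord /=; congr (_ + _); apply: eq_bigr => i _.
    by rewrite (unsplitK (inl i)).
  by rewrite (unsplitK (inr i)).
- exists n, a, (fun i => b * c i); split=> //.
  by rewrite mulr_sumr; apply: eq_bigr => i _; rewrite mulrA.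
Qed.

Lemma gen_unit_pt R R' (f : {lrmorphism R -> R'}) (D : R -> Prop) :
  gen_unit f D <-> forall K (g : {lrmorphism R' -> K}), is_field K ->
    exists2 a, D a & g (f a) <> 0.
Proof.
split=> [[n [a [c [Da e]]]] K g fK|H].
  apply: contrapT => no; move: (congr1 g e); rewrite rmorph1 rmorph_sum big1.
    by move/esym/eqP; rewrite oner_eq0.
  move=> i _; rewrite rmorphM /=; have [->|ne] := eqVneq (g (f (a i))) 0.
    by rewrite mulr0.
  by case: no; exists (a i) => //; exact/eqP.
have [|n [a [c [Da e]]]] := @ideal1_pt k R' _ (ideal_gen_ideal (fun y => exists2 a, D a & y = f a)).
  move=> K g fK; have [a Da ga] := H K g fK; exists (f a) => //.
  exists 1%N, (fun=> f a), (fun=> 1); rewrite big_ord1 mul1r; split=> // _.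
  by exists a.
have Da2 i : exists z, D z /\ a i = f z by have [z Dz e'] := Da i; exists z.
have [a' Ha'] := choice Da2.
exists n, a', c; split=> [i|]; first by case: (Ha' i).
by rewrite -e; apply: eq_bigr => i _; case: (Ha' i) => _ ->.
Qed.

Lemma unit_pt R (a : R) :
  (forall K (g : {lrmorphism R -> K}), is_field K -> g a <> 0) -> exists u, a * u = 1.
Proof.
move=> H; have [||u e] := @ideal1_pt k R (fun x => exists u, a * u = x).
- split=> [|x y [u <-] [v <-]|b x [u <-]].
  + by exists 0; rewrite mulr0.
  + by exists (u + v); rewrite mulrDr.
  + by exists (b * u); rewrite mulrCA.
- by move=> K g fK; exists a; [exists 1; rewrite mulr1 | exact: H].
by exists u.
Qed.

Lemma gen_unit_unit R R' (f : {lrmorphism R -> R'}) (D : R -> Prop) a u :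
  D a -> f a * u = 1 -> gen_unit f D.
Proof.
by move=> Da e; exists 1%N, (fun=> a), (fun=> u); rewrite big_ord1 mulrC.
Qed.

Lemma unit_neq0 R K (g : {lrmorphism R -> K}) (a u : R) : a * u = 1 -> g a <> 0.
Proof.
move=> e ga; move: (congr1 g e); rewrite rmorphM /= ga mul0r rmorph1.
by move/esym/eqP; rewrite oner_eq0.
Qed.

Lemma field_inv K (x : K) : is_field K -> x <> 0 -> exists u, x * u = 1.
Proof. by move=> fK /eqP /fK. Qed.

Lemma loc_at R K (f : {lrmorphism R -> K}) (r : R) : is_field K -> f r <> 0 ->
  exists (Rr : comAlgType k) (l : {lrmorphism R -> Rr}), is_localization l r /\
    forall C (g : {lrmorphism R -> C}) (u : C), g r * u = 1 ->
      exists g' : {lrmorphism Rr -> C}, forall a, g' (l a) = g a.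
Proof.
move=> fK fr; apply: exists_localization => n e; apply: fr; apply: (field_exp0 fK (n := n)).
by rewrite -rmorphXn e rmorph0.
Qed.

Lemma unit_expX R (a u : R) n : a * u = 1 -> a ^+ n * u ^+ n = 1.
Proof. by move=> e; rewrite -exprMn e expr1n. Qed.

Lemma localization_eq R R' C (l : {lrmorphism R -> R'}) (r : R) (f g : {lrmorphism R' -> C}) :
  is_localization l r -> (forall a, f (l a) = g (l a)) -> f =1 g.
Proof.
case=> [[u lu] surj _] fg b; have [n [a e]] := surj b.
have fb (h : {lrmorphism R' -> C}) : h b = h (l a) * h u ^+ n.
  by rewrite -rmorphXn -rmorphM /= -e -mulrA (unit_expX n lu) mulr1.
rewrite !fb fg; congr (_ * _ ^+ n).
have gu (h : {lrmorphism R' -> C}) : h (l r) * h u = 1 by rewrite -rmorphM /= lu rmorph1.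
by rewrite -[f u]mulr1 -(gu g) -fg mulrA [f u * _]mulrC gu mul1r.
Qed.

Section Relative.
Variable X : kfunctor k.
Implicit Types Z U O : subfunctor X.

(** Openness is tested on points of Z only, so U may be arbitrary elsewhere; this allows open parts
    of locally closed loci. *)
Definition open_in Z U : Prop :=
  forall R (x : X R), Z R x -> exists D : R -> Prop,
  forall R' (f : {lrmorphism R -> R'}), U R' (fmap f x) <-> gen_unit f D.

Lemma open_in_sub Z U : open_sub U -> open_in Z U.
Proof. by move=> oU R x _; exact: oU. Qed.

Lemma open_pts Z U R (x : X R) : open_in Z U -> Z R x ->
  (forall K (f : {lrmorphism R -> K}), is_field K -> U K (fmap f x)) -> U R x.
Proof.
move=> oU Zx H; have [D HD] := oU R x Zx; rewrite -[x]fmap_id; apply/HD/gen_unit_pt => K g fK.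
have /HD/gen_unit_pt := H K g fK => /(_ K idfun fK) [a Da ga].
by exists a.
Qed.

(** Every field-valued point of C kills the nilpotent kernel and so factors through C'; open
    conditions do not see nilpotents. *)
Lemma open_thick Z U C C' (t : {lrmorphism C -> C'}) (x : X C) :
  open_in Z U -> Z C x -> (forall y, exists z, t z = y) ->
  (forall y, t y = 0 -> exists n, y ^+ n = 0) -> U C' (fmap t x) -> U C x.
Proof.
move=> oU Zx st nil Ut; apply: open_pts oU Zx _ => K f fK.
have [h hE] : exists h : {lrmorphism C' -> K}, forall x, h (t x) = f x.
  apply: (surj_lift (p := t) (g := f) (eta := GRing.in_alg C)) => //.
  - move=> y /nil [n e]; apply: (field_exp0 fK (n := n)).
    by rewrite -rmorphXn e rmorph0.
  - by move=> c; exact: rmorph_alg.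
  - by move=> c; exact: rmorph_alg.
by rewrite -(fmap_tri x hE); exact: smem_map.
Qed.

Lemma open_ext Z U K K' (e : {lrmorphism K -> K'}) (x : X K) : open_in Z U ->
  is_field K -> is_field K' -> Z K x -> U K' (fmap e x) -> U K x.
Proof.
move=> oU fK fK' Zx Ux; have [D HD] := oU K x Zx.
have [a Da ea] := proj1 (gen_unit_pt _ _) (proj1 (HD _ e) Ux) K' idfun fK'.
rewrite -[x]fmap_id; apply/HD; have [|u au] := @field_inv K a fK.
  by move=> a0; apply: ea; rewrite a0 rmorph0.
exact: (@gen_unit_unit K K idfun D a u Da au).
Qed.

Lemma open_loc Z U R (x : X R) K (f : {lrmorphism R -> K}) :
  open_in Z U -> Z R x -> is_field K -> U K (fmap f x) ->
  exists r (Rr : comAlgType k) (l : {lrmorphism R -> Rr}),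
    [/\ is_localization l r, f r <> 0, U Rr (fmap l x)
      & forall C (g : {lrmorphism R -> C}) (u : C), g r * u = 1 ->
          exists g' : {lrmorphism Rr -> C}, forall a, g' (l a) = g a].
Proof.
move=> oU Zx fK Ux; have [D HD] := oU R x Zx.
have [a Da fa] := proj1 (gen_unit_pt _ _) (proj1 (HD _ f) Ux) K idfun fK.
have [Rr [l [loc univ]]] := @loc_at R K f a fK fa; exists a, Rr, l; split=> //.
by apply/HD; have [[u lu] _ _] := loc; exact: gen_unit_unit Da lu.
Qed.

Lemma pts_sub_map (P : point_pred X) R R' (f : {lrmorphism R -> R'}) (x : X R) :
  (forall K (g : {lrmorphism R -> K}), is_field K -> P K (fmap g x)) ->
  forall K (g : {lrmorphism R' -> K}), is_field K -> P K (fmap g (fmap f x)).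
Proof. by move=> H K g fK; rewrite -fmap_comp; exact: H. Qed.

(** The largest subfunctor with field-valued points in P. An open subfunctor is recovered from its
    field-valued points in this way ([open_pts]). *)
Definition pts_sub (P : point_pred X) : subfunctor X := SubFunctor (@pts_sub_map P).

Lemma pts_sub_open Z (P : point_pred X) :
  (forall R (x : X R) K (f : {lrmorphism R -> K}), Z R x -> is_field K -> P K (fmap f x) ->
     exists r, f r <> 0 /\ forall K' (g : {lrmorphism R -> K'}), is_field K' -> g r <> 0 ->
       P K' (fmap g x)) ->
  open_in Z (pts_sub P).
Proof.
move=> H R x Zx.
exists (fun r => forall K' (g : {lrmorphism R -> K'}), is_field K' -> g r <> 0 -> P K' (fmap g x)).
move=> R' f; split=> [Ux|/gen_unit_pt Ux].
  apply/gen_unit_pt => K g fK.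
  have Pg : P K (fmap (g \o f) x) by rewrite fmap_comp; exact: Ux.
  by have [r [fr Hr]] := H R x K (g \o f) Zx fK Pg; exists r.
move=> K g fK; have [r Hr gr] := Ux K g fK.
by rewrite -fmap_comp; apply: Hr.
Qed.

Definition rep Z U A (u : X A) : Prop :=
  [/\ Z A u, U A u,
      forall R (x : X R), Z R x -> U R x -> exists f : {lrmorphism A -> R}, fmap f u = x
    & forall R (f g : {lrmorphism A -> R}), fmap f u = fmap g u -> f =1 g].

Definition sq_lifts Z : Prop :=
  forall C C' (t : {lrmorphism C -> C'}), sq_zero_thickening t ->
  forall x' : X C', Z C' x' -> exists2 x : X C, Z C x & fmap t x = x'.

(** Smoothness over k, in a form that makes sense for a subfunctor: infinitesimal lifting inside Z
    together with charts of finite type that are open in Z. *)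
Definition nice Z : Prop := sq_lifts Z /\
  forall K (x : X K), is_field K -> Z K x -> exists U A (u : X A),
    [/\ open_in Z U, U K x, rep Z U u & fin_gen A].

Lemma meet_map Z U R R' (f : {lrmorphism R -> R'}) (x : X R) :
  Z R x /\ U R x -> Z R' (fmap f x) /\ U R' (fmap f x).
Proof. by case=> Zx Ux; split; exact: smem_map. Qed.

Definition meet Z U : subfunctor X := SubFunctor (@meet_map Z U).

Lemma sq_thick_nil C C' (t : {lrmorphism C -> C'}) : sq_zero_thickening t ->
  forall y, t y = 0 -> exists n, y ^+ n = 0.
Proof. by case=> _ sq y ty; exists 2%N; rewrite expr2 sq. Qed.

Lemma chart_fsmooth Z U A (u : X A) :
  sq_lifts Z -> open_in Z U -> rep Z U u -> fsmooth A.
Proof.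
move=> lf oU [Zu Uu ex inj] C C' t st h'.
have [x Zx e] := lf C C' t st (fmap h' u) (smem_map _ Zu).
have Ux : U C x.
  apply: open_thick oU Zx (proj1 st) (sq_thick_nil st) _.
  by rewrite e; exact: smem_map.
have [h hx] := ex C x Zx Ux; exists h.
by apply: (inj C' (t \o h) h'); rewrite fmap_comp hx.
Qed.

Section Principal.
Variables (Z U : subfunctor X) (A : comAlgType k) (u : X A).
Hypotheses (oU : open_in Z U) (ru : rep Z U u).
Variables (a : A) (Aa : comAlgType k) (l : {lrmorphism A -> Aa}).
Hypothesis la : is_localization l a.
Hypothesis univ : forall C (g : {lrmorphism A -> C}) (u : C), g a * u = 1 ->
          exists g' : {lrmorphism Aa -> C}, forall a, g' (l a) = g a.

Definition principal_pt : point_pred X := fun K x =>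
  U K x /\ exists g : {lrmorphism A -> K}, fmap g u = x /\ g a <> 0.

Lemma principal_open : open_in Z (pts_sub principal_pt).
Proof.
have [Zu Uu ex inj] := ru.
apply: pts_sub_open => R x K f Zx fK [Ux [g [gx ga]]].
have [r [Rr [lr [[[v lv] surj _] fr Ul univr]]]] := open_loc oU Zx fK Ux.
have [g1 g1x] := ex Rr (fmap lr x) (smem_map lr Zx) Ul.
have [n [b e]] := surj (g1 a).
have step K' (h : {lrmorphism R -> K'}) : is_field K' -> h r <> 0 ->
    exists h' : {lrmorphism Rr -> K'}, fmap (h' \o g1) u = fmap h x /\ h b = h' (g1 a) * h r ^+ n.
  move=> fK' hr; have [w hw] := field_inv fK' hr; have [h' h'E] := univr K' h w hw.
  exists h'; rewrite fmap_comp g1x (fmap_tri x h'E); split=> //.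
  by rewrite -h'E -e rmorphM rmorphXn /= h'E.
exists (r * b); split.
  have [h' [h'u fb]] := step K f fK fr.
  rewrite rmorphM /=; apply: (field_mulf fK) => //; rewrite fb.
  have -> : h' (g1 a) = g a by apply: (inj K (h' \o g1) g); rewrite h'u gx.
  by apply: (field_mulf fK) => // /(field_exp0 fK).
move=> K' h fK' hrb.
have hr : h r <> 0 by move=> e0; apply: hrb; rewrite rmorphM /= e0 mul0r.
have [h' [h'u hb]] := step K' h fK' hr; split; last first.
  exists (h' \o g1); split=> //= e0; apply: hrb.
  by rewrite rmorphM /= hb e0 mul0r mulr0.
by rewrite -h'u; exact: smem_map.
Qed.

Lemma principal_in R (x : X R) : Z R x -> pts_sub principal_pt R x ->
  U R x /\ exists g : {lrmorphism A -> R}, fmap g u = x /\ exists v, g a * v = 1.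
Proof.
have [Zu Uu ex inj] := ru.
move=> Zx H; have Ux : U R x by apply: open_pts oU Zx _ => K f fK; case: (H K f fK).
split=> //; have [g gx] := ex R x Zx Ux; exists g; split=> //.
apply: unit_pt => K h fK; have [_ [h' [h'x ha]]] := H K h fK.
suff -> : h (g a) = h' a by [].
by apply: (inj K (h \o g) h'); rewrite fmap_comp gx h'x.
Qed.

Lemma principal_pt_ext K (x : X K) : is_field K -> principal_pt x -> pts_sub principal_pt K x.
Proof.
move=> fK [Ux [g [gx ga]]] K' h fK'; split; first exact: smem_map.
exists (h \o g); split; first by rewrite fmap_comp gx.
by have [v gv] := field_inv fK ga; exact: unit_neq0 gv.
Qed.

Lemma principal_rep : rep Z (pts_sub principal_pt) (fmap l u).
Proof.
have [Zu Uu ex inj] := ru; have [[v lv] _ _] := la.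
split.
- exact: smem_map.
- move=> K g fK; split; first by do 2!apply: smem_map.
  by exists (g \o l); split; [rewrite fmap_comp | exact: unit_neq0 lv].
- move=> R x Zx /(principal_in Zx) [Ux [g [gx [w gw]]]].
  have [g' g'E] := univ gw; exists g'.
  by rewrite (fmap_tri u g'E).
- move=> R f g; rewrite -!fmap_comp => /inj e; apply: localization_eq la _; exact: e.
Qed.
End Principal.

End Relative.
End Functors.

Lemma unit_cancel (R : comNzRingType) (x v b c : R) : x * v = 1 -> x * b = x * c -> b = c.
Proof. by move=> e xb; rewrite -[b]mul1r -[c]mul1r -e mulrAC xb mulrAC. Qed.

Section FinGen.
Variable k : closedFieldType.
Implicit Types (R A B C K : comAlgType k).

Definition alg_closed B (S : B -> Prop) : Prop :=
  [/\ forall c : k, S c%:A, forall x y, S x -> S y -> S (x + y)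
    & forall x y, S x -> S y -> S (x * y)].

Lemma fin_gen_over A B (f : {lrmorphism A -> B}) m (c : 'I_m -> B) : fin_gen A ->
  (forall S, alg_closed S -> (forall a, S (f a)) -> (forall i, S (c i)) -> forall x, S x) ->
  fin_gen B.
Proof.
case=> n [b bA] H.
pose b' (i : 'I_(n + m)) := match split i with inl j => f (b j) | inr j => c j end.
pose ev : {rmorphism mpoly (n + m) k -> B} := mmap (GRing.in_alg B) b'.
exists (n + m)%N, b'; apply: (H (fun x => exists p, ev p = x)).
- split=> [d|_ _ [x <-] [y <-]|_ _ [x <-] [y <-]].
  + by exists (mpolyC _ d); rewrite /ev /= mmapC.
  + by exists (x + y); exact: rmorphD.
  + by exists (x * y); exact: rmorphM.
- move=> a; have [p <-] := bA a; elim/mpoly_gen: p => [d|i|p q [x ex] [y ey]|p q [x ex] [y ey]].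
  + exists (mpolyC _ d); rewrite /ev /= !mmapC; exact/esym/rmorph_alg.
  + exists (mvar k (lshift m i)); rewrite /ev /= !mmap_var /b'.
    by rewrite (unsplitK (inl i)).
  + exists (x + y); rewrite (rmorphD ev) ex ey -rmorphD; congr (f _); exact/esym/(rmorphD (mmap (GRing.in_alg A) b)).
  + exists (x * y); rewrite (rmorphM ev) ex ey -rmorphM; congr (f _); exact/esym/(rmorphM (mmap (GRing.in_alg A) b)).
- move=> i; exists (mvar k (rshift n i)); rewrite /ev /= mmap_var /b'.
  by rewrite (unsplitK (inr i)).
Qed.

Lemma alg_closedX B (S : B -> Prop) x n : alg_closed S -> S x -> S (x ^+ n).
Proof.
case=> S1 _ SM Sx; elim: n => [|n IH]; first by rewrite expr0 -[1]scale1r.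
by rewrite exprS; exact: SM.
Qed.

Lemma fin_gen_loc A (Aa : comAlgType k) (l : {lrmorphism A -> Aa}) a : is_localization l a ->
  fin_gen A -> fin_gen Aa.
Proof.
case=> [[v lv] surj _] fA; apply: (@fin_gen_over A Aa l 1 (fun=> v) fA) => S Sc Sl Sv x.
have [n [b e]] := surj x; have -> : x = l b * v ^+ n.
  by rewrite -e -mulrA (unit_expX n lv) mulr1.
by case: (Sc) => _ _; apply; [exact: Sl | exact: alg_closedX (Sv ord0)].
Qed.

Lemma fin_gen_surj A B (f : {lrmorphism A -> B}) : (forall y, exists x, f x = y) ->
  fin_gen A -> fin_gen B.
Proof.
move=> sf fA; apply: (@fin_gen_over A B f 0 (fun=> 0) fA) => S _ Sf _ y.
by have [x <-] := sf y.
Qed.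

Lemma jetT_mul R N (y : jet R N) : jT R N ^+ N * y = 0 -> j0 R N y = 0.
Proof.
have [p <-] := jpi_surj y; have -> : jT R N = jpi R N 'X by [].
rewrite -rmorphXn -rmorphM => /jpi0 /(_ N (leqnn N)).
by rewrite coefXnM ltnn subnn j0pi.
Qed.

Lemma j0_surj R N (y : R) : exists x, j0 R N x = y.
Proof. by exists (jC R N y); rewrite j0C. Qed.

Lemma jetT_dvd R N (y : jet R N) : j0 R N y = 0 -> exists z, y = jT R N * z.
Proof.
have [p <-] := jpi_surj y; rewrite j0pi => p0.
have /factor_theorem [q qE] : root p 0 by apply/rootP; rewrite horner_coef0.
by exists (jpi R N q); rewrite qE subr0 mulrC rmorphM.
Qed.

Lemma j0_nil R N (y : jet R N) : j0 R N y = 0 -> exists n, y ^+ n = 0.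
Proof.
by move/jetT_dvd=> [z ->]; exists N.+1; rewrite exprMn jTN mul0r.
Qed.

Lemma local_eq R (a b : R) :
  (forall K (f : {lrmorphism R -> K}), is_field K ->
    exists r (Rr : comAlgType k) (l : {lrmorphism R -> Rr}),
      [/\ is_localization l r, f r <> 0 & l a = l b]) -> a = b.
Proof.
move=> H; apply/eqP; rewrite -subr_eq0; apply/eqP/zero_local => K f fK.
have [r [Rr [l [[_ _ ker] fr e]]]] := H K f fK.
have [|n e0] := ker (a - b); first by rewrite rmorphB /= e subrr.
by exists (r ^+ n); rewrite // rmorphXn => /(field_exp0 fK).
Qed.

Definition loc_univ R (Rr : comAlgType k) (l : {lrmorphism R -> Rr}) r : Prop :=
  forall C (g : {lrmorphism R -> C}) (u : C), g r * u = 1 ->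
    exists g' : {lrmorphism Rr -> C}, forall a, g' (l a) = g a.

Lemma unit_ideal_exp R n (r c : 'I_n -> R) N : \sum_i c i * r i = 1 ->
  exists c' : 'I_n -> R, \sum_i c' i * r i ^+ N = 1.
Proof.
move=> e; have [||c' e'] := @ideal1_pt k R (fun x => exists c' : 'I_n -> R, \sum_i c' i * r i ^+ N = x).
- split=> [|_ _ [x <-] [y <-]|b _ [x <-]].
  + by exists (fun=> 0); rewrite big1 // => i _; rewrite mul0r.
  + by exists (fun i => x i + y i); rewrite -big_split; apply: eq_bigr => i _; rewrite mulrDl.
  + by exists (fun i => b * x i); rewrite mulr_sumr; apply: eq_bigr => i _; rewrite mulrA.
- move=> K f fK; have [i fi] : exists i, f (r i) <> 0.
    apply: contrapT => no; move: (congr1 f e); rewrite rmorph1 rmorph_sum big1.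
      by move/esym/eqP; rewrite oner_eq0.
    move=> i _; rewrite rmorphM /=; have [->|ne] := eqVneq (f (r i)) 0; first by rewrite mulr0.
    by case: no; exists i; exact/eqP.
  exists (r i ^+ N); last by rewrite rmorphXn => /(field_exp0 fK).
  exists (fun j => (j == i)%:R); rewrite (bigD1 i) //= eqxx mul1r big1 ?addr0 // => j /negPf ->.
  by rewrite mul0r.
- by exists c'.
Qed.

Lemma glue_arith (R : comNzRingType) (ri rj ai aj cj : R) N M :
  (ri * rj) ^+ M * (ai * rj ^+ N - aj * ri ^+ N) = 0 ->
  ri ^+ (N + M) * (cj * (rj ^+ M * aj)) = cj * rj ^+ (N + M) * (ri ^+ M * ai).
Proof.
move=> e; apply/eqP; rewrite -subr_eq0 -oppr_eq0 -[X in _ == X](mulr0 cj) -e; apply/eqP.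
by rewrite !exprD exprMn; ring.
Qed.

Lemma glue_fun R n (r c : 'I_n -> R) (Rr : 'I_n -> comAlgType k)
    (l : forall i, {lrmorphism R -> Rr i}) (s : forall i, Rr i) :
  \sum_i c i * r i = 1 ->
  (forall i, is_localization (l i) (r i)) -> (forall i, loc_univ (l i) (r i)) ->
  (forall i j C (g : {lrmorphism Rr i -> C}) (h : {lrmorphism Rr j -> C}),
     (forall a, g (l i a) = h (l j a)) -> g (s i) = h (s j)) ->
  exists b, forall i, l i b = s i.
Proof.
move=> cr loc univ agree.
have H1 i : exists na : nat * R, s i * l i (r i) ^+ na.1 = l i na.2.
  by have [_ surj _] := loc i; have [m [a e]] := surj (s i); exists (m, a).
have [na naE] := choice H1; pose N := (\sum_i (na i).1)%N.
pose a i := (na i).2 * r i ^+ (N - (na i).1).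
have nN i : ((na i).1 <= N)%N by rewrite /N (bigD1 i) //= leq_addr.
have aE i : s i * l i (r i) ^+ N = l i (a i).
  by rewrite rmorphM rmorphXn /= -naE -mulrA -exprD subnKC.
have H2 (p : 'I_n * 'I_n) : exists M, (r p.1 * r p.2) ^+ M *
    (a p.1 * r p.2 ^+ N - a p.2 * r p.1 ^+ N) = 0.
  case: p => i j /=; have [[m e0]|nn] := pselect (exists m, (r i * r j) ^+ m = 0).
    by exists m; rewrite e0 mul0r.
  have [|C [lC [[[u lu] _ ker] _]]] := @exists_localization k R (r i * r j).
    by move=> m e0; apply: nn; exists m.
  have ui : lC (r i) * (lC (r j) * u) = 1 by rewrite mulrA -rmorphM.
  have uj : lC (r j) * (lC (r i) * u) = 1 by rewrite mulrA -rmorphM [r j * _]mulrC.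
  have [g gE] := univ i C lC _ ui; have [h hE] := univ j C lC _ uj.
  apply: ker; have es := agree i j C g h (fun a => etrans (gE a) (esym (hE a))).
  have e : lC (a i) * lC (r j) ^+ N = lC (a j) * lC (r i) ^+ N.
    rewrite -(gE (a i)) -(hE (a j)) -!aE (rmorphM g) (rmorphM h) (rmorphXn g) (rmorphXn h) /=.
    by rewrite es (gE (r i)) (hE (r j)) -!mulrA [lC (r i) ^+ N * _]mulrC.
  have -> : lC (a i * r j ^+ N - a j * r i ^+ N) = lC (a i) * lC (r j) ^+ N - lC (a j) * lC (r i) ^+ N.
    by rewrite (rmorphB lC) !(rmorphM lC) !(rmorphXn lC).
  by rewrite e subrr.
have [M0 M0E] := choice H2; pose M := (\sum_p M0 p)%N.
have ME i j : (r i * r j) ^+ M * (a i * r j ^+ N - a j * r i ^+ N) = 0.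
  have le : (M0 (i, j) <= M)%N by rewrite /M (bigD1 (i, j)) //= leq_addr.
  by rewrite -(subnK le) exprD -mulrA (M0E (i, j)) mulr0.
have [c' c'E] := unit_ideal_exp (N + M) cr.
(* The a j are numerators for the common denominators r j ^+ N; the factors r j ^+ M turn equality
   in the localizations into equality in R. *)
exists (\sum_j c' j * (r j ^+ M * a j)) => i; set b := \sum_j _.
have e : r i ^+ (N + M) * b = r i ^+ M * a i.
  rewrite mulr_sumr -[RHS]mul1r -c'E mulr_suml; apply: eq_bigr => j _.
  exact: glue_arith.
have [[u lu] _ _] := loc i; have un := unit_expX (N + M) lu.
have e2 : l i (r i) ^+ (N + M) * l i b = l i (r i) ^+ M * (s i * l i (r i) ^+ N).
  by rewrite aE -!rmorphXn -!rmorphM e.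
apply: (unit_cancel un); rewrite e2 exprD -mulrA [s i * _]mulrC mulrCA.
by rewrite !mulrA.
Qed.
End FinGen.

Section Nice.
Variable k : closedFieldType.
Implicit Types (R A B C K : comAlgType k).
Variable X : kfunctor k.
Implicit Types Z U O : subfunctor X.

Lemma chart_in Z O K (x : X K) : nice Z -> open_in Z O -> is_field K -> Z K x -> O K x ->
  exists U A (u : X A), [/\ open_in Z U, U K x, rep Z U u, fin_gen A
    & forall R (y : X R), Z R y -> U R y -> O R y].
Proof.
move=> [lf ch] oO fK Zx Ox; have [U [A [u [oU Ux ru fA]]]] := ch K x fK Zx.
have [Zu Uu ex inj] := ru; have [g gx] := ex K x Zx Ux.
have [D HD] := oO A u Zu; have Og : O K (fmap g u) by rewrite gx.
have [a Da ga] := proj1 (gen_unit_pt _ _) (proj1 (HD _ g) Og) K idfun fK.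
have [Aa [l [la univ]]] := @loc_at k A K g a fK ga.
exists (pts_sub (@principal_pt k X U A u a)), Aa, (fmap l u); split.
- exact: principal_open.
- by apply: principal_pt_ext => //; split=> //; exists g.
- exact: (principal_rep oU ru la).
- exact: fin_gen_loc la fA.
- move=> R y Zy /(principal_in oU ru Zy) [Uy [f [<- [v fv]]]].
  by apply/HD; exact: gen_unit_unit Da fv.
Qed.

Lemma nice_open Z O : nice Z -> open_in Z O -> nice (meet Z O).
Proof.
move=> nZ oO; have [lf ch] := nZ; split.
  move=> C C' t st x' [Zx' Ox']; have [x Zx e] := lf C C' t st x' Zx'.
  exists x => //; split=> //.
  by apply: open_thick oO Zx (proj1 st) (sq_thick_nil st) _; rewrite e.
move=> K x fK [Zx Ox]; have [U [A [u [oU Ux [Zu Uu ex inj] fA UO]]]] := chart_in nZ oO fK Zx Ox.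
exists U, A, u; split=> //.
- by move=> R y [Zy _]; exact: oU.
- split=> //; first by split=> //; exact: UO.
  by move=> R y [Zy _]; exact: ex.
Qed.

Definition closed_in Z Z' : Prop :=
  forall R (x : X R), Z R x -> exists D : R -> Prop,
  forall R' (f : {lrmorphism R -> R'}), Z' R' (fmap f x) <-> (forall a, D a -> f a = 0).

Lemma nice_closed Z Z' : nice Z -> (forall R (x : X R), Z' R x -> Z R x) ->
  closed_in Z Z' -> sq_lifts Z' -> nice Z'.
Proof.
move=> [lf ch] sub cl lf'; split=> // K x fK Z'x.
have Zx := sub _ _ Z'x; have [U [A [u [oU Ux [Zu Uu ex inj] fA]]]] := ch K x fK Zx.
have [g gx] := ex K x Zx Ux; have [D HD] := cl A u Zu.
have gD : forall a, D a -> g a = 0 by apply/HD; rewrite gx.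
have I1 : ~ ideal_gen D 1.
  case=> n [a [c [Da e]]]; move: (congr1 g e); rewrite rmorph1 rmorph_sum big1.
    by move/esym/eqP; rewrite oner_eq0.
  by move=> i _; rewrite rmorphM /= (gD (a i)) // mulr0.
pose J := PIdeal (ideal_gen_ideal D) I1; pose pi := qap J.
exists U, (qa J), (fmap pi u); split=> //.
- by move=> R y Z'y; apply: oU; exact: sub.
- split.
  + apply/HD => a Da; apply/qap0; exists 1%N, (fun=> a), (fun=> 1).
    by rewrite big_ord1 mul1r.
  + exact: smem_map.
  + move=> R y Z'y Uy; have [f fy] := ex R y (sub _ _ Z'y) Uy.
    have fD : forall a, D a -> f a = 0 by apply/HD; rewrite fy.
    have [|f' f'E] := @qap_lift k A J R f.
      move=> _ [n [a [c [Da <-]]]]; rewrite rmorph_sum big1 // => i _.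
      by rewrite rmorphM /= (fD (a i)) // mulr0.
    by exists f'; rewrite (fmap_tri u f'E).
  + move=> R f f'; rewrite -!fmap_comp => /inj e y.
    by have [a <-] := qap_surj y; exact: e.
- exact: fin_gen_surj (@qap_surj k A J) fA.
Qed.

(** Charts of Z are reduced by smoothness. Most identities below are obtained from this, after a
    computation over fields where division is possible. *)
Lemma eq_on_points Z (s s' : forall R, X R -> R) : nice Z -> regular_on Z s -> regular_on Z s' ->
  (forall K (x : X K), is_field K -> Z K x -> s K x = s' K x) ->
  forall R (x : X R), Z R x -> s R x = s' R x.
Proof.
move=> [lf ch] rs rs' H R x Zx; apply: local_eq => K f fK.
have [U [A [u [oU Ux ru fA]]]] := ch K (fmap f x) fK (smem_map _ Zx).
have [r [Rr [l [loc fr Ul _]]]] := open_loc oU Zx fK Ux.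
exists r, Rr, l; split=> //; have [Zu Uu ex inj] := ru.
have [g gx] := ex Rr (fmap l x) (smem_map _ Zx) Ul.
rewrite -rs // -rs' // -gx rs // rs' //; congr (g _).
apply/eqP; rewrite -subr_eq0; apply/eqP/(smooth_reduced (chart_fsmooth lf oU ru) fA) => L h fL.
rewrite rmorphB /= -rs // -rs' // H ?subrr //; exact: smem_map.
Qed.

(** At every zero of c in Z there is a tangent vector of Z along which c has derivative 1. *)
Definition transversal Z (c : forall R, X R -> R) : Prop :=
  forall K (x : X K), is_field K -> Z K x -> c K x = 0 ->
  exists y : X (jet K 1), [/\ Z _ y, fmap (j0 K 1) y = x & c _ y = jT K 1].

(** Where c is nonzero, a vanishes. At a zero of c, the relation c a = 0 along the transversal
    tangent vector reads T a = 0 modulo T^2, so a vanishes there too; a chart is reduced. *)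
Lemma chart_nzd Z U A (u : X A) (c : forall R, X R -> R) a : nice Z -> regular_on Z c ->
  transversal Z c -> open_in Z U -> rep Z U u -> fin_gen A -> c A u * a = 0 -> a = 0.
Proof.
move=> [lf ch] rc tr oU ru fA ca; have [Zu Uu ex inj] := ru.
apply: (smooth_reduced (chart_fsmooth lf oU ru) fA) => K x fK.
have [xc|xc] := pselect (c K (fmap x u) = 0); last first.
  by apply: (field_mul0 fK) xc; rewrite rc // -rmorphM ca rmorph0.
have [y [Zy y0 cy]] := tr K (fmap x u) fK (smem_map _ Zu) xc.
have Uy : U _ y.
  apply: open_thick oU Zy (@j0_surj k K 1) (@j0_nil k K 1) _.
  by rewrite y0; exact: smem_map.
have [h hy] := ex _ y Zy Uy.
have <- : j0 K 1 (h a) = x a by apply: (inj K (j0 K 1 \o h) x); rewrite fmap_comp hy.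
by apply: jetT_mul; rewrite expr1 -cy -hy rc // -rmorphM ca rmorph0.
Qed.

(** Gluing: a value that exists and is unique locally defines a function on Z. *)
Lemma extend Z (P : forall R, X R -> R -> Prop) :
  (forall R R' (f : {lrmorphism R -> R'}) x b, Z R x -> P R x b -> P R' (fmap f x) (f b)) ->
  (forall R x b b', Z R x -> P R x b -> P R x b' -> b = b') ->
  (forall R x K (f : {lrmorphism R -> K}), Z R x -> is_field K ->
     exists r (Rr : comAlgType k) (l : {lrmorphism R -> Rr}) (b : Rr),
       [/\ is_localization l r, loc_univ l r, f r <> 0 & P Rr (fmap l x) b]) ->
  exists s, regular_on Z s /\ forall R x b, Z R x -> P R x b -> s R x = b.
Proof.
move=> Pmap Puniq Ploc.
(* The glued value is characterized by its images in all algebras where P has a solution; this makes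
   its uniqueness and functoriality immediate. *)
pose Q R (x : X R) b := forall C (h : {lrmorphism R -> C}) c, P C (fmap h x) c -> h b = c.
have exQ R (x : X R) : exists b, Z R x -> Q R x b.
  have [Zx|] := pselect (Z R x); last by exists 0.
  pose L := {Rr : comAlgType k & ({lrmorphism R -> Rr} * Rr)%type}.
  pose ok r (L0 : L) := [/\ is_localization (projT2 L0).1 r, loc_univ (projT2 L0).1 r
    & P (projT1 L0) (fmap (projT2 L0).1 x) (projT2 L0).2].
  have [|n [r [c [Dr cr]]]] := @ideal1_pt k R _ (ideal_gen_ideal (fun r => exists L0, ok r L0)).
  - move=> K f fK; have [r [Rr [l [b [loc un fr Pb]]]]] := Ploc R x K f Zx fK.
    exists r => //; exists 1%N, (fun=> r), (fun=> 1); rewrite big_ord1 mul1r; split=> // _.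
    by exists (existT _ Rr (l, b)).
  have [L0 L0E] := choice Dr.
  have [|i|i|i j C g h gh|b bE] := @glue_fun k R n r c (fun i => projT1 (L0 i))
    (fun i => (projT2 (L0 i)).1) (fun i => (projT2 (L0 i)).2).
  - exact: cr.
  - by case: (L0E i).
  - by case: (L0E i).
  - have [_ _ Pi] := L0E i; have [_ _ Pj] := L0E j.
    have Zl i' : Z _ (fmap (projT2 (L0 i')).1 x) := smem_map _ Zx.
    have := Pmap _ _ h _ _ (Zl j) Pj; have := Pmap _ _ g _ _ (Zl i) Pi.
    rewrite -!fmap_comp; set f1 := g \o _; set f2 := h \o _.
    rewrite (@fmap_eq k X R C f1 f2) //; apply: Puniq; exact: smem_map.
  exists b => _ C h d Pd; apply: local_eq => K f fK.
  have [i fi] : exists i, f (h (r i)) <> 0.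
    apply: contrapT => no; move: (congr1 (f \o h) cr); rewrite rmorph1 rmorph_sum big1.
      by move/esym/eqP; rewrite oner_eq0.
    move=> i _; rewrite rmorphM /=; have [->|ne] := eqVneq (f (h (r i))) 0; first by rewrite mulr0.
    by case: no; exists i; exact/eqP.
  have [Cr [l [lr univ]]] := @loc_at k C K f (h (r i)) fK fi.
  have [_ un Pi] := L0E i; have [[v lv] _ _] := lr.
  have [g gE] := un Cr (l \o h) v lv.
  exists (h (r i)), Cr, l; split=> //.
  have e : fmap g (fmap (projT2 (L0 i)).1 x) = fmap l (fmap h x).
    by rewrite -!fmap_comp; apply: fmap_eq => a; exact: gE.
  have P1 := Pmap _ _ g _ _ (smem_map _ Zx) Pi.
  have P2 := Pmap _ _ l _ _ (smem_map h Zx) Pd.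
  rewrite e in P1; rewrite -(Puniq _ _ _ _ (smem_map l (smem_map h Zx)) P1 P2).
  by rewrite -bE; exact/esym/gE.
have Quniq R x b b' : Z R x -> Q R x b -> Q R x b' -> b = b'.
  move=> Zx Qb Qb'; apply: local_eq => K f fK.
  have [r [Rr [l [d [loc un fr Pd]]]]] := Ploc R x K f Zx fK.
  by exists r, Rr, l; rewrite (Qb _ _ _ Pd) (Qb' _ _ _ Pd).
have QP R x b : Z R x -> P R x b -> Q R x b.
  move=> Zx Pb C h d Pd; apply: Puniq Pd; first exact: smem_map.
  exact: Pmap.
have Qmap R R' (f : {lrmorphism R -> R'}) x b : Q R x b -> Q R' (fmap f x) (f b).
  by move=> Qb C h d; rewrite -fmap_comp => /Qb.
pose s R (x : X R) : R := projT1 (cid (exQ R x)).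
have sQ R (x : X R) : Z R x -> Q R x (s R x) by rewrite /s; case: cid.
exists s; split=> [R R' f x Zx|R x b Zx Pb].
  apply: (Quniq _ (fmap f x)); [exact: smem_map| |exact/Qmap/sQ].
  by apply: sQ; exact: smem_map.
apply: Quniq (Zx) (sQ _ _ Zx) _; exact: QP.
Qed.

Lemma chart_value_uniq Z (s c : forall R, X R -> R) : nice Z -> regular_on Z s ->
  regular_on Z c -> transversal Z c ->
  forall U A (u : X A) U' A' (u' : X A') a a' R (g : {lrmorphism A -> R}) (g' : {lrmorphism A' -> R}),
  open_in Z U -> rep Z U u -> open_in Z U' -> rep Z U' u' ->
  s A u = c A u * a -> s A' u' = c A' u' * a' -> fmap g u = fmap g' u' -> g a = g' a'.
Proof.
move=> nZ rs rc tr U A u U' A' u' a a' R g g' oU ru oU' ru' sa sa' e.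
have [Zu Uu ex inj] := ru; have [Zu' Uu' ex' inj'] := ru'.
have Zx : Z R (fmap g u) by exact: smem_map.
have Ux : U R (fmap g u) by exact: smem_map.
have Ux' : U' R (fmap g u) by rewrite e; exact: smem_map.
apply: local_eq => K f fK.
have oM : open_in (meet Z U) U' by move=> R' y [Zy _]; exact: oU'.
have [V [B [v [oV Vx rv fB VU]]]] := chart_in (nice_open nZ oU) oM fK
  (conj (smem_map f Zx) (smem_map f Ux)) (smem_map f Ux').
have [[Zv Uv] Vv exv injv] := rv; have U'v := VU _ _ (conj Zv Uv) Vv.
have [p pv] := ex B v Zv Uv; have [p' pv'] := ex' B v Zv U'v.
have [r [Rr [l [loc fr Vl _]]]] := open_loc oV (conj Zx Ux) fK Vx.
exists r, Rr, l; split=> //.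
have [h hx] := exv Rr (fmap l (fmap g u)) (smem_map l (conj Zx Ux : meet Z U R (fmap g u))) Vl.
have -> : l (g a) = h (p a).
  by apply: (inj Rr (l \o g) (h \o p)); rewrite !fmap_comp pv hx.
have -> : l (g' a') = h (p' a').
  by apply: (inj' Rr (l \o g') (h \o p')); rewrite !fmap_comp pv' hx e.
congr (h _); apply/eqP; rewrite -subr_eq0; apply/eqP.
apply: (@chart_nzd (meet Z U) V B v c); rewrite //.
- exact: nice_open.
- by move=> ? ? ? y [Zy _]; exact: rc.
- move=> L y fL [Zy Uy] cy; have [y1 [Zy1 y10 cy1]] := tr L y fL Zy cy.
  exists y1; split=> //; split=> //.
  apply: open_thick oU Zy1 (@j0_surj k L 1) (@j0_nil k L 1) _; by rewrite y10.
- have e1 : c B v * p a = s B v.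
    by move: (rs _ _ p u Zu); rewrite pv => ->; rewrite sa rmorphM /= -(rc _ _ p u Zu) pv.
  have e2 : c B v * p' a' = s B v.
    by move: (rs _ _ p' u' Zu'); rewrite pv' => ->; rewrite sa' rmorphM /= -(rc _ _ p' u' Zu') pv'.
  by rewrite mulrBr e1 e2 subrr.
Qed.

(** The quotient exists on each chart, and it is unique because c is not a zero divisor, so the
    local quotients glue. *)
Lemma divide Z (s c : forall R, X R -> R) : nice Z -> regular_on Z s -> regular_on Z c ->
  transversal Z c -> (forall R (x : X R), Z R x -> c R x = 0 -> s R x = 0) ->
  exists s', regular_on Z s' /\ forall R (x : X R), Z R x -> s R x = c R x * s' R x.
Proof.
move=> nZ rs rc tr sc.
have loc U A (u : X A) : rep Z U u -> exists a, s A u = c A u * a.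
  (* Modulo c, the universal point of the chart lies on the zero locus of c, where s vanishes by
     hypothesis; hence s is a multiple of c. *)
  move=> [Zu _ _ _]; pose J x := exists a, x = c A u * a.
  have [J1|J1] := pselect (J 1).
    by case: J1 => a e; exists (a * s A u); rewrite mulrA -e mul1r.
  have iJ : is_ideal J.
    split=> [|_ _ [x ->] [y ->]|b _ [x ->]].
    - by exists 0; rewrite mulr0.
    - by exists (x + y); rewrite mulrDr.
    - by exists (b * x); rewrite mulrCA.
  apply: (proj1 (qap0 (PIdeal iJ J1) _)); rewrite -rs //.
  apply: sc; first exact: smem_map.
  by rewrite rc //; apply/qap0; exists 1; rewrite mulr1.
pose P R (x : X R) b := exists U A (u : X A) (g : {lrmorphism A -> R}) a,
  [/\ open_in Z U, rep Z U u, s A u = c A u * a, fmap g u = x & b = g a].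
have [|||s' [rs' s'P]] := @extend Z P.
- move=> R R' f x b Zx [U [A [u [g [a [oU ru sa gx ->]]]]]].
  by exists U, A, u, (f \o g), a; split=> //; rewrite fmap_comp gx.
- move=> R x b b' Zx [U [A [u [g [a [oU ru sa gx ->]]]]]] [U' [A' [u' [g' [a' [oU' ru' sa' gx' ->]]]]]].
  by apply: (chart_value_uniq nZ rs rc tr oU ru oU' ru' sa sa'); rewrite gx.
- move=> R x K f Zx fK.
  have [U [A [u [oU Ux ru fA]]]] := (proj2 nZ) K (fmap f x) fK (smem_map _ Zx).
  have [r [Rr [l [lo fr Ul un]]]] := open_loc oU Zx fK Ux.
  have [Zu Uu ex inj] := ru; have [g gx] := ex Rr (fmap l x) (smem_map _ Zx) Ul.
  have [a sa] := loc U A u ru.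
  by exists r, Rr, l, (g a); split=> //; exists U, A, u, g, a.
exists s'; split=> // R x Zx; apply: local_eq => K f fK.
have [U [A [u [oU Ux ru fA]]]] := (proj2 nZ) K (fmap f x) fK (smem_map _ Zx).
have [r [Rr [l [lo fr Ul un]]]] := open_loc oU Zx fK Ux.
have [Zu Uu ex inj] := ru; have [g gx] := ex Rr (fmap l x) (smem_map _ Zx) Ul.
have [a sa] := loc U A u ru.
exists r, Rr, l; split=> //; rewrite rmorphM /= -rs // -rc // -rs' //.
have Zl : Z _ (fmap l x) by exact: smem_map.
rewrite (s'P Rr (fmap l x) (g a)) //; last by exists U, A, u, g, a.
by rewrite -gx rs // rc // sa rmorphM.
Qed.
End Nice.

Section NearZero.
Variable k : closedFieldType.
Implicit Types (R A B C K L : comAlgType k).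
Variable X : kfunctor k.
Implicit Types Z U O : subfunctor X.

Lemma field_map_neq0 K R (e : {lrmorphism K -> R}) (x : K) : is_field K -> x <> 0 ->
  exists u, e x * u = 1.
Proof.
by move=> fK /(field_inv fK) [u xu]; exists (e u); rewrite -rmorphM /= xu rmorph1.
Qed.

Lemma chart_pts_open Z (P : point_pred X) :
  (forall K (x : X K), is_field K -> Z K x -> P K x -> exists U A (u : X A) a,
     [/\ open_in Z U, rep Z U u, exists2 g : {lrmorphism A -> K}, fmap g u = x & g a <> 0
       & forall K' (g : {lrmorphism A -> K'}), is_field K' -> g a <> 0 -> P K' (fmap g u)]) ->
  open_in Z (pts_sub P).
Proof.
move=> H; apply: pts_sub_open => R x K f Zx fK Px.
have [U [A [u [a [oU ru [g gx ga] HP]]]]] := H K (fmap f x) fK (smem_map _ Zx) Px.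
have [Zu Uu ex inj] := ru.
have Ufx : U K (fmap f x) by rewrite -gx; exact: smem_map.
have Up : pts_sub (@principal_pt k X U A u a) K (fmap f x).
  by apply: principal_pt_ext => //; split=> //; exists g.
have oP := principal_open oU ru a.
have [r [Rr [l [loc fr Ul univ]]]] := open_loc oP Zx fK Up.
exists r; split=> // K' h fK' hr; have [w hw] := field_inv fK' hr.
have [h' h'E] := univ K' h w hw.
have [_ [p [pu [v pv]]]] := principal_in oU ru (smem_map l Zx) Ul.
rewrite -(fmap_tri x h'E) -pu -fmap_comp; apply: HP => //.
exact: (unit_neq0 (g := h') pv).
Qed.

(** On smooth Z this means that s vanishes in a neighbourhood of x ([near_zero_chart]). Stated
    through jets it involves no chart, so a group action can be applied to it directly. *)
Definition near_zero Z (s : forall R, X R -> R) : point_pred X := fun K x =>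
  forall R (e : {lrmorphism K -> R}) N (y : X (jet R N)),
    Z _ y -> fmap (j0 R N) y = fmap e x -> s _ y = 0.

Section Fixed.
Variables (Z : subfunctor X) (s : forall R, X R -> R).
Arguments s : clear implicits.
Hypotheses (nZ : nice Z) (rs : regular_on Z s).

Lemma near_zero0 K (x : X K) : Z K x -> near_zero Z s x -> s K x = 0.
Proof.
move=> Zx nz; have := nz K idfun 0%N (fmap (jC K 0) x) (smem_map _ Zx).
rewrite -fmap_comp => /(_ _)/(congr1 (j0 K 0)); rewrite rs // rmorph0 j0C; apply.
by apply: fmap_eq => a /=; rewrite j0C.
Qed.

Lemma near_zero_map K R (e : {lrmorphism K -> R}) (x : X K) :
  near_zero Z s x -> near_zero Z s (fmap e x).
Proof. by move=> nz R' e' N y Zy; rewrite -fmap_comp; exact: nz. Qed.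

Lemma jet_cancel R N (a v : jet R N) (w : R) : j0 R N a * w = 1 -> a * v = 0 -> v = 0.
Proof.
move=> aw av; have [z e] : exists z, a * jC R N w - 1 = jT R N * z.
  by apply: jetT_dvd; rewrite rmorphB rmorphM /= j0C aw rmorph1 subrr.
have ev : v = - (jT R N * z) * v.
  by rewrite -e opprB mulrBl mul1r mulrAC av mul0r subr0.
have evn n : v = (- (jT R N * z)) ^+ n * v.
  by elim: n => [|n IH]; [rewrite mul1r | rewrite exprSr -mulrA -ev].
by rewrite (evn N.+1) exprNn exprMn jTN mul0r mulr0 mul0r.
Qed.

Lemma near_zero_chart K (x : X K) : is_field K -> Z K x -> exists U A (u : X A) (G : A -> Prop),
  [/\ open_in Z U, rep Z U u, exists g : {lrmorphism A -> K}, fmap g u = x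
    & forall L (g : {lrmorphism A -> L}), is_field L ->
      (near_zero Z s (fmap g u) <-> forall c, G c -> g c = 0) /\
      (near_zero Z s (fmap g u) <-> exists c, g c <> 0 /\ c * s A u = 0)].
Proof.
have [lf ch] := nZ; move=> fK Zx; have [U [A [u [oU Ux ru fA]]]] := ch K x fK Zx.
have [Zu Uu ex inj] := ru; have [g gx] := ex K x Zx Ux.
have sm := chart_fsmooth lf oU ru; have [G GP] := smooth_local_zero sm fA (s A u).
exists U, A, u, G; split=> //; first by exists g.
move=> L h fL; have [P1 P2 P3] := GP L h fL.
have H1 : near_zero Z s (fmap h u) -> forall c, G c -> h c = 0.
  move=> nz; apply: (P3) => R e N y ye; rewrite -rs //; apply: (nz R e) => //.
    exact: smem_map.
  by rewrite -!fmap_comp; apply: fmap_eq.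
have H2 : (exists c, h c <> 0 /\ c * s A u = 0) -> near_zero Z s (fmap h u).
  move=> [c [hc c0]] R e N y Zy ye.
  have Uy : U _ y.
    apply: open_thick oU Zy (@j0_surj k R N) (@j0_nil k R N) _.
    by rewrite ye; do 2!apply: smem_map.
  have [p py] := ex _ y Zy Uy.
  have [w hw] := field_map_neq0 e fL hc.
  rewrite -py rs //; apply: (@jet_cancel R N (p c) _ w).
    suff -> : j0 R N (p c) = e (h c) by [].
    by apply: (inj R (j0 R N \o p) (e \o h)); rewrite !fmap_comp py.
  by rewrite -rmorphM c0 rmorph0.
by split; split=> //; [move/P1/H2|move/H1/P1].
Qed.

Lemma near_zero_open : open_in Z (pts_sub (near_zero Z s)).
Proof.
apply: chart_pts_open => K x fK Zx nz.
have [U [A [u [G [oU ru [g gx] H]]]]] := near_zero_chart fK Zx.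
have [c [gc c0]] : exists c, g c <> 0 /\ c * s A u = 0 by apply/(proj2 (H K g fK)); rewrite gx.
exists U, A, u, c; split=> //; first by exists g.
by move=> L h fL hc; apply/(proj2 (H L h fL)); exists c.
Qed.

Lemma not_near_zero_open : open_in Z (pts_sub (fun K x => ~ near_zero Z s x)).
Proof.
apply: chart_pts_open => K x fK Zx nz.
have [U [A [u [G [oU ru [g gx] H]]]]] := near_zero_chart fK Zx.
have [c Gc gc] : exists2 c, G c & g c <> 0.
  apply: contrapT => no; apply: nz; rewrite -gx; apply/(proj1 (H K g fK)) => c Gc.
  by apply: contrapT => gc; apply: no; exists c.
exists U, A, u, c; split=> //; first by exists g.
by move=> L h fL hc /(proj1 (H L h fL)) /(_ c Gc).
Qed.

Lemma near_zero_ext K L (e : {lrmorphism K -> L}) (x : X K) : is_field K -> is_field L -> Z K x ->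
  near_zero Z s (fmap e x) -> near_zero Z s x.
Proof.
move=> fK fL Zx nz; have [U [A [u [G [oU ru [g gx] H]]]]] := near_zero_chart fK Zx.
rewrite -gx; apply/(proj1 (H K g fK)) => c Gc; apply: contrapT => gc.
move: nz; rewrite -gx -fmap_comp => /(proj1 (H L (e \o g) fL)) /(_ c Gc) /= e0.
by have [w] := field_map_neq0 e fK gc; rewrite e0 mul0r => /esym/eqP; rewrite oner_eq0.
Qed.

End Fixed.
End NearZero.

Section Affine.
Variable k : closedFieldType.
Implicit Types (R A B C K L : comAlgType k).

Definition zero_ideal (T : comNzRingType) : pideal T.
Proof.
apply: (@PIdeal T (fun x => x = 0)).
  by split=> // [x y -> ->|a x ->]; rewrite ?addr0 ?mulr0.
by apply/eqP; exact: oner_neq0.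
Defined.

(** The quotient by the zero ideal is the polynomial ring again, now with scalars from k instead of
    A. *)
Definition polyA A : comAlgType k := QAlg (rC A) (zero_ideal {poly A}).
Definition polyq A : {rmorphism {poly A} -> polyA A} := qpi (rC A) (zero_ideal {poly A}).

Lemma polyq_inj A : injective (polyq A).
Proof.
move=> p r e; apply/eqP; rewrite -subr_eq0; apply/eqP/(qpi0P (rC A) (zero_ideal _)).
by rewrite -/(polyq A (p - r)) rmorphB e subrr.
Qed.

Lemma polyq_surj A (y : polyA A) : exists p, polyq A p = y.
Proof. exact: qpi_surj. Qed.

Lemma polyAC_alg A (c : k) : (polyq A \o polyC : {rmorphism A -> polyA A}) c%:A = c%:A.
Proof. exact: qpi_alg. Qed.

Definition polyAC A : {lrmorphism A -> polyA A} := mklr (@polyAC_alg A).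
Definition polyAX A : polyA A := polyq A 'X.

Lemma polyACE A a : polyAC A a = polyq A a%:P. Proof. by rewrite mklrE. Qed.

Lemma polyA_lift A B (g : {lrmorphism A -> B}) (t : B) :
  exists h : {lrmorphism polyA A -> B}, forall p, h (polyq A p) = (map_poly g p).[t].
Proof.
have cf : commr_rmorph g t by move=> c; rewrite /GRing.comm mulrC.
have hJ p : zero_ideal {poly A} p -> horner_morph cf p = 0 by move=> ->; rewrite rmorph0.
have hk (c : k) : horner_morph cf (rC A c) = c%:A.
  by rewrite /= horner_morphC; exact: rmorph_alg.
by exists (qlift hJ hk) => p; rewrite qliftE.
Qed.

Lemma polyA_eq A B (g h : {lrmorphism polyA A -> B}) :
  (forall a, g (polyAC A a) = h (polyAC A a)) -> g (polyAX A) = h (polyAX A) -> g =1 h.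
Proof.
move=> ec eX y; have [p <-] := polyq_surj y.
elim/poly_ind: p => [|p c IH]; first by rewrite !rmorph0.
have -> : polyq A (p * 'X + c%:P) = polyq A p * polyAX A + polyAC A c.
  by rewrite polyACE rmorphD rmorphM.
by rewrite (rmorphD g) (rmorphD h) (rmorphM g) (rmorphM h) /= IH ec eX.
Qed.

Variable X : kfunctor k.

End Affine.

(** * GL_3 and functors smooth over it *)

Section GLNice.
Variable k : closedFieldType.
Implicit Types (R A B C K L : comAlgType k).

Definition all_sub (X : kfunctor k) : subfunctor X :=
  @SubFunctor k X (fun _ _ => True) (fun _ _ _ _ _ => I).

Lemma sq_thick_mx C C' (t : {lrmorphism C -> C'}) m n (M N : 'M[C]_(m, n)) l (N' : 'M[C]_(n, l)) :
  sq_zero_thickening t -> map_mx t M = 0 -> map_mx t N' = 0 -> M *m N' = 0.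
Proof.
move=> [_ sq] tM tN; apply/matrixP => i j; rewrite !mxE big1 // => h _.
by apply: sq; [move/matrixP/(_ i h): tM | move/matrixP/(_ h j): tN]; rewrite !mxE.
Qed.

Lemma GL3_lift C C' (t : {lrmorphism C -> C'}) (g' : GL3 C') (M : 'M[C]_3) :
  sq_zero_thickening t -> map_mx t M = gmx g' -> exists2 g : GL3 C, gmx g = M & gmap t g = g'.
Proof.
move=> st tM; have [N tN] : exists N, map_mx t N = gmxV g'.
  have H (ij : 'I_3 * 'I_3) : exists c, t c = gmxV g' ij.1 ij.2 by exact: (proj1 st).
  have [c cE] := choice H; exists (\matrix_(i, j) c (i, j)).
  by apply/matrixP => i j; rewrite !mxE cE.
pose nu := M *m N - 1%:M.
have tnu : map_mx t nu = 0.
  by rewrite map_mxB map_mxM tM tN (eqP (gmx_mulV g')) map_mx1 subrr.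
have MN : M *m N = 1%:M + nu by rewrite addrC subrK.
have gV : M *m (N *m (1%:M - nu)) == 1%:M.
  rewrite mulmxA MN mulmxBr mulmx1 mulmxDl mul1mx.
  by rewrite (sq_thick_mx nu st tnu tnu) addr0 addrK.
exists (MkGL3 gV) => //; exact: GL3_inj.
Qed.

Definition glev R (g : GL3 R) (i : 'I_9 + 'I_9) : R :=
  match i with
  | inl j => gmx g (inord (j %/ 3)) (inord (j %% 3))
  | inr j => gmxV g (inord (j %/ 3)) (inord (j %% 3)) end.

Definition glhom R (g : GL3 R) : {rmorphism mpoly (9 + 9) k -> R} :=
  mmap (GRing.in_alg R) (fun i => glev g (split i)).

(** All relations that hold at every point, rather than the ideal generated by the equations for the
    inverse matrix; the universal property of the quotient is then immediate. *)
Definition gl_ideal (p : mpoly (9 + 9) k) : Prop := forall R (g : GL3 R), glhom g p = 0.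

Lemma gl_ideal_ideal : is_ideal gl_ideal.
Proof.
split=> [R g|x y Hx Hy R g|a x Hx R g]; first exact: rmorph0.
  by rewrite (rmorphD (glhom g)) Hx Hy addr0.
by rewrite (rmorphM (glhom g)) Hx mulr0.
Qed.

Lemma gl_ideal1 : ~ gl_ideal 1.
Proof.
move=> /(_ k^o (gone k^o)); rewrite rmorph1 => /eqP.
by rewrite oner_eq0.
Qed.

Definition gl_pideal := PIdeal gl_ideal_ideal gl_ideal1.
Definition gl_alg : comAlgType k := QAlg (@mpolyC (9 + 9) k) gl_pideal.
Definition glpi : {rmorphism mpoly (9 + 9) k -> gl_alg} := qpi (@mpolyC (9 + 9) k) gl_pideal.

Lemma glpi_surj y : exists p, glpi p = y. Proof. exact: qpi_surj. Qed.
Lemma glpi0 p : glpi p = 0 <-> gl_ideal p. Proof. exact: qpi0P. Qed.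

Definition gl_var (b : bool) (i j : 'I_3) : mpoly (9 + 9) k :=
  mvar k (unsplit ((if b then inr else inl) (inord (i * 3 + j)))).

Lemma gl_varE R (g : GL3 R) b i j : glhom g (gl_var b i j) = (if b then gmxV g else gmx g) i j.
Proof.
rewrite /glhom /= mmap_var unsplitK.
have lt : (i * 3 + j < 9)%N by case: i j => [[|[|[|]]] //= Hi] [[|[|[|]]] //= Hj].
have di : inord ((i * 3 + j) %/ 3) = i :> 'I_3.
  by apply/val_inj; rewrite /= divnMDl // divn_small ?addn0 ?inordK.
have dj : inord ((i * 3 + j) %% 3) = j :> 'I_3.
  by apply/val_inj; rewrite /= modnMDl modn_small ?inordK.
by case: b => /=; rewrite inordK // di dj.
Qed.

Lemma gl_univ_subproof : (\matrix_(i, j) glpi (gl_var false i j)) *m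
  (\matrix_(i, j) glpi (gl_var true i j)) == 1%:M.
Proof.
apply/eqP/matrixP => i j; rewrite !mxE.
have -> : (i == j)%:R = glpi (i == j)%:R by rewrite rmorph_nat.
under eq_bigr do rewrite !mxE -rmorphM.
rewrite -rmorph_sum; apply/eqP; rewrite -subr_eq0 -rmorphB; apply/eqP/glpi0 => R g.
have := eqP (gmx_mulV g); move/matrixP/(_ i j); rewrite !mxE.
rewrite (rmorphB (glhom g)) (rmorph_sum (glhom g)) (rmorph_nat (glhom g)) => <-.
apply/eqP; rewrite subr_eq0; apply/eqP/eq_bigr => h _.
by rewrite (rmorphM (glhom g)) !gl_varE.
Qed.

Definition gl_univ : GL3 gl_alg := MkGL3 gl_univ_subproof.

Lemma gl_rep (U : subfunctor (GLfun k)) : (forall R (x : GLfun k R), U R x) ->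
  rep (all_sub (GLfun k)) U (gl_univ : GLfun k gl_alg).
Proof.
move=> UT; split=> //.
- move=> R x _ _.
  have [|c|c|h hE] := @surj_lift k _ gl_alg R glpi (glhom x) (@mpolyC (9 + 9) k) glpi_surj.
  - by move=> p /glpi0; exact.
  - exact: qpi_alg.
  - by rewrite /glhom /= mmapC.
  exists h; apply: GL3_inj; apply/matrixP => i j.
  by move: (hE (gl_var false i j)); rewrite gl_varE => <-; rewrite !mxE.
- move=> R f g e y; have [p <-] := glpi_surj y.
  apply: (@mpoly_hom_eq _ k R (f \o glpi) (g \o glpi)) => [c|i] /=.
    have -> : glpi (mpolyC _ c) = c%:A by exact: qpi_alg.
    by rewrite !rmorph_alg.
  have [b [a1 [a2 ei]]] : exists b a1 a2, mvar k i = gl_var b a1 a2.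
    rewrite -[i]splitK; case: (split i) => j; [exists false | exists true];
      exists (inord (j %/ 3)), (inord (j %% 3)); congr (mvar k (unsplit _)) => /=; congr (_ _);
      apply/val_inj; rewrite /= !inordK ?ltn_mod ?ltn_divLR // -?divn_eq ?ltn_ord //.
  have em : gmx (gmap f gl_univ) = gmx (gmap g gl_univ) by rewrite [gmap f _]e.
  have emV : gmxV (gmap f gl_univ) = gmxV (gmap g gl_univ) by rewrite [gmap f _]e.
  rewrite ei; case: b ei => _.
    by move/matrixP/(_ a1 a2): emV; rewrite !mxE.
  by move/matrixP/(_ a1 a2): em; rewrite !mxE.
Qed.

Lemma open_in_all (X : kfunctor k) (Z U : subfunctor X) : (forall R (x : X R), U R x) -> open_in Z U.
Proof.
move=> UT R x _; exists (fun a => a = 1) => R' f; split=> // _.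
by apply: (@gen_unit_unit k R R' f _ 1 1) => //; rewrite rmorph1 mulr1.
Qed.

Lemma nice_GL : nice (all_sub (GLfun k)).
Proof.
split.
  move=> C C' t st g' _.
  have [M tM] : exists M, map_mx t M = gmx g'.
    have H (ij : 'I_3 * 'I_3) : exists c, t c = gmx g' ij.1 ij.2 by exact: (proj1 st).
    have [c cE] := choice H; exists (\matrix_(i, j) c (i, j)).
    by apply/matrixP => i j; rewrite !mxE cE.
  by have [g _ e] := GL3_lift st tM; exists g.
move=> K x fK _; exists (all_sub (GLfun k)), gl_alg, gl_univ; split=> //.
- exact: open_in_all.
- exact: gl_rep.
- exists (9 + 9)%N, (fun i => glpi (mvar k i)) => a; have [p <-] := glpi_surj a; exists p.
  apply: (@mpoly_hom_eq _ k gl_alg (mmap (GRing.in_alg gl_alg) _) glpi) => [c|i] /=.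
    by rewrite mmapC; exact/esym/qpi_alg.
  by rewrite mmap_var.
Qed.

Section SmoothOverGL.
Variables (X : kfunctor k) (w : kmor X (GLfun k)).
Hypothesis smw : smooth w.

Lemma X_lift C C' (t : {lrmorphism C -> C'}) (x' : X C') (M : 'M[C]_3) :
  sq_zero_thickening t -> map_mx t M = gmx (w C' x') ->
  exists2 x : X C, fmap t x = x' & gmx (w C x) = M.
Proof.
move=> st /(GL3_lift st) [g gM e]; have [x [e1 e2]] := (proj1 smw) C C' t st x' g (esym e).
by exists x => //; rewrite e2.
Qed.

(** Locally X is Spec A with A finitely presented over a chart B of GL_3, but nothing is said about
    generators of B over k. A principal open part B_b of Spec B lies in a chart B' of finite type,
    and B_b is generated by the image of B' and 1 / b; so the localization of A at b is finitely
    generated over k. *)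
Lemma nice_smooth : nice (all_sub X).
Proof.
split.
  move=> C C' t st x' _; have [g _ e] := (proj1 nice_GL) C C' t st (w C' x') I.
  by have [x [e1 _]] := (proj1 smw) C C' t st x' g (esym e); exists x.
move=> K x fK _; have [U [V [A [u [B [v [f [[oU oV] [ru rv] Ux uv fp]]]]]]]] := (proj2 smw) K x fK.
have ru' : rep (all_sub X) U u by case: ru => Uu ex inj; split=> // R y _; exact: ex.
have [Uu ex inj] := ru; have [Vv exv injv] := rv.
have [g gx] := ex K x Ux.
have wx : w K x = fmap (g \o f) v by rewrite -gx kfun_nat uv -fmap_comp.
have Vx : V K (fmap (g \o f) v) by exact: smem_map.
have [V' [B' [v' [oV' V'x [_ V'v' ex' inj'] fB' V'V]]]] :=
  chart_in nice_GL (open_in_sub oV) fK (I : all_sub (GLfun k) K (fmap (g \o f) v)) Vx.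
have [m mv] := exv B' v' (V'V _ _ I V'v').
have [D HD] := oV' B v I.
have [b Db gb] := proj1 (gen_unit_pt _ _) (proj1 (HD _ (g \o f)) V'x) K idfun fK.
have [Bb [lb [locb univb]]] := @loc_at k B K (g \o f) b fK gb.
have [[bi lbi] surjb _] := locb.
have V'b : V' Bb (fmap lb v) by apply/HD; exact: gen_unit_unit Db lbi.
have [n nv] := ex' Bb (fmap lb v) I V'b.
have nm : forall a, n (m a) = lb a by apply: (injv Bb (n \o m) lb); rewrite fmap_comp mv.
have fBb : fin_gen Bb.
  apply: (@fin_gen_over k B' Bb n 1 (fun=> bi) fB') => S Sc Sn Sb c.
  have [j [a e]] := surjb c; have -> : c = n (m a) * bi ^+ j.
    by rewrite nm -e -mulrA (unit_expX j lbi) mulr1.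
  by case: (Sc) => _ _; apply; [exact: Sn | exact: alg_closedX (Sb ord0)].
have [Aa [l [loca univa]]] := @loc_at k A K g (f b) fK gb.
have [[ai lai] surja _] := loca.
have [f' f'E] := univb Aa (l \o f) ai lai.
exists (pts_sub (@principal_pt k X U A u (f b))), Aa, (fmap l u); split.
- exact: principal_open (open_in_sub oU) ru' _.
- by apply: principal_pt_ext => //; split=> //; exists g.
- have H := principal_rep (open_in_sub oU) ru' loca univa; exact H.
- have [n0 [m0 [c [r [csurj _]]]]] := fp.
  apply: (@fin_gen_over k Bb Aa f' n0 (l \o c) fBb) => S [S1 SD SM] Sf Sc y.
  have Sl a : S (l a).
    have [p <-] := csurj a; elim/mpoly_gen: p => [d|i|p q Sp Sq|p q Sp Sq].
    + by rewrite mmapC -[l _]/((l \o f) d) -f'E.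
    + by rewrite mmap_var; exact: Sc.
    + by rewrite (rmorphD (mmap f c)) (rmorphD l); exact: SD.
    + by rewrite (rmorphM (mmap f c)) (rmorphM l); exact: SM.
  have [j [a e]] := surja y; have -> : y = l a * f' bi ^+ j.
    have e1 : l (f b) * f' bi = 1 by rewrite -[l _]/((l \o f) b) -f'E -rmorphM lbi rmorph1.
    by rewrite -e -mulrA (unit_expX j e1) mulr1.
  by apply: (SM) => //; apply: alg_closedX.
Qed.
End SmoothOverGL.
End GLNice.

Definition e0 : 'I_3 := @Ordinal 3 0 isT.
Definition e1 : 'I_3 := @Ordinal 3 1 isT.
Definition e2 : 'I_3 := @Ordinal 3 2 isT.

Lemma sum3 (V : nmodType) (F : 'I_3 -> V) : \sum_i F i = F e0 + F e1 + F e2.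
Proof.
rewrite !big_ord_recl big_ord0 addr0 addrA.
by congr (F _ + F _ + F _); apply/val_inj.
Qed.

Lemma prod3 (R : comNzRingType) (F : 'I_3 -> R) : \prod_i F i = F e0 * F e1 * F e2.
Proof.
rewrite !big_ord_recl big_ord0 mulr1 mulrA.
by congr (F _ * F _ * F _); apply/val_inj.
Qed.

Lemma forall3 (P : 'I_3 -> Prop) : P e0 -> P e1 -> P e2 -> forall i, P i.
Proof.
move=> P0 P1 P2 [[|[|[|//]]] Hi].
- by rewrite (_ : Ordinal Hi = e0) //; apply/val_inj.
- by rewrite (_ : Ordinal Hi = e1) //; apply/val_inj.
- by rewrite (_ : Ordinal Hi = e2) //; apply/val_inj.
Qed.

Lemma rev0 : rev_ord e0 = e2. Proof. exact/val_inj. Qed.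
Lemma rev1 : rev_ord e1 = e1. Proof. exact/val_inj. Qed.
Lemma rev2 : rev_ord e2 = e0. Proof. exact/val_inj. Qed.
Definition revE := (rev0, rev1, rev2).

Definition mx3 (R : Type) (a b c d e f g h i : R) : 'M[R]_3 :=
  \matrix_(x, y) nth a (nth [::] [:: [:: a; b; c]; [:: d; e; f]; [:: g; h; i]] x) y.

Lemma mulmx3 (R : comNzRingType) (A B : 'M[R]_3) i j :
  (A *m B) i j = A i e0 * B e0 j + A i e1 * B e1 j + A i e2 * B e2 j.
Proof. by rewrite mxE sum3. Qed.

Lemma J_conj (R : comNzRingType) (A : 'M[R]_3) i j :
  (Jmx R *m A *m Jmx R) i j = A (rev_ord i) (rev_ord j).
Proof.
rewrite mxE (bigD1 (rev_ord j)) //= big1 ?addr0.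
  rewrite !mxE eqxx mulr1 (bigD1 (rev_ord i)) //= big1 ?addr0.
    by rewrite !mxE rev_ordK eqxx mul1r.
  move=> l ne; rewrite !mxE; case: eqP => [e|]; last by rewrite mul0r.
  by rewrite e rev_ordK eqxx in ne.
by move=> l ne; rewrite [X in _ * X]mxE (negPf ne) mulr0.
Qed.

(** * The zip group and its semi-invariants *)

Section Zip.
Variable R : comNzRingType.
Implicit Types g h x y l m : GL3 R.

Lemma gtwistE g i j : gmx (gtwist g) i j = gmxV g (rev_ord j) (rev_ord i).
Proof. by rewrite /= J_conj mxE. Qed.

Lemma gtwistVE g i j : gmxV (gtwist g) i j = gmx g (rev_ord j) (rev_ord i).
Proof. by rewrite /= J_conj mxE. Qed.

Lemma gtwistK g : gtwist (gtwist g) = g.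
Proof. by apply: GL3_inj; apply/matrixP => i j; rewrite gtwistE gtwistVE !rev_ordK. Qed.

Lemma muE (t : R) i j : mu t i j = (if i == j then (if (i < 2)%N then t else 1) else 0).
Proof. by rewrite !mxE mulrb. Qed.

Lemma mu_mull (t : R) (A : 'M[R]_3) i j : (mu t *m A) i j = (if (i < 2)%N then t else 1) * A i j.
Proof.
rewrite mxE (bigD1 i) //= muE eqxx big1 ?addr0 // => l ne.
by rewrite muE eq_sym (negPf ne) mul0r.
Qed.

Lemma mu_mulr (t : R) (A : 'M[R]_3) i j : (A *m mu t) i j = A i j * (if (j < 2)%N then t else 1).
Proof.
rewrite mxE (bigD1 j) //= muE eqxx big1 ?addr0 // => l ne.
by rewrite muE (negPf ne) mulr0.
Qed.

Lemma gmxVM g : gmxV g *m gmx g = 1%:M.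
Proof. exact/mulmx1C/eqP/gmx_mulV. Qed.

Lemma gmxMV g : gmx g *m gmxV g = 1%:M.
Proof. exact/eqP/gmx_mulV. Qed.
End Zip.

Lemma inv_col2 (R : comNzRingType) (A B : 'M[R]_3) : A *m B = 1%:M ->
  A e0 e2 = 0 -> A e1 e2 = 0 -> B e0 e2 = 0 /\ B e1 e2 = 0.
Proof.
move=> AB A02 A12; have BA := mulmx1C AB.
have E i j : A i e0 * B e0 j + A i e1 * B e1 j + A i e2 * B e2 j = (i == j)%:R.
  by rewrite -mulmx3 AB mxE.
have F i j : B i e0 * A e0 j + B i e1 * A e1 j + B i e2 * A e2 j = (i == j)%:R.
  by rewrite -mulmx3 BA mxE.
have F2 i : B i e2 * A e2 e2 = (i == e2)%:R by rewrite -F A02 A12 !mulr0 !add0r.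
have F22 : B e2 e2 * A e2 e2 = 1 by exact: F2.
have z i : (i == e2)%:R = 0 :> R -> B i e2 = 0.
  move=> e; rewrite -[LHS]mulr1 -F22 [B e2 e2 * _]mulrC mulrA F2 e mul0r; by [].
by split; exact: z.
Qed.

Section LimMinus.
Variable R : comNzRingType.
Implicit Types x l : GL3 R.

(** The projection to the Levi subgroup GL_2 x GL_1. *)
Definition blk (A : 'M[R]_3) : 'M[R]_3 :=
  \matrix_(i, j) (if ((i < 2)%N == (j < 2)%N) then A i j else 0).

Lemma mulX_const (p : {poly R}) c : 'X * p = c%:P -> c = 0 /\ p = 0.
Proof.
move=> e; have p0 i : p`_i = 0.
  by move: (congr1 (fun r : {poly R} => r`_i.+1) e); rewrite coefXM coefC.
split; last by apply/polyP => i; rewrite p0 coef0.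
by move: (congr1 (fun r : {poly R} => r`_0) e); rewrite coefXM coefC.
Qed.

Lemma col_aux (S : comNzRingType) (t a b c d e : S) :
  a * t * b + c * t * d + e * t = t * (a * b + c * d + e).
Proof. by ring. Qed.

(** Conjugation by mu(t)^(-1) divides the entries (0, 2) and (1, 2) by t, multiplies (2, 0) and (2,
    1) by t, and fixes the others. *)
Lemma lim_minusP x l : lim_minus x l <->
  [/\ gmx x e0 e2 = 0, gmx x e1 e2 = 0 & gmx l = blk (gmx x)].
Proof.
split=> [[N [e N0]]|[x02 x12 le]].
  have E (i j : 'I_3) : (if (i < 2)%N then 'X else 1) * gmx N i j = (gmx x i j)%:P * (if (j < 2)%N then 'X else 1).
    by rewrite -mu_mull e mu_mulr [polyG x i j]mxE.
  have E2 (i : 'I_3) : (i < 2)%N -> gmx x i e2 = 0 /\ gmx N i e2 = 0.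
    by move=> i2; apply: mulX_const; have := E i e2; rewrite i2 mulr1.
  have [x02 N02] := E2 e0 isT; have [x12 N12] := E2 e1 isT.
  split=> //; rewrite -N0; apply/matrixP => i j; rewrite !mxE.
  have X0 c : (c%:P * 'X : {poly R}).[0] = 0 by rewrite hornerM hornerX mulr0.
  have [i2|i2] := ltnP i 2; have [j2|j2] := ltnP j 2 => //=.
  - have := E i j; rewrite i2 j2 mulrC => /polyP eX.
    have -> : gmx N i j = (gmx x i j)%:P.
      apply/polyP => d; move: (eX d.+1); rewrite !coefMX /=; by [].
    by rewrite hornerC.
  - have -> : j = e2 by apply/val_inj/eqP; rewrite /= eqn_leq j2 -ltnS ltn_ord.
    by have [_ ->] := E2 i i2; rewrite horner0.
  - by have := E i j; rewrite j2 [(i < 2)%N]ltnNge i2 mul1r /= => ->; rewrite X0.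
  - by have := E i j; rewrite [(i < 2)%N]ltnNge [(j < 2)%N]ltnNge i2 j2 mul1r mulr1 /= => ->; rewrite hornerC.
have [v02 v12] := inv_col2 (gmxMV x) x02 x12.
(* The conjugate of A by mu(T)^(-1); conjugating the inverse matrix in the same way provides the
   inverse of N. *)
pose cj (A : 'M[R]_3) : 'M[{poly R}]_3 := \matrix_(i, j)
  ((A i j)%:P * (if ((i < 2)%N == (j < 2)%N) then 1 else if (i < 2)%N then 0 else 'X)).
have cjM (A B : 'M[R]_3) : A e0 e2 = 0 -> A e1 e2 = 0 -> B e0 e2 = 0 -> B e1 e2 = 0 ->
    A *m B = 1%:M -> cj A *m cj B = 1%:M.
  move=> A02 A12 B02 B12 AB; apply/matrixP.
  have H i j : A i e0 * B e0 j + A i e1 * B e1 j + A i e2 * B e2 j = (i == j)%:R.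
    by rewrite -mulmx3 AB mxE.
  apply: forall3; apply: forall3; rewrite mulmx3 !mxE /= ?(A02, A12, B02, B12) ?mulr1 ?mulr0 ?mul0r ?addr0;
    rewrite ?mulrA -?polyCM -?polyCD.
  all: try by (have := H e0 e0; rewrite A02 mul0r addr0 => ->).
  all: try by (have := H e0 e1; rewrite A02 mul0r addr0 => ->).
  all: try by (have := H e1 e0; rewrite A12 mul0r addr0 => ->).
  all: try by (have := H e1 e1; rewrite A12 mul0r addr0 => ->).
  all: try by (have := H e2 e2; rewrite B02 B12 !mulr0 !add0r => ->).
  1,2: reflexivity.
  - apply: (etrans (@col_aux {poly R} 'X _ _ _ _ _)).
    by rewrite -!polyCM -!polyCD (H e2 e0) polyC0 mulr0.
  - apply: (etrans (@col_aux {poly R} 'X _ _ _ _ _)).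
    by rewrite -!polyCM -!polyCD (H e2 e1) polyC0 mulr0.
exists (MkGL3 (introT eqP (cjM _ _ x02 x12 v02 v12 (gmxMV x)))); split.
  apply/matrixP; apply: forall3; apply: forall3; rewrite mu_mull mu_mulr !mxE /= ?(x02, x12);
    rewrite ?mulr1 ?mul1r ?mul0r ?mulr0 // mulrC //.
rewrite le; apply/matrixP; apply: forall3; apply: forall3; rewrite !mxE /=;
  rewrite ?mulr1 ?hornerC // ?mulr0 ?horner0 // hornerM hornerX mulr0 //.
Qed.

End LimMinus.

Definition gtr (R : comNzRingType) (g : GL3 R) : GL3 R :=
  MkGL3 (introT eqP (etrans (esym (trmx_mul (gmxV g) (gmx g)))
    (etrans (congr1 trmx (gmxVM g)) (trmx1 _ _)))).

Lemma lim_plus_tr (R : comNzRingType) (x l : GL3 R) : lim_plus x l <-> lim_minus (gtr x) (gtr l).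
Proof.
have muT (S : comNzRingType) (t : S) : (mu t)^T = mu t by rewrite /mu tr_diag_mx.
have GT (g : GL3 R) : polyG (gtr g) = (polyG g)^T by apply/matrixP => i j; rewrite !mxE.
have NT (N : GL3 {poly R}) : map_mx (fun p : {poly R} => p.[0]) (gmx (gtr N)) =
  (map_mx (fun p : {poly R} => p.[0]) (gmx N))^T by apply/matrixP => i j; rewrite !mxE.
split=> [[N [e N0]]|[N [e N0]]]; exists (gtr N); rewrite ?GT NT.
  split; last by rewrite N0.
  by rewrite -[X in X *m gmx _]muT -trmx_mul e trmx_mul muT.
split; last by rewrite N0 /= trmxK.
by apply: trmx_inj; rewrite !trmx_mul muT /= trmxK e GT.
Qed.

Lemma lim_plusP (R : comNzRingType) (x l : GL3 R) : lim_plus x l <->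
  [/\ gmx x e2 e0 = 0, gmx x e2 e1 = 0 & gmx l = blk (gmx x)].
Proof.
rewrite lim_plus_tr lim_minusP /= !mxE.
have E : (gmx l)^T = blk (gmx x)^T <-> gmx l = blk (gmx x).
  by split=> [e|->]; [apply: trmx_inj; rewrite e|];
    apply/matrixP => i j; rewrite !mxE eq_sym.
by split=> [[a b /E c]|[a b /E c]].
Qed.

Lemma exists_frob (p r : nat) (R : comNzRingType) : p \in [pchar R] ->
  exists F : {rmorphism R -> R}, forall x, F x = x ^+ (p ^ r).
Proof.
move=> cR; elim: r => [|r [F FE]]; first by exists idfun => x; rewrite expr1.
exists (pFrobenius_aut cR \o F) => x.
by rewrite /= pFrobenius_autE FE -exprM -expnSr.
Qed.

Section ZipE.
Variables (q : nat) (R : comNzRingType) (fr : {rmorphism R -> R}).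
Hypothesis frE : forall x, fr x = x ^+ q.
Implicit Types x y l m : GL3 R.

Lemma blk_inv (A B : 'M[R]_3) : A *m B = 1%:M -> A e0 e2 = 0 -> A e1 e2 = 0 ->
  blk A *m blk B = 1%:M.
Proof.
move=> AB A02 A12; have [B02 B12] := inv_col2 AB A02 A12.
have E i j : A i e0 * B e0 j + A i e1 * B e1 j + A i e2 * B e2 j = (i == j)%:R.
  by rewrite -mulmx3 AB mxE.
apply/matrixP; apply: forall3; apply: forall3; rewrite mulmx3 !mxE /= ?mulr0 ?mul0r ?addr0 ?add0r //.
- by have := E e0 e0; rewrite A02 mul0r addr0.
- by have := E e0 e1; rewrite A02 mul0r addr0.
- by have := E e1 e0; rewrite A12 mul0r addr0.
- by have := E e1 e1; rewrite A12 mul0r addr0.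
- by have := E e2 e2; rewrite B02 B12 !mulr0 !add0r.
Qed.

(** The zip group in the coordinates A = x and B = y^(-1). The inverse of y is the one that occurs
    in the action x g y^(-1), and it removes the inverse from the twist: its Levi entries are plain
    q-th powers of entries of x. *)
Definition zip_eqs (A B : 'M[R]_3) : Prop :=
  [/\ A e0 e2 = 0 /\ A e1 e2 = 0, B e1 e0 = 0 /\ B e2 e0 = 0,
      B e0 e0 = A e2 e2 ^+ q, B e1 e1 = A e1 e1 ^+ q /\ B e2 e2 = A e0 e0 ^+ q
    & B e1 e2 = A e0 e1 ^+ q /\ B e2 e1 = A e1 e0 ^+ q].

Lemma frob_mxE l : frob_mx q l = gmx (gtwist (gmap fr l)).
Proof.
rewrite /frob_mx /=; congr (_ *m _ *m _); congr (_^T).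
by apply/matrixP => i j; rewrite !mxE frE.
Qed.

Lemma zipEP x y : zipE q (x, y) <-> zip_eqs (gmx x) (gmxV y).
Proof.
split=> [[l [m [/= /lim_minusP [x02 x12 le]]]]|[[x02 x12] [y10 y20] y00 [y11 y22] [y12 y21]]].
  case=> y' [m' [/lim_plusP [y'20 y'21 m'e] -> ->]]; rewrite frob_mxE => /GL3_inj.
  move/(congr1 (@gtwist R)); rewrite !gtwistK => em.
  have H i j : blk (gmx y') i j = (blk (gmx x) i j) ^+ q.
    by rewrite -m'e -le em mxE frE.
  have := H e0 e0; have := H e0 e1; have := H e1 e0; have := H e1 e1; have := H e2 e2.
  by rewrite !mxE /= => h1 h2 h3 h4 h5; split; rewrite ?gtwistVE ?revE.
have [v02 v12] := inv_col2 (gmxMV x) x02 x12.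
have bI : blk (gmx x) *m blk (gmxV x) == 1%:M by apply/eqP/blk_inv => //; exact: gmxMV.
pose l := MkGL3 bI; exists l, (gtwist (gmap fr l)); split; last by rewrite frob_mxE.
  exact/lim_minusP.
exists (gtwist y), (gmap fr l); split=> //; last by rewrite gtwistK.
apply/lim_plusP; rewrite !gtwistE !revE; split=> //.
move: (gmx (gtwist y)) (gtwistE y) => W WE.
apply/matrixP; apply: forall3; apply: forall3; rewrite !mxE /= ?WE ?revE ?rmorph0 //.
all: by rewrite frE.
Qed.
End ZipE.

Section ZipGroup.
Variables (p r : nat) (k : closedFieldType).
Hypothesis char_k : p \in [pchar k].
Implicit Types (R A B C K L : comAlgType k).
Local Notation q := (p ^ r)%N.
Local Notation zE := (@zipE q _).

Lemma char_alg R : p \in [pchar R].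
Proof.
apply/andP; split; first exact: pcharf_prime char_k.
by rewrite -(rmorph_nat (GRing.in_alg R)) (pcharf0 char_k) rmorph0.
Qed.

Lemma ex_frob R : exists fr : {rmorphism R -> R}, forall x, fr x = x ^+ q.
Proof. exact: exists_frob (char_alg R). Qed.

Lemma zipP R (x y : GL3 R) : zE (x, y) <-> zip_eqs q (gmx x) (gmxV y).
Proof. by have [fr frE] := ex_frob R; exact: zipEP frE _ _. Qed.

Lemma zip_eqs_mul R (A B A' B' : 'M[R]_3) : zip_eqs q A B -> zip_eqs q A' B' ->
  zip_eqs q (A *m A') (B' *m B).
Proof.
have [fr frE] := ex_frob R; rewrite /zip_eqs -!frE.
case=> [[a02 a12] [b10 b20] b00 [b11 b22] [b12 b21]] [[a02' a12'] [b10' b20'] b00' [b11' b22'] [b12' b21']].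
rewrite !mulmx3 a02 a12 b10 b20 a02' a12' b10' b20' b00 b00' b11 b11' b22 b22' b12 b12' b21 b21'.
rewrite !(rmorphD fr, rmorphM fr) /= !(mulr0, mul0r, addr0, add0r) ?rmorph0 ?mulr0 ?mul0r ?addr0 ?add0r.
move: (fr (A e0 e0)) (fr (A e0 e1)) (fr (A e1 e0)) (fr (A e1 e1)) (fr (A e2 e2)) => c1 c2 c3 c4 c5.
move: (fr (A' e0 e0)) (fr (A' e0 e1)) (fr (A' e1 e0)) (fr (A' e1 e1)) (fr (A' e2 e2)) => d1 d2 d3 d4 d5.
by split=> //; [exact: mulrC | split; ring | split; ring].
Qed.

Lemma zipE_mul R (e e' : GL3 R * GL3 R) : zE e -> zE e' ->
  zE (gmul e.1 e'.1, gmul e.2 e'.2).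
Proof.
by case: e e' => x y [x' y'] /zipP h /zipP h'; apply/zipP; exact: zip_eqs_mul.
Qed.

Lemma zipE_one R : zE (gone R, gone R).
Proof.
have [fr frE] := ex_frob R; apply/zipP; rewrite /zip_eqs -!frE !mxE /=.
by rewrite ?rmorph0 ?rmorph1; split.
Qed.

Definition inv2 R (e : GL3 R * GL3 R) : GL3 R * GL3 R := (ginv e.1, ginv e.2).
Definition mul2 R (e e' : GL3 R * GL3 R) : GL3 R * GL3 R := (gmul e.1 e'.1, gmul e.2 e'.2).
Definition map2 R R' (f : {lrmorphism R -> R'}) (e : GL3 R * GL3 R) := (gmap f e.1, gmap f e.2).

Lemma gmulV R (g : GL3 R) : gmul g (ginv g) = gone R.
Proof. by apply: GL3_inj; rewrite /= gmxMV. Qed.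
Lemma gVmul R (g : GL3 R) : gmul (ginv g) g = gone R.
Proof. by apply: GL3_inj; rewrite /= gmxVM. Qed.
Lemma gmulA R (g h l : GL3 R) : gmul g (gmul h l) = gmul (gmul g h) l.
Proof. by apply: GL3_inj; rewrite /= mulmxA. Qed.
Lemma gmul1 R (g : GL3 R) : gmul g (gone R) = g.
Proof. by apply: GL3_inj; rewrite /= mulmx1. Qed.
Lemma g1mul R (g : GL3 R) : gmul (gone R) g = g.
Proof. by apply: GL3_inj; rewrite /= mul1mx. Qed.
Lemma ginvM R (g h : GL3 R) : ginv (gmul g h) = gmul (ginv h) (ginv g).
Proof. exact: GL3_inj. Qed.
Lemma ginvK R (g : GL3 R) : ginv (ginv g) = g.
Proof. exact: GL3_inj. Qed.
Lemma gmapM R R' (f : {lrmorphism R -> R'}) (g h : GL3 R) :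
  gmap f (gmul g h) = gmul (gmap f g) (gmap f h).
Proof. by apply: GL3_inj; rewrite /= map_mxM. Qed.
Lemma gmapV R R' (f : {lrmorphism R -> R'}) (g : GL3 R) : gmap f (ginv g) = ginv (gmap f g).
Proof. exact: GL3_inj. Qed.

(** The zip group projects onto P: for y one can take the twisted Frobenius of the Levi component of
    x, which lies in M. *)
Lemma zip_section R (x : GL3 R) : gmx x e0 e2 = 0 -> gmx x e1 e2 = 0 ->
  exists y, [/\ zE (x, y), gmxV y e0 e1 = 0 & gmxV y e0 e2 = 0].
Proof.
move=> x02 x12; have [fr frE] := ex_frob R.
have bI : blk (gmx x) *m blk (gmxV x) == 1%:M by apply/eqP/blk_inv => //; exact: gmxMV.
exists (gtwist (gmap fr (MkGL3 bI))); split; last 2 first.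
- by rewrite gtwistVE !revE /= !mxE /= rmorph0.
- by rewrite gtwistVE !revE /= !mxE /= rmorph0.
apply/zipP; rewrite /zip_eqs !gtwistVE !revE -!frE /= !mxE /= !rmorph0.
by split.
Qed.

Lemma in_PE R (x : GL3 R) : in_P x <-> gmx x e0 e2 = 0 /\ gmx x e1 e2 = 0.
Proof.
split=> [[l /lim_minusP [a b _]] //|[x02 x12]].
have bI : blk (gmx x) *m blk (gmxV x) == 1%:M by apply/eqP/blk_inv => //; exact: gmxMV.
by exists (MkGL3 bI); apply/lim_minusP.
Qed.

Lemma zip_in_P R (e : GL3 R * GL3 R) : zE e -> in_P e.1.
Proof. by case: e => x y /zipP [h _ _ _ _]; apply/in_PE. Qed.

Lemma lim_minusV R (x l : GL3 R) : lim_minus x l -> lim_minus (ginv x) (ginv l).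
Proof.
move=> /lim_minusP [x02 x12 le]; have [v02 v12] := inv_col2 (gmxMV x) x02 x12.
apply/lim_minusP; split=> //=.
have := blk_inv (gmxMV x) x02 x12; rewrite -le => e.
by rewrite -[LHS]mulmx1 -e mulmxA gmxVM mul1mx.
Qed.

Lemma zipE_inv R (e : GL3 R * GL3 R) : zE e -> zE (inv2 e).
Proof.
case: e => x y [l [m [/= xl [y' [m' [/lim_plus_tr ym' ey em']]] em]]]; subst y m.
exists (ginv l), (ginv (gtwist m')); split; first exact: lim_minusV xl.
  exists (ginv y'), (ginv m'); split; [|exact: GL3_inj..].
  apply/lim_plus_tr; have -> : gtr (ginv y') = ginv (gtr y') by exact: GL3_inj.
  have -> : gtr (ginv m') = ginv (gtr m') by exact: GL3_inj.
  exact: lim_minusV.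
have [fr frE] := ex_frob R; move: em; rewrite !(frob_mxE frE) => /GL3_inj ->.
by [].
Qed.

Lemma upow0 (R : comNzRingType) (u v : R) : upow u v 0 = 1.
Proof. by []. Qed.

Lemma upowD (R : comNzRingType) (u v : R) (a b : int) : u * v = 1 ->
  upow u v (a + b) = upow u v a * upow u v b.
Proof.
move=> uv; have S c : upow u v (c + 1) = upow u v c * u.
  case: c => n; first by rewrite -PoszD addn1 /= exprSr.
  case: n => [|n]; first by rewrite /= mulrC uv.
  have -> : Negz n.+1 + 1 = Negz n by rewrite !NegzE -addn1 PoszD opprD addrNK.
  by rewrite /= [v ^+ n.+2]exprSr -mulrA [v * u]mulrC uv mulr1.
have P c : upow u v (c - 1) = upow u v c * v.
  by rewrite -{2}[c](subrK 1) S -mulrA uv mulr1.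
elim/int_rec: b => [|n IH|n IH].
- by rewrite addr0 upow0 mulr1.
- by rewrite -addn1 PoszD addrA !S IH mulrA.
- by rewrite -addn1 PoszD opprD addrA !P IH mulrA.
Qed.

Lemma upow_map (R R' : comNzRingType) (f : {rmorphism R -> R'}) (u v : R) a :
  f (upow u v a) = upow (f u) (f v) a.
Proof. by case: a => n; rewrite /= rmorphXn. Qed.

Definition wt (a b c : int) : 'rV[int]_3 := \row_i (if i == e0 then a else if i == e1 then b else c).

Lemma wtE (la : 'rV[int]_3) : la = wt (la ord0 e0) (la ord0 e1) (la ord0 e2).
Proof. by apply/rowP; apply: forall3; rewrite !mxE. Qed.

Lemma wtD a b c a' b' c' : wt a b c + wt a' b' c' = wt (a + a') (b + b') (c + c').
Proof. by apply/rowP; apply: forall3; rewrite !mxE. Qed.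

Lemma chiE a b c (R : comNzRingType) (g : GL3 R) : chi (wt a b c) g =
  upow (gmx g e0 e0) (gmxV g e0 e0) a * upow (gmx g e1 e1) (gmxV g e1 e1) b *
  upow (gmx g e2 e2) (gmxV g e2 e2) c.
Proof. by rewrite /chi prod3 !mxE. Qed.

Lemma chi_map la R R' (f : {lrmorphism R -> R'}) (g : GL3 R) : chi la (gmap f g) = f (chi la g).
Proof. by rewrite /chi rmorph_prod; apply: eq_bigr => i _; rewrite !mxE upow_map. Qed.

Lemma tri_entries R (b : GL3 R) : in_B b ->
  [/\ gmx b e0 e1 = 0, gmx b e0 e2 = 0 & gmx b e1 e2 = 0].
Proof. by move/is_trig_mxP=> H; split; apply: H. Qed.

Lemma in_BE R (b : GL3 R) : in_B b <->
  [/\ gmx b e0 e1 = 0, gmx b e0 e2 = 0 & gmx b e1 e2 = 0].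
Proof.
split; first exact: tri_entries.
by move=> [h1 h2 h3]; apply/is_trig_mxP; apply: forall3; apply: forall3.
Qed.

Lemma tri_inv (R : comNzRingType) (A B : 'M[R]_3) : A *m B = 1%:M ->
  A e0 e1 = 0 -> A e0 e2 = 0 -> A e1 e2 = 0 ->
  [/\ B e0 e1 = 0, B e0 e2 = 0 & B e1 e2 = 0] /\ forall i, A i i * B i i = 1.
Proof.
move=> AB A01 A02 A12.
have E i j : A i e0 * B e0 j + A i e1 * B e1 j + A i e2 * B e2 j = (i == j)%:R.
  by rewrite -mulmx3 AB mxE.
have E00 : A e0 e0 * B e0 e0 = 1 by rewrite -[RHS](E e0 e0) A01 A02 !mul0r !addr0.
have z (a b c : R) : a * b = 1 -> a * c = 0 -> c = 0.
  by move=> ab ac; rewrite -[c]mul1r -ab mulrAC ac mul0r.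
have B01 : B e0 e1 = 0 by apply: z E00 _; rewrite -[RHS](E e0 e1) A01 A02 !mul0r !addr0.
have B02 : B e0 e2 = 0 by apply: z E00 _; rewrite -[RHS](E e0 e2) A01 A02 !mul0r !addr0.
have E11 : A e1 e1 * B e1 e1 = 1 by rewrite -[RHS](E e1 e1) A12 B01 mulr0 mul0r add0r addr0.
have B12 : B e1 e2 = 0 by apply: z E11 _; rewrite -[RHS](E e1 e2) A12 B02 mulr0 mul0r add0r addr0.
have E22 : A e2 e2 * B e2 e2 = 1 by rewrite -[RHS](E e2 e2) B02 B12 !mulr0 !add0r.
by split=> //; apply: forall3.
Qed.

Lemma in_BV R (b : GL3 R) : in_B b -> in_B (ginv b).
Proof. by move=> /tri_entries [h1 h2 h3]; have [H _] := tri_inv (gmxMV b) h1 h2 h3; apply/in_BE. Qed.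

Lemma diag_inv R (b : GL3 R) i : in_B b -> gmx b i i * gmxV b i i = 1.
Proof. by move=> /tri_entries [h1 h2 h3]; have [_ H] := tri_inv (gmxMV b) h1 h2 h3. Qed.

Lemma chiD la la' R (b : GL3 R) : in_B b -> chi (la + la') b = chi la b * chi la' b.
Proof.
move=> Bb; rewrite /chi -big_split; apply: eq_bigr => i _.
by rewrite !mxE upowD // diag_inv.
Qed.

Lemma chi0 R (b : GL3 R) : chi 0 b = 1.
Proof. by rewrite /chi big1 // => i _; rewrite mxE. Qed.

Lemma chiN la R (b : GL3 R) : in_B b -> chi la b * chi (- la) b = 1.
Proof. by move=> Bb; rewrite -chiD // subrr chi0. Qed.

Lemma chiV la R (b : GL3 R) : in_B b -> chi la (ginv b) = chi (- la) b.
Proof.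
move=> Bb; rewrite /chi; apply: eq_bigr => i _ /=; rewrite !mxE.
have e := diag_inv i Bb; have e' : gmxV b i i * gmx b i i = 1 by rewrite mulrC.
apply: (unit_cancel (x := upow (gmx b i i) (gmxV b i i) (la ord0 i))
  (v := upow (gmx b i i) (gmxV b i i) (- la ord0 i))); first by rewrite -upowD // subrr.
rewrite -upowD // subrr upow0; case: (la ord0 i) => n /=; by rewrite -exprMn ?e ?e' expr1n.
Qed.

Lemma chiMn la n R (b : GL3 R) : in_B b -> chi (la *+ n) b = chi la b ^+ n.
Proof.
move=> Bb; elim: n => [|n IH]; first by rewrite mulr0n chi0.
by rewrite mulrS chiD // IH exprS.
Qed.

Lemma zipE'P R (e : GL3 R * GL3 R) : zipE' q e <-> zE e /\ gmx e.1 e0 e1 = 0.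
Proof.
split=> [[H /tri_entries [h _ _]] //|[H h]]; split=> //.
by case: e H h => x y /zipP [[x02 x12] _ _ _ _] h; apply/in_BE.
Qed.
End ZipGroup.

Section Param.
Variable R : comNzRingType.

Lemma tri_subproof (a0 a1 a2 b0 b1 b2 c10 c20 c21 : R) :
  a0 * b0 = 1 -> a1 * b1 = 1 -> a2 * b2 = 1 ->
  mx3 a0 0 0 c10 a1 0 c20 c21 a2 *m
  mx3 b0 0 0 (- (b1 * c10 * b0)) b1 0 (b2 * (c21 * b1 * c10 - c20) * b0) (- (b2 * c21 * b1)) b2
  == 1%:M.
Proof.
move=> ab0 ab1 ab2; apply/eqP/matrixP; apply: forall3; apply: forall3; rewrite mulmx3 !mxE /=;
  rewrite ?(mulr0, mul0r, addr0, add0r) //.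
- by rewrite mulrN mulrA mulrA ab1 mul1r subrr.
- have -> : c20 * b0 + c21 * - (b1 * c10 * b0) + a2 * (b2 * (c21 * b1 * c10 - c20) * b0) =
    (a2 * b2 - 1) * (c21 * b1 * c10 - c20) * b0 by ring.
  by rewrite ab2 subrr !mul0r.
- have -> : c21 * b1 + a2 * - (b2 * c21 * b1) = (1 - a2 * b2) * c21 * b1 by ring.
  by rewrite ab2 subrr !mul0r.
Qed.

Lemma opp_subproof (a0 a1 a2 b0 b1 b2 c v01 v02 : R) :
  a0 * b0 = 1 -> a1 * b1 = 1 -> a2 * b2 = 1 ->
  mx3 b2 (- (b2 * (v01 * b1 - v02 * b0 * c * b1))) (- (b2 * v02 * b0)) 0 b1 0 0 (- (b0 * c * b1)) b0
  *m mx3 a2 v01 v02 0 a1 0 0 c a0 == 1%:M.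
Proof.
move=> ab0 ab1 ab2; apply/eqP/matrixP; apply: forall3; apply: forall3; rewrite mulmx3 !mxE /=;
  rewrite ?(mulr0, mul0r, addr0, add0r) // ?[b2 * a2]mulrC ?[b1 * a1]mulrC ?[b0 * a0]mulrC //.
- have -> : b2 * v01 + - (b2 * (v01 * b1 - v02 * b0 * c * b1)) * a1 + - (b2 * v02 * b0) * c =
    b2 * (v01 - v02 * b0 * c) * (1 - a1 * b1) by ring.
  by rewrite ab1 subrr !mulr0.
- have -> : b2 * v02 + - (b2 * v02 * b0) * a0 = b2 * v02 * (1 - a0 * b0) by ring.
  by rewrite ab0 subrr !mulr0.
- have -> : - (b0 * c * b1) * a1 + b0 * c = b0 * c * (1 - a1 * b1) by ring.
  by rewrite ab1 subrr !mulr0.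
Qed.
End Param.

(** * Products with affine space; semi-invariance tested over fields *)

Section AffineN.
Variables (k : closedFieldType) (n : nat).
Implicit Types (R A B C K L : comAlgType k).

Definition mpC A : {rmorphism k -> mpoly n A} := @mpolyC n A \o GRing.in_alg A.
Definition mpA A : comAlgType k := QAlg (mpC A) (zero_ideal (mpoly n A)).
Definition mpq A : {rmorphism mpoly n A -> mpA A} := qpi (mpC A) (zero_ideal (mpoly n A)).

Lemma mpq_surj A (y : mpA A) : exists p, mpq A p = y.
Proof. exact: qpi_surj. Qed.

Lemma mpAC_alg A (c : k) : (mpq A \o @mpolyC n A : {rmorphism A -> mpA A}) c%:A = c%:A.
Proof. exact: qpi_alg. Qed.

Definition mpAC A : {lrmorphism A -> mpA A} := mklr (@mpAC_alg A).
Definition mpAX A (i : 'I_n) : mpA A := mpq A (mvar A i).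

Lemma mpACE A a : mpAC A a = mpq A (mpolyC n a). Proof. by rewrite mklrE. Qed.

Lemma mpA_lift A B (g : {lrmorphism A -> B}) (b : 'I_n -> B) :
  exists h : {lrmorphism mpA A -> B}, forall p, h (mpq A p) = mmap g b p.
Proof.
have hJ p : zero_ideal (mpoly n A) p -> (mmap g b : {rmorphism mpoly n A -> B}) p = 0.
  by move=> ->; exact: rmorph0.
have hk (c : k) : (mmap g b : {rmorphism mpoly n A -> B}) (mpC A c) = c%:A.
  by rewrite /= mmapC; exact: rmorph_alg.
by exists (qlift hJ hk) => p; rewrite qliftE.
Qed.

Lemma mpA_eq A B (g h : {lrmorphism mpA A -> B}) :
  (forall a, g (mpAC A a) = h (mpAC A a)) -> (forall i, g (mpAX A i) = h (mpAX A i)) -> g =1 h.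
Proof.
move=> ec eX y; have [p <-] := mpq_surj y.
apply: (@mpoly_hom_eq n A B (g \o mpq A) (h \o mpq A)) => [c|i] /=; last exact: eX.
by rewrite -mpACE ec.
Qed.

Variable X : kfunctor k.

Lemma affn_id R (x : X R * ('I_n -> R)) : (fmap idfun x.1, idfun \o x.2) = x.
Proof. by case: x => x v; rewrite fmap_id. Qed.

Lemma affn_comp R R' R'' (f : {lrmorphism R -> R'}) (g : {lrmorphism R' -> R''})
  (x : X R * ('I_n -> R)) :
  (fmap (g \o f) x.1, (g \o f) \o x.2) = (fmap g (fmap f x.1, f \o x.2).1, g \o (fmap f x.1, f \o x.2).2).
Proof. by rewrite fmap_comp. Qed.

Definition affn : kfunctor k :=
  @KFunctor k (fun R => (X R * ('I_n -> R))%type) (fun R R' f x => (fmap f x.1, f \o x.2)) affn_id affn_comp.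

Definition affnsub (Z : subfunctor X) : subfunctor affn :=
  @SubFunctor k affn (fun R x => Z R x.1) (fun R R' f x => @smem_map k X Z R R' f x.1).

Lemma nice_affn (Z : subfunctor X) : nice Z -> nice (affnsub Z).
Proof.
move=> [lf ch]; split.
  move=> C C' t st [x' v'] Zx'; have [x Zx <-] := lf C C' t st x' Zx'.
  have [v vE] := choice (fun i => proj1 st (v' i)).
  by exists (x, v) => //; congr (_, _); apply/funext.
move=> K [x v] fK Zx; have [U [A [u [oU Ux [Zu Uu ex inj] fA]]]] := ch K x fK Zx.
exists (affnsub U), (mpA A), ((fmap (mpAC A) u, mpAX A) : affn (mpA A)); split=> //.
- by move=> R [y b] Zy; have [D HD] := oU R y Zy; exists D.
- split; [exact: smem_map|exact: smem_map| |].
  + move=> R [y b] Zy Uy; have [g gy] := ex R y Zy Uy; have [h hE] := mpA_lift g b.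
    exists h; congr (_, _); last by apply/funext => i; rewrite /= hE mmap_var.
    by rewrite /= -gy; apply: fmap_tri => c; rewrite mpACE hE mmapC.
  + move=> R f g [e1 e2]; apply: mpA_eq; last first.
      by move=> i; exact: (congr1 (fun v => v i) e2).
    by apply: (inj R (f \o mpAC A) (g \o mpAC A)); rewrite !fmap_comp.
- apply: (@fin_gen_over k A (mpA A) (mpAC A) n (mpAX A) fA) => S [S1 SD SM] SC SX y.
  have [p <-] := mpq_surj y; elim/mpoly_gen: p => [c|i|a b Sa Sb|a b Sa Sb].
  + by rewrite -mpACE.
  + exact: SX.
  + by rewrite (rmorphD (mpq A)); exact: SD.
  + by rewrite (rmorphM (mpq A)); exact: SM.
Qed.
End AffineN.

Section Law.
Variables (p r : nat) (k : closedFieldType).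
Hypothesis char_k : p \in [pchar k].
Implicit Types (R A B C K L : comAlgType k).
Local Notation q := (p ^ r)%N.
Variables (X : kfunctor k) (act : pre_action X).
Hypothesis actP : Defs.is_action (@zipE q) act.
Implicit Types Z U O : subfunctor X.

Definition stable Z : Prop := forall R (e : GL3 R * GL3 R) (x : X R), zipE' q e -> Z R x -> Z R (act e x).

Definition law Z (la : 'rV[int]_3) (s : forall R, X R -> R) : Prop :=
  forall R (e : GL3 R * GL3 R) (x : X R), zipE' q e -> Z R x -> s R (act e x) = chi la e.1 * s R x.

Definition law_pt Z (la : 'rV[int]_3) (s : forall R, X R -> R) : Prop :=
  forall K (e : GL3 K * GL3 K) (x : X K), is_field K -> zipE' q e -> Z K x ->
    s K (act e x) = chi la e.1 * s K x.

Lemma law_law_pt Z la s : law Z la s -> law_pt Z la s.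
Proof. by move=> H K e x _; exact: H. Qed.

Notation affs := (affn 11 X).

(* [v] lists the diagonal of an element of B, its inverse, the entries below the
   diagonal, and two free entries of the second component. *)
Definition units Z R (y : affs R) : Prop :=
  Z R y.1 /\ forall i, y.2 (lshift 8 (i : 'I_3)) * y.2 (rshift 3 (lshift 5 i)) = 1.

Lemma units_map Z R R' (f : {lrmorphism R -> R'}) y : units Z y -> units Z (fmap f y).
Proof.
by move=> [Zx H]; split=> [|i]; [exact: smem_map | rewrite /= -rmorphM H rmorph1].
Qed.

Definition units_sub Z : subfunctor affs := SubFunctor (@units_map Z).

Lemma unit_lift C C' (t : {lrmorphism C -> C'}) (a' b' : C') : sq_zero_thickening t -> a' * b' = 1 ->
  exists a b, [/\ t a = a', t b = b' & a * b = 1].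
Proof.
move=> [st sq] ab; have [a ta] := st a'; have [b tb] := st b'.
(* One Newton step for the inverse of a, exact because 1 - a b has square zero. *)
exists a, (b * (2%:R - a * b)); split=> //.
  by rewrite rmorphM rmorphB rmorphM rmorph_nat /= ta tb ab -[2%:R]/(1 + 1 : C') addrK mulr1.
have e : (1 - a * b) * (1 - a * b) = 0.
  by apply: sq; rewrite rmorphB rmorphM rmorph1 /= ta tb ab subrr.
have -> : a * (b * (2%:R - a * b)) = 1 - (1 - a * b) * (1 - a * b) by ring.
by rewrite e subr0.
Qed.

Lemma nice_units Z : nice Z -> nice (units_sub Z).
Proof.
move=> nZ; apply: (@nice_closed k affs (affnsub 11 Z)).
- exact: nice_affn.
- by move=> R y [].
- move=> R [x v] Zx.
  exists (fun c => exists i : 'I_3, c = v (lshift 8 i) * v (rshift 3 (lshift 5 i)) - 1) => R' f.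
  have E (a b : R) : f (a * b - 1) = 0 <-> f a * f b = 1.
    rewrite rmorphB rmorphM rmorph1 /=; split=> [/eqP|->]; last by rewrite subrr.
    by rewrite subr_eq0 => /eqP.
  split=> [[_ H] c [i ->]|H]; first by apply/E; exact: H.
  by split=> [|i]; [exact: (smem_map f Zx) | apply/E; apply: H; exists i].
- move=> C C' t st [x' v'] /= [Zx H].
  have [x Zx0 ex] := (proj1 nZ) C C' t st x' Zx.
  have ex1 (i : 'I_3) : exists ab : C * C, [/\ t ab.1 = v' (lshift 8 i), t ab.2 = v' (rshift 3 (lshift 5 i))
      & ab.1 * ab.2 = 1].
    by have [a [b [ta tb ab]]] := unit_lift st (H i); exists (a, b).
  have [ab abE] := choice ex1; have [v vE] := choice (fun i => proj1 st (v' i)).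
  exists (x, fun i : 'I_(3 + 8) => match split i with inl i => (ab i).1 | inr j =>
     match split (j : 'I_(3 + 5)) with inl i => (ab i).2 | inr _ => v i end end).
    split=> //= i; rewrite (unsplitK (inl i)) (unsplitK (inr (lshift 5 i))) (unsplitK (inl i)).
    by case: (abE i).
  rewrite /= ex; congr (_, _); apply/funext => i /=.
  rewrite -[i](@splitK 3 8); case: (@split 3 8 i) => j; rewrite unsplitK; first by case: (abE j).
  rewrite -[j](@splitK 3 5); case: (@split 3 5 j) => l; rewrite unsplitK; first by case: (abE l).
  by rewrite vE.
Qed.

Definition par_eqs R (y : affs R) (e : GL3 R * GL3 R) : Prop :=
  let v i := y.2 (inord i) in
  gmx e.1 = mx3 (v 0%N) 0 0 (v 6) (v 1%N) 0 (v 7) (v 8) (v 2) /\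
  gmxV e.2 = mx3 (v 2 ^+ q) (v 9) (v 10) 0 (v 1%N ^+ q) 0 0 (v 6 ^+ q) (v 0%N ^+ q).

Lemma units_inord R (y : affs R) : units (all_sub X) y ->
  [/\ y.2 (inord 0) * y.2 (inord 3) = 1, y.2 (inord 1) * y.2 (inord 4) = 1
    & y.2 (inord 2) * y.2 (inord 5) = 1].
Proof.
move=> [_ H]; have E (i : 'I_3) : y.2 (inord i) * y.2 (inord (3 + i)) = 1.
  rewrite -(H i); congr (y.2 _ * y.2 _); apply/val_inj;
  by rewrite /= inordK //; case: i => [[|[|[|]]]].
by split; [exact: (E e0) | exact: (E e1) | exact: (E e2)].
Qed.

Lemma ex_par R (y : affs R) : units (all_sub X) y -> exists e, par_eqs y e /\ zipE' q e.
Proof.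
move=> /units_inord [h0 h1 h2].
have hq (a b : R) : a * b = 1 -> a ^+ q * b ^+ q = 1 by move=> ab; rewrite -exprMn ab expr1n.
pose v i := y.2 (inord i).
pose e : GL3 R * GL3 R := (MkGL3 (tri_subproof (v 6) (v 7) (v 8) h0 h1 h2),
  MkGL3 (opp_subproof (v 6 ^+ q) (v 9) (v 10) (hq _ _ h0) (hq _ _ h1) (hq _ _ h2))).
exists e; split=> //; apply/(zipE'P r char_k); split; last by rewrite /= mxE.
have [fr frE] := ex_frob r char_k R.
by apply/(zipP r char_k _ _); rewrite /zip_eqs !mxE /= -!frE rmorph0; split.
Qed.

Lemma GL3_injV R (g h : GL3 R) : gmxV g = gmxV h -> g = h.
Proof. by move=> e; rewrite -[g]ginvK -[h]ginvK; congr ginv; exact: GL3_inj. Qed.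

Lemma par_uniq R (y : affs R) e e' : par_eqs y e -> par_eqs y e' -> e = e'.
Proof.
case: e e' => [g h] [g' h'] [/= h1 h2] [/= h1' h2']; congr (_, _).
  by apply: GL3_inj; rewrite h1 h1'.
by apply: GL3_injV; rewrite h2 h2'.
Qed.

Lemma map_mx3 (R R' : comNzRingType) (f : {rmorphism R -> R'}) (a b c d e g h i j : R) :
  map_mx f (mx3 a b c d e g h i j) = mx3 (f a) (f b) (f c) (f d) (f e) (f g) (f h) (f i) (f j).
Proof. by apply/matrixP; apply: forall3; apply: forall3; rewrite !mxE. Qed.

Lemma par_map R R' (f : {lrmorphism R -> R'}) (y : affs R) e :
  par_eqs y e -> par_eqs (fmap f y : affs R') (map2 f e).
Proof. by move=> [/= h1 h2]; split=> /=; rewrite ?h1 ?h2 map_mx3 ?rmorphXn ?rmorph0. Qed.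

Lemma par_surj R (e : GL3 R * GL3 R) (x : X R) : zipE' q e -> exists y : affs R,
  [/\ units (all_sub X) y, par_eqs y e & y.1 = x].
Proof.
case: e => g h H; have [E1 /= Bg] := H; have [E g01] := proj1 (zipE'P r char_k _) H.
have [_ g02 g12] := tri_entries Bg.
have /(zipP r char_k) [_ [b10 b20] b00 [b11 b22] [b12 b21]] := E.
have hq : (0 : R) ^+ q = 0 by have [fr frE] := ex_frob r char_k R; rewrite -frE rmorph0.
rewrite /= in g01; rewrite g01 hq in b12.
pose s := [:: gmx g e0 e0; gmx g e1 e1; gmx g e2 e2; gmxV g e0 e0; gmxV g e1 e1; gmxV g e2 e2;
  gmx g e1 e0; gmx g e2 e0; gmx g e2 e1; gmxV h e0 e1; gmxV h e0 e2].
have sE (i : nat) : (i < 11)%N -> nth 0 s (inord i : 'I_11) = nth 0 s i by move=> lt; rewrite inordK.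
exists (x, fun i : 'I_11 => nth 0 s i); split=> //.
  by split=> // -[[|[|[|//]]] Hi]; [exact: (diag_inv e0 Bg) | exact: (diag_inv e1 Bg) | exact: (diag_inv e2 Bg)].
split=> /=; rewrite !sE //= ?b00; apply/matrixP; apply: forall3; apply: forall3; rewrite !mxE //=.
Qed.

(** The parameters of [par_eqs] identify E' x Z with [units_sub Z], which is smooth over k. Hence it
    is enough to compare the two sides at field-valued points. *)
Lemma law_upgrade Z la s : nice Z -> regular_on Z s -> stable Z -> law_pt Z la s -> law Z la s.
Proof.
move=> nZ rs st H R e x Ee Zx.
have exe L (y : affs L) : exists e : GL3 L * GL3 L, units (all_sub X) y -> par_eqs y e /\ zipE' q e.
  have [u|] := pselect (units (all_sub X) y); last by exists (gone L, gone L).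
  by have [e' He'] := ex_par u; exists e'.
pose pe L (y : affs L) := projT1 (cid (exe L y)).
have peP L (y : affs L) : units (all_sub X) y -> par_eqs y (pe L y) /\ zipE' q (pe L y).
  by move=> u; rewrite /pe; case: cid => e' /= /(_ u).
pose base L (y : affs L) : X L := y.1.
have uall L (y : affs L) : units Z y -> units (all_sub X) y by move=> [_ H1]; split.
have uZ L (y : affs L) : units Z y -> Z L (base L y) by case.
have baseM L L' (f : {lrmorphism L -> L'}) (y : affs L) : base L' (fmap f y) = fmap f (base L y) by [].
have peM L L' (f : {lrmorphism L -> L'}) (y : affs L) : units (all_sub X) y ->
    pe L' (fmap f y) = map2 f (pe L y).
  move=> u; apply: (@par_uniq L' (fmap f y)); first by have [] := peP L' (fmap f y) (units_map f u).
  by apply: par_map; have [] := peP L y u.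
have key : forall L (y : affs L), units_sub Z L y ->
    s L (act (pe L y) (base L y)) = chi la (pe L y).1 * s L (base L y).
  apply: (@eq_on_points k affs (units_sub Z) (fun L y => s L (act (pe L y) (base L y)))
    (fun L y => chi la (pe L y).1 * s L (base L y)) (nice_units nZ)).
  - move=> L L' f y u; have uy := uall _ _ u; have [_ E'y] := peP L y uy.
    have [_ _ actF] := actP; rewrite peM // baseM -actF ?rs //; last by case: E'y.
    by apply: st => //; exact: uZ.
  - move=> L L' f y u; rewrite peM ?baseM; last exact: uall.
    by rewrite rmorphM rs ?chi_map //; exact: uZ.
  - move=> K y fK u; apply: H => //; last exact: uZ.
    by case: (peP K y (uall _ _ u)).
have [y [u Py ey]] := par_surj x Ee.
have uy : units Z y by case: u => _ H1; split=> //; rewrite ey.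
have ee : pe R y = e by apply: par_uniq Py; have [] := peP R y u.
by have := key R y uy; rewrite ee /base ey.
Qed.
End Law.

(* If (a,b,c) and (a',b',c') are two rows of the inverse of a matrix with columns x and y,
   then c x2 = 1, c y2 = 0, c' x2 = 0, c' y2 = 1 modulo (x0, x1, y0, y1). *)
Lemma unimod_aux (R : comNzRingType) (a b c a' b' c' x0 x1 x2 y0 y1 y2 : R) :
  a * x0 + b * x1 + c * x2 = 1 -> a' * y0 + b' * y1 + c' * y2 = 1 ->
  a * y0 + b * y1 + c * y2 = 0 -> a' * x0 + b' * x1 + c' * x2 = 0 ->
  exists c0 c1 c2 c3, c0 * x0 + c1 * y0 + c2 * x1 + c3 * y1 = 1.
Proof.
move=> h1 h2 h3 h4; pose u := a * x0 + b * x1; pose v' := a' * x0 + b' * x1.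
exists a, (a' * (1 - u) + a * v'), b, (b' * (1 - u) + b * v').
have hu : 1 - u = c * x2 by rewrite -h1 /u; ring.
have hv' : v' = - (c' * x2) by rewrite -[RHS]add0r -h4 /v'; ring.
have e : c * x2 * (c' * y2) = c * y2 * (c' * x2) by ring.
have hy : c * y2 = - (a * y0 + b * y1) by rewrite -[RHS]add0r -h3; ring.
rewrite hy in e.
have -> : a * x0 + (a' * (1 - u) + a * v') * y0 + b * x1 + (b' * (1 - u) + b * v') * y1 =
  u + (1 - u) * (a' * y0 + b' * y1) + (a * y0 + b * y1) * v' by rewrite /u /v'; ring.
have -> : a' * y0 + b' * y1 = 1 - c' * y2 by rewrite -h2; ring.
by rewrite mulrBr mulr1 {2}hu e hv'; ring.
Qed.

(** * Smoothness and transversality of the loci in X *)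

Section Loci.
Variables (k : closedFieldType) (X : kfunctor k) (w : kmor X (GLfun k)).
Hypothesis smw : smooth w.
Implicit Types (R A B C K L : comAlgType k) (Z U O : subfunctor X).

Definition ent i j R (x : X R) : R := gmx (w R x) i j.

Lemma entE i j R (x : X R) : ent i j x = gmx (w R x) i j. Proof. by []. Qed.

Lemma ent_map i j R R' (f : {lrmorphism R -> R'}) (x : X R) : ent i j (fmap f x) = f (ent i j x).
Proof. by rewrite /ent kfun_nat /= mxE. Qed.

Definition vanish (s : seq ('I_3 * 'I_3)) R (x : X R) : Prop :=
  forall i j, (i, j) \in s -> ent i j x = 0.

Lemma vanish_map s R R' (f : {lrmorphism R -> R'}) (x : X R) : vanish s x -> vanish s (fmap f x).
Proof. by move=> H i j ij; rewrite ent_map H ?rmorph0. Qed.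

Definition vanish_sub s : subfunctor X := SubFunctor (@vanish_map s).

Lemma nice_X : nice (all_sub X). Proof. exact: nice_smooth smw. Qed.

Lemma ex_mx_lift C C' (t : {lrmorphism C -> C'}) (N : 'M[C']_3) : sq_zero_thickening t ->
  exists M, map_mx t M = N /\ forall i j, N i j = 0 -> M i j = 0.
Proof.
move=> [st _]; have H (ij : 'I_3 * 'I_3) : exists c, t c = N ij.1 ij.2 /\ (N ij.1 ij.2 = 0 -> c = 0).
  have [->|ne] := pselect (N ij.1 ij.2 = 0); first by exists 0; rewrite rmorph0.
  by have [c cE] := st (N ij.1 ij.2); exists c.
have [c cE] := choice H; exists (\matrix_(i, j) c (i, j)); split.
  by apply/matrixP => i j; rewrite !mxE; case: (cE (i, j)).
by move=> i j Nij; rewrite mxE; case: (cE (i, j)) => _; apply.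
Qed.

Lemma nice_vanish s : nice (vanish_sub s).
Proof.
apply: (nice_closed nice_X) => //.
- move=> R x _; exists (fun c => exists i j, (i, j) \in s /\ c = ent i j x) => R' f; split.
    by move=> H c [i [j [ij ->]]]; rewrite -ent_map; exact: H.
  by move=> H i j ij; rewrite ent_map; apply: H; exists i, j.
- move=> C C' t st x' Zx'; have [M [tM M0]] := ex_mx_lift (gmx (w C' x')) st.
  have [x e gx] := X_lift smw st tM; exists x => // i j ij.
  by rewrite /ent gx; apply: M0; exact: Zx'.
Qed.

Lemma j0_sq R : sq_zero_thickening (j0 R 1).
Proof.
split; first exact: j0_surj.
move=> x y /jetT_dvd [x' ->] /jetT_dvd [y' ->].
by rewrite mulrACA -expr2 jTN mul0r.
Qed.

Lemma jet_lift R (x : X R) (D : 'M[jet R 1]_3) : exists y : X (jet R 1),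
  fmap (j0 R 1) y = x /\ forall i j, ent i j y = jC R 1 (ent i j x) + jT R 1 * D i j.
Proof.
have [|y e gy] := X_lift smw (M := map_mx (jC R 1) (gmx (w R x)) + jT R 1 *: D) (@j0_sq R) (x' := x).
  by apply/matrixP => i j; rewrite !mxE rmorphD rmorphM /= j0C j0T mul0r addr0.
by exists y; split=> // i j; rewrite /ent gy !mxE.
Qed.

Lemma transversal_vanish s i j : (i, j) \notin s -> transversal (vanish_sub s) (ent i j).
Proof.
move=> ns K x fK Zx xij; have [y [y0 gy]] := jet_lift x (delta_mx i j).
exists y; split=> // [i' j' ij'|].
  rewrite gy mxE Zx // rmorph0 add0r.
  have [e1|] := eqVneq i' i; have [e2|] := eqVneq j' j; rewrite ?mulr0 //.
  by rewrite e1 e2 (negPf ns) in ij'.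
by rewrite gy mxE !eqxx xij rmorph0 add0r mulr1.
Qed.

Lemma transversal_open Z O c : open_in Z O -> transversal Z c -> transversal (meet Z O) c.
Proof.
move=> oO tr K x fK [Zx Ox] cx; have [y [Zy y0 cy]] := tr K x fK Zx cx.
exists y; split=> //; split=> //.
by apply: open_thick oO Zy (@j0_surj k K 1) (@j0_nil k K 1) _; rewrite y0.
Qed.

Definition f3 R (x : X R) : R := ent e0 e0 x * ent e1 e2 x - ent e0 e2 x * ent e1 e0 x.
Definition f2 R (x : X R) : R := ent e0 e0 x * ent e1 e1 x - ent e0 e1 x * ent e1 e0 x.

Lemma f3_map R R' (f : {lrmorphism R -> R'}) (x : X R) : f3 (fmap f x) = f (f3 x).
Proof. by rewrite /f3 !ent_map rmorphB !rmorphM. Qed.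
Lemma f2_map R R' (f : {lrmorphism R -> R'}) (x : X R) : f2 (fmap f x) = f (f2 x).
Proof. by rewrite /f2 !ent_map rmorphB !rmorphM. Qed.

Lemma f3_sub_map R R' (f : {lrmorphism R -> R'}) (x : X R) : f3 x = 0 -> f3 (fmap f x) = 0.
Proof. by rewrite f3_map => ->; rewrite rmorph0. Qed.
Definition D2 : subfunctor X := SubFunctor f3_sub_map.

(** These four entries are, up to sign, the partial derivatives of f3. They have no common zero,
    since the columns 0 and 2 of an invertible matrix are independent. *)
Lemma unimodular R (x : X R) : exists c00 c02 c10 c12 : R,
  c00 * ent e0 e0 x + c02 * ent e0 e2 x + c10 * ent e1 e0 x + c12 * ent e1 e2 x = 1.
Proof.
have H := gmxVM (w R x); set V := gmxV _ in H; set g := gmx _ in H.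
have E i j : V i e0 * g e0 j + V i e1 * g e1 j + V i e2 * g e2 j = (i == j)%:R.
  by rewrite -mulmx3 H mxE.
have [c0 [c1 [c2 [c3 e]]]] := unimod_aux (E e0 e0) (E e2 e2) (E e0 e2) (E e2 e0).
by exists c0, c1, c2, c3.
Qed.

Definition mx4 R (c00 c02 c10 c12 : R) : 'M[R]_3 := mx3 c00 0 c02 c10 0 c12 0 0 0.

Lemma mx4E R (c00 c02 c10 c12 : R) : let M := mx4 c00 c02 c10 c12 in
  [/\ M e0 e0 = c00, M e0 e2 = c02, M e1 e0 = c10 & M e1 e2 = c12] /\ M e0 e1 = 0 /\ M e1 e1 = 0.
Proof. by rewrite /= !mxE. Qed.

Lemma transversal_f3 : transversal (all_sub X) f3.
Proof.
move=> K x fK _ x3; have [c00 [c02 [c10 [c12 e]]]] := unimodular x.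
(* The derivative of f3 in this direction is the combination from [unimodular], that is 1. *)
have [y [y0 gy]] := jet_lift x (mx4 (jC K 1 c12) (- jC K 1 c10) (- jC K 1 c02) (jC K 1 c00)).
have [[m00 m02 m10 m12] _] := mx4E (jC K 1 c12) (- jC K 1 c10) (- jC K 1 c02) (jC K 1 c00).
exists y; split=> //; rewrite /f3 !gy m00 m02 m10 m12 {gy m00 m02 m10 m12}.
have x3' : ent e0 e0 x * ent e1 e2 x = ent e0 e2 x * ent e1 e0 x.
  by apply/eqP; rewrite -subr_eq0; apply/eqP.
have x3j : jC K 1 (ent e0 e0 x) * jC K 1 (ent e1 e2 x) = jC K 1 (ent e0 e2 x) * jC K 1 (ent e1 e0 x).
  by rewrite -!rmorphM x3'.
have ej : jC K 1 c00 * jC K 1 (ent e0 e0 x) + jC K 1 c02 * jC K 1 (ent e0 e2 x) +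
    jC K 1 c10 * jC K 1 (ent e1 e0 x) + jC K 1 c12 * jC K 1 (ent e1 e2 x) = 1.
  by rewrite -!rmorphM -!rmorphD e rmorph1.
have T2 : jT K 1 * jT K 1 = 0 by rewrite -expr2 jTN.
move: (jC K 1 (ent e0 e0 x)) (jC K 1 (ent e1 e2 x)) (jC K 1 (ent e0 e2 x)) (jC K 1 (ent e1 e0 x))
  (jC K 1 c00) (jC K 1 c02) (jC K 1 c10) (jC K 1 c12) (jT K 1) x3j ej T2
  => a b c d c1 c2 c3 c4 t h1 h2 h3.
have -> : (a + t * c4) * (b + t * c1) - (c + t * - c3) * (d + t * - c2) =
  (a * b - c * d) + t * (c1 * a + c2 * c + c3 * d + c4 * b) + t * t * (c4 * c1 - c3 * c2) by ring.
by rewrite h1 h2 h3 subrr mulr1 mul0r add0r addr0.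
Qed.

Lemma nice_D2 : nice D2.
Proof.
apply: (nice_closed nice_X) => //.
- move=> R x _; exists (fun c => c = f3 x) => R' f /=; rewrite f3_map; split.
    by move=> H c ->.
  exact.
- move=> C C' t st x' x3; have [x _ ex] := (proj1 nice_X) C C' t st x' I.
  have [c00 [c02 [c10 [c12 e]]]] := unimodular x.
  have tn : t (f3 x) = 0 by rewrite -f3_map ex.
  have n2 : f3 x * f3 x = 0 by apply: (proj2 st).
  (* A Newton correction along the direction in which f3 has derivative 1; f3 x has square zero. *)
  have [|y ey gy] := X_lift smw (M := gmx (w C x) - f3 x *: mx4 c12 (- c10) (- c02) c00) st (x' := x').
    apply/matrixP => i j; rewrite -ex kfun_nat !mxE rmorphB rmorphM /= tn mul0r subr0; by [].
  exists y => //; rewrite /= /f3 /ent gy !mxE /= -!/(ent _ _ x).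
  move: n2 e; rewrite /f3; move: (ent e0 e0 x) (ent e1 e2 x) (ent e0 e2 x) (ent e1 e0 x) => a b c d n2 e.
  set n := a * b - c * d in n2 *.
  have -> : (a - n * c12) * (b - n * c00) - (c - n * - c10) * (d - n * - c02) =
    n - n * (c00 * a + c02 * c + c10 * d + c12 * b) + n * n * (c12 * c00 - c10 * c02) by rewrite /n; ring.
  by rewrite e n2 mulr1 subrr mul0r addr0.
Qed.

(* The two minors vanish only where the third one, of the columns 1 and 2, is invertible. *)
Lemma transversal_f2 : transversal D2 f2.
Proof.
move=> K x fK x3 x2; have x3' : f3 x = 0 := x3.
have H := gmxMV (w K x); set V := gmxV _ in H; set g := gmx _ in H.
have E i j : g i e0 * V e0 j + g i e1 * V e1 j + g i e2 * V e2 j = (i == j)%:R.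
  by rewrite -mulmx3 H mxE.
pose n := g e0 e1 * g e1 e2 - g e0 e2 * g e1 e1.
have m3 : g e0 e0 * g e1 e2 - g e0 e2 * g e1 e0 = 0 := x3'.
have m2 : g e0 e0 * g e1 e1 - g e0 e1 * g e1 e0 = 0 := x2.
have n1 : n * (V e1 e0 * V e2 e1 - V e2 e0 * V e1 e1) = 1.
  have -> : 1 = (g e0 e0 * V e0 e0 + g e0 e1 * V e1 e0 + g e0 e2 * V e2 e0) *
    (g e1 e0 * V e0 e1 + g e1 e1 * V e1 e1 + g e1 e2 * V e2 e1) -
    (g e0 e0 * V e0 e1 + g e0 e1 * V e1 e1 + g e0 e2 * V e2 e1) *
    (g e1 e0 * V e0 e0 + g e1 e1 * V e1 e0 + g e1 e2 * V e2 e0).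
    by rewrite !E /= mulr1 mul0r subr0.
  rewrite -[LHS]addr0 -[X in _ + X](mul0r (V e0 e0 * V e2 e1 - V e2 e0 * V e0 e1)) -m3.
  rewrite -[LHS]addr0 -[X in _ + X](mul0r (V e0 e0 * V e1 e1 - V e1 e0 * V e0 e1)) -m2 /n.
  by ring.
pose c := V e1 e0 * V e2 e1 - V e2 e0 * V e1 e1.
have nz (a : K) : n * a = 0 -> a = 0 by move=> e; rewrite -[a]mul1r -n1 mulrAC e mul0r.
have g00 : g e0 e0 = 0.
  apply: nz; have -> : n * g e0 e0 = g e0 e1 * (g e0 e0 * g e1 e2 - g e0 e2 * g e1 e0) -
    g e0 e2 * (g e0 e0 * g e1 e1 - g e0 e1 * g e1 e0) by rewrite /n; ring.
  by rewrite m3 m2 !mulr0 subr0.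
have g10 : g e1 e0 = 0.
  apply: nz; have -> : n * g e1 e0 = g e1 e1 * (g e0 e0 * g e1 e2 - g e0 e2 * g e1 e0) -
    g e1 e2 * (g e0 e0 * g e1 e1 - g e0 e1 * g e1 e0) by rewrite /n; ring.
  by rewrite m3 m2 !mulr0 subr0.
have [y [y0 gy]] := jet_lift x (mx4 (- jC K 1 (g e0 e2 * c)) 0 (- jC K 1 (g e1 e2 * c)) 0).
have [[m00 m02 m10 m12] [m01 m11]] := mx4E (- jC K 1 (g e0 e2 * c)) 0 (- jC K 1 (g e1 e2 * c)) 0.
have n1j : jC K 1 n * jC K 1 c = 1 by rewrite -rmorphM n1 rmorph1.
have nj : jC K 1 n = jC K 1 (g e0 e1) * jC K 1 (g e1 e2) - jC K 1 (g e0 e2) * jC K 1 (g e1 e1).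
  by rewrite -!rmorphM -rmorphB.
have g00' : ent e0 e0 x = 0 := g00; have g10' : ent e1 e0 x = 0 := g10.
have gE i j : ent i j x = g i j by [].
exists y; split=> //=; rewrite /f3 /f2 !gy m00 ?m02 m10 ?m12 ?m01 ?m11 g00' g10' !rmorph0 !mulr0 !addr0 !add0r !gE
  !(rmorphM (jC K 1)).
  by ring.
by rewrite -[RHS]mulr1 -n1j nj; ring.
Qed.
End Loci.

Lemma det3 (R : comNzRingType) (A : 'M[R]_3) : \det A =
  A e0 e0 * (A e1 e1 * A e2 e2 - A e1 e2 * A e2 e1) -
  A e0 e1 * (A e1 e0 * A e2 e2 - A e1 e2 * A e2 e0) +
  A e0 e2 * (A e1 e0 * A e2 e1 - A e1 e1 * A e2 e0).
Proof.
pose f i j := A (inord i) (inord j).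
have fE i j : A i j = f i j by rewrite /f !inord_val.
have det2 (B : 'M[R]_2) : \det B = B 0 0 * B (lift 0 0) (lift 0 0) - B 0 (lift 0 0) * B (lift 0 0) 0.
  rewrite (expand_det_row _ 0) !big_ord_recl big_ord0 addr0 /cofactor !det_mx11 !mxE.
  rewrite /bump /= !addn0 expr0 expr1 mul1r mulN1r mulrN.
  by congr (_ - _ * B _ _); apply/val_inj.
rewrite (expand_det_row _ e0) sum3 /cofactor !det2 !mxE !fE /= /bump /= expr0 expr1 sqrrN expr1n.
by rewrite !mul1r mulN1r mulrN.
Qed.

(** * The action on matrix entries and the weights of the semi-invariants *)

Section Action.
Variables (p r : nat) (k : closedFieldType).
Hypothesis char_k : p \in [pchar k].
Local Notation q := (p ^ r)%N.
Variables (X : kfunctor k) (act : pre_action X) (w : kmor X (GLfun k)).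
Hypothesis actP : Defs.is_action (@zipE q) act.
Hypothesis w_act : forall (R : comAlgType k) (e : GL3 R * GL3 R) (x : X R), zipE q e ->
    w R (act e x) = zip_act e (w R x).
Hypothesis smw : smooth w.
Implicit Types (R A B C K L : comAlgType k) (Z U O : subfunctor X).
Local Notation ent := (ent w).

Lemma act1 R (x : X R) : act (gone R, gone R) x = x.
Proof. by case: actP. Qed.

Lemma actM R (e e' : GL3 R * GL3 R) (x : X R) : zipE q e -> zipE q e' ->
  act (mul2 e e') x = act e (act e' x).
Proof. by case: actP => _ H _; exact: H. Qed.

Lemma act_map R R' (f : {lrmorphism R -> R'}) (e : GL3 R * GL3 R) (x : X R) : zipE q e ->
  fmap f (act e x) = act (map2 f e) (fmap f x).
Proof. by case: actP => _ _ H; exact: H. Qed.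

Lemma zipE_map R R' (f : {lrmorphism R -> R'}) (e : GL3 R * GL3 R) : zipE q e -> zipE q (map2 f e).
Proof.
case: e => x y /(zipP r char_k) [[a02 a12] [b10 b20] b00 [b11 b22] [b12 b21]].
apply/(zipP r char_k); rewrite /zip_eqs !mxE a02 a12 b10 b20 b00 b11 b22 b12 b21.
by rewrite !rmorph0 !rmorphXn; split.
Qed.

Lemma zipE'_map R R' (f : {lrmorphism R -> R'}) (e : GL3 R * GL3 R) : zipE' q e -> zipE' q (map2 f e).
Proof.
move=> /(zipE'P r char_k) [H h]; apply/(zipE'P r char_k); split; first exact: zipE_map.
by rewrite /= mxE h rmorph0.
Qed.

Lemma actK R (e : GL3 R * GL3 R) (x : X R) : zipE q e -> act (inv2 e) (act e x) = x.
Proof.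
move=> H; rewrite -actM //; last exact: (@zipE_inv p r k char_k).
by rewrite /mul2 /inv2 /= !gVmul act1.
Qed.

Lemma actVK R (e : GL3 R * GL3 R) (x : X R) : zipE q e -> act e (act (inv2 e) x) = x.
Proof.
move=> H; rewrite -actM //; last exact: (@zipE_inv p r k char_k).
by rewrite /mul2 /inv2 /= !gmulV act1.
Qed.

Lemma zipE'_inv R (e : GL3 R * GL3 R) : zipE' q e -> zipE' q (inv2 e).
Proof. by move=> [H1 H2]; split; [exact: (@zipE_inv p r k char_k _ _ H1) | exact: in_BV]. Qed.

Lemma ent_act R (e : GL3 R * GL3 R) (x : X R) i j : zipE q e ->
  ent i j (act e x) = (gmx e.1 *m gmx (w R x) *m gmxV e.2) i j.
Proof. by move=> H; rewrite /ent w_act. Qed.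

Lemma ent_actE R (e : GL3 R * GL3 R) (x : X R) (i : 'I_3) : zipE q e -> (i < 2)%N ->
  let r j := gmx e.1 i e0 * ent e0 j x + gmx e.1 i e1 * ent e1 j x in
  [/\ ent i e0 (act e x) = gmx e.1 e2 e2 ^+ q * r e0,
      ent i e1 (act e x) = gmxV e.2 e0 e1 * r e0 + gmx e.1 e1 e1 ^+ q * r e1 + gmx e.1 e1 e0 ^+ q * r e2
    & ent i e2 (act e x) = gmxV e.2 e0 e2 * r e0 + gmx e.1 e0 e1 ^+ q * r e1 + gmx e.1 e0 e0 ^+ q * r e2].
Proof.
move=> H i2; case: e H => a b H.
have /(zipP r char_k) [[a02 a12] [b10 b20] b00 [b11 b22] [b12 b21]] := H.
have ai2 : gmx a i e2 = 0 by case: i i2 => [[|[|//]]] Hi _;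
  [rewrite -a02 | rewrite -a12]; congr (gmx a _ _); exact/val_inj.
have rE j : (gmx a *m gmx (w R x)) i j = gmx a i e0 * ent e0 j x + gmx a i e1 * ent e1 j x.
  by rewrite mulmx3 ai2 mul0r addr0.
by move=> rr; rewrite /rr; split; rewrite ent_act // mulmx3 !rE /= ?b10 ?b20 ?b00 ?b11 ?b22 ?b12 ?b21
  ?mulr0 ?addr0; rewrite ![_ * (_ + _)]mulrC.
Qed.

Lemma zipE'_E R (e : GL3 R * GL3 R) : zipE' q e -> zipE q e. Proof. by case. Qed.

Section Borel.
Variables (R : comAlgType k) (e : GL3 R * GL3 R) (x : X R).
Hypothesis E' : zipE' q e.
Let a i j := gmx e.1 i j.

Lemma act00 : ent e0 e0 (act e x) = a e0 e0 * a e2 e2 ^+ q * ent e0 e0 x.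
Proof.
have [H h] := proj1 (zipE'P r char_k _) E'.
by have [-> _ _] := ent_actE x (i := e0) H isT; rewrite h mul0r addr0 /a; ring.
Qed.

Lemma act10 : ent e1 e0 (act e x) = a e2 e2 ^+ q * (a e1 e0 * ent e0 e0 x + a e1 e1 * ent e1 e0 x).
Proof.
have [H h] := proj1 (zipE'P r char_k _) E'.
by have [-> _ _] := ent_actE x (i := e1) H isT.
Qed.

Lemma act02 : ent e0 e2 (act e x) = a e0 e0 * (gmxV e.2 e0 e2 * ent e0 e0 x + a e0 e0 ^+ q * ent e0 e2 x)
  + a e0 e0 * a e0 e1 ^+ q * ent e0 e1 x.
Proof.
have [H h] := proj1 (zipE'P r char_k _) E'.
by have [_ _ ->] := ent_actE x (i := e0) H isT; rewrite !h !mul0r !addr0 /a h; ring.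
Qed.

Lemma act01 : ent e0 e1 (act e x) = a e0 e0 *
  (gmxV e.2 e0 e1 * ent e0 e0 x + a e1 e1 ^+ q * ent e0 e1 x + a e1 e0 ^+ q * ent e0 e2 x).
Proof.
have [H h] := proj1 (zipE'P r char_k _) E'.
by have [_ -> _] := ent_actE x (i := e0) H isT; rewrite !h !mul0r !addr0 /a; ring.
Qed.

Lemma act_f3 : f3 w (act e x) = a e0 e0 ^+ q.+1 * a e1 e1 * a e2 e2 ^+ q * f3 w x.
Proof.
have [H h] := proj1 (zipE'P r char_k _) E'; rewrite /f3.
have [-> _ ->] := ent_actE x (i := e0) H isT.
have [-> _ ->] := ent_actE x (i := e1) H isT.
have q0 : (0 : R) ^+ q = 0 by have [fr frE] := ex_frob r char_k R; rewrite -frE rmorph0.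
by rewrite !h q0 exprS /a; ring.
Qed.

Lemma act_f2 : f2 w (act e x) = a e0 e0 * a e1 e1 * a e2 e2 ^+ q *
  (a e1 e1 ^+ q * f2 w x + a e1 e0 ^+ q * f3 w x).
Proof.
have [H h] := proj1 (zipE'P r char_k _) E'; rewrite /f2 /f3.
have [-> -> _] := ent_actE x (i := e0) H isT.
have [-> -> _] := ent_actE x (i := e1) H isT.
by rewrite !h /a; ring.
Qed.

Lemma act_det : \det (gmx (w R (act e x))) =
  (a e0 e0 * a e1 e1 * a e2 e2) ^+ q.+1 * \det (gmx (w R x)).
Proof.
have [H h] := proj1 (zipE'P r char_k _) E'.
have [_ Bg] := E'; have [h01 h02 h12] := tri_entries Bg.
have := H; rewrite [e]surjective_pairing => /(zipP r char_k) [_ [b10 b20] b00 [b11 b22] [b12 b21]].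
rewrite w_act //= !det_mulmx.
have dg : \det (gmx e.1) = a e0 e0 * a e1 e1 * a e2 e2 by rewrite (det_trig Bg) prod3.
have dV : \det (gmxV e.2) = (a e0 e0 * a e1 e1 * a e2 e2) ^+ q.
  have q0 : (0 : R) ^+ q = 0 by have [fr frE] := ex_frob r char_k R; rewrite -frE rmorph0.
  by rewrite det3 b10 b20 b00 b11 b22 b12 h q0 !exprMn /a; ring.
by rewrite dg dV exprS; ring.
Qed.
End Borel.

End Action.

Lemma closed_avoid (k : closedFieldType) (s : seq k) : exists c, c \notin s.
Proof.
have /closed_nonrootP [c] : \prod_(a <- s) ('X - a%:P) != 0 by exact/monic_neq0/monic_prod_XsubC.
by rewrite root_prod_XsubC; exists c.
Qed.

Lemma closed_avoids (k : closedFieldType) (s : seq k) n :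
  exists t, [/\ uniq t, size t = n & forall c, c \in t -> c \notin s].
Proof.
elim: n => [|n [t [ut st ts]]]; first by exists [::].
have [c] := closed_avoid (s ++ t); rewrite mem_cat negb_or => /andP [cs ct].
exists (c :: t); split=> /=; rewrite ?ct ?st // => d.
by rewrite inE => /orP [/eqP ->|/ts].
Qed.

Section PolyInf.
Variables (k : closedFieldType) (R : comAlgType k).

(** Differences of distinct elements of k are units of R, so the usual count of roots works over
    every k-algebra. *)
Lemma poly_seq0 (p : {poly R}) (s : seq k) : uniq s -> (size p <= size s)%N ->
  (forall c, c \in s -> p.[c%:A] = 0) -> p = 0.
Proof.
elim: s p => [|c s IH] p; first by move=> _; rewrite leqn0 size_poly_eq0 => /eqP.
move=> /= /andP [cs us] sz H.
have /factor_theorem [u pE] : root p c%:A by apply/rootP; apply: H; rewrite inE eqxx.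
have [u0|u0] := eqVneq u 0; first by rewrite pE u0 mul0r.
have u0' : u = 0; last by rewrite u0' eqxx in u0.
apply: (IH) => //.
  by move: sz; rewrite pE size_Mmonic ?monicXsubC // size_XsubC addn2.
move=> d ds; have := H d; rewrite inE ds orbT => /(_ isT).
rewrite pE hornerM hornerXsubC -scalerBl mulr_algr => e.
have dc : d - c != 0 by rewrite subr_eq0; apply: contraNneq cs => <-.
by rewrite -[LHS]scale1r -(mulVf dc) -scalerA e scaler0.
Qed.

Lemma poly_inf (p : {poly R}) (s : seq k) :
  (forall c, c \notin s -> p.[c%:A] = 0) -> p = 0.
Proof.
move=> H; have [t [ut st ts]] := closed_avoids s (size p).
by apply: (@poly_seq0 p t) => // [|c /ts]; [rewrite st | exact: H].
Qed.

Lemma poly_inf_eq (p p' : {poly R}) (s : seq k) :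
  (forall c, c \notin s -> p.[c%:A] = p'.[c%:A]) -> p = p'.
Proof.
move=> H; apply/eqP; rewrite -subr_eq0; apply/eqP/(@poly_inf _ s) => c cs.
by rewrite hornerD hornerN H // subrr.
Qed.

(* T^D p(1/T) when p has degree at most D *)
Definition flip (D : nat) (p : {poly R}) : {poly R} := \poly_(i < D.+1) p`_(D - i).

Lemma flip_horner D (p : {poly R}) (t t' : R) : (size p <= D.+1)%N -> t * t' = 1 ->
  (flip D p).[t] = t ^+ D * p.[t'].
Proof.
move=> sp tt'; rewrite (horner_coef_wide t' sp) horner_poly mulr_sumr.
rewrite (reindex_inj rev_ord_inj) /=; apply: eq_bigr => i _.
have iD : (i <= D)%N by rewrite -ltnS.
rewrite subSS subKn // mulrCA; congr (_ * _).
have -> : t ^+ D = t ^+ (D - i) * t ^+ i by rewrite -exprD subnK.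
by rewrite -mulrA -exprMn tt' expr1n mulr1.
Qed.
End PolyInf.

Section Orbit.
Variables (p r : nat) (k : closedFieldType).
Hypothesis char_k : p \in [pchar k].
Local Notation q := (p ^ r)%N.
Variables (X : kfunctor k) (act : pre_action X) (w : kmor X (GLfun k)).
Hypothesis actP : Defs.is_action (@zipE q) act.
Hypothesis w_act : forall (R : comAlgType k) (e : GL3 R * GL3 R) (x : X R), zipE q e ->
    w R (act e x) = zip_act e (w R x).
Hypothesis smw : smooth w.
Implicit Types (R A B C K L : comAlgType k) (Z U O : subfunctor X).
Local Notation ent := (ent w).
Local Notation stable := (stable p r act).
Local Notation law := (law p r act).
Local Notation law_pt := (law_pt p r act).

(** [D1] is a divisor stable under E', [Cb] the preimage of the closure of a one-dimensional flag
    stratum inside it, and [Xe] the preimage of the smallest zip stratum. *)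
Definition D1 := vanish_sub w [:: (e0, e0)].
Definition Cb := vanish_sub w [:: (e0, e0); (e0, e2)].
Definition Xe := vanish_sub w [:: (e0, e0); (e1, e0)].

Lemma D1P R (x : X R) : D1 R x <-> ent e0 e0 x = 0.
Proof.
split=> [H|h i j]; first by apply: H; rewrite inE.
by rewrite inE => /eqP [-> ->].
Qed.

Lemma CbP R (x : X R) : Cb R x <-> ent e0 e0 x = 0 /\ ent e0 e2 x = 0.
Proof.
split=> [H|[h h'] i j]; first by split; apply: H; rewrite !inE.
by rewrite !inE => /orP [] /eqP [-> ->].
Qed.

Lemma XeP R (x : X R) : Xe R x <-> ent e0 e0 x = 0 /\ ent e1 e0 x = 0.
Proof.
split=> [H|[h h'] i j]; first by split; apply: H; rewrite !inE.
by rewrite !inE => /orP [] /eqP [-> ->].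
Qed.

Lemma exp0q R : (0 : R) ^+ q = 0.
Proof. by have [fr frE] := ex_frob r char_k R; rewrite -frE rmorph0. Qed.

Lemma tri01 R (e : GL3 R * GL3 R) : zipE' q e -> gmx e.1 e0 e1 = 0.
Proof. by case/(zipE'P r char_k). Qed.

Lemma stable_D1 : stable D1.
Proof. by move=> R e x E /D1P h; apply/D1P; rewrite (act00 char_k w_act) // h mulr0. Qed.

Lemma stable_Cb : stable Cb.
Proof.
move=> R e x E /CbP [h h']; apply/CbP; split; first by rewrite (act00 char_k w_act) // h mulr0.
by rewrite (act02 char_k w_act) // h h' tri01 // exp0q !(mulr0, mul0r, addr0).
Qed.

Lemma Xe_orbit R (e : GL3 R * GL3 R) (x : X R) : zipE q e -> Xe R x -> Xe R (act e x).
Proof.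
move=> E /XeP [h h']; apply/XeP.
have [-> _ _] := ent_actE char_k w_act x (i := e0) E isT.
have [-> _ _] := ent_actE char_k w_act x (i := e1) E isT.
by rewrite h h' !(mulr0, addr0).
Qed.

Lemma stable_all : stable (all_sub X). Proof. by []. Qed.

Lemma stable_meet Z O : stable Z -> stable O -> stable (meet Z O).
Proof. by move=> sZ sO R e x E [Zx Ox]; split; [exact: sZ | exact: sO]. Qed.

Lemma chi_nat a b c R (g : GL3 R) : chi (wt (Posz a) (Posz b) (Posz c)) g =
  gmx g e0 e0 ^+ a * gmx g e1 e1 ^+ b * gmx g e2 e2 ^+ c.
Proof. by rewrite chiE. Qed.

Lemma law_f3 : law (all_sub X) (wt q.+1 1 q) (f3 w).
Proof.
move=> R e x E _; rewrite (act_f3 char_k w_act) // chi_nat expr1; by [].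
Qed.

Lemma law_det : law (all_sub X) (wt q.+1 q.+1 q.+1) (fun R x => \det (gmx (w R x))).
Proof.
by move=> R e x E _; rewrite (act_det char_k w_act) // chi_nat !exprMn.
Qed.

Lemma law_10 : law D1 (wt 0 1 q) (ent e1 e0).
Proof.
move=> R e x E /D1P h; rewrite (act10 char_k w_act) // h mulr0 add0r chi_nat expr0 expr1 mul1r.
by rewrite mulrA [_ ^+ q * _]mulrC.
Qed.

Lemma law_02 : law D1 (wt q.+1 0 0) (ent e0 e2).
Proof.
move=> R e x E /D1P h; rewrite (act02 char_k w_act) // h tri01 // exp0q chi_nat !expr0 exprS.
by rewrite !(mulr0, mul0r, addr0, add0r, mulr1) mulrA.
Qed.

Lemma law_01 : law Cb (wt 1 q 0) (ent e0 e1).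
Proof.
move=> R e x E /CbP [h h']; rewrite (act01 char_k w_act) // h h' chi_nat expr0 expr1.
by rewrite !(mulr0, addr0, add0r, mulr1) mulrA.
Qed.

Lemma lawW Z Z' la s : (forall R (x : X R), Z R x -> Z' R x) -> law Z' la s -> law Z la s.
Proof. by move=> sub H R e x E Zx; apply: H => //; exact: sub. Qed.

(** Where c is nonzero it cancels from the law of s. At a zero of c the law is multiplied out along
    a transversal jet, with the group element extended as a constant jet, and the factor T is
    removed. *)
Lemma law_div Z la lb (s c s' : forall R, X R -> R) : nice Z -> stable Z ->
  regular_on Z s' -> regular_on Z c -> transversal Z c ->
  (forall R (x : X R), Z R x -> s R x = c R x * s' R x) ->
  law Z la s -> law Z lb c -> law Z (la - lb) s'.
Proof.
move=> nZ sZ rs' rc tr sE ls lc; apply: (law_upgrade char_k actP nZ rs' sZ) => K e x fK E Zx.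
have Be : in_B e.1 by case: E.
suff H : chi lb e.1 * s' K (act e x) = chi la e.1 * s' K x.
  rewrite chiD // mulrAC -H mulrAC chiN // mul1r; by [].
have prod R (e' : GL3 R * GL3 R) (y : X R) : zipE' q e' -> Z R y ->
    c R y * (chi lb e'.1 * s' R (act e' y) - chi la e'.1 * s' R y) = 0.
  move=> E1 Zy; have E2 := ls R e' y E1 Zy.
  rewrite !sE // in E2; last exact: sZ.
  rewrite lc // in E2.
  apply/eqP; rewrite mulrBr subr_eq0; apply/eqP.
  by rewrite mulrA [c R y * _]mulrC E2 mulrCA.
apply/eqP; rewrite -subr_eq0; apply/eqP.
have [cx|cx] := pselect (c K x = 0); last first.
  by apply: (field_mul0 fK (x := c K x)) => //; exact: prod.
have [y [Zy y0 cy]] := tr K x fK Zx cx.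
have E' : zipE' q (map2 (jC K 1) e) by exact: zipE'_map char_k _ _ _ _ E.
have := prod _ _ _ E' Zy; rewrite cy -[jT K 1]expr1 => /jetT_mul.
have jK : forall g : GL3 K, gmap (j0 K 1) (gmap (jC K 1) g) = g.
  by move=> g; apply: GL3_inj; apply/matrixP => i j; rewrite !mxE; exact: j0C.
rewrite rmorphB !rmorphM /= -!chi_map jK -!rs' // ?y0; last exact: sZ.
rewrite (act_map actP) ?y0 //; last by case: E'.
by rewrite /map2 /= !jK -surjective_pairing.
Qed.
End Orbit.

(** * Translation by a unipotent of L and the degree bound *)

Section UE.
Variable R : comNzRingType.

Lemma ue_subproof (t : R) : mx3 1 t 0 0 1 0 0 0 1 *m mx3 1 (- t) 0 0 1 0 0 0 1 == 1%:M.
Proof.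
apply/eqP/matrixP; apply: forall3; apply: forall3; rewrite mulmx3 !mxE /=; ring.
Qed.

Lemma ue2_subproof (t : R) : mx3 1 0 0 0 1 (- t) 0 0 1 *m mx3 1 0 0 0 1 t 0 0 1 == 1%:M.
Proof.
apply/eqP/matrixP; apply: forall3; apply: forall3; rewrite mulmx3 !mxE /=; ring.
Qed.

Definition uE (q : nat) (t : R) : GL3 R * GL3 R := (MkGL3 (ue_subproof t), MkGL3 (ue2_subproof (t ^+ q))).

Lemma re_subproof (t : R) : mx3 t 1 0 (-1) 0 0 0 0 1 *m mx3 0 (-1) 0 1 t 0 0 0 1 == 1%:M.
Proof.
apply/eqP/matrixP; apply: forall3; apply: forall3; rewrite mulmx3 !mxE /=; ring.
Qed.

(** For invertible t this equals b u_(1/t) with b lower triangular of diagonal (t, 1/t, 1). It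
    continues the family of the u_s to s at infinity on the projective line of cosets of the Borel
    in L. *)
Definition rE (t : R) : GL3 R := MkGL3 (re_subproof t).
End UE.

Section Phi.
Variables (p r : nat) (k : closedFieldType).
Hypothesis char_k : p \in [pchar k].
Local Notation q := (p ^ r)%N.
Variables (X : kfunctor k) (act : pre_action X) (w : kmor X (GLfun k)).
Hypothesis actP : Defs.is_action (@zipE q) act.
Hypothesis w_act : forall (R : comAlgType k) (e : GL3 R * GL3 R) (x : X R), zipE q e ->
    w R (act e x) = zip_act e (w R x).
Implicit Types (R A B C K L : comAlgType k) (Z U O : subfunctor X).
Local Notation ent := (ent w).
Local Notation law_pt := (law_pt p r act).
Local Notation u := (@uE _ q).

Lemma zipE_uE R (t : R) : zipE q (u t).
Proof.
apply/(zipP r char_k); rewrite /zip_eqs /= !mxE /= !expr1n (exp0q r char_k); by split.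
Qed.

Lemma map2_uE R R' (f : {lrmorphism R -> R'}) (t : R) : map2 f (u t) = u (f t).
Proof.
by congr (_, _); apply: GL3_inj; rewrite /= map_mx3 !rmorph0 !rmorph1 ?rmorphN ?rmorphXn.
Qed.

Lemma uE_add R (s t : R) : mul2 (u s) (u t) = u (s + t).
Proof.
have [fr frE] := ex_frob r char_k R.
congr (_, _); apply: GL3_inj; apply/matrixP; apply: forall3; apply: forall3;
  rewrite mulmx3 !mxE /= -?frE ?rmorphD /=; ring.
Qed.

Lemma uE0 R : u (0 : R) = (gone R, gone R).
Proof.
congr (_, _); apply: GL3_inj; apply/matrixP; apply: forall3; apply: forall3;
  by rewrite !mxE /= ?(exp0q r char_k) ?oppr0.
Qed.

Lemma uE_act R (s t : R) (x : X R) : act (u s) (act (u t) x) = act (u (s + t)) x.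
Proof. by rewrite -(actM actP) ?uE_add //; exact: zipE_uE. Qed.

Lemma ent_uE R (t : R) (x : X R) : let v := act (u t) x in
  [/\ ent e0 e0 v = ent e0 e0 x + t * ent e1 e0 x, ent e1 e0 v = ent e1 e0 x,
      ent e0 e1 v = ent e0 e1 x + t * ent e1 e1 x, ent e1 e1 v = ent e1 e1 x &
      ent e0 e2 v = ent e0 e2 x + t * ent e1 e2 x + t ^+ q * (ent e0 e1 x + t * ent e1 e1 x)
      /\ ent e1 e2 v = ent e1 e2 x + t ^+ q * ent e1 e1 x].
Proof.
have H := zipE_uE t; move=> v; rewrite /v.
have [-> -> ->] := ent_actE char_k w_act x (i := e0) H isT.
have [-> -> ->] := ent_actE char_k w_act x (i := e1) H isT.
rewrite /= !mxE /= !expr1n (exp0q r char_k).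
by split; [..|split]; ring.
Qed.

Lemma f3_uE R (t : R) (x : X R) : f3 w (act (u t) x) = f3 w x + t ^+ q * f2 w x.
Proof.
by rewrite /f3 /f2; have [-> -> _ _ [-> ->]] := ent_uE t x; ring.
Qed.

Lemma f2_uE R (t : R) (x : X R) : f2 w (act (u t) x) = f2 w x.
Proof.
by rewrite /f2; have [-> -> -> -> _] := ent_uE t x; ring.
Qed.

Definition uX R (x : X R) : X (polyA R) := act (u (polyAX R)) (fmap (polyAC R) x).

(* The polynomial s(u_T x) in T. *)
Definition phi (s : forall R, X R -> R) R (x : X R) : {poly R} :=
  projT1 (cid (polyq_surj (s _ (uX x)))).

Lemma phiE (s : forall R, X R -> R) R (x : X R) : polyq R (phi s x) = s _ (uX x).
Proof. by rewrite /phi; case: cid. Qed.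

Lemma map_act_lift R C (g : {lrmorphism polyA R -> C}) (h : {lrmorphism R -> C}) (t : C) e (x : X R) :
  (forall P, g (polyq R P) = (map_poly h P).[t]) -> zipE q e ->
  fmap g (act e (fmap (polyAC R) x)) = act (map2 g e) (fmap h x).
Proof.
move=> gE E; rewrite (act_map actP) //; congr act; apply: fmap_tri => a.
by rewrite polyACE gE map_polyC hornerC.
Qed.

Lemma phi_horner Z s R (x : X R) C (h : {lrmorphism R -> C}) (t : C) :
  regular_on Z s -> Z _ (uX x) -> s C (act (u t) (fmap h x)) = (map_poly h (phi s x)).[t].
Proof.
move=> rs Zx; have [g gE] := polyA_lift h t.
rewrite -gE phiE -rs // (map_act_lift _ gE); last exact: zipE_uE.
by rewrite map2_uE /polyAX gE map_polyX hornerX.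
Qed.

Lemma map_poly_idfun R (P : {poly R}) : map_poly idfun P = P.
Proof. exact: map_poly_id. Qed.

Lemma phi_map Z s R C (h : {lrmorphism R -> C}) (x : X R) : regular_on Z s -> Z _ (uX x) ->
  phi s (fmap h x) = map_poly h (phi s x).
Proof.
move=> rs Zx; apply: (@polyq_inj k C); rewrite phiE.
rewrite /uX -fmap_comp (phi_horner (polyAC C \o h) (polyAX C) rs Zx).
rewrite map_poly_comp /= /polyAX.
have [g gE] := polyA_lift (polyAC C) (polyAX C).
rewrite -gE; suff : g =1 idfun by move->.
apply: polyA_eq => [a|]; first by rewrite [X in g X]polyACE gE map_polyC hornerC.
by rewrite /polyAX gE map_polyX hornerX.
Qed.

(** With a = l0 - l1, the value of s along [rE t] is t^a phi(1/t), since [rE t] and u_(1/t) differ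
    by an element of E' whose character is t^a. This value is also a polynomial in t, so a is at
    least the degree of phi. *)
Lemma phi_size Z la s K (x : X K) : is_field K -> regular_on Z s -> law_pt Z la s ->
  (forall R (h : {lrmorphism K -> R}) e, zipE q e -> Z R (act e (fmap h x))) ->
  phi s x != 0 ->
  exists d : nat, la ord0 e0 - la ord0 e1 = d /\ (size (phi s x) <= d.+1)%N.
Proof.
move=> fK rs ls orb nz.
have Zx : Z _ (uX x) by apply: orb; exact: zipE_uE.
have [y [Ey _ _]] := @zip_section p r k char_k _ (rE (polyAX K)) (mxE _ _ _ _) (mxE _ _ _ _).
have [th thE] := polyq_surj (s _ (act (rE (polyAX K), y) (fmap (polyAC K) x))).
pose D := (size (phi s x)).-1.
have szD : size (phi s x) = D.+1 by rewrite /D prednK // lt0n size_poly_eq0.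
pose a := la ord0 e0 - la ord0 e1.
have key (c : k) : c != 0 -> th.[c%:A] = upow (c%:A : K) (c^-1)%:A a * (phi s x).[(c^-1)%:A].
  move=> c0; set t : K := c%:A; set t' : K := (c^-1)%:A.
  have tt' : t * t' = 1 by rewrite /t /t' mulr_algl scalerA mulfV // scale1r.
  have [g gE] := polyA_lift (idfun : {lrmorphism K -> K}) t.
  pose et := map2 g (rE (polyAX K), y).
  have Eet : zipE q et by apply: zipE_map char_k _ _ _ _ Ey.
  have th_t : th.[t] = s K (act et x).
    rewrite -[th]map_poly_idfun -gE thE -rs; last exact: orb.
    by rewrite (map_act_lift _ gE) // fmap_id.
  have gX : g (polyAX K) = t by rewrite /polyAX gE map_polyX hornerX.
  have x1 : gmx et.1 = mx3 t 1 0 (-1) 0 0 0 0 1.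
    apply: (etrans (map_mx3 g _ _ _ _ _ _ _ _ _)); rewrite rmorph0 rmorph1 rmorphN1.
    congr (mx3 _ 1 0 (-1) 0 0 0 0 1); exact: gX.
  have xV : gmxV et.1 = mx3 0 (-1) 0 1 t 0 0 0 1.
    apply: (etrans (map_mx3 g _ _ _ _ _ _ _ _ _)); rewrite rmorph0 rmorph1 rmorphN1.
    congr (mx3 0 (-1) 0 1 _ 0 0 0 1); exact: gX.
  pose e' := mul2 et (inv2 (u t')).
  have Ee : zipE q e'.
    apply: (@zipE_mul p r k char_k) => //; apply: (@zipE_inv p r k char_k); exact: zipE_uE.
  have g1 : gmx e'.1 = mx3 t 1 0 (-1) 0 0 0 0 1 *m mx3 1 (- t') 0 0 1 0 0 0 1 by rewrite -x1.
  have gV : gmxV e'.1 = mx3 1 t' 0 0 1 0 0 0 1 *m mx3 0 (-1) 0 1 t 0 0 0 1 by rewrite -xV.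
  have b01 : gmx e'.1 e0 e1 = 0.
    by rewrite g1 mulmx3 !mxE /= mulrN tt' mulr1 mul0r addr0 addNr.
  have E' : zipE' q e' by apply/(zipE'P r char_k).
  have ee : mul2 e' (u t') = et.
    by rewrite [RHS]surjective_pairing; congr (_, _); rewrite -gmulA gVmul gmul1.
  have hu : s K (act (u t') x) = (phi s x).[t'].
    by rewrite -{1}[x]fmap_id (phi_horner _ _ rs Zx) map_poly_idfun.
  rewrite th_t -ee (actM actP) //; last exact: zipE_uE.
  rewrite ls //; last by rewrite -[x]fmap_id; apply: orb; exact: zipE_uE.
  rewrite hu; congr (_ * _).
  rewrite [la]wtE chiE g1 gV !mulmx3 !mxE /=.
  rewrite !(mulr0, mul0r, mulr1, mul1r, addr0, add0r) mulrN mulN1r opprK.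
  have up1 (z : int) : upow 1 1 z = 1 :> K by case: z => n; rewrite /= expr1n.
  rewrite up1 mulr1 /a upowD //; congr (_ * _).
  apply: (unit_cancel (x := upow t t' (la ord0 e1)) (v := upow t t' (- la ord0 e1))).
    by rewrite -upowD // subrr upow0.
  rewrite -upowD // subrr upow0; case: (la ord0 e1) => n /=; rewrite -exprMn ?tt' ?expr1n //.
  by rewrite mulrC tt' expr1n.
(* The constant coefficient of the reversed polynomial is the leading coefficient of phi; it
   contradicts both a negative a and D > a. *)
have flip0 : (flip D (phi s x))`_0 != 0.
  by rewrite coef_poly /= subn0 -[D]/(D.+1.-1) -szD -lead_coefE lead_coef_eq0.
have cc (c : k) : c != 0 -> c%:A * (c^-1)%:A = 1 :> K.
  by move=> c0; rewrite mulr_algl scalerA mulfV // scale1r.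
have fl (c : k) : c != 0 -> (flip D (phi s x)).[c%:A] = c%:A ^+ D * (phi s x).[(c^-1)%:A].
  by move=> c0; apply: flip_horner; [rewrite szD | exact: cc].
case ea : a => [d|m]; last first.
  have e : 'X^(m.+1 + D) * th = flip D (phi s x).
    apply: (@poly_inf_eq k K _ _ [:: 0]) => c; rewrite inE => c0.
    rewrite fl // hornerM hornerXn key // ea /= exprD mulrACA -exprMn cc // expr1n mul1r; by [].
  by move: flip0; rewrite -e coefXnM addSn /= eqxx.
exists d; split=> //.
have e : 'X^D * th = 'X^d * flip D (phi s x).
  apply: (@poly_inf_eq k K _ _ [:: 0]) => c; rewrite inE => c0.
  by rewrite !hornerM !hornerXn fl // key // ea /= mulrCA.
rewrite szD ltnS leqNgt; apply/negP => dD.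
move: (congr1 (fun P : {poly K} => P`_d) e); rewrite !coefXnM dD ltnn subnn => /esym/eqP.
exact/negP.
Qed.
End Phi.

(** * Flag strata and pseudo-completeness *)

Section Torsor.
Variables (k : closedFieldType) (H : G2pred) (X Y : kfunctor k) (act : pre_action X) (pi : kmor X Y).
Hypothesis tP : is_torsor H act pi.
Implicit Types (R A B C K L : comAlgType k).

Lemma torsor_cover R (y : Y R) : exists R' (f : {lrmorphism R -> R'}) (i : X R'),
  etale_cover f /\ pi R' i = fmap f y.
Proof. by case: tP => _ _; apply. Qed.

Lemma torsor_same R (i j : X R) : pi R i = pi R j -> exists e, H e /\ act e i = j.
Proof. by case: tP => _ HH _ /HH [e [He _]]; exists e. Qed.

(** Over the pushout of R' and C the two points i and j lie above the same point of Y, hence differ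
    by a group element. The injectivity and the description of the kernel carry equations back to C
    and down to R. *)
Lemma torsor_pushout R R' (f : {lrmorphism R -> R'}) (i : X R') (y : Y R) C
    (g : {lrmorphism R -> C}) (j : X C) :
  etale_cover f -> pi R' i = fmap f y -> pi C j = fmap g y ->
  exists (N : comAlgType k) (f' : {lrmorphism C -> N}) (h' : {lrmorphism R' -> N}) e,
  [/\ forall x, f' x = 0 -> x = 0, forall a, h' (f a) = f' (g a),
      H e, act e (fmap h' i) = fmap f' j
    & forall a : R', h' a = 0 ->
        exists (I : finType) (d : I -> R) (c : I -> R'), (forall l, g (d l) = 0) /\ a = \sum_l c l * f (d l)].
Proof.
move=> fc ei ej; have [N [f' [h' [h1 h2 h3]]]] := etale_pushout fc g.
have [|e [He Ae]] := @torsor_same N (fmap h' i) (fmap f' j).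
  rewrite !kfun_nat ei ej -!fmap_comp; exact: fmap_eq.
by exists N, f', h', e.
Qed.

Lemma torsor_act R e (x : X R) : H e -> pi R (act e x) = pi R x.
Proof. by case: tP => HH _ _ /HH. Qed.
End Torsor.

Lemma inv3_tri (k : closedFieldType) (K : comAlgType k) (a0 a1 a2 c10 c20 c21 : K) :
  is_field K -> a0 <> 0 -> a1 <> 0 -> a2 <> 0 ->
  exists b : GL3 K, gmx b = mx3 a0 0 0 c10 a1 0 c20 c21 a2 /\ in_B b.
Proof.
move=> fK /(field_inv fK) [b0 h0] /(field_inv fK) [b1 h1] /(field_inv fK) [b2 h2].
exists (MkGL3 (tri_subproof c10 c20 c21 h0 h1 h2)); split=> //.
by apply/in_BE; rewrite /= !mxE.
Qed.

(** The reflection of length 1 whose flag stratum has [Cb] as the preimage of its closure. *)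
Definition wb : 'S_3 := tperm e1 e2.

Lemma inord0 : inord 0 = e0. Proof. by apply/val_inj; rewrite /= inordK. Qed.
Lemma inord1 : inord 1 = e1. Proof. by apply/val_inj; rewrite /= inordK. Qed.

Lemma zWE : [/\ zW e0 = e2, zW e1 = e0 & zW e2 = e1].
Proof.
have tE : [/\ w0I e0 = e1, w0I e1 = e0 & w0I e2 = e2].
  by rewrite /w0I inord0 inord1 tpermL tpermR tpermD.
have wE : [/\ w0 e0 = e2, w0 e1 = e1 & w0 e2 = e0] by rewrite /w0 !permE !revE.
have [t0 t1 t2] := tE; have [v0 v1 v2] := wE.
rewrite /zW /sigmaW !permM; split.
- by rewrite v0 t2 v2 v0.
- by rewrite v1 t1 v0 v2.
- by rewrite v2 t0 v1 v1.
Qed.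

Lemma col_perm_zW (R : comNzRingType) (A : 'M[R]_3) i j : (A *m perm_mx (zW^-1)%g) i j = A i (zW j).
Proof. by rewrite -col_permE mxE. Qed.

Lemma lenW_wb : lenW wb = 1%N.
Proof.
apply: (etrans _ (cards1 (e1, e2))); apply: eq_card => -[i j]; rewrite !inE /= /wb.
have [t0 t1 t2] : [/\ tperm e1 e2 e0 = e0, tperm e1 e2 e1 = e2 & tperm e1 e2 e2 = e1].
  by rewrite tpermL tpermR tpermD.
move: i j; apply: (forall3 (P := fun i => forall j, (_ && _) = _)); apply: forall3;
  by rewrite ?t0 ?t1 ?t2.
Qed.

Lemma in_cellE (k : closedFieldType) (R : comAlgType k) (g b b' : GL3 R) : in_B b -> in_B b' ->
  gmx g = gmx b *m perm_mx wb *m gmx b' *m perm_mx (zW^-1)%g ->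
  gmx g e0 e0 = 0 /\ gmx g e0 e2 = 0.
Proof.
move=> /tri_entries [b01 b02 b12] /tri_entries [c01 c02 c12] ->.
have [z0 z1 z2] := zWE; rewrite !col_perm_zW z0 z2 -!mulmxA mulmx3 [in X in _ /\ X]mulmx3 b01 b02.
have pE i j : (perm_mx wb *m gmx b') i j = gmx b' (wb i) j by rewrite -row_permE mxE.
have wb0 : wb e0 = e0 by rewrite tpermD.
by rewrite !pE wb0 c01 c02 !mulr0 !mul0r !addr0.
Qed.

(** Elimination: g20 is cleared with the pivot g10. The determinant is - g01 (g10 g22 - g12 g20), so
    the remaining diagonal entries of the second factor are nonzero. *)
Lemma in_cell_pt (k : closedFieldType) (K : comAlgType k) (g : GL3 K) : is_field K ->
  gmx g e0 e0 = 0 -> gmx g e0 e2 = 0 -> gmx g e1 e0 <> 0 -> in_cell wb g.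
Proof.
move=> fK g00 g02 g10; have dg : \det (gmx g) * \det (gmxV g) = 1.
  by rewrite -det_mulmx gmxMV det1.
rewrite det3 g00 g02 !mul0r sub0r addr0 in dg.
set a := gmx g e0 e1 in dg; set m := _ - _ in dg.
have a0 : a <> 0 by move=> e; move: dg; rewrite e mul0r oppr0 mul0r => /esym/eqP; rewrite oner_eq0.
have m0 : m <> 0.
  by move=> e; move: dg; rewrite e mulr0 oppr0 mul0r => /esym/eqP; rewrite oner_eq0.
have [v hv] := field_inv fK g10.
have n0 : gmx g e2 e2 - v * gmx g e2 e0 * gmx g e1 e2 <> 0.
  move=> e; apply: m0; rewrite /m; have -> : gmx g e1 e0 * gmx g e2 e2 - gmx g e1 e2 * gmx g e2 e0 =
    gmx g e1 e0 * (gmx g e2 e2 - v * gmx g e2 e0 * gmx g e1 e2) +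
    (gmx g e1 e0 * v - 1) * gmx g e1 e2 * gmx g e2 e0 by ring.
  by rewrite e hv subrr mulr0 !mul0r addr0.
have one0 : (1 : K) <> 0 by move/eqP; rewrite oner_eq0.
have [b [bE Bb]] := inv3_tri 0 0 (v * gmx g e2 e0) fK one0 one0 one0.
have [b' [b'E Bb']] := inv3_tri (gmx g e2 e1 - v * gmx g e2 e0 * gmx g e1 e1)
  (gmx g e1 e1) (gmx g e1 e2) fK a0 n0 g10.
exists b, b'; split=> //.
have [z0 z1 z2] := zWE.
have pE i j : (perm_mx wb *m gmx b') i j = gmx b' (wb i) j by rewrite -row_permE mxE.
have wb0 : wb e0 = e0 by rewrite tpermD.
have wb1 : wb e1 = e2 by rewrite tpermL.
have wb2 : wb e2 = e1 by rewrite tpermR.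
apply/matrixP; apply: forall3; apply: forall3; rewrite col_perm_zW ?z0 ?z1 ?z2 -!mulmxA mulmx3 !pE
  wb0 wb1 wb2 bE b'E !mxE /= ?g00 ?g02 !(mul0r, mulr0, mul1r, addr0, add0r) //.
- by rewrite mulrAC [v * _]mulrC hv mul1r.
- by rewrite addrC subrK.
- by rewrite addrC subrK.
Qed.

Section Flag.
Variables (p r : nat) (k : closedFieldType).
Hypothesis char_k : p \in [pchar k].
Local Notation q := (p ^ r)%N.
Variables (S : kfunctor k) (zeta : zip_mor q S).
Hypothesis zeta_smooth : zip_smooth zeta.
Variable F : flag_space zeta.
Hypothesis F_complete : flag_curves_pseudo_complete F.
Implicit Types (R A B C K L : comAlgType k).
Local Notation X := (ztors zeta).
Local Notation w := (zmap zeta).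
Local Notation ent := (ent w).
Local Notation Cb := (Cb w).
Local Notation act := (zact (z := zeta)).
Local Notation pi := (fproj F).

Lemma flag_torsor : is_torsor (@zipE' q) act pi. Proof. exact: fprojP. Qed.

Lemma Cb_act R (e : GL3 R * GL3 R) (x : X R) : zipE' q e -> Cb R x -> Cb R (act e x).
Proof. exact: (stable_Cb char_k (zmap_equiv (z := zeta))). Qed.

Lemma Cb_same R (i j : X R) : pi R i = pi R j -> Cb R i -> Cb R j.
Proof. by move=> /(torsor_same flag_torsor) [e [He <-]]; exact: Cb_act. Qed.

Lemma Cb_inj R R' (f : {lrmorphism R -> R'}) (x : X R) : (forall a, f a = 0 -> a = 0) ->
  Cb R' (fmap f x) -> Cb R x.
Proof. by move=> fi /CbP [h h']; apply/CbP; split; apply: fi; rewrite -ent_map. Qed.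

Lemma CbF_map R R' (f : {lrmorphism R -> R'}) (x : flag F R) :
  (forall R' (f : {lrmorphism R -> R'}) (i : X R'), pi R' i = fmap f x -> Cb R' i) ->
  forall R'' (g : {lrmorphism R' -> R''}) (i : X R''), pi R'' i = fmap g (fmap f x) -> Cb R'' i.
Proof. by move=> H R'' g i; rewrite -fmap_comp; exact: H. Qed.

Definition CbF : subfunctor (flag F) := SubFunctor CbF_map.

(** The ideal on R is the preimage of the ideal I0 of [Cb] on an etale cover R'. It generates I0:
    over the pushout of R' and R' / I0 the point i0 is a translate of a point of [Cb], so by
    E'-stability the two equations die there, and flatness writes them through elements of R that
    lie in I0. *)
Lemma CbF_closed : closed_sub CbF.
Proof.
move=> R x; have [R' [f0 [i0 [f0c e0']]]] := torsor_cover flag_torsor x.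
pose I0 := ideal_gen (fun c : R' => c = ent e0 e0 i0 \/ c = ent e0 e2 i0).
have I0i : is_ideal I0 by exact: ideal_gen_ideal.
have I0g c : c = ent e0 e0 i0 \/ c = ent e0 e2 i0 -> I0 c.
  by move=> Hc; exists 1%N, (fun=> c), (fun=> 1); rewrite big_ord1 mul1r.
exists (fun a => I0 (f0 a)) => C f; split=> [Cx a [n [b [c [Db e]]]]|fD].
  have [C' [g' [h [sq' g'i _]]]] := etale_pushout f0c f.
  have CbC : Cb C' (fmap h i0).
    apply: (Cx C' g'); rewrite kfun_nat e0' -!fmap_comp; exact: fmap_eq.
  apply: g'i; rewrite -sq' -e rmorph_sum big1 // => j _; rewrite rmorphM /=.
  move/CbP: CbC => [h0 h2]; rewrite !ent_map in h0 h2.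
  by case: (Db j) => ->; rewrite ?h0 ?h2 mulr0.
have I1 : ~ I0 1.
  by move=> H1; have := fD 1; rewrite rmorph1 => /(_ H1) /eqP; rewrite rmorph1 oner_eq0.
pose J := PIdeal I0i I1; pose pr := qap J.
have CbN : Cb (qa J) (fmap pr i0).
  by apply/CbP; rewrite !ent_map; split; apply/qap0/I0g; [left|right].
have ker c : c = ent e0 e0 i0 \/ c = ent e0 e2 i0 ->
    exists (I : finType) (d : I -> R) (c' : I -> R'), (forall l, I0 (f0 (d l))) /\ c = \sum_l c' l * f0 (d l).
  move=> Hc.
  have [|N' [f' [h' [e1 [f'i sq He Ae kk]]]]] :=
    torsor_pushout (g := pr \o f0) (j := fmap pr i0) flag_torsor f0c e0' _.
    by rewrite kfun_nat e0' -fmap_comp.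
  have Cb' : Cb N' (fmap h' i0).
    apply: (@Cb_same N' (fmap f' (fmap pr i0))); last exact: smem_map.
    by rewrite -Ae (torsor_act flag_torsor).
  move/CbP: Cb' => [h0 h2]; rewrite !ent_map in h0 h2.
  have [|I [d [c' [d0 ->]]]] := kk c; first by case: Hc => ->.
  by exists I, d, c'; split=> // l; apply/(qap0 J)/d0.
move=> R'' g i; rewrite -fmap_comp => ei.
have [N [f' [h' [e1 [f'i sq He Ae _]]]]] := torsor_pushout flag_torsor f0c e0' ei.
have z c : c = ent e0 e0 i0 \/ c = ent e0 e2 i0 -> h' c = 0.
  move=> /ker [I [d [c' [dI ->]]]]; rewrite rmorph_sum big1 // => l _.
  by rewrite rmorphM /= sq /= fD // !rmorph0 mulr0.
apply: (Cb_inj f'i); rewrite -Ae; apply: Cb_act => //.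
by apply/CbP; rewrite !ent_map !z; [|right|left].
Qed.

Lemma CbF_red_closure R (x : flag F R) : red_closure (flag_stratum (F := F) wb) x -> CbF R x.
Proof.
move=> H; apply: (H CbF CbF_closed) => K y fK [K' [f [i [fK' ei [b [b' [Bb Bb' ce]]]]]]].
have Cbi : Cb K' i by apply/CbP; exact: in_cellE Bb Bb' ce.
have Cy : CbF K' (fmap f y).
  move=> R' g j ej; apply: (@Cb_same R' (fmap g i)); last exact: smem_map.
  by rewrite kfun_nat ei.
have [D HD] := CbF_closed y; rewrite -[y]fmap_id; apply/HD => a Da.
apply: contrapT => a0; have fa := proj1 (HD K' f) Cy a Da.
by have [v] := field_map_neq0 f fK a0; rewrite fa mul0r => /esym/eqP; rewrite oner_eq0.
Qed.

(** The points of [Cb] with g10 <> 0 lie over the stratum by [in_cell_pt]. An equation of a closed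
    subscheme containing the stratum is therefore killed by g10 on charts of [Cb], and g10 is not a
    zero divisor there. *)
Lemma red_closure_Cb K (x : X K) : is_field K -> Cb K x ->
  red_closure (flag_stratum (F := F) wb) (pi K x).
Proof.
move=> fK Cbx Z clZ subZ; have nC := nice_vanish zeta_smooth [:: (e0, e0); (e0, e2)].
have [U [A [u [oU Ux ru fA]]]] := (proj2 nC) K x fK Cbx.
have [Cu Uu ex inj] := ru; have [g gx] := ex K x Cbx Ux.
rewrite -gx kfun_nat; have [D HD] := clZ A (pi A u); apply/HD => a Da.
suff -> : a = 0 by rewrite rmorph0.
have oS := chart_fsmooth (proj1 nC) oU ru.
apply: (@chart_nzd k X Cb U A u (ent e1 e0)) => //.
- by move=> ? ? f y _; exact: ent_map.
- exact: transversal_vanish.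
apply: (smooth_reduced oS fA) => L h fL; rewrite rmorphM /= -ent_map.
have [->|/eqP ne] := eqVneq (ent e1 e0 (fmap h u)) 0; first by rewrite mul0r.
suff -> : h a = 0 by rewrite mulr0.
apply: (proj1 (HD L h)) => //; rewrite -kfun_nat; apply: subZ => //.
have [c0 c2] := proj1 (CbP _ _) (smem_map h Cu).
exists L, idfun, (fmap h u); split=> //; first by rewrite fmap_id.
exact: in_cell_pt.
Qed.

(** An E'-invariant function takes the same value at any two lifts of a point of Flag(S), so it
    descends along etale covers to a function there, regular on the reduced closure of the stratum,
    to which pseudo-completeness applies. *)
Lemma flag_const (s : forall R, X R -> R) : regular_on Cb s ->
  (forall R (e : GL3 R * GL3 R) (x : X R), zipE' q e -> Cb R x -> s R (act e x) = s R x) ->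
  forall K (x : X K), is_field K -> Cb K x -> exists N : subfunctor X,
    [/\ open_in (all_sub X) N, N K x
      & exists c : k, forall L (y : X L), is_field L -> Cb L y -> N L y -> s L y = c%:A].
Proof.
move=> rs inv; pose val R (x : flag F R) a := forall R' (f : {lrmorphism R -> R'}) (i : X R'),
  pi R' i = fmap f x -> s R' i = f a.
have exv R (x : flag F R) : exists a, CbF R x -> val R x a.
  have [Cx|] := pselect (CbF R x); last by exists 0.
  have [R' [f0 [i0 [f0c e0']]]] := torsor_cover flag_torsor x.
  have Ci0 : Cb R' i0 by exact: (Cx R' f0 i0 e0').
  have [C g h gh|a f0a] := etale_descent f0c (v := s R' i0).
    have [|e [He Ae]] := torsor_same flag_torsor (i := fmap g i0) (j := fmap h i0).
      by rewrite !kfun_nat e0' -!fmap_comp; apply: fmap_eq.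
    by rewrite -!rs // -Ae inv //; exact: smem_map.
  exists a => _ C g j ej.
  have [N [f' [h' [e [f'i sq He Ae _]]]]] := torsor_pushout flag_torsor f0c e0' ej.
  apply/eqP; rewrite -subr_eq0; apply/eqP/f'i; rewrite rmorphB /= -sq f0a.
  rewrite -!rs //; last exact: (Cx C g j ej).
  by rewrite -Ae inv ?subrr //; exact: smem_map.
pose sF R (x : flag F R) : R := projT1 (cid (exv R x)).
have sFP R (x : flag F R) : CbF R x -> val R x (sF R x).
  by rewrite /sF; case: cid => a /= H /H.
have sF_reg : regular_on (red_closure (flag_stratum (F := F) wb)) sF.
  move=> R R' f x /CbF_red_closure Cx; have Cfx : CbF R' (fmap f x) by exact: smem_map.
  have [R'' [f0 [i0 [f0c e0']]]] := torsor_cover flag_torsor (fmap f x).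
  apply: (etale_inj f0c); rewrite -(sFP _ _ Cfx R'' f0 i0 e0').
  by rewrite (sFP _ _ Cx R'' (f0 \o f) i0) // fmap_comp.
move=> K x fK Cbx; have Zx := red_closure_Cb fK Cbx.
have [U [oU Ux [c Hc]]] := F_complete lenW_wb sF_reg fK Zx.
have Nmap R R' (f : {lrmorphism R -> R'}) (y : X R) : U R (pi R y) -> U R' (pi R' (fmap f y)).
  by rewrite kfun_nat; exact: smem_map.
exists (SubFunctor Nmap); split=> //.
  by move=> R y _; have [D HD] := oU R (pi R y); exists D => R' f /=; rewrite kfun_nat.
exists c => L y fL Cby Ny; have Zy := red_closure_Cb fL Cby.
rewrite -(Hc L (pi L y) Zy Ny).
by rewrite (sFP _ _ (CbF_red_closure Zy) L idfun y) // fmap_id.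
Qed.
End Flag.

Section OpenGen.
Variables (k : closedFieldType) (X : kfunctor k).
Implicit Types (R A B C K L : comAlgType k) (Z U O N : subfunctor X).

Lemma open_in_meet Z U O : open_in Z U -> open_in Z O -> open_in Z (meet U O).
Proof.
move=> oU oO R x Zx; have [D HD] := oU R x Zx; have [D' HD'] := oO R x Zx.
exists (fun c => exists a b, [/\ D a, D' b & c = a * b]) => R' f; split.
  move=> [/HD /gen_unit_pt h /HD' /gen_unit_pt h']; apply/gen_unit_pt => K g fK.
  have [a Da fa] := h K g fK; have [b Db fb] := h' K g fK.
  exists (a * b); first by exists a, b.
  by rewrite !rmorphM /=; exact: field_mulf.
move/gen_unit_pt => h; split; [apply/HD|apply/HD']; apply/gen_unit_pt => K g fK;
  have [_ [a [b [Da Db ->]]]] := h K g fK; rewrite !rmorphM /= => ab.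
  by exists a => // e; apply: ab; rewrite e mul0r.
by exists b => // e; apply: ab; rewrite e mulr0.
Qed.

Lemma pts_sub_nbhd Z (P : point_pred X) :
  (forall K (x : X K), is_field K -> Z K x -> P K x -> exists N,
     [/\ open_in Z N, N K x & forall L (y : X L), is_field L -> Z L y -> N L y -> P L y]) ->
  open_in Z (pts_sub P).
Proof.
move=> H; apply: pts_sub_open => R x K f Zx fK Px.
have [N [oN Nx NP]] := H K (fmap f x) fK (smem_map _ Zx) Px.
have [D HD] := oN R x Zx.
have [a Da fa] := proj1 (gen_unit_pt _ _) (proj1 (HD _ f) Nx) K idfun fK.
exists a; split=> // L g fL ga; apply: NP => //; first exact: smem_map.
by have [u gu] := field_inv fL ga; apply/HD; exact: gen_unit_unit Da gu.
Qed.

Lemma pts_sub_pt (P : point_pred X) K (x : X K) : is_field K -> pts_sub P K x -> P K x.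
Proof. by move=> fK H; have := H K idfun fK; rewrite fmap_id. Qed.

Lemma open_in_sub' Z Z' U : (forall R (x : X R), Z R x -> Z' R x) -> open_in Z' U -> open_in Z U.
Proof. by move=> sub oU R x Zx; apply: oU; exact: sub. Qed.

End OpenGen.

Section ChiInt.
Variables (k : closedFieldType) (R : comAlgType k).
Implicit Types b : GL3 R.

Lemma upow_mul (u u' v v' : R) a : upow (u * v) (u' * v') a = upow u u' a * upow v v' a.
Proof. by case: a => n; rewrite /= exprMn. Qed.

Lemma chiMz la (a : int) b : in_B b -> chi (a *: la) b = upow (chi la b) (chi (- la) b) a.
Proof.
move=> Bb; case: a => n /=; first by rewrite -chiMn // -[Posz n]natz scaler_nat.
by rewrite -chiMn // NegzE scaleNr -[Posz n.+1]natz scaler_nat mulNrn.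
Qed.

Lemma inv_uniq (u v v' : R) : u * v = 1 -> u * v' = 1 -> v = v'.
Proof. by move=> e e'; apply: (unit_cancel e); rewrite e. Qed.

Lemma unit_mul0 (x v v' : R) : v * v' = 1 -> x * v = 0 -> x = 0.
Proof. by move=> e xv; rewrite -[x]mulr1 -e mulrA xv mul0r. Qed.

Lemma upow_unit (u u' : R) a : u * u' = 1 -> exists v, upow u u' a * v = 1.
Proof. by move=> e; exists (upow u u' (- a)); rewrite -upowD // subrr upow0. Qed.
End ChiInt.

Section LawAlgebra.
Variables (p r : nat) (k : closedFieldType) (X : kfunctor k) (act : pre_action X).
Implicit Types (R : comAlgType k) (Z : subfunctor X).
Local Notation stable := (stable p r act).
Local Notation law := (law p r act).

Lemma upow_law Z la (s s' : forall R, X R -> R) a : law Z la s ->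
  stable Z -> (forall R (x : X R), Z R x -> s R x * s' R x = 1) ->
  law Z (a *: la) (fun R x => upow (s R x) (s' R x) a).
Proof.
move=> ls sZ inv R e x E Zx; have Be : in_B e.1 by case: E.
rewrite chiMz // -upow_mul -ls //; congr (upow _ _ _).
apply: (@inv_uniq k R (s R (act e x))); first by apply: inv; exact: sZ.
by rewrite ls // mulrACA chiN // inv // mulr1.
Qed.

Lemma law_mul Z la lb (s s' : forall R, X R -> R) : law Z la s -> law Z lb s' ->
  law Z (la + lb) (fun R x => s R x * s' R x).
Proof.
move=> ls ls' R e x E Zx; have Be : in_B e.1 by case: E.
by rewrite chiD // ls // ls' // mulrACA.
Qed.

Lemma law_exp Z la (s : forall R, X R -> R) n : law Z la s -> law Z (la *+ n) (fun R x => s R x ^+ n).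
Proof.
move=> ls R e x E Zx; have Be : in_B e.1 by case: E.
by rewrite chiMn // ls // exprMn.
Qed.

End LawAlgebra.

(** * Repeated division by g02 *)

Section ClaimC.
Variables (p r : nat) (k : closedFieldType).
Hypothesis char_k : p \in [pchar k].
Hypothesis r_gt0 : (0 < r)%N.
Local Notation q := (p ^ r)%N.
Variables (S : kfunctor k) (zeta : zip_mor q S).
Hypothesis zeta_smooth : zip_smooth zeta.
Variable F : flag_space zeta.
Hypothesis F_complete : flag_curves_pseudo_complete F.
Implicit Types (R A B C K L : comAlgType k).
Local Notation X := (ztors zeta).
Local Notation w := (zmap zeta).
Local Notation ent := (ent w).
Local Notation Cb := (Cb w).
Local Notation D1 := (D1 w).
Local Notation Xe := (Xe w).
Local Notation act := (zact (z := zeta)).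
Local Notation stable := (stable p r act).
Local Notation law := (law p r act).
Implicit Types (Z U O N : subfunctor X).

Lemma Cb_D1 R (x : X R) : Cb R x -> D1 R x.
Proof. by move=> /CbP [h _]; apply/D1P. Qed.

Lemma stable_iff O R (e : GL3 R * GL3 R) (x : X R) : stable O -> zipE' q e ->
  O R (act e x) -> O R x.
Proof.
move=> sO E H; rewrite -(actK char_k (@zactP _ _ _ zeta) x (zipE'_E E)).
by apply: sO => //; exact: (zipE'_inv char_k).
Qed.

Lemma ent_reg Z i j : regular_on Z (ent i j).
Proof. by move=> ? ? ? ? _; exact: ent_map. Qed.

Definition dtr R (x : X R) : R := \det (gmx (w R x)).
Definition dtV R (x : X R) : R := \det (gmxV (w R x)).
(** The inverse of g01 on [Cb], where the determinant is - g01 (g10 g22 - g12 g20). *)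
Definition g01V R (x : X R) : R :=
  - (ent e1 e0 x * ent e2 e2 x - ent e1 e2 x * ent e2 e0 x) * dtV x.

Lemma dtrV R (x : X R) : dtr x * dtV x = 1.
Proof. by rewrite /dtr /dtV -det_mulmx gmxMV det1. Qed.

Lemma g01_inv R (x : X R) : Cb R x -> ent e0 e1 x * g01V x = 1.
Proof.
move=> /CbP [h0 h2]; rewrite -(dtrV x) /g01V mulrA; congr (_ * _).
by rewrite /dtr det3 -!/(ent _ _ x) h0 h2 !mul0r sub0r addr0 mulrN.
Qed.

Lemma dtr_map R R' (f : {lrmorphism R -> R'}) (x : X R) : dtr (fmap f x) = f (dtr x).
Proof. by rewrite /dtr kfun_nat /= det_map_mx. Qed.

Lemma dtV_map R R' (f : {lrmorphism R -> R'}) (x : X R) : dtV (fmap f x) = f (dtV x).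
Proof. by rewrite /dtV kfun_nat /= det_map_mx. Qed.

Lemma g01V_map R R' (f : {lrmorphism R -> R'}) (x : X R) : g01V (fmap f x) = f (g01V x).
Proof. by rewrite /g01V !ent_map dtV_map rmorphM rmorphN rmorphB !rmorphM. Qed.

Section Stage.
Variables (La : 'rV[int]_3) (psi : forall R, X R -> R).
Arguments psi : clear implicits.

(** Divisibility of psi by g02^j on an open O. The complement of O in [Cb] is open in [Cb], so that
    functions on the part of [Cb] in O extend by zero to all of [Cb], where invariant functions are
    known to be locally constant. O contains the points of [D1] off [Cb] and those of [Cb] in [Xe],
    because [claimC] evaluates psi near the latter. *)
Definition stage (j : nat) : Prop := exists O (s : forall R, X R -> R),
  [/\ open_in (all_sub X) O /\ open_in Cb (pts_sub (fun K x => ~ O K x)), stable O,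
      (forall K (x : X K), is_field K -> D1 K x -> ~ Cb K x -> O K x) /\
      (forall K (x : X K), is_field K -> Cb K x -> Xe K x -> O K x),
      regular_on (meet D1 O) s /\ law (meet D1 O) (La - wt (j * q.+1)%N 0 0) s
    & forall R (x : X R), D1 R x -> O R x -> psi R x = ent e0 e2 x ^+ j * s R x].

Lemma stage0 : regular_on D1 psi -> law D1 La psi -> stage 0.
Proof.
move=> rpsi lpsi; exists (all_sub X), psi; split=> //.
- split; first exact: open_in_all.
  by apply: pts_sub_open => R x K f Cx fK [].
- split; first by move=> ? ? ? ? [Zx _]; exact: rpsi.
  have -> : La - wt (0 * q.+1)%N 0 0 = La.
    by apply/rowP; apply: forall3; rewrite !mxE subr0.
  by move=> R e x E [Zx _]; exact: lpsi.
- by move=> R x _ _; rewrite expr0 mul1r.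
Qed.

(** The solution of a linear system: N = Q^3 + 1 times the weight is cancelled by multiples of the
    weights (0, 1, Q), (1, Q, 0) and (Q+1)(1, 1, 1) of g10, g01 and det. The multiple (Q+1) m of the
    first is positive exactly when m is; the others may be negative, as g01 and det are units on
    [Cb]. *)
Lemma weight_sum (l0 l1 l2 Q m : int) : m = Q * (l0 - l2) - (l1 - l2) ->
  let N := (Q * (Q - 1) + 1) * (Q + 1) in
  let a := N * (l2 - l0) + Q * (Q + 1) * m in
  let b := - ((Q * (Q - 1) + 1) * l2 + Q * m) in
  [/\ l0 * N + 0 * ((Q + 1) * m) + a * 1 + b * (Q + 1) = 0,
      l1 * N + 1 * ((Q + 1) * m) + a * Q + b * (Q + 1) = 0
    & l2 * N + Q * ((Q + 1) * m) + a * 0 + b * (Q + 1) = 0].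
Proof. by move=> -> /=; split; ring. Qed.

Lemma q_gt0 : (0 < q)%N.
Proof. by rewrite expn_gt0 prime_gt0 // (pcharf_prime char_k). Qed.

Lemma weights (l : 'rV[int]_3) (m : nat) :
  m%:Z = q%:Z * (l ord0 e0 - l ord0 e2) - (l ord0 e1 - l ord0 e2) ->
  exists (N : nat) (a b : int), (0 < N)%N /\
    l *+ N + wt 0 1 q *+ (q.+1 * m) + a *: wt 1 q 0 + b *: wt q.+1 q.+1 q.+1 = 0.
Proof.
move=> hm; have [h0 h1 h2] := weight_sum hm.
pose N : int := (q%:Z * (q%:Z - 1) + 1) * (q%:Z + 1).
pose a : int := N * (l ord0 e2 - l ord0 e0) + q%:Z * (q%:Z + 1) * m%:Z.
pose b : int := - ((q%:Z * (q%:Z - 1) + 1) * l ord0 e2 + q%:Z * m%:Z).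
have NE : ((q * q.-1).+1 * q.+1)%N%:Z = N.
  rewrite -(addn1 (q * q.-1)) -[q.+1]addn1 PoszM !PoszD PoszM /N; congr ((_ * _ + _) * _).
  by have := q_gt0; case: (q) => // n _; rewrite -addn1 PoszD addrK addn1.
exists ((q * q.-1).+1 * q.+1)%N, a, b; split=> //.
have qE : q.+1%:Z = q%:Z + 1 by rewrite -addn1 PoszD.
have ME : (q.+1 * m)%N%:Z = (q%:Z + 1) * m by rewrite PoszM qE.
have Mn (z : int) (n : nat) : z *+ n = z * n%:Z by rewrite -mulr_natr natz.
apply/rowP; apply: forall3; rewrite !(mulmxnE, mxE) /= !Mn NE ME ?qE.
- exact: h0.
- exact: h1.
- exact: h2.
Qed.

Lemma pts_open_notCb : open_in (all_sub X) (pts_sub (fun K x => ~ Cb K x)).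
Proof.
apply: pts_sub_open => R x K f _ fK nC.
have [h|h] := pselect (ent e0 e0 (fmap f x) = 0); last first.
  exists (ent e0 e0 x); split=> [|L g fL]; first by rewrite -ent_map.
  by rewrite -ent_map => n0 /CbP [].
have h2 : ent e0 e2 (fmap f x) <> 0 by move=> h2; apply: nC; apply/CbP.
exists (ent e0 e2 x); split=> [|L g fL]; first by rewrite -ent_map.
by rewrite -ent_map => n0 /CbP [].
Qed.

Lemma Cb_ext K L (f : {lrmorphism K -> L}) (x : X K) : is_field K -> Cb L (fmap f x) -> Cb K x.
Proof.
move=> fK; have inj (a : K) : f a = 0 -> a = 0.
  move=> fa; apply: contrapT => a0; have [v] := field_map_neq0 f fK a0.
  by rewrite fa mul0r => /esym/eqP; rewrite oner_eq0.
by move=> /CbP [h h']; apply/CbP; split; apply: inj; rewrite -ent_map.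
Qed.

Lemma pts_not_ext Z O K (x : X K) : open_in Z O -> is_field K -> Z K x -> ~ O K x ->
  pts_sub (fun K x => ~ O K x) K x.
Proof. by move=> oO fK Zx nO L g fL Og; apply: nO; exact: open_ext oO fK fL Zx Og. Qed.

Lemma extend0 O (s : forall R, X R -> R) : open_in (all_sub X) O ->
  open_in Cb (pts_sub (fun K x => ~ O K x)) -> regular_on (meet Cb O) s ->
  exists s', [/\ regular_on Cb s', forall R (x : X R), Cb R x -> O R x -> s' R x = s R x
    & forall K (x : X K), is_field K -> Cb K x -> ~ O K x -> s' K x = 0].
Proof.
move=> oO oO' rs; pose O' := pts_sub (fun K (x : X K) => ~ O K x).
have disj R (x : X R) : O R x -> O' R x -> False.
  have [K [f fK]] := exists_field_pt R.
  by move=> Ox O'x; apply: (O'x K f fK); exact: smem_map.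
have [|||s' [rs' s'E]] := @extend k X Cb
    (fun R x b => (O R x /\ b = s R x) \/ (O' R x /\ b = 0)).
- move=> R R' f x b Cx [[Ox ->]|[Ox ->]]; [left|right]; (split; first exact: smem_map).
    by rewrite (rs R R' f x).
  by rewrite rmorph0.
- move=> R x b b' Cx [[Ox ->]|[Ox ->]] [[Ox' ->]|[Ox' ->]] //.
    by case: (disj R x).
  by case: (disj R x).
- move=> R x K f Cx fK; have [Of|nO] := pselect (O K (fmap f x)).
    have [a [Ra [l [loc fa Ol un]]]] := open_loc oO I fK Of.
    by exists a, Ra, l, (s Ra (fmap l x)); split=> //; left.
  have O'f : O' K (fmap f x) by exact: pts_not_ext oO fK I nO.
  have [a [Ra [l [loc fa Ol un]]]] := open_loc oO' Cx fK O'f.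
  by exists a, Ra, l, 0; split=> //; right.
exists s'; split=> // [R x Cx Ox|K x fK Cx nO]; first by apply: s'E => //; left.
by apply: s'E => //; right; split=> //; exact: pts_not_ext oO fK I nO.
Qed.

(** The function [Ff], a power of the quotient at stage j times powers of g10, g01 and det, has
    weight 0. Extended by zero to [Cb] it is locally constant, and it vanishes where g10 = 0 because
    m > 0. Where it vanishes, the quotient is zero on [Cb] and can be divided by g02. *)
Lemma stage_step j (m : nat) : (0 < m)%N ->
  let l := La - wt (j * q.+1)%N 0 0 in
  m%:Z = q%:Z * (l ord0 e0 - l ord0 e2) - (l ord0 e1 - l ord0 e2) ->
  stage j -> stage j.+1.
Proof.
move=> m0 l hm [O [sj [[oO oO'] sO [OD OY] [rs ls] psiE]]].
have [N [a [b [N0 hw]]]] := weights hm.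
pose w_equiv := zmap_equiv (z := zeta); pose acP := @zactP _ _ _ zeta.
have stC : stable Cb := stable_Cb char_k w_equiv.
have nCb : nice Cb by exact: nice_vanish.
have nD1 : nice D1 by exact: nice_vanish.
pose Ff R (x : X R) := sj R x ^+ N * ent e1 e0 x ^+ (q.+1 * m) *
  upow (ent e0 e1 x) (g01V x) a * upow (dtr x) (dtV x) b.
have sub1 R (x : X R) : meet Cb O R x -> meet D1 O R x by case=> /Cb_D1.
have rF : regular_on (meet Cb O) Ff.
  move=> R R' f x Zx; rewrite /Ff (rs R R' f x (sub1 _ _ Zx)) !ent_map g01V_map dtr_map dtV_map.
  by move: (g01V x) (dtr x) (dtV x) => v1 v2 v3; rewrite !rmorphM !rmorphXn !(upow_map f).
have lF : law (meet Cb O) 0 Ff.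
  rewrite -hw; apply: law_mul; first (apply: law_mul; first apply: law_mul).
  - by apply: law_exp; exact: lawW ls.
  - by apply: law_exp; apply: lawW (law_10 char_k w_equiv) => R x [/Cb_D1].
  - apply: upow_law; first by apply: lawW (law_01 char_k w_equiv) => R x [].
      exact: stable_meet.
    by move=> R x [Cx _]; exact: g01_inv.
  - apply: upow_law; first by apply: lawW (law_det char_k w_equiv).
      exact: stable_meet.
    by move=> R x _; exact: dtrV.
have [s [rS sE s0]] := extend0 oO oO' rF.
have inv : law Cb 0 s.
  apply: (law_upgrade char_k acP nCb rS stC) => K e x fK E Cx; rewrite chi0 mul1r.
  have [Ox|nO] := pselect (O K x).
    rewrite !sE //; [|exact: stC|exact: sO].
    by rewrite lF // chi0 mul1r.
  rewrite !s0 //; first exact: stC.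
  by move=> Oe; apply: nO; exact: stable_iff sO E Oe.
have inv' R (e : GL3 R * GL3 R) (x : X R) : zipE' q e -> Cb R x -> s R (act e x) = s R x.
  by move=> E Cx; rewrite inv // chi0 mul1r.
have cst := flag_const char_k zeta_smooth F_complete rS inv'.
have sY K (x : X K) : is_field K -> Cb K x -> ent e1 e0 x = 0 -> s K x = 0.
  move=> fK Cx x10; have Yx : Xe K x by apply/XeP; case/CbP: Cx.
  rewrite sE //; last exact: (OY K x fK).
  by rewrite /Ff x10 -(prednK m0) mulnS addSn exprS !(mul0r, mulr0).
(* The new open set: from O are removed the points of [Cb] where the locally constant s is nonzero.
   What is removed is open and closed in [Cb]. *)
pose P : point_pred X := fun K x => O K x /\ (Cb K x -> s K x = 0).
have Pext K L (f : {lrmorphism K -> L}) (x : X K) : is_field K -> P K x -> P L (fmap f x).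
  move=> fK [Ox sx]; split=> [|/(Cb_ext fK) Cx]; first exact: smem_map.
  by rewrite rS // sx ?rmorph0.
have PE K (x : X K) : is_field K -> pts_sub P K x <-> P K x.
  by move=> fK; split=> [|Px L f fL]; [exact: pts_sub_pt | exact: Pext].
have cne K (c : k) : c%:A = 0 :> K -> c = 0.
  move=> e; apply/eqP; apply: contraT => c0; have := congr1 (fun z => c^-1 *: z) e.
  by rewrite scalerA mulVf // scale1r scaler0 => /eqP; rewrite oner_eq0.
have oP : open_in (all_sub X) (pts_sub P).
  apply: pts_sub_nbhd => K x fK _ [Ox sx].
  have [Cx|nC] := pselect (Cb K x).
    have [V [oV Vx [c Vc]]] := cst K x fK Cx.
    exists (meet O V); split; [exact: open_in_meet|by []|] => L y fL _ [Oy Vy]; split=> // Cy.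
    have c0 : c = 0 by apply: (cne K); rewrite -(Vc K x fK Cx Vx); exact: sx.
    by rewrite Vc // c0 scale0r.
  exists (meet O (pts_sub (fun K x => ~ Cb K x))); split.
  - by apply: open_in_meet => //; exact: pts_open_notCb.
  - by split=> // L f fL /(Cb_ext fK).
  - by move=> L y fL _ [Oy nCy]; split=> // Cy; case: (pts_sub_pt fL nCy).
have oP' : open_in Cb (pts_sub (fun K x => ~ pts_sub P K x)).
  apply: pts_sub_nbhd => K x fK Cx nP.
  have [Ox|nO] := pselect (O K x).
    have [V [oV Vx [c Vc]]] := cst K x fK Cx.
    exists V; split=> //; first exact: open_in_sub' oV.
    move=> L y fL Cy Vy /(PE L y fL) [_ /(_ Cy)]; rewrite Vc // => /cne c0.
    by apply: nP; apply/PE => //; split=> // _; rewrite Vc // c0 scale0r.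
  exists (pts_sub (fun K x => ~ O K x)); split=> //.
    exact: pts_not_ext oO fK I nO.
  by move=> L y fL Cy nOy /(PE L y fL) [Oy _]; exact: (pts_sub_pt fL nOy).
have stP : stable (pts_sub P).
  move=> R e x E Px K g fK; have [Og sg] := Px K g fK.
  rewrite (act_map acP) //; last by case: E.
  have E' := zipE'_map char_k g E; split; first exact: sO.
  by move=> /(stable_iff stC E') Cg; rewrite inv' // sg.
pose Z := meet D1 (pts_sub P).
have oPD U : open_in U (pts_sub P) by exact: (open_in_sub' _ oP).
have nZ : nice Z by exact: nice_open.
have nCP : nice (meet Cb (pts_sub P)) by exact: nice_open.
have PO R (x : X R) : pts_sub P R x -> O R x.
  by move=> Px; apply: (open_pts oO I) => K g fK; case: (Px K g fK).
have rsC : regular_on (meet Cb (pts_sub P)) sj.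
  by move=> R R' f x [Cx Px]; apply: rs; split; [exact: Cb_D1 | exact: PO].
have pt0 K (x : X K) : is_field K -> Cb K x -> pts_sub P K x -> sj K x * ent e1 e0 x = 0.
  move=> fK Cx Px; have [Ox /(_ Cx)] := proj1 (PE K x fK) Px; rewrite sE // /Ff.
  have [u1 hu1] := upow_unit a (g01_inv Cx); have [u2 hu2] := upow_unit b (dtrV x).
  move=> e; have e' : sj K x ^+ N * ent e1 e0 x ^+ (q.+1 * m) = 0.
    by apply: (unit_mul0 hu1); apply: (unit_mul0 hu2).
  have [->|/eqP n0] := eqVneq (sj K x) 0; first by rewrite mul0r.
  have sN : sj K x ^+ N <> 0 by move=> /(field_exp0 fK).
  by rewrite (field_exp0 fK (field_mul0 fK e' sN)) mulr0.
have R0 R (x : X R) : meet Cb (pts_sub P) R x -> sj R x * ent e1 e0 x = 0.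
  apply: (@eq_on_points k X (meet Cb (pts_sub P)) (fun R x => sj R x * ent e1 e0 x) (fun R _ => 0) nCP).
  - by move=> ? ? f y Zy; rewrite rsC // ent_map rmorphM.
  - by move=> ? ? f y _; rewrite rmorph0.
  - by move=> K y fK [Cy Py]; exact: pt0.
have tC10 : transversal (meet Cb (pts_sub P)) (ent e1 e0).
  by apply: transversal_open => //; exact: transversal_vanish.
have R1 R (x : X R) : meet Cb (pts_sub P) R x -> sj R x = 0.
  apply: (@eq_on_points k X (meet Cb (pts_sub P)) sj (fun R _ => 0) nCP) => //.
    by move=> ? ? f y _; rewrite rmorph0.
  move=> K y fK Zy; have [y10|y10] := pselect (ent e1 e0 y = 0); last first.
    by apply: (field_mul0 fK) y10; rewrite mulrC; exact: R0.
  have [v [Zv v0 v10]] := tC10 K y fK Zy y10.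
  have := R0 _ _ Zv; rewrite v10 mulrC -[jT K 1]expr1 => /jetT_mul.
  by rewrite -rsC // v0.
have [||||s' [rs' s'E]] := @divide k X Z sj (ent e0 e2) nZ.
- by move=> ? ? f y [Dy Py]; apply: rs; split=> //; exact: PO.
- exact: ent_reg.
- by apply: transversal_open => //; exact: transversal_vanish.
- by move=> R x [/D1P h Px] h2; apply: R1; split=> //; apply/CbP.
exists (pts_sub P), s'; split=> //.
- split=> [K x fK Dx nC|K x fK Cx Yx]; apply/PE => //; split; [exact: OD|by []|exact: OY|].
  by move=> _; apply: sY => //; case/XeP: Yx.
- split=> //; have -> : La - wt (j.+1 * q.+1)%N 0 0 = l - wt q.+1 0 0.
    rewrite /l -addrA -opprD wtD; congr (_ - wt _ _ _).
    by rewrite mulSn PoszD addrC.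
  apply: (law_div char_k acP nZ _ rs' _ _ s'E) => //.
  + by apply: stable_meet; [exact: (stable_D1 char_k w_equiv) | exact: stP].
  + exact: ent_reg.
  + by apply: transversal_open => //; exact: transversal_vanish.
  + by apply: lawW ls => R x [Dx /PO].
  + by apply: lawW (law_02 char_k w_equiv) => R x [].
- move=> R x Dx Px; rewrite psiE //; last exact: PO.
  by rewrite s'E // mulrA -exprSr.
Qed.
End Stage.
End ClaimC.

Section ClaimCFinal.
Variables (p r : nat) (k : closedFieldType).
Hypothesis char_k : p \in [pchar k].
Hypothesis r_gt0 : (0 < r)%N.
Local Notation q := (p ^ r)%N.
Variables (S : kfunctor k) (zeta : zip_mor q S).
Hypothesis zeta_smooth : zip_smooth zeta.
Variable F : flag_space zeta.
Hypothesis F_complete : flag_curves_pseudo_complete F.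
Implicit Types (R A B C K L : comAlgType k).
Local Notation X := (ztors zeta).
Local Notation w := (zmap zeta).
Local Notation ent := (ent w).
Local Notation Cb := (Cb w).
Local Notation D1 := (D1 w).
Local Notation Xe := (Xe w).
Local Notation act := (zact (z := zeta)).
Local Notation stable := (stable p r act).
Local Notation law := (law p r act).
Implicit Types (Z U O N : subfunctor X).
Let w_equiv := zmap_equiv (z := zeta).
Let acP := @zactP _ _ _ zeta.

Lemma q_gt1 : (1 < q)%N.
Proof.
have p1 := prime_gt1 (pcharf_prime char_k).
by apply: (leq_trans p1); rewrite -{1}(expn1 p) leq_exp2l.
Qed.

Lemma dtr_neq0 K (x : X K) : dtr x <> 0.
Proof. by move=> e; have := dtrV x; rewrite e mul0r => /esym/eqP; rewrite oner_eq0. Qed.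

(** A lower unipotent of L with parameter c turns g11 into P(c), a polynomial with coefficients g01
    and g02 in degrees 1 and q + 1. These are not both zero, since g00 = 0 and the determinant is
    invertible. A nonzero g11 makes the polynomial [fibre] below monic. *)
Lemma Xe_g11 (psi : forall R, X R -> R) La K (x : X K) : is_field K -> law D1 La psi ->
  Xe K x -> psi K x <> 0 -> exists y : X K, [/\ Xe K y, psi K y <> 0 & ent e1 e1 y <> 0].
Proof.
move=> fK lpsi Xx nx; have [x00 x10] := proj1 (XeP _ _) Xx.
pose P : {poly K} := (ent e1 e1 x)%:P + ent e0 e1 x *: 'X + ent e1 e2 x *: 'X^q + ent e0 e2 x *: 'X^(q.+1).
have [c Pc] : exists c : k, P.[c%:A] <> 0.
  apply: contrapT => no; have P0 : P = 0.
    by apply: (@poly_inf k K P [::]) => c _; apply: contrapT => Pc; apply: no; exists c.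
  have q1 := q_gt1; have cf i : P`_i = 0 by rewrite P0 coef0.
  have := cf 1%N; rewrite !coefD coefC !coefZ coefX !coefXn /= (ltn_eqF q1) eqSS (ltn_eqF (ltnW q1)).
  rewrite mulr1 !mulr0 add0r !addr0 => h1.
  have q11 : (q.+1 == 1)%N = false by rewrite eqSS gtn_eqF // ltnW.
  have := cf q.+1; rewrite !coefD coefC !coefZ coefX !coefXn /= q11 (gtn_eqF (ltnSn q)) eqxx.
  rewrite mulr1 !mulr0 !add0r => h2.
  apply: (@dtr_neq0 K x); rewrite /dtr det3 -!/(ent _ _ x) x00 h1 h2; ring.
have h1 : (1 : K) * 1 = 1 by rewrite mulr1.
pose g := MkGL3 (tri_subproof (c%:A : K) 0 0 h1 h1 h1).
have [y [Ey V01 V02]] := @zip_section p r k char_k K g (mxE _ _ _ _) (mxE _ _ _ _).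
have E' : zipE' q (g, y) by apply/(zipE'P r char_k); split=> //; rewrite /= mxE.
exists (act (g, y) x); split.
- exact: (Xe_orbit char_k w_equiv Ey Xx).
- rewrite lpsi //; last by apply/D1P.
  apply: (field_mulf fK) => // e; have Bg : in_B (g, y).1 by case: E'.
  by have := chiN La Bg; rewrite e mul0r => /esym/eqP; rewrite oner_eq0.
- have [_ -> _] := ent_actE char_k w_equiv x (i := e1) Ey isT.
  rewrite [gmxV _ _ _]V01 /= !mxE /= mul0r add0r expr1n !mul1r => e; apply: Pc; rewrite -[RHS]e.
  rewrite /P !hornerE exprS; ring.
Qed.

Lemma monic_exp_size K (G : {poly K}) n : G \is monic -> (n * (size G).-1).+1 = size (G ^+ n).
Proof.
move=> mG; elim: n => [|n IH]; first by rewrite expr0 size_poly1.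
have Gn0 : G ^+ n != 0 by rewrite monic_neq0 // monic_exp.
have sG : (0 < size G)%N by rewrite lt0n size_poly_eq0 monic_neq0.
rewrite exprSr size_Mmonic // -IH mulSn addSn /= addnC -{2}(prednK sG).
by case: (size G) sG => // m _; rewrite /= addnS.
Qed.

(** The polynomial g02(u_T x) / g11, where v stands for 1 / g11. *)
Definition fibre K (v : K) (x : X K) : {poly K} :=
  'X^(q.+1) + (v * ent e0 e2 x)%:P + (v * ent e1 e2 x) *: 'X + (v * ent e0 e1 x) *: 'X^q.

Lemma fibre_monic K v (x : X K) : fibre v x \is monic /\ size (fibre v x) = q.+2.
Proof.
have q1 := q_gt1; rewrite /fibre -!addrA; set rest := (_%:P + _).
have sr : (size rest < size ('X^(q.+1) : {poly K}))%N.
  rewrite size_polyXn ltnS; apply: (leq_trans (size_polyD _ _)); rewrite geq_max; apply/andP; split.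
    by apply: (leq_trans (size_polyC_leq1 _)).
  apply: (leq_trans (size_polyD _ _)); rewrite geq_max; apply/andP; split.
    by apply: (leq_trans (size_scale_leq _ _)); rewrite size_polyX ltnW // ltnS.
  by apply: (leq_trans (size_scale_leq _ _)); rewrite size_polyXn.
split; last by rewrite size_polyDl // size_polyXn.
by rewrite monicE lead_coefDl // lead_coefXn.
Qed.

Lemma fibre_ent K v (x : X K) : ent e1 e1 x * v = 1 ->
  polyq K (fibre v x) = polyAC K v * ent e0 e2 (uX p r act x).
Proof.
move=> hv; rewrite /uX; have [_ _ _ _ [-> _]] := ent_uE char_k w_equiv (polyAX K) (fmap (polyAC K) x).
rewrite !ent_map /fibre !polyACE /polyAX -!mul_polyC !polyCM.
have -> : 'X^(q.+1) = (ent e1 e1 x * v)%:P * 'X * 'X^q :> {poly K} by rewrite hv mul1r exprS.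
rewrite polyCM !(rmorphD (polyq K)) !(rmorphM (polyq K)) (rmorphXn (polyq K)).
move: (polyq K v%:P) (polyq K (ent e0 e2 x)%:P) (polyq K (ent e1 e2 x)%:P) (polyq K (ent e0 e1 x)%:P)
  (polyq K (ent e1 e1 x)%:P) (polyq K 'X) => a b c d e t.
by move: (t ^+ q) => tq; ring.
Qed.

Lemma claimC (psi : forall R, X R -> R) La K (x : X K) : is_field K ->
  regular_on D1 psi -> law D1 La psi -> Xe K x -> psi K x <> 0 ->
  La ord0 e1 <= La ord0 e2.
Proof.
move=> fK rpsi lpsi; move=> Xx0 nx0.
have [{Xx0 nx0}y [Xx nx g11]] := Xe_g11 fK lpsi Xx0 nx0; move: x y Xx nx g11 => _ x Xx nx g11.
pose v : int := q%:Z * (La ord0 e0 - La ord0 e2) - (La ord0 e1 - La ord0 e2).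
pose M := (q * q.+1)%N.
have [J0 J0P] : exists J : nat, v <= (J * M)%N%:Z.
  exists `|v|%N; apply: (le_trans (lez_abs v)); rewrite lez_nat leq_pmulr //.
  by rewrite /M muln_gt0 (ltnW q_gt1).
have [J vJ Jmin] := @ex_minnP (fun n => v <= (n * M)%N%:Z) (ex_intro _ J0 J0P).
have stg n : (n <= J)%N -> stage La psi n.
  elim: n => [_|n IH nJ]; first exact: stage0.
  have vn : 0 < v - (n * M)%N%:Z.
    by rewrite subr_gt0 ltNge; apply/negP => /Jmin; rewrite leqNgt nJ.
  have mE : `|v - (n * M)%N%:Z|%N%:Z = v - (n * M)%N%:Z by rewrite gez0_abs // ltW.
  apply: (stage_step char_k zeta_smooth F_complete (m := `|v - (n * M)%N%:Z|%N)).
  - by rewrite absz_gt0 gt_eqF.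
  - rewrite mE /v /M !mxE /= !PoszM -[q.+1]addn1 !PoszD; ring.
  - by apply: IH; exact: ltnW.
have orb R (h : {lrmorphism K -> R}) (e : GL3 R * GL3 R) : zipE q e -> D1 R (act e (fmap h x)).
  move=> E; have /XeP [h0 _] := Xe_orbit char_k w_equiv E (smem_map h Xx); exact/D1P.
have Du : D1 _ (uX p r act x) by apply: orb; exact: (@zipE_uE p r k char_k).
have phi0 : (phi p r act psi x).[0] = psi K x.
  rewrite -[phi _ _ _ _ _]map_poly_idfun -(phi_horner char_k acP idfun 0 rpsi Du) fmap_id.
  by rewrite uE0 // (act1 acP).
have phin : phi p r act psi x != 0.
  by apply/eqP => e; apply: nx; rewrite -phi0 e horner0.
have [d [dE sd]] := phi_size char_k acP fK rpsi (law_law_pt lpsi) orb phin.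
have Jd : (J * q.+1 <= d)%N.
  have [->|J0'] := posnP J; first by rewrite mul0n.
  have [vv hv] := field_inv fK g11; have [mG sG] := fibre_monic vv x.
  have hG := fibre_ent hv; set G := fibre vv x in mG sG hG.
  have mGJ : G ^+ J \is monic by exact: monic_exp.
  have sGJ : size (G ^+ J) = (J * q.+1).+1 by rewrite -monic_exp_size // sG.
  (* Over K[T] / (G^J) the function g02^J vanishes at u_T x. So every field-valued point of this
     family lies in [Cb] and [Xe], hence in O, and psi = g02^J s vanishes on it: G^J divides the
     polynomial psi(u_T x). *)
  pose I (h : polyA K) := exists H, h = polyq K (G ^+ J * H).
  have iI : is_ideal I.
    split=> [|_ _ [H ->] [H' ->]|b _ [H ->]].
    - by exists 0; rewrite mulr0 rmorph0.
    - by exists (H + H'); rewrite mulrDr rmorphD.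
    - have [B <-] := polyq_surj b; exists (B * H); rewrite -rmorphM; congr (polyq K _).
      by rewrite mulrCA.
  have szM (H : {poly K}) : H != 0 -> ((J * q.+1).+1 <= size (G ^+ J * H)%R)%N.
    move=> H0; rewrite mulrC size_Mmonic // sGJ addnS /=.
    by rewrite -[X in (X <= _)%N]add1n leq_add2r lt0n size_poly_eq0.
  have I1 : ~ I 1.
    case=> H; rewrite -(rmorph1 (polyq K)) => /polyq_inj e.
    have H0 : H != 0 by apply/eqP => H0; move/eqP: e; rewrite H0 mulr0 oner_eq0.
    by move: (szM H H0); rewrite -e size_poly1 ltnS leqNgt muln_gt0 J0'.
  pose Q := PIdeal iI I1; pose pr := qap Q.
  have [O [s [[oO _] _ [_ OY] _ psiE]]] := stg J (leqnn J).
  pose xr := fmap pr (uX p r act x).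
  have Xu : Xe _ (uX p r act x).
    by apply: (Xe_orbit char_k w_equiv); [exact: (@zipE_uE p r k char_k) | exact: smem_map].
  have gJ : ent e0 e2 xr ^+ J = 0.
    have vu : polyAC K vv * polyAC K (ent e1 e1 x) = 1 by rewrite -rmorphM mulrC hv rmorph1.
    rewrite ent_map -rmorphXn; apply/(qap0 Q); exists ((ent e1 e1 x)%:P ^+ J).
    rewrite -exprMn (rmorphXn (polyq K)); congr (_ ^+ J).
    by rewrite rmorphM hG -polyACE mulrAC vu mul1r.
  have Oxr : O _ xr.
    apply: (open_pts oO Logic.I) => L g fL; apply: OY => //; last by do 2!apply: smem_map.
    have /XeP [h0 _] := smem_map (g \o pr) Xu.
    apply/CbP; rewrite /xr -fmap_comp; split=> //; apply: (field_exp0 fL (n := J)).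
    by rewrite fmap_comp ent_map -rmorphXn gJ rmorph0.
  have p0 : pr (psi _ (uX p r act x)) = 0.
    rewrite -rpsi // psiE //; last exact: smem_map.
    by rewrite gJ mul0r.
  have [H] := proj1 (qap0 Q _) p0.
  rewrite -phiE => /polyq_inj e.
  have H0 : H != 0 by apply/eqP => H0; move: phin; rewrite e H0 mulr0 eqxx.
  by have := leq_trans (szM H H0) (eq_leq (esym (congr1 (fun P : {poly K} => size P) e))) => h;
    have := leq_trans h sd; rewrite ltnS.
have vd : v <= q%:Z * d%:Z.
  apply: (le_trans vJ); rewrite -PoszM lez_nat /M mulnCA; exact: leq_mul.
(* Since q (a0 - a1) = q d, comparison with v <= q d leaves (q - 1)(a1 - a2) <= 0. *)
have vE : v = q%:Z * (La ord0 e0 - La ord0 e1) + (q%:Z - 1) * (La ord0 e1 - La ord0 e2) by rewrite /v; ring.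
rewrite vE dE gerDl in vd.
have q1 : 0 < q%:Z - 1 :> int by rewrite subr_gt0 ltz_nat q_gt1.
by rewrite -subr_le0 -(pmulr_rle0 _ q1).
Qed.
End ClaimCFinal.

(** * The second inequality *)

Section Hom.
Variable R : comNzRingType.
Implicit Types (P : {poly R}) (a b c : R).

(* The homogenization of degree d of P, evaluated at (a, b). *)
Definition hom d P a b : R := \sum_(j < d.+1) P`_j * a ^+ (d - j) * b ^+ j.

Definition lin (l : R * R) : {poly R} := l.1%:P + l.2 *: 'X.
Definition linE (l : R * R) a b : R := l.1 * a + l.2 * b.

Lemma homD d P Q a b : hom d (P + Q) a b = hom d P a b + hom d Q a b.
Proof. by rewrite /hom -big_split; apply: eq_bigr => j _; rewrite coefD !mulrDl. Qed.

Lemma homZ d c P a b : hom d (c *: P) a b = c * hom d P a b.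
Proof. by rewrite /hom mulr_sumr; apply: eq_bigr => j _; rewrite coefZ -!mulrA. Qed.

Lemma hom_sum d I (r : seq I) (G : I -> {poly R}) a b :
  hom d (\sum_(i <- r) G i) a b = \sum_(i <- r) hom d (G i) a b.
Proof.
elim: r => [|i r IH]; last by rewrite !big_cons homD IH.
by rewrite !big_nil /hom big1 // => j _; rewrite coef0 !mul0r.
Qed.

Lemma hom_mulX d P a b : hom d.+1 (P * 'X) a b = hom d P a b * b.
Proof.
rewrite /hom big_ord_recl coefMX /= !mul0r add0r mulr_suml.
by apply: eq_bigr => j _; rewrite coefMX /= /bump /= add1n subSS exprSr mulrA.
Qed.

Lemma hom_up d P a b : (size P <= d.+1)%N -> hom d.+1 P a b = hom d P a b * a.
Proof.
move=> sP; rewrite /hom big_ord_recr /= (nth_default 0 sP) !mul0r addr0 mulr_suml.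
apply: eq_bigr => j _; rewrite subSn; last by rewrite -ltnS.
by rewrite exprSr !mulrA mulrAC.
Qed.

Lemma hom_mul_lin d P l a b : (size P <= d.+1)%N ->
  hom d.+1 (P * lin l) a b = hom d P a b * linE l a b.
Proof.
move=> sP; rewrite /lin mulrDr -scalerAr [P * _%:P]mulrC mul_polyC homD !homZ hom_mulX hom_up //.
by rewrite /linE mulrDr ![l.1 * _]mulrC ![l.2 * _]mulrC -!mulrA ![_ * l.1]mulrC ![_ * l.2]mulrC.
Qed.

Lemma size_lin l : (size (lin l) <= 2)%N.
Proof.
apply: (leq_trans (size_polyD _ _)); rewrite geq_max; apply/andP; split.
  by apply: (leq_trans (size_polyC_leq1 _)).
by apply: (leq_trans (size_scale_leq _ _)); rewrite size_polyX.
Qed.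

Lemma size_mul_lin P l n : (size P <= n.+1)%N -> (size (P * lin l)%R <= n.+2)%N.
Proof.
move=> sP; apply: (leq_trans (size_polyMleq _ _)).
have := leq_add sP (size_lin l); rewrite addn2 => h.
by rewrite -subn1 leq_subLR add1n.
Qed.

Lemma hom_lins i j l m a b : let Q := lin l ^+ i * lin m ^+ j in
  (size Q <= (i + j).+1)%N /\ hom (i + j) Q a b = linE l a b ^+ i * linE m a b ^+ j.
Proof.
elim: j => [|j [s IH]] /=.
  rewrite addn0 !mulr1; elim: i => [|i [s IH]].
    by rewrite !expr0 size_poly1 /hom big_ord1 coef1 /= !mul1r.
  by rewrite !exprSr; split; [exact: size_mul_lin | rewrite hom_mul_lin // IH].
rewrite addnS !exprSr !mulrA; split; first exact: size_mul_lin.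
by rewrite hom_mul_lin // IH.
Qed.

Lemma hom_subst d P l m a b :
  hom d (\sum_(j < d.+1) P`_j *: (lin l ^+ (d - j) * lin m ^+ j)) a b =
  hom d P (linE l a b) (linE m a b).
Proof.
rewrite hom_sum [RHS]/hom; apply: eq_bigr => j _; rewrite homZ -mulrA; congr (_ * _).
have jd : (j <= d)%N by rewrite -ltnS.
by rewrite -{1}(subnK jd); case: (hom_lins (d - j) j l m a b).
Qed.

End Hom.

Lemma map_lin (R R' : comNzRingType) (f : {rmorphism R -> R'}) l :
  map_poly f (lin l) = lin (f l.1, f l.2).
Proof. by rewrite /lin rmorphD /= map_polyC map_polyZ map_polyX. Qed.

Lemma map_subst (R R' : comNzRingType) (f : {rmorphism R -> R'}) d (P : {poly R}) l m :
  map_poly f (\sum_(j < d.+1) P`_j *: (lin l ^+ (d - j) * lin m ^+ j)) =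
  \sum_(j < d.+1) (map_poly f P)`_j *: (lin (f l.1, f l.2) ^+ (d - j) * lin (f m.1, f m.2) ^+ j).
Proof.
rewrite rmorph_sum; apply: eq_bigr => j _ /=.
by rewrite map_polyZ rmorphM !rmorphXn /= !map_lin coef_map.
Qed.

Section Rho.
Variables (p r : nat) (k : closedFieldType).
Hypothesis char_k : p \in [pchar k].
Local Notation q := (p ^ r)%N.
Variables (X : kfunctor k) (act : pre_action X) (w : kmor X (GLfun k)).
Hypothesis actP : Defs.is_action (@zipE q) act.
Hypothesis w_act : forall (R : comAlgType k) (e : GL3 R * GL3 R) (x : X R), zipE q e ->
    w R (act e x) = zip_act e (w R x).
Hypothesis smw : smooth w.
Implicit Types (R A B C K L : comAlgType k) (Z U O : subfunctor X).
Local Notation ent := (ent w).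
Local Notation law := (law p r act).
Local Notation law_pt := (law_pt p r act).
Local Notation u := (@uE _ q).
Local Notation phi := (phi p r act).
Local Notation all := (all_sub X).

Variables (f : forall R, X R -> R) (la : 'rV[int]_3) (d : nat).
Arguments f : clear implicits.
Hypothesis rf : regular_on all f.
Hypothesis lf : law all la f.
Hypothesis dE : la ord0 e0 - la ord0 e1 = d.

Lemma phi_size_pt K (x : X K) : is_field K -> (size (phi f x) <= d.+1)%N.
Proof.
move=> fK; have [->|nz] := eqVneq (phi f x) 0; first by rewrite size_poly0.
have [//|d' [e sd]] := @phi_size p r k char_k X act actP all la f K x fK rf (law_law_pt lf) _ nz.
by move: e; rewrite dE => -[->].
Qed.

(** The degree bound over fields, carried to all algebras coefficient by coefficient because X is
    reduced. *)
Lemma phi_coef0 R (x : X R) j : (d < j)%N -> (phi f x)`_j = 0.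
Proof.
move=> dj; apply: (@eq_on_points k X all (fun R x => (phi f x)`_j) (fun R _ => 0) (nice_X smw)) => //.
- by move=> ? ? h y _; rewrite (phi_map char_k actP h rf) // coef_map.
- by move=> ? ? h y _; rewrite rmorph0.
- by move=> K y fK _; rewrite nth_default // (leq_trans (phi_size_pt y fK)).
Qed.

Lemma phi_size_all R (x : X R) : (size (phi f x) <= d.+1)%N.
Proof. by apply/leq_sizeP => j dj; exact: phi_coef0. Qed.

Definition hq R (P : {poly R}) (a b : R) : R := \sum_(j < d.+1) P`_j ^+ q * a ^+ (d - j) * b ^+ j.

Lemma hqE R (fr : {rmorphism R -> R}) (P : {poly R}) a b : (forall x, fr x = x ^+ q) ->
  hq P a b = hom d (map_poly fr P) a b.
Proof. by move=> frE; apply: eq_bigr => j _; rewrite coef_map /= frE. Qed.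

Definition rho R (x : X R) : R := hq (phi f x) (f2 w x) (- f3 w x).

Lemma rhoE R (x : X R) : rho x = hq (phi f x) (f2 w x) (- f3 w x). Proof. by []. Qed.

Lemma hq_map R R' (h : {lrmorphism R -> R'}) (P : {poly R}) a b :
  hq (map_poly h P) (h a) (h b) = h (hq P a b).
Proof.
rewrite /hq rmorph_sum; apply: eq_bigr => j _.
by rewrite !rmorphM !rmorphXn coef_map.
Qed.

Lemma rho_map R R' (h : {lrmorphism R -> R'}) (x : X R) : rho (fmap h x) = h (rho x).
Proof.
rewrite /rho (phi_map char_k actP h rf) // f2_map f3_map -rmorphN; exact: hq_map.
Qed.

Lemma poly_subst_lin R (P : {poly R}) t : (size P <= d.+1)%N ->
  P \Po ('X + t%:P) = \sum_(j < d.+1) P`_j *: (lin (1, 0) ^+ (d - j) * lin (t, 1) ^+ j).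
Proof.
move=> sP; rewrite comp_polyE (big_ord_widen _ (fun j => P`_j *: ('X + t%:P) ^+ j) sP) big_mkcond /=.
apply: eq_bigr => j _; rewrite /lin /= scale0r scale1r addr0 expr1n mul1r [t%:P + _]addrC.
by case: ltnP => // h; rewrite nth_default // scale0r.
Qed.

Lemma phi_uE R (x : X R) t : phi f (act (u t) x) = phi f x \Po ('X + t%:P).
Proof.
apply: (@polyq_inj k R); rewrite phiE /uX (act_map actP); last exact: zipE_uE.
rewrite map2_uE (uE_act char_k actP) (phi_horner char_k actP (polyAC R) _ rf) //.
elim/poly_ind: (phi f x) => [|P c IH]; first by rewrite comp_poly0 !rmorph0 horner0.
rewrite comp_polyD comp_polyM comp_polyX comp_polyC (rmorphD (polyq R)) (rmorphM (polyq R)) -IH.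
rewrite rmorphD rmorphM /= map_polyX map_polyC !hornerE; congr (_ * _ + _).
by rewrite -[RHS]/(polyq R ('X + t%:P)) rmorphD.
Qed.

Lemma rho_uE R (x : X R) t : rho (act (u t) x) = rho x.
Proof.
have [fr frE] := ex_frob r char_k R.
rewrite /rho !(hqE _ _ _ frE) (f2_uE char_k w_act) (f3_uE char_k w_act) phi_uE.
rewrite poly_subst_lin ?phi_size_all // map_subst hom_subst /linE /= !frE.
rewrite expr1n (exp0q r char_k) mul1r mul0r addr0 mul1r.
by congr (hom _ _ _ _); ring.
Qed.

Lemma avoid_lin K (b0 b1 : K) : is_field K -> b0 <> 0 ->
  exists s : seq k, forall t, t \notin s -> b0 + t%:A * b1 <> 0.
Proof.
move=> fK b00; have [[c hc]|no] := pselect (exists c : k, b0 + c%:A * b1 = 0); last first.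
  by exists [::] => t _ e; apply: no; exists t.
exists [:: c] => t; rewrite inE => tc e.
have e1 : (t - c) *: b1 = 0.
  have := etrans e (esym hc); rewrite !mulr_algl scalerBl => /addrI ->.
  by rewrite subrr.
have b10 : b1 = 0.
  have tc0 : t - c != 0 by rewrite subr_eq0.
  by rewrite -[b1]scale1r -(mulVf tc0) -scalerA e1 scaler0.
by apply: b00; rewrite -hc b10 mulr0 addr0.
Qed.

Lemma chi_diag l R (b : GL3 R) (D D' : 'I_3 -> R) : in_B b -> (forall i, gmx b i i = D i) ->
  (forall i, D i * D' i = 1) -> chi l b = \prod_i upow (D i) (D' i) (l ord0 i).
Proof.
move=> Bb bD DD; apply: eq_bigr => i _; rewrite bD; congr (upow _ _ _).
by apply: (inv_uniq _ (DD i)); rewrite -bD diag_inv.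
Qed.

(** Moving e past u_t changes the coordinate t to s by a fractional linear map and leaves an element
    of E' with diagonal (b, b00 b11 / b, b22), where b = b00 + t b10. With l0 = l1 + d its character
    is b^d times that of (l1, l1, l2) at e. *)
Lemma twist_borel K (e : GL3 K * GL3 K) (t s v : K) : zipE' q e ->
  (gmx e.1 e0 e0 + t * gmx e.1 e1 e0) * v = 1 -> s = t * gmx e.1 e1 e1 * v ->
  let e' := mul2 (mul2 (u t) e) (inv2 (u s)) in
  [/\ zipE' q e', mul2 (u t) e = mul2 e' (u s)
    & chi la e'.1 = chi (wt (la ord0 e1) (la ord0 e1) (la ord0 e2)) e.1 *
        (gmx e.1 e0 e0 + t * gmx e.1 e1 e0) ^+ d].
Proof.
move=> E hv sE e'; have [Ez Bb] := E; have [b01 b02 b12] := tri_entries Bb.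
have Eu t' : zipE q (u t' : GL3 K * GL3 K) by exact: zipE_uE.
have E1 : zipE q e'.
  by apply: (@zipE_mul p r k char_k); [exact: (@zipE_mul p r k char_k) | exact: (@zipE_inv p r k char_k)].
pose U (t : K) : 'M[K]_3 := mx3 1 t 0 0 1 0 0 0 1.
have xE : gmx e'.1 = U t *m gmx e.1 *m U (- s) by [].
have xij i j : gmx e'.1 i j = (U t *m gmx e.1) i e0 * U (- s) e0 j + (U t *m gmx e.1) i e1 * U (- s) e1 j
   + (U t *m gmx e.1) i e2 * U (- s) e2 j by rewrite xE mulmx3.
set b := gmx e.1 e0 e0 + _ in hv *.
have x00 : gmx e'.1 e0 e0 = b by rewrite xij !mulmx3 !mxE /= /b; ring.
have x01 : gmx e'.1 e0 e1 = 0.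
  rewrite xij !mulmx3 !mxE /= b01 b02.
  have -> : (1 * gmx e.1 e0 e0 + t * gmx e.1 e1 e0 + 0 * gmx e.1 e2 e0) * - s +
    (1 * 0 + t * gmx e.1 e1 e1 + 0 * gmx e.1 e2 e1) * 1 +
    (1 * 0 + t * gmx e.1 e1 e2 + 0 * gmx e.1 e2 e2) * 0 = t * gmx e.1 e1 e1 - b * s by rewrite /b; ring.
  rewrite sE; have -> : t * gmx e.1 e1 e1 - b * (t * gmx e.1 e1 e1 * v) = t * gmx e.1 e1 e1 * (1 - b * v) by ring.
  by rewrite hv subrr mulr0.
have x11 : gmx e'.1 e1 e1 = gmx e.1 e0 e0 * gmx e.1 e1 e1 * v.
  rewrite xij !mulmx3 !mxE /=.
  have -> : (0 * gmx e.1 e0 e0 + 1 * gmx e.1 e1 e0 + 0 * gmx e.1 e2 e0) * - s +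
    (0 * gmx e.1 e0 e1 + 1 * gmx e.1 e1 e1 + 0 * gmx e.1 e2 e1) * 1 +
    (0 * gmx e.1 e0 e2 + 1 * gmx e.1 e1 e2 + 0 * gmx e.1 e2 e2) * 0 =
    gmx e.1 e1 e1 * 1 - gmx e.1 e1 e0 * s by ring.
  by rewrite -hv sE /b; ring.
have x22 : gmx e'.1 e2 e2 = gmx e.1 e2 e2 by rewrite xij !mulmx3 !mxE /=; ring.
have E' : zipE' q e' by apply/(zipE'P r char_k).
split=> //.
  rewrite [LHS]surjective_pairing [RHS]surjective_pairing; congr (_, _);
  by rewrite /e' /= -gmulA gVmul gmul1.
have dg i : gmx e.1 i i * gmxV e.1 i i = 1 by exact: diag_inv.
pose D i : K := if i == e0 then b else if i == e1 then gmx e.1 e0 e0 * gmx e.1 e1 e1 * v else gmx e.1 e2 e2.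
pose D' i : K := if i == e0 then v else if i == e1 then gmxV e.1 e0 e0 * gmxV e.1 e1 e1 * b else gmxV e.1 e2 e2.
have vb : v * b = 1 by rewrite mulrC.
have vb' : b * v = 1 := hv.
rewrite (@chi_diag la _ _ D D'); last 3 first.
- by case: E'.
- by apply: forall3; rewrite /D /=.
- apply: forall3; rewrite /D /D' //=.
  by rewrite mulrACA [v * _]mulrC vb' mulr1 mulrACA !dg mulr1.
rewrite prod3 /D /D' /= chiE !upow_mul.
have -> : la ord0 e0 = la ord0 e1 + d%:Z by rewrite -dE addrC subrK.
rewrite upowD //=; set A := upow b v _.
have AV : A * upow v b (la ord0 e1) = 1.
  by rewrite /A -upow_mul hv vb; case: (la ord0 e1) => n; rewrite /= expr1n.
set B := upow v b _ in AV *; set c0 := upow _ _ _; set c1 := upow _ _ _; set c2 := upow _ _ _.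
by rewrite -[RHS]mul1r -AV; ring.
Qed.

(** E' acts on phi, viewed as a binary form of degree d, by a linear substitution and a character.
    By [twist_borel] both sides agree at all t in k with b00 + t b10 <> 0, that is at all but
    finitely many. *)
Lemma phi_borel K (e : GL3 K * GL3 K) (x : X K) : is_field K -> zipE' q e ->
  let b i j := gmx e.1 i j in
  phi f (act e x) = chi (wt (la ord0 e1) (la ord0 e1) (la ord0 e2)) e.1 *:
    \sum_(j < d.+1) (phi f x)`_j *: (lin (b e0 e0, b e1 e0) ^+ (d - j) * lin (0, b e1 e1) ^+ j).
Proof.
move=> fK E b; have [Ez Bb] := E.
have b00 : b e0 e0 <> 0.
  by move=> h; have := diag_inv e0 Bb; rewrite -/(b e0 e0) h mul0r => /esym/eqP; rewrite oner_eq0.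
have [s sP] := avoid_lin (b e1 e0) fK b00.
apply: (@poly_inf_eq k K _ _ s) => t0 /sP; set t : K := t0%:A => nz.
have [v hv] := field_inv fK nz; pose s0 := t * b e1 e1 * v.
have [E' ee ce] := twist_borel E hv (erefl s0).
have hor y t' : f K (act (u t') y) = (phi f y).[t'].
  by rewrite -{1}[y]fmap_id (phi_horner char_k actP idfun _ rf) // map_poly_idfun.
have Eu t' : zipE q (u t' : GL3 K * GL3 K) by exact: zipE_uE.
rewrite -hor -(actM actP) // ee (actM actP) //; last by case: E'.
rewrite lf // hor ce hornerZ -mulrA; congr (_ * _).
rewrite (horner_coef_wide _ (phi_size_pt x fK)) mulr_sumr horner_sum; apply: eq_bigr => j _.
rewrite hornerZ hornerM !horner_exp /lin /= !hornerD !hornerZ !hornerC !hornerX add0r.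
have jd : (j <= d)%N by rewrite -ltnS.
have -> : (b e0 e0 + t * b e1 e0) ^+ d = (b e0 e0 + t * b e1 e0) ^+ (d - j) * (b e0 e0 + t * b e1 e0) ^+ j.
  by rewrite -exprD subnK.
rewrite mulrCA; congr (_ * _); rewrite [b e1 e0 * t]mulrC -mulrA; congr (_ * _).
rewrite -exprMn; congr (_ ^+ j); rewrite /s0.
have -> : (b e0 e0 + t * b e1 e0) * (t * b e1 e1 * v) =
  (b e0 e0 + t * b e1 e0) * v * (b e1 e1 * t) by ring.
by rewrite hv mul1r.
Qed.

Lemma rho_law : law all (wt (la ord0 e1) (la ord0 e1) (la ord0 e2) *+ q + wt q.+1 q.+1 q *+ d) rho.
Proof.
apply: (law_upgrade char_k actP (nice_X smw)) => // [R R' h x _|K e x fK E _].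
  exact: rho_map.
have [fr frE] := ex_frob r char_k K; have Bb : in_B e.1 by case: E.
rewrite /rho !(hqE _ _ _ frE) phi_borel // map_polyZ homZ map_subst hom_subst.
rewrite chiD // !chiMn // chi_nat frE -mulrA; congr (_ * _).
rewrite (act_f2 char_k w_act) // (act_f3 char_k w_act) // /linE /= rmorph0 mul0r add0r !frE.
set b00 := gmx e.1 e0 e0; set b10 := gmx e.1 e1 e0; set b11 := gmx e.1 e1 e1; set b22 := gmx e.1 e2 e2.
rewrite !exprS; move: (b00 ^+ q) (b10 ^+ q) (b11 ^+ q) (b22 ^+ q) => B00 B10 B11 B22.
rewrite /hom mulr_sumr; apply: eq_bigr => j _.
have jd : (j <= d)%N by rewrite -ltnS.
(* The substitution returns f2 and - f3, both multiplied by the same c; c^d is the character of d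
   (q+1, q+1, q). *)
set c := b00 * B00 * (b11 * B11) * B22.
have -> : B00 * (b00 * b11 * B22 * (B11 * f2 w x + B10 * f3 w x)) +
  B10 * - (b00 * B00 * b11 * B22 * f3 w x) = c * f2 w x by rewrite /c; ring.
have -> : B11 * - (b00 * B00 * b11 * B22 * f3 w x) = c * - f3 w x by rewrite /c; ring.
have cd : c ^+ (d - j) * c ^+ j = c ^+ d by rewrite -exprD subnK.
by rewrite [(c * f2 w x) ^+ _]exprMn [(c * - f3 w x) ^+ _]exprMn -/c -cd; ring.
Qed.
End Rho.

Lemma jet_unit (k : closedFieldType) (R : comAlgType k) N (a : jet R N) (v : R) :
  j0 R N a * v = 1 -> exists b, a * b = 1.
Proof.
move=> av; apply: unit_pt => K g fK ga.
have [z e] : exists z, a * jC R N v - 1 = jT R N * z.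
  by apply: jetT_dvd; rewrite rmorphB rmorphM /= j0C av rmorph1 subrr.
have gT : g (jT R N) = 0 by apply: (field_exp0 fK (n := N.+1)); rewrite -rmorphXn jTN rmorph0.
have := congr1 g e; rewrite rmorphB !rmorphM rmorph1 /= ga gT !mul0r sub0r => /eqP.
by rewrite oppr_eq0 oner_eq0.
Qed.

Section Rho1.
Variables (p r : nat) (k : closedFieldType).
Hypothesis char_k : p \in [pchar k].
Local Notation q := (p ^ r)%N.
Variables (X : kfunctor k) (act : pre_action X) (w : kmor X (GLfun k)).
Hypothesis actP : Defs.is_action (@zipE q) act.
Hypothesis w_act : forall (R : comAlgType k) (e : GL3 R * GL3 R) (x : X R), zipE q e ->
    w R (act e x) = zip_act e (w R x).
Hypothesis smw : smooth w.
Implicit Types (R A B C K L : comAlgType k) (Z U O : subfunctor X).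
Local Notation ent := (ent w).
Local Notation law := (law p r act).
Local Notation stable := (stable p r act).
Local Notation u := (@uE _ q).
Local Notation phi := (phi p r act).
Local Notation all := (all_sub X).
Local Notation D1 := (D1 w).
Local Notation Xe := (Xe w).
Local Notation Cb := (Cb w).

Lemma law_div_exp Z la lb (s c s' : forall R, X R -> R) n : nice Z -> stable Z ->
  regular_on Z s' -> regular_on Z c -> transversal Z c ->
  (forall R (x : X R), Z R x -> s R x = c R x ^+ n * s' R x) ->
  law Z la s -> law Z lb c -> law Z (la - lb *+ n) s'.
Proof.
move=> nZ sZ rs' rc tr; elim: n la s => [|n IH] la s sE ls lc.
  rewrite mulr0n subr0 => R e x E Zx; rewrite -[s' R x]mul1r -[s' R (act e x)]mul1r.
  by rewrite -[1](expr0 (c R x)) -sE // [X in X * _](_ : _ = c R (act e x) ^+ 0) // -sE ?ls //; exact: sZ.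
rewrite mulrS opprD addrA; apply: (IH (la - lb) (fun R x => c R x ^+ n * s' R x)) => //.
apply: (law_div char_k actP nZ sZ _ rc tr (s := s)) => //.
  by move=> R R' f x Zx; rewrite rc // rs' // rmorphM rmorphXn.
by move=> R x Zx; rewrite sE // exprS mulrA.
Qed.

Lemma map2_mul R R' (h : {lrmorphism R -> R'}) (e e' : GL3 R * GL3 R) :
  map2 h (mul2 e e') = mul2 (map2 h e) (map2 h e').
Proof. by congr (_, _); exact: gmapM. Qed.

(** A jet at e x is carried to a jet at x by the inverse of the constant jet of e, and s changes
    only by a factor. *)
Lemma near_zero_act (s : forall R, X R -> R) K (e : GL3 K * GL3 K) (x : X K) : zipE q e ->
  (forall R (h : {lrmorphism K -> R}) (y : X R), exists c, s R (act (map2 h e) y) = c * s R y) ->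
  near_zero all s x -> near_zero all s (act e x).
Proof.
move=> E sE nz R h N y _ y0.
pose j : {lrmorphism K -> jet R N} := jC R N \o h.
have Ej : zipE q (map2 j e) by exact: (zipE_map char_k).
pose y' := act (inv2 (map2 j e)) y.
have yE : act (map2 j e) y' = y by exact: (actVK char_k actP).
have [c] := sE _ j y'; rewrite yE => ->; rewrite (nz R h N y') ?mulr0 //.
have Ei : zipE q (inv2 (map2 j e)) by exact: (@zipE_inv p r k char_k).
rewrite (act_map actP) // y0 (act_map actP) // -[RHS](actK char_k actP _ (zipE_map char_k h E)).
congr act; rewrite /map2 /inv2 /= !gmapV.
have jh (g : GL3 K) : gmap (j0 R N) (gmap j g) = gmap h g.
  by apply: GL3_inj; apply/matrixP => i l; rewrite !mxE; exact: j0C.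
by rewrite !jh.
Qed.

Variables (f : forall R, X R -> R) (la : 'rV[int]_3) (d : nat).
Arguments f : clear implicits.
Hypothesis rf : regular_on all f.
Hypothesis lf : law all la f.
Hypothesis dE : la ord0 e0 - la ord0 e1 = d.
Local Notation rho := (rho p r act w f d).
Let rho_law := rho_law char_k actP w_act smw rf lf dE.
Let rho_uE := rho_uE char_k actP w_act smw rf lf dE.
Let rho_map := rho_map char_k w actP d rf.

(** rho is semi-invariant under E' and invariant under the u_t, and over a field these generate E:
    an e with e00 <> 0 is b u_s with b in E', and otherwise u_1 e has this form. *)
Lemma rho_E K (e : GL3 K * GL3 K) : is_field K -> zipE q e ->
  forall R (h : {lrmorphism K -> R}) (y : X R), exists c, rho (act (map2 h e) y) = c * rho y.
Proof.
move=> fK; have Eu R (t : R) : zipE q (u t : GL3 R * GL3 R) by exact: zipE_uE.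
have case1 (e' : GL3 K * GL3 K) : zipE q e' -> gmx e'.1 e0 e0 <> 0 ->
    forall R (h : {lrmorphism K -> R}) (y : X R), exists c, rho (act (map2 h e') y) = c * rho y.
  move=> E n0 R h y; have [v hv] := field_inv fK n0.
  pose s := gmx e'.1 e0 e1 * v; pose b := mul2 e' (inv2 (u s)).
  have Eb : zipE q b by apply: (@zipE_mul p r k char_k) => //; exact: (@zipE_inv p r k char_k).
  have E' : zipE' q b.
    apply/(zipE'P r char_k); split=> //; rewrite /= mulmx3 !mxE /= mulrN mulr1 mulr0 addr0.
    have -> : gmx e'.1 e0 e0 * s = gmx e'.1 e0 e0 * v * gmx e'.1 e0 e1 by rewrite /s; ring.
    by rewrite hv mul1r addNr.
  have eE : e' = mul2 b (u s).
    rewrite [LHS]surjective_pairing; congr (_, _); by rewrite /b /= -gmulA gVmul gmul1.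
  rewrite eE map2_mul map2_uE (actM actP) //; last by exact: (zipE_map char_k).
  rewrite rho_law //; last exact: (zipE'_map char_k).
  by rewrite rho_uE; eexists.
move=> E R h y; have [n0|n0] := pselect (gmx e.1 e0 e0 = 0); last exact: case1.
have E1 : zipE q (mul2 (u 1) e) by exact: (@zipE_mul p r k char_k).
have [x02 x12] : gmx e.1 e0 e2 = 0 /\ gmx e.1 e1 e2 = 0.
  by case: e E {E1 n0} => g g' /(zipP r char_k) [].
have n1 : gmx (mul2 (u 1) e).1 e0 e0 <> 0.
  rewrite /= mulmx3 !mxE /= n0 mulr0 mul1r mul0r add0r addr0 => x10.
  have : \det (gmx e.1) * \det (gmxV e.1) = 1 by rewrite -det_mulmx gmxMV det1.
  rewrite det3 n0 x02 x12 x10 !(mul0r, mulr0, subr0, addr0) => /esym/eqP.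
  by rewrite oner_eq0.
have [c] := case1 _ E1 n1 R h y; rewrite map2_mul map2_uE (actM actP) //; last exact: (zipE_map char_k).
by rewrite rho_uE; exists c.
Qed.

Lemma near_zero_rho_act K (e : GL3 K * GL3 K) (x : X K) : is_field K -> zipE q e ->
  near_zero all rho (act e x) <-> near_zero all rho x.
Proof.
move=> fK E; split; last by apply: near_zero_act => //; exact: rho_E.
rewrite -{2}(actK char_k actP x E); have E' := @zipE_inv p r k char_k K e E.
by apply: near_zero_act => //; exact: rho_E.
Qed.

Lemma phi0 R (x : X R) : (phi f x)`_0 = f R x.
Proof.
rewrite -horner_coef0 -[phi f x]map_poly_idfun -(phi_horner char_k actP idfun 0 rf) // fmap_id.
by rewrite uE0 // (act1 actP).
Qed.

(** On f3 = 0 only the term f^q f2^d of rho survives. If rho were zero at all points, f f2 would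
    vanish on this divisor, and f2, being transversal there, could be cancelled. *)
Lemma rho_nz K (x : X K) : is_field K -> f3 w x = 0 -> f K x <> 0 ->
  exists L (y : X L), is_field L /\ rho y <> 0.
Proof.
move=> fK x3 fx; apply: contrapT => no.
have H L (y : X L) : is_field L -> f3 w y = 0 -> f L y * f2 w y = 0.
  move=> fL y3; have [->|n2] := pselect (f2 w y = 0); first by rewrite mulr0.
  have [->|nf] := pselect (f L y = 0); first by rewrite mul0r.
  case: no; exists L, y; split=> //; rewrite rhoE /hq big_ord_recl big1 ?addr0.
    rewrite y3 expr0 mulr1 subn0 phi0; apply: (field_mulf fL) => /(field_exp0 fL) //.
  by move=> i _; rewrite y3 oppr0 /bump /= exprS mul0r mulr0.
have H2 R (y : X R) : D2 w R y -> f R y * f2 w y = 0.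
  apply: (@eq_on_points k X (D2 w) (fun R y => f R y * f2 w y) (fun R _ => 0) (nice_D2 smw)).
  - by move=> ? ? h z _; rewrite rf // f2_map rmorphM.
  - by move=> ? ? h z _; rewrite rmorph0.
  - by move=> L z fL; exact: H.
have [x2|x2] := pselect (f2 w x = 0); last first.
  by apply: fx; apply: (field_mul0 fK) x2; rewrite mulrC; exact: H2.
have [y [Dy y0 y2]] := transversal_f2 smw fK x3 x2.
apply: fx; have := H2 _ _ Dy; rewrite y2 mulrC -[jT K 1]expr1 => /jetT_mul.
by rewrite -rf // y0.
Qed.

(** On [D1] one has f2 = - g01 g10 and - f3 = g02 g10, so a factor g10^d splits off from rho; this
    is the quotient. *)
Definition rho1 R (x : X R) : R := hq p r d (phi f x) (- ent e0 e1 x) (ent e0 e2 x).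

Lemma rho1_map R R' (h : {lrmorphism R -> R'}) (x : X R) : rho1 (fmap h x) = h (rho1 x).
Proof.
rewrite /rho1 (phi_map char_k actP h rf) // !ent_map -rmorphN; exact: hq_map.
Qed.

Lemma rho1E R (x : X R) : D1 R x -> rho x = ent e1 e0 x ^+ d * rho1 x.
Proof.
move/D1P => x00; rewrite rhoE /rho1 /hq mulr_sumr; apply: eq_bigr => j _.
have jd : (j <= d)%N by rewrite -ltnS.
rewrite /f2 /f3 x00 !mul0r !sub0r opprK -mulNr !exprMn.
have -> : ent e1 e0 x ^+ d = ent e1 e0 x ^+ (d - j) * ent e1 e0 x ^+ j by rewrite -exprD subnK.
by ring.
Qed.

(** If division by g10 never stopped, rho1 would be divisible by every power of g10, hence vanish
    near y0 in [D1]. At a nearby point of [D1] with g10 <> 0, any jet of X is moved into [D1] by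
    some u_t, which does not change rho; so rho would vanish near that point of X, although this
    fails near y0. *)
Lemma exists_psi K0 (y0 : X K0) : is_field K0 -> ent e0 e0 y0 = 0 -> ent e1 e0 y0 = 0 ->
  ~ near_zero all rho y0 -> exists n (psi : forall R, X R -> R),
  [/\ regular_on D1 psi, law D1 (wt (la ord0 e1) (la ord0 e1) (la ord0 e2) *+ q +
        wt q.+1 q.+1 q *+ d - wt 0 1 q *+ d - wt 0 1 q *+ n) psi
    & exists K (x : X K), [/\ is_field K, Xe K x & psi K x <> 0]].
Proof.
move=> fK0 y00 y10 nz.
have nD1 : nice D1 by exact: nice_vanish.
have sD1 : stable D1 by exact: (stable_D1 char_k w_act).
have r10 Z : regular_on Z (ent e1 e0) by move=> ? ? ? ? _; exact: ent_map.
have t10 : transversal D1 (ent e1 e0) by exact: transversal_vanish.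
have rr1 : regular_on D1 rho1 by move=> ? ? ? ? _; exact: rho1_map.
have l1 : law D1 (wt (la ord0 e1) (la ord0 e1) (la ord0 e2) *+ q +
        wt q.+1 q.+1 q *+ d - wt 0 1 q *+ d) rho1.
  apply: (law_div_exp nD1 sD1 rr1 (r10 _) t10 rho1E); last exact: (law_10 char_k w_act).
  by apply: lawW rho_law.
apply: contrapT => no.
have div n : exists s, regular_on D1 s /\ forall R (x : X R), D1 R x -> rho1 x = ent e1 e0 x ^+ n * s R x.
  elim: n => [|n [s [rs sE]]]; first by exists rho1; split=> // R x _; rewrite expr0 mul1r.
  have s0 K (x : X K) : is_field K -> Xe K x -> s K x = 0.
    move=> fK Xx; apply: contrapT => sx; apply: no; exists n, s; split=> //; last by exists K, x.
    apply: (law_div_exp nD1 sD1 rs (r10 _) t10 sE) => //; exact: (law_10 char_k w_act).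
  have XD R (x : X R) : Xe R x -> D1 R x by move=> /XeP [h _]; exact/D1P.
  have sR R (x : X R) : Xe R x -> s R x = 0.
    apply: (@eq_on_points k X Xe s (fun R _ => 0)) => //; first exact: nice_vanish.
      by move=> ? ? h y /XD; exact: rs.
    by move=> ? ? h y _; rewrite rmorph0.
  have [|s' [rs' s'E]] := divide nD1 rs (r10 _) t10 (s := s).
    by move=> R x /D1P h h'; apply: sR; apply/XeP.
  by exists s'; split=> // R x Dx; rewrite sE // s'E // mulrA -exprSr.
have Dy0 : D1 K0 y0 by apply/D1P.
have nz1 : near_zero D1 rho1 y0.
  move=> R h N y Dy y0E; have [s [rs sE]] := div N.+1.
  have [z ez] : exists z, ent e1 e0 y = jT R N * z.
    by apply: jetT_dvd; rewrite -ent_map y0E ent_map y10 rmorph0.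
  by rewrite sE // ez exprMn jTN !mul0r.
have reg_rho : regular_on all rho by move=> ? ? ? ? _; exact: rho_map.
(* Both conditions are open and hold at y0. As g10 is transversal on this part of [D1], it cannot
   vanish identically there. *)
pose O := meet (pts_sub (near_zero D1 rho1)) (pts_sub (fun K x => ~ near_zero all rho x)).
have oO : open_in D1 O.
  apply: open_in_meet; first exact: near_zero_open.
  by apply: (open_in_sub' (Z' := all)) => //; exact: (not_near_zero_open (nice_X smw)).
have Oy0 : O K0 y0.
  split=> L g fL; first exact: near_zero_map.
  by move=> /(near_zero_ext (nice_X smw) reg_rho fK0 fL) => /(_ I).
have nO : nice (meet D1 O) by exact: nice_open.
have tO : transversal (meet D1 O) (ent e1 e0) by exact: transversal_open.
have [K [x [fK [Dx Ox] x10]]] : exists K (x : X K), [/\ is_field K, meet D1 O K x & ent e1 e0 x <> 0].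
  apply: contrapT => none.
  have z R (x : X R) : meet D1 O R x -> ent e1 e0 x = 0.
    apply: (@eq_on_points k X (meet D1 O) (ent e1 e0) (fun R _ => 0)) => //.
      by move=> ? ? h y _; rewrite rmorph0.
    by move=> K v fK Zv; apply: contrapT => vn; apply: none; exists K, v.
  have [y [Zy _ yT]] := tO K0 y0 fK0 (conj Dy0 Oy0) y10.
  have := z _ _ Zy; rewrite yT => T0.
  have : j0 K0 1 1 = 0 by apply: jetT_mul; rewrite expr1 T0 mul0r.
  by rewrite rmorph1 => /eqP; rewrite oner_eq0.
have [nx1 nxr] := Ox; apply: (pts_sub_pt fK nxr) => R h N y _ yE.
have nzx := pts_sub_pt fK nx1.
have [v hv] := field_map_neq0 h fK x10.
have [b hb] : exists b, ent e1 e0 y * b = 1.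
  by apply: (jet_unit (v := v)); rewrite -ent_map yE ent_map.
(* The entry g00 becomes g00 + t g10 under u_t, and this t makes it zero. *)
pose t := - (ent e0 e0 y * b); pose y' := act (u t) y.
have Dy' : D1 _ y'.
  apply/D1P; have [-> _ _ _ _] := ent_uE char_k w_act t y.
  by rewrite /t mulNr -mulrA [b * _]mulrC hb mulr1 subrr.
have t0 : j0 R N t = 0.
  by rewrite /t rmorphN rmorphM /= -ent_map yE ent_map (proj1 (D1P _ _) Dx) rmorph0 mul0r oppr0.
have y'E : fmap (j0 R N) y' = fmap h x.
  rewrite /y' (act_map actP); last exact: zipE_uE.
  by rewrite map2_uE t0 uE0 // (act1 actP).
by rewrite -(rho_uE y t) rho1E // (nzx R h N y' Dy' y'E) mulr0.
Qed.
End Rho1.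

(** * Descent of open sets along a torsor, and connected components *)

Section TorsorOpen.
Variables (k : closedFieldType) (H : G2pred) (X Y : kfunctor k) (act : pre_action X) (pi : kmor X Y).
Hypothesis tP : is_torsor H act pi.
Implicit Types (R A B C K L : comAlgType k).
Variable U : subfunctor X.
Hypothesis oU : open_sub U.
Hypothesis stU : forall K (e : GL3 K * GL3 K) (x : X K), is_field K -> H e -> U K x -> U K (act e x).
Let oU' : open_in (all_sub X) U := open_in_sub oU.

Lemma image_map R R' (f : {lrmorphism R -> R'}) (y : Y R) :
  (forall C (g : {lrmorphism R -> C}) (i : X C), pi C i = fmap g y -> U C i) ->
  forall C (g : {lrmorphism R' -> C}) (i : X C), pi C i = fmap g (fmap f y) -> U C i.
Proof. by move=> Hy C g i; rewrite -fmap_comp; exact: Hy. Qed.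

(** All liftings are required to lie in U; for saturated U this is the image of U ([image_pt]). *)
Definition image_sub : subfunctor Y := SubFunctor image_map.

Lemma image_pt K (x : X K) : is_field K -> image_sub K (pi K x) <-> U K x.
Proof.
move=> fK; split=> [Hx|Ux C g i ei].
  by apply: (Hx K idfun); rewrite fmap_id.
apply: (open_pts oU' I) => L h fL.
have [|e [He <-]] := torsor_same tP (i := fmap (h \o g) x) (j := fmap h i).
  by rewrite !kfun_nat ei fmap_comp.
by apply: stU => //; exact: smem_map.
Qed.

Lemma image_pts R (y : Y R) :
  (forall K (g : {lrmorphism R -> K}), is_field K -> image_sub K (fmap g y)) -> image_sub R y.
Proof.
move=> Hy C g i ei; apply: (open_pts oU' I) => L h fL.
apply: (Hy L (h \o g) fL L idfun); by rewrite kfun_nat ei fmap_id -fmap_comp.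
Qed.

(** The ideal on R is the preimage of the one on an etale cover, as in [CbF_closed]. Stability of U
    is given at field-valued points only, so the comparison over the pushout yields nilpotents, and
    it is a power of each generator that comes from R. *)
Lemma image_open : open_sub image_sub.
Proof.
move=> R y; have [R' [f0 [i0 [f0c e0']]]] := torsor_cover tP y.
have [D HD] := oU i0; pose I0 := ideal_gen D.
have I0i : is_ideal I0 by exact: ideal_gen_ideal.
have DI c : D c -> I0 c by move=> Dc; exists 1%N, (fun=> c), (fun=> 1); rewrite big_ord1 mul1r.
(* The ideal descends because the complement of U is saturated. *)
have ker b : D b -> exists n (J : finType) (a : J -> R) (c : J -> R'),
    (forall l, I0 (f0 (a l))) /\ b ^+ n = \sum_l c l * f0 (a l).
  move=> Db; have [I1|I1] := pselect (I0 1).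
    by exists 0%N, unit, (fun=> 1), (fun=> 1); rewrite rmorph1 expr0 big_const card_unit /= mulr1 addr0.
  pose J := PIdeal I0i I1; pose pr := qap J.
  have [|N [f' [h' [e [f'i sq He Ae kk]]]]] :=
    torsor_pushout (g := pr \o f0) (j := fmap pr i0) tP f0c e0' _.
    by rewrite kfun_nat e0' -fmap_comp.
  have [n hn] : exists n, h' b ^+ n = 0.
    apply: nilpotent_pt => L g fL; apply: contrapT => gb.
    have U1 : U L (fmap g (fmap h' i0)).
      by rewrite -fmap_comp; apply/HD/gen_unit_pt => K' g' fK'; exists b => //=;
        have [v hv] := field_map_neq0 g' fL gb; exact: (unit_neq0 (g := idfun) hv).
    have : U L (fmap (g \o f' \o pr) i0).
      rewrite !fmap_comp -Ae.
      have [e' [He' <-]] := torsor_same tP (i := fmap g (fmap h' i0)) (j := fmap g (act e (fmap h' i0)))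
        (etrans (kfun_nat _ _ _) (esym (etrans (kfun_nat _ _ _) (congr1 _ (torsor_act tP _ He))))).
      exact: stU.
    move/HD/gen_unit_pt/(_ L idfun fL) => [a Da]; apply.
    have e2 : g (f' (pr a)) = 0 by rewrite (proj2 (qap0 J a) (DI _ Da)) !rmorph0.
    exact: e2.
  have [|J' [a [c [a0 bE]]]] := kk (b ^+ n); first by rewrite rmorphXn.
  by exists n, J', a, c; split=> // l; apply/(qap0 J)/a0.
have main K (g : {lrmorphism R -> K}) : is_field K ->
    image_sub K (fmap g y) <-> exists2 a, I0 (f0 a) & g a <> 0.
  move=> fK; split=> [Uy|[a Ia ga]].
    have [N [h [f' [sq f'i _]]]] := etale_pushout f0c g.
    have Ui : U N (fmap f' i0).
      apply: (Uy N h); rewrite kfun_nat e0' -!fmap_comp; apply: fmap_eq => z; exact: sq.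
    have [L [x fL]] := exists_field_pt N.
    have [b Db xb] := proj1 (gen_unit_pt _ _) (proj1 (HD _ f') Ui) L x fL.
    have [n [J [a [c [Ia bE]]]]] := ker b Db.
    apply: contrapT => no; apply: xb; apply: (field_exp0 fL (n := n)).
    rewrite -!rmorphXn bE !rmorph_sum big1 // => l _; rewrite !rmorphM /= sq.
    have -> : g (a l) = 0 by apply: contrapT => gn; apply: no; exists (a l).
    by rewrite !rmorph0 mulr0.
  move=> C g' i; rewrite -fmap_comp => ei.
  have [N [f' [h' [e [f'i sq He Ae _]]]]] := torsor_pushout tP f0c e0' ei.
  apply: (open_pts oU' I) => L x fL.
  have [N2 [f2 [h2 [e2 [f2i sq2 He2 Ae2 _]]]]] := torsor_pushout (j := fmap x i) (g := x \o (g' \o g)) tP f0c e0'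
    (etrans (kfun_nat _ _ _) (etrans (congr1 _ ei) (esym (fmap_comp _ _ _)))).
  have [L2 [z fL2]] := exists_field_pt N2.
  apply: (open_ext (e := z \o f2) oU' fL fL2 I); rewrite fmap_comp -Ae2.
  have U0 : U L2 (fmap z (fmap h2 i0)).
    rewrite -fmap_comp; apply/HD/gen_unit_pt => K' x' fK'.
    have [n [a' [c [Da' s]]]] := Ia.
    apply: contrapT => no.
    have z0 j : x' (z (h2 (a' j))) = 0 by apply: contrapT => nz; apply: no; exists (a' j).
    have [v hv] := field_inv fK ga.
    have : x' (z (h2 (f0 a))) = 0.
      by rewrite -s !rmorph_sum big1 // => j _; rewrite !rmorphM /= z0 mulr0.
    rewrite sq2 /=; apply: (unit_neq0 (g := x' \o (z \o (f2 \o (x \o g')))) hv).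
  have [e' [He' <-]] := torsor_same tP (i := fmap z (fmap h2 i0)) (j := fmap z (act e2 (fmap h2 i0)))
    (etrans (kfun_nat _ _ _) (esym (etrans (kfun_nat _ _ _) (congr1 _ (torsor_act tP _ He2))))).
  exact: stU.
exists (fun a => I0 (f0 a)) => R1 f; split=> [Uy|/gen_unit_pt Hf].
  by apply/gen_unit_pt => K g fK; apply: (proj1 (main K (g \o f) fK)); rewrite fmap_comp; exact: smem_map.
apply: image_pts => K g fK; rewrite -fmap_comp; apply/main => //.
by have [a Ia ga] := Hf K g fK; exists a.
Qed.

Lemma torsor_lift_pt K (y : Y K) : is_field K ->
  exists L (f : {lrmorphism K -> L}) (x : X L), is_field L /\ pi L x = fmap f y.
Proof.
move=> fK; have [R' [f0 [i0 [f0c e]]]] := torsor_cover tP y.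
have [L [g fL]] := exists_field_pt R'.
by exists L, (g \o f0), (fmap g i0); rewrite kfun_nat e fmap_comp.
Qed.
End TorsorOpen.

Section Components.
Variables (k : closedFieldType) (Y : kfunctor k).
Implicit Types (K L : comAlgType k).

Lemma open_sub_ext (U : subfunctor Y) K L (f : {lrmorphism K -> L}) (y : Y K) : open_sub U ->
  is_field K -> is_field L -> (U K y <-> U L (fmap f y)).
Proof.
move=> oU fK fL; split; first exact: smem_map.
exact: (@open_ext k Y (all_sub Y) U K L f y (open_in_sub oU) fK fL I).
Qed.

Definition component K0 (y0 : Y K0) : point_pred Y := fun K y =>
  exists W : point_pred Y, [/\ point_set W, connected W, W K0 y0 & W K y].

(** Subsets of the space have to be invariant under field extension. The point y0 is therefore
    replaced by all points lying in the same open subfunctors as y0, and these cannot be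
    separated. *)
Lemma component_self K0 (y0 : Y K0) : is_field K0 -> component y0 y0.
Proof.
move=> fK0; exists (fun K y => forall U : subfunctor Y, open_sub U -> (U K y <-> U K0 y0)); split=> //.
  move=> K K' f x fK fK'; split=> HU U oU; rewrite -(HU U oU); last exact: (open_sub_ext f x oU).
  by split=> h; apply/(open_sub_ext f x oU).
split; first by exists K0, y0.
move=> U V oU oV cov dis.
have [Uy|Vy] := cov K0 y0 fK0 (fun U _ => conj id id); [left|right] => K x fK Wx; exact/Wx.
Qed.

Lemma component_sub K0 (y0 : Y K0) (W : point_pred Y) : point_set W -> connected W -> W K0 y0 ->
  point_sub W (component y0).
Proof. by move=> pW cW Wy K x fK Wx; exists W. Qed.

Lemma component_split K0 (y0 : Y K0) (U V : subfunctor Y) : is_field K0 -> open_sub U -> open_sub V ->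
  (forall K (x : Y K), is_field K -> component y0 x -> U K x \/ V K x) ->
  (forall K (x : Y K), is_field K -> component y0 x -> ~ (U K x /\ V K x)) ->
  U K0 y0 -> point_sub (component y0) U.
Proof.
move=> fK0 oU oV cov dis Uy K x fK [W [pW cW Wy Wx]].
have sub := component_sub pW cW Wy.
have [//||WU|WV] := (proj2 cW) U V oU oV.
- by move=> L v fL Wv; apply: cov => //; exact: sub.
- by move=> L v fL Wv; apply: dis => //; exact: sub.
- exact: WU.
- by case: (dis K0 y0 fK0 (component_self y0 fK0)); split=> //; exact: WV.
Qed.

Lemma componentP K0 (y0 : Y K0) : is_field K0 -> connected_component (component y0).
Proof.
move=> fK0; have self := component_self y0 fK0; split.
- move=> K K' f x fK fK'; split=> -[W [pW cW Wy Wx]]; exists W; split=> //.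
    by apply/(pW K K' f x fK fK').
  by apply/(pW K K' f x fK fK').
- split; first by exists K0, y0.
  move=> U V oU oV cov dis; have [Uy|Vy] := cov K0 y0 fK0 self.
    by left; exact: (component_split fK0 oU oV).
  right; apply: (component_split fK0 oV oU) => // [K x fK Wx|K x fK Wx [Vx Ux]].
    by have [Ux|Vx] := cov K x fK Wx; [right | left].
  by apply: (dis K x fK Wx).
- move=> W pW cW sub K x fK Wx; exists W; split=> //; exact: sub.
Qed.
End Components.

(** * The inequalities for weights of functions on X *)

Section Ineq.
Variables (p r : nat) (k : closedFieldType).
Hypothesis char_k : p \in [pchar k].
Hypothesis r_gt0 : (0 < r)%N.
Local Notation q := (p ^ r)%N.
Variables (S : kfunctor k) (zeta : zip_mor q S).
Hypothesis zeta_smooth : zip_smooth zeta.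
Hypothesis zeta_surj : zip_surjective_on_components zeta.
Variable F : flag_space zeta.
Hypothesis F_complete : flag_curves_pseudo_complete F.
Implicit Types (R A B C K L : comAlgType k).
Local Notation X := (ztors zeta).
Local Notation w := (zmap zeta).
Local Notation ent := (ent w).
Local Notation act := (zact (z := zeta)).
Local Notation law := (law p r act).
Local Notation all := (all_sub X).
Let w_equiv := zmap_equiv (z := zeta).
Let acP := @zactP _ _ _ zeta.
Let tP := @zprojP _ _ _ zeta.

Lemma cyc_subproof (R : comNzRingType) :
  mx3 0 1 0 0 0 1 1 0 0 *m mx3 0 0 1 1 0 0 0 1 0 == 1%:M :> 'M[R]_3.
Proof.
apply/eqP/matrixP; apply: forall3; apply: forall3; rewrite mulmx3 !mxE /=; ring.
Qed.

(** A point of the smallest zip stratum g00 = g10 = 0. *)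
Definition cyc (R : comNzRingType) : GL3 R := MkGL3 (cyc_subproof R).

(* Vanishing near a point is an open and closed condition, invariant under E, so
   it descends to S; every component of S meets the image of the smallest stratum. *)
Lemma not_near_zero_cyc (s : forall R, X R -> R) K0 (x0 : X K0) : is_field K0 ->
  regular_on all s -> s K0 x0 <> 0 ->
  (forall K (e : GL3 K * GL3 K) (x : X K), is_field K -> zipE q e ->
     near_zero all s (act e x) <-> near_zero all s x) ->
  exists K (y : X K), [/\ is_field K, ~ near_zero all s y, ent e0 e0 y = 0 & ent e1 e0 y = 0].
Proof.
move=> fK0 rs sx0 inv; have nX : nice all := nice_X zeta_smooth.
pose U1 := pts_sub (near_zero all s); pose U2 := pts_sub (fun K x => ~ near_zero all s (K := K) x).
have oU1 : open_sub U1 by move=> R x; exact: (near_zero_open nX rs).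
have oU2 : open_sub U2 by move=> R x; exact: (not_near_zero_open nX rs).
have U1P K (x : X K) : is_field K -> U1 K x <-> near_zero all s x.
  by move=> fK; split=> [|nz L f fL]; [exact: pts_sub_pt | exact: near_zero_map].
have U2P K (x : X K) : is_field K -> U2 K x <-> ~ near_zero all s x.
  move=> fK; split=> [|nz L f fL]; first exact: pts_sub_pt.
  by move=> nz'; apply: nz; exact: (near_zero_ext nX rs fK fL I nz').
have st1 K (e : GL3 K * GL3 K) (x : X K) : is_field K -> zipE q e -> U1 K x -> U1 K (act e x).
  by move=> fK E /(U1P _ _ fK) nz; apply/U1P => //; apply/inv.
have st2 K (e : GL3 K * GL3 K) (x : X K) : is_field K -> zipE q e -> U2 K x -> U2 K (act e x).
  by move=> fK E /(U2P _ _ fK) nz; apply/U2P => // nz'; apply: nz; exact/(inv _ _ _ fK E).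
pose V1 := image_sub (zproj zeta) U1; pose V2 := image_sub (zproj zeta) U2.
have oV1 : open_sub V1 by exact: (image_open tP oU1 st1).
have oV2 : open_sub V2 by exact: (image_open tP oU2 st2).
have V1P K (x : X K) : is_field K -> V1 K (zproj zeta K x) <-> U1 K x.
  by move=> fK; exact: (image_pt tP oU1 st1).
have V2P K (x : X K) : is_field K -> V2 K (zproj zeta K x) <-> U2 K x.
  by move=> fK; exact: (image_pt tP oU2 st2).
have dec K (y : S K) : is_field K -> V1 K y \/ V2 K y.
  move=> fK; have [L [f [x [fL ex]]]] := torsor_lift_pt tP y fK.
  have [nz|nz] := pselect (near_zero all s x); [left|right].
    by apply/(open_sub_ext f y oV1) => //; rewrite -ex; apply/V1P/U1P.
  by apply/(open_sub_ext f y oV2) => //; rewrite -ex; apply/V2P/U2P.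
have dis K (y : S K) : is_field K -> ~ (V2 K y /\ V1 K y).
  move=> fK [h2 h1]; have [L [f [x [fL ex]]]] := torsor_lift_pt tP y fK.
  have := smem_map f h1; have := smem_map f h2; rewrite -ex.
  by move=> /(V2P _ _ fL)/(U2P _ _ fL) h2' /(V1P _ _ fL)/(U1P _ _ fL).
have V2x : V2 K0 (zproj zeta K0 x0).
  apply/V2P => //; apply/U2P => // nz; apply: sx0; exact: (near_zero0 rs I nz).
have WV : point_sub (component (zproj zeta K0 x0)) V2.
  apply: (component_split fK0 oV2 oV1) => // [K x fK _|K x fK _]; last exact: dis.
  by have [h|h] := dec K x fK; [right|left].
have fk : is_field (k^o : comAlgType k) by move=> x /mulfV e; exists x^-1.
have [K [f [y [fK Wy gy]]]] := zeta_surj (componentP (zproj zeta K0 x0) fK0) (cyc (k^o : comAlgType k)) fk.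
exists K, y; split=> //; first by apply/(U2P _ _ fK)/(V2P _ _ fK); exact: WV.
  by rewrite !entE gy /= !mxE /= rmorph0.
by rewrite !entE gy /= !mxE /= rmorph0.
Qed.

Lemma weight_ineq d : forall (la : 'rV[int]_3) (f : forall R, X R -> R), la ord0 e0 - la ord0 e1 = d%:Z ->
  regular_on all f -> law all la f -> (exists K (x : X K), is_field K /\ f K x <> 0) ->
  (q%:Z - 1) * la ord0 e0 + la ord0 e1 <= q%:Z * la ord0 e2.
Proof.
elim/ltn_ind: d => d IH la f dE rf lf [K1 [x1 [fK1 fx1]]].
have phi_d : forall la (f : forall R, X R -> R) K (x : X K), is_field K -> regular_on all f ->
    law all la f -> f K x <> 0 -> exists d : nat, la ord0 e0 - la ord0 e1 = d.
  move=> la' f' K x fK rf' lf' fx.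
  have nz : phi p r act f' x != 0.
    by apply/eqP => e; apply: fx; rewrite -(phi0 char_k acP rf') e coef0.
  have [//|d' [e _]] := phi_size char_k acP fK rf' (law_law_pt lf') _ nz.
  by exists d'.
have [[K [x [fK x3 fx]]]|no] := pselect (exists K (x : X K), [/\ is_field K, f3 w x = 0 & f K x <> 0]).
  have [K0 [x0 [fK0 rx0]]] := rho_nz char_k acP zeta_smooth d rf fK x3 fx.
  have [||K2 [y [fK2 nzy y00 y10]]] := not_near_zero_cyc fK0 (s := rho p r act w f d) _ rx0 _.
  - by move=> ? ? h z _; exact: (rho_map char_k w acP d rf h z).
  - by move=> L e z fL E; exact: (near_zero_rho_act char_k acP w_equiv zeta_smooth rf lf dE).
  have [n [psi [rpsi lpsi [K3 [z [fK3 Xz nz]]]]]] :=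
    exists_psi char_k acP w_equiv zeta_smooth rf lf dE fK2 y00 y10 nzy.
  have := claimC char_k r_gt0 zeta_smooth F_complete fK3 rpsi lpsi Xz nz.
  have Mn (a : int) (m : nat) : a *+ m = a * m%:Z by rewrite -mulr_natr natz.
  rewrite !(mulmxnE, mxE) /= !Mn -[q.+1]addn1 !PoszD => h.
  have q1 : 1 <= q%:Z :> int by rewrite lez_nat (q_gt0 r char_k).
  have n0 : 0 <= n%:Z :> int by [].
  have q0 : 0 < q%:Z :> int by rewrite ltz_nat (q_gt0 r char_k).
  have l0E : la ord0 e0 = la ord0 e1 + d%:Z by rewrite -dE addrC subrK.
  (* The bound a1 <= a2 for the weight of psi reads q (l0 - l2) <= n (1 - q), where n counts the
     further divisions by g10. *)
  have h2 : q%:Z * (la ord0 e0 - la ord0 e2) <= 0.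
    apply: (@le_trans _ _ (n%:Z * (1 - q%:Z))); last by rewrite mulr_ge0_le0 // subr_le0.
    rewrite -subr_le0 l0E; rewrite -subr_le0 in h; apply: le_trans h; rewrite le_eqVlt; apply/orP; left.
    by apply/eqP; ring.
  have h3 : la ord0 e0 - la ord0 e2 <= 0 by rewrite -(pmulr_rle0 _ q0).
  have -> : (q%:Z - 1) * la ord0 e0 + la ord0 e1 = q%:Z * la ord0 e0 - d%:Z by rewrite -dE; ring.
  apply: (@le_trans _ _ (q%:Z * la ord0 e0)); first by rewrite gerBl.
  by rewrite ler_pM2l // -subr_le0.
have f0 R (x : X R) : f3 w x = 0 -> f R x = 0.
  apply: (@eq_on_points k X (D2 w) f (fun R _ => 0) (nice_D2 zeta_smooth)).
  - by move=> ? ? h y _; exact: rf.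
  - by move=> ? ? h y _; rewrite rmorph0.
  - by move=> K y fK y3; apply: contrapT => fy; apply: no; exists K, y.
have r3 : regular_on all (f3 w) by move=> ? ? ? ? _; exact: f3_map.
have [|f' [rf' fE]] := divide (nice_X zeta_smooth) rf r3 (transversal_f3 zeta_smooth).
  by move=> R x _; exact: f0.
have lf' : law all (la - wt q.+1 1 q) f'.
  apply: (law_div char_k acP (nice_X zeta_smooth) _ rf' r3 (transversal_f3 zeta_smooth) fE lf) => //.
  exact: (law_f3 char_k w_equiv).
have fx1' : f' K1 x1 <> 0 by move=> e; apply: fx1; rewrite fE // e mulr0.
have [d' dE'] := phi_d _ _ _ _ fK1 rf' lf' fx1'.
have dd : (d' < d)%N.
  rewrite -ltz_nat -dE' -dE !mxE /= -[q.+1]addn1 PoszD.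
  have -> : la ord0 e0 - (q%:Z + 1%:Z) - (la ord0 e1 - 1) = la ord0 e0 - la ord0 e1 - q%:Z by ring.
  by rewrite ltrBlDr ltrDl ltz_nat (q_gt0 r char_k).
have := IH d' dd _ _ dE' rf' lf' (ex_intro _ K1 (ex_intro _ x1 (conj fK1 fx1'))).
rewrite !mxE /= -[q.+1]addn1 PoszD -subr_ge0 => h; rewrite -subr_ge0; apply: le_trans h _.
by rewrite le_eqVlt; apply/orP; left; apply/eqP; ring.
Qed.

Lemma weight_ineqs (la : 'rV[int]_3) (f : forall R, X R -> R) :
  regular_on all f -> law all la f -> (exists K (x : X K), is_field K /\ f K x <> 0) ->
  la ord0 e1 <= la ord0 e0 /\ (q%:Z - 1) * la ord0 e0 + la ord0 e1 <= q%:Z * la ord0 e2.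
Proof.
move=> rf lf [K [x [fK fx]]].
have nz : phi p r act f x != 0.
  by apply/eqP => e; apply: fx; rewrite -(phi0 char_k acP rf) e coef0.
have [//|d [dE _]] := phi_size char_k acP fK rf (law_law_pt lf) _ nz.
split; first by rewrite -subr_ge0 dE.
by apply: weight_ineq rf lf _ => //; [exact: dE | exists K, x].
Qed.
End Ineq.

(** * Sections of the automorphic bundles *)

Section Sections.
Variables (p r : nat) (k : closedFieldType).
Hypothesis char_k : p \in [pchar k].
Local Notation q := (p ^ r)%N.
Variables (X : kfunctor k) (act : pre_action X).
Hypothesis actP : Defs.is_action (@zipE q) act.
Implicit Types (R A B C K L : comAlgType k) (la : 'rV[int]_3).
Local Notation law := (law p r act).
Local Notation all := (all_sub X).

Lemma in_P_gone R : in_P (gone R).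
Proof. by apply/in_PE; rewrite !mxE. Qed.

Lemma law_inv la (f : forall R, X R -> R) R (e e' : GL3 R * GL3 R) (b : GL3 R) (i : X R) :
  law all la f -> zipE q e -> zipE q e' -> e'.1 = gmul e.1 b -> in_B b ->
  f R (act (inv2 e') i) = chi la (ginv b) * f R (act (inv2 e) i).
Proof.
move=> lf E E' eb Bb; have IE' := @zipE_inv p r k char_k _ _ E'.
have c1 : (mul2 (inv2 e') e).1 = ginv b.
  by rewrite /mul2 /inv2 /= eb ginvM -gmulA gVmul gmul1.
rewrite -{1}(actVK char_k actP i E) -(actM actP) //.
rewrite -c1 -lf //; split; first exact: (@zipE_mul p r k char_k).
by rewrite c1; exact: in_BV.
Qed.

Lemma law_inv_same la (f : forall R, X R -> R) R (e e' : GL3 R * GL3 R) (i : X R) :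
  law all la f -> zipE q e -> zipE q e' -> e'.1 = e.1 -> f R (act (inv2 e') i) = f R (act (inv2 e) i).
Proof.
move=> lf E E' ee; have B1 : in_B (gone R) by apply/in_BE; rewrite !mxE.
rewrite (law_inv i lf E E' (b := gone R)) //; last by rewrite gmul1.
by rewrite chiV // /chi big1 ?mul1r // => j _; rewrite !mxE eqxx /=; case: (- _) => n /=; rewrite expr1n.
Qed.

(** Frobenius reciprocity: the section sends x and g in P to f(e^(-1) x), where e is any element of
    E above g. Two such e differ by an element of E' with first component 1, on which the character
    is trivial. *)
Lemma section_of_law la (f : forall R, X R -> R) : regular_on all f -> law all la f ->
  (exists R (x : X R), f R x <> 0) -> H0_nonzero q act la.
Proof.
move=> rf lf [K [x fx]].
have ys R (g : GL3 R) : exists y, in_P g -> zipE q (g, y).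
  have [/in_PE [g0 g1]|no] := pselect (in_P g); last by exists g.
  by have [y [E _ _]] := @zip_section p r k char_k _ _ g0 g1; exists y.
pose y R g := projT1 (cid (ys R g)); have yE R g : in_P g -> zipE q (g, y R g) by exact: projT2 (cid (ys R g)).
exists (fun R i R' h g => f R' (act (inv2 (g, y R' g)) (fmap h i))); split; last first.
  exists K, x, K, idfun, (gone K); split; first exact: in_P_gone.
  rewrite fmap_id (law_inv_same x lf (@zipE_one p r k char_k K)) //; last exact: yE (in_P_gone K).
  have -> : inv2 (gone K, gone K) = (gone K, gone K) by congr (_, _); exact: GL3_inj.
  by rewrite (act1 actP).
split=> [R i|R R' R'' h h' i g _|R R' h e i g E Pg]; last 1 first.
- have E' : zipE q (map2 h e) by exact: zipE_map.
  have Eg := yE _ _ Pg; have Ig := @zipE_inv p r k char_k _ _ Eg.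
  rewrite (act_map actP) // -(actM actP) //.
  have Ee : zipE q (mul2 (inv2 (map2 h e)) (g, y R' g)).
    exact: (@zipE_mul p r k char_k _ _ _ (@zipE_inv p r k char_k _ _ E') Eg).
  have -> : mul2 (inv2 (g, y R' g)) (map2 h e) = inv2 (mul2 (inv2 (map2 h e)) (g, y R' g)).
    by congr (_, _); exact: GL3_inj.
  by apply: law_inv_same lf _ _ _ => //; apply: yE; exact: zip_in_P Ee.
- split=> [R' R'' h h' g Pg|R' h g b Pg Bb].
    have Eg := yE _ _ Pg; have Ig := @zipE_inv p r k char_k _ _ Eg.
    rewrite fmap_comp -rf // (act_map actP) //.
    have E' : zipE q (map2 h' (g, y R' g)) by exact: zipE_map.
    have -> : map2 h' (inv2 (g, y R' g)) = inv2 (map2 h' (g, y R' g)).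
      by congr (_, _); exact: GL3_inj.
    by apply: law_inv_same lf _ _ _ => //; apply: yE; exact: zip_in_P E'.
  apply: law_inv => //; first exact: yE.
  apply: yE; move: Pg => /in_PE [g0 g1]; have [_ _ b12] := tri_entries Bb; have [_ b02 _] := tri_entries Bb.
  by apply/in_PE; rewrite /= !mulmx3 b12 b02 g0 g1 !(mulr0, mul0r, addr0).
- by rewrite fmap_comp.
Qed.

(** The inverse construction evaluates the section at the identity of P. Equivariance under E
    recovers all its values from these, so f is not zero, and reducedness of X gives a field-valued
    point where it is nonzero. *)
Lemma law_of_section la : nice all -> H0_nonzero q act la -> exists f : forall R, X R -> R,
  [/\ regular_on all f, law all la f & exists K (x : X K), is_field K /\ f K x <> 0].
Proof.
move=> nX [s [[sV sM sE] [R0 [i0 [R1 [h0 [g0 [Pg0 ng0]]]]]]]].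
pose f R (i : X R) := s R i R idfun (gone R).
have rf : regular_on all f.
  move=> R R' h x _; rewrite /f (sM R R' R' h idfun x (gone R') (in_P_gone R')).
  have <- := (sV R x).1 R R' idfun h (gone R) (in_P_gone R).
  have -> : gmap h (gone R) = gone R' by apply: GL3_inj; rewrite /= map_mx1.
  by congr (s _ _ _ _ _); exact: lrmorphism_eq.
exists f; split=> //.
  move=> R e x E' _; have E := zipE'_E E'; have Be : in_B e.1 by case: E'.
  rewrite /f (sE R R idfun e x (gone R) E (in_P_gone R)) GLfun_id gmul1.
  have {1}-> : ginv e.1 = gmul (gone R) (ginv e.1) by rewrite g1mul.
  by rewrite ((sV R x).2 R idfun _ _ (in_P_gone R)) ?ginvK //; exact: in_BV.
apply: contrapT => no; apply: ng0.
have f0 R (x : X R) : f R x = 0.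
  apply: (@eq_on_points k X all f (fun R _ => 0) nX) => //.
    by move=> ? ? h y _; rewrite rmorph0.
  by move=> K y fK _; apply: contrapT => fy; apply: no; exists K, y.
have /in_PE [g00 g01] := Pg0; have [y [E _ _]] := @zip_section p r k char_k _ _ g00 g01.
have IE := @zipE_inv p r k char_k _ _ E.
have := f0 R1 (act (inv2 (g0, y)) (fmap h0 i0)).
rewrite /f (sE R1 R1 idfun _ _ (gone R1) IE (in_P_gone R1)) GLfun_id /= ginvK gmul1.
rewrite (sM R0 R1 R1 h0 idfun i0 g0 Pg0) => <-.
by congr (s _ _ _ _ _); exact: lrmorphism_eq.
Qed.
End Sections.

(** * Sections on the stack of G-zips from the inequalities *)

Section Converse.
Variables (p r : nat) (k : closedFieldType).
Hypothesis char_k : p \in [pchar k].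
Hypothesis r_gt0 : (0 < r)%N.
Local Notation q := (p ^ r)%N.
Implicit Types (R A B C K L : comAlgType k) (la : 'rV[int]_3).

Definition id_mor (X : kfunctor k) : kmor X X := @KMor k X X (fun R x => x) (fun _ _ _ _ => erefl).
Local Notation X := (GLfun k).
Local Notation act := (fun R (e : GL3 R * GL3 R) (g : X R) => zip_act e g).
Local Notation w := (id_mor X).
Local Notation law := (law p r act).
Local Notation all := (all_sub X).
Local Notation ent := (ent w).

Lemma zip_act_action : Defs.is_action (@zipE q) (act : pre_action X).
Proof.
split=> [R g|R e e' g _ _|R R' f e g _]; apply: GL3_inj; rewrite /= ?mul1mx ?mulmx1 ?map_mxM //.
by rewrite !mulmxA.
Qed.

Definition hasse R (g : X R) : R := ent e0 e0 g ^+ q * f2 w g - ent e1 e0 g ^+ q * f3 w g.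

Lemma law_hasse : law all (wt q.+1 q.+1 (q * q.+1)%N) hasse.
Proof.
move=> R e g E _; have [fr frE] := ex_frob r char_k R.
have wa : forall R e (x : X R), zipE q e -> w R (act R e x) = zip_act e (w R x) by [].
rewrite /hasse chi_nat [_ ^+ (q * q.+1)]exprM -!frE (act00 char_k wa) // (act10 char_k wa) // (act_f3 char_k wa) //.
rewrite (act_f2 char_k wa) // -!frE !(rmorphM, rmorphD) /= !exprS -!frE.
ring.
Qed.

Lemma hasse_map R R' (f : {lrmorphism R -> R'}) (g : X R) : hasse (fmap f g) = f (hasse g).
Proof. by rewrite /hasse f2_map f3_map !ent_map [RHS]rmorphB !rmorphM !rmorphXn. Qed.

Lemma dtV1 R (g : GL3 R) : \det (gmx g) * \det (gmxV g) = 1.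
Proof. by rewrite -det_mulmx gmxMV det1. Qed.

Lemma C_zip_of_ineqs la : la ord0 e1 <= la ord0 e0 ->
  (q%:Z - 1) * la ord0 e0 + la ord0 e1 <= q%:Z * la ord0 e2 ->
  @C_zip k q (la *+ (q.-1 * (q * q.+1))).
Proof.
move=> h1 h2; have qp := q_gt0 r char_k.
have Q1 : q.-1%:Z = q%:Z - 1 by rewrite predn_int.
have QS : q.+1%:Z = q%:Z + 1 by rewrite -addn1 PoszD.
(* The exponents a, b, c solve q (q^2 - 1) la = a wt(f3) + b wt(h) + c wt(det). Here a is q^2 - 1
   times the slack of the first inequality, b is the slack of the second, and c may have any
   sign. *)
have [a aE] : exists a : nat, a%:Z = (q%:Z - 1) * (q%:Z + 1) * (la ord0 e0 - la ord0 e1).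
  exists (absz ((q%:Z - 1) * (q%:Z + 1) * (la ord0 e0 - la ord0 e1))).
  by rewrite gez0_abs // -Q1 -QS mulr_ge0 // subr_ge0.
have [b bE] : exists b : nat, b%:Z = q%:Z * la ord0 e2 - ((q%:Z - 1) * la ord0 e0 + la ord0 e1).
  exists (absz (q%:Z * la ord0 e2 - ((q%:Z - 1) * la ord0 e0 + la ord0 e1))%R).
  by rewrite gez0_abs // subr_ge0.
pose c := q%:Z * (q%:Z - 1) * la ord0 e0 - a%:Z - b%:Z.
have laE : la *+ (q.-1 * (q * q.+1)) =
    wt q.+1 1 q *+ a + wt q.+1 q.+1 (q * q.+1)%N *+ b + c *: wt q.+1 q.+1 q.+1.
  have Mn (x : int) (m : nat) : x *+ m = x * m%:Z by rewrite -mulr_natr natz.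
  apply/rowP; apply: forall3; rewrite !(mulmxnE, mxE) /= !Mn !PoszM Q1 QS /c aE bE; ring.
have wa : forall R e (x : X R), zipE q e -> w R (act R e x) = zip_act e (w R x) by [].
pose f R (g : X R) := f3 w g ^+ a * hasse g ^+ b * upow (\det (gmx g)) (\det (gmxV g)) c.
have := @section_of_law p r k char_k X _ zip_act_action (la *+ (q.-1 * (q * q.+1))) f.
apply.
- by move=> R R' h g _; rewrite /f f3_map hasse_map /= !det_map_mx !rmorphM !rmorphXn (upow_map h).
- rewrite laE /f; apply: (law_mul (s := fun R g => f3 w g ^+ a * hasse g ^+ b)); first apply: law_mul.
  + by apply: law_exp; exact: (law_f3 char_k wa).
  + by apply: law_exp; exact: law_hasse.
  + apply: upow_law; first exact: (law_det char_k wa).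
      exact: stable_all.
    by move=> R x _; exact: dtV1.
(* At this point f3 = - 1 and h = 1, so every monomial in f3, h and det is nonzero. *)
pose g := ginv (cyc (k^o : comAlgType k)); exists (k^o : comAlgType k), g.
have q0 := exp0q r char_k (k^o : comAlgType k).
have g3 : f3 w g = - 1 by rewrite /f3 !entE /= !mxE /=; ring.
have gh : hasse g = 1.
  by rewrite /hasse g3 !entE /= !mxE /= q0 expr1n; ring.
rewrite /f g3 gh expr1n mulr1 => e.
have : (- 1) ^+ a * (- 1) ^+ a * (upow (\det (gmx g)) (\det (gmxV g)) c * upow (\det (gmxV g)) (\det (gmx g)) c) = 0 :> k^o.
  by rewrite mulrACA e mul0r.
have [d1 d2] := (dtV1 g, mulrC (\det (gmx g)) (\det (gmxV g))).
rewrite -exprMn mulrNN mulr1 expr1n mul1r -upow_mul -d2 d1.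
case: c {laE f e} => n /=; rewrite expr1n => /eqP; by rewrite oner_eq0.
Qed.
End Converse.

Theorem theorem4p3p3 (p r : nat) (k : closedFieldType)
    (p_prime : prime p) (r_gt0 : (0 < r)%N) (char_k : p \in [pchar k])
    (k_algebraic : forall x : k,
       exists2 n : nat, (0 < n)%N & x ^+ ((p ^ r) ^ n) = x)
    (S : kfunctor k) (S_scheme : is_scheme S)
    (S_nonempty : exists R : comAlgType k, inhabited (S R))
    (zeta : zip_mor (p ^ r) S)
    (zeta_smooth : zip_smooth zeta)
    (zeta_surj : zip_surjective_on_components zeta)
    (F : flag_space zeta)
    (F_complete : flag_curves_pseudo_complete F) :
  forall la : 'rV[int]_3,
    saturation (C_S zeta) la <-> saturation (@C_zip k (p ^ r)) la.
Proof.
move=> la; split=> -[N N0 H].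
  have [f [rf lf nf]] := law_of_section char_k (nice_X zeta_smooth) H.
  have [] := weight_ineqs char_k r_gt0 zeta_smooth zeta_surj F_complete rf lf nf.
  (* Both inequalities are homogeneous, so they pass from N la to la. *)
  rewrite !mulmxnE !mulrnAr -mulrnDl !ler_pMn2r // => h1 h2.
  exists ((p ^ r).-1 * (p ^ r * (p ^ r).+1))%N; last exact: C_zip_of_ineqs.
  by rewrite !muln_gt0 (q_gt0 r char_k) /= andbT -subn1 subn_gt0 (q_gt1 char_k r_gt0).
exists N => //; have [f [rf lf [K [g [fK fg]]]]] := law_of_section char_k (nice_GL k) H.
apply: (section_of_law char_k (zactP zeta) (f := fun R x => f R (zmap zeta R x))).
- by move=> R R' h x _; rewrite kfun_nat rf.
- by move=> R e x E' _; rewrite zmap_equiv ?lf //; exact: zipE'_E.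
(* The component of a point of S surjects onto the stack, so the point g with f g <> 0 lifts to the
   torsor after a field extension. *)
have [R0 [y]] := S_nonempty; have [L [h fL]] := exists_field_pt R0.
have [L' [h' [x [fL' _ xg]]]] := zeta_surj _ (componentP (fmap h y) fL) K g fK.
exists L', x; rewrite xg -[gmap h' g]/(fmap (h' : {lrmorphism K -> L'}) (g : GLfun k K)) rf // => e.
by have [u] := field_map_neq0 h' fK fg; rewrite e mul0r => /esym/eqP; rewrite oner_eq0.
Qed.
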